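(* Let $d\ge5$ and $\delta>0$. Let $(\varepsilon_k)_{k\in\mathbb{N}}$ be a sequence of positive numbers tending to $0$ along which the joint law under $\overline{\mathbb{P}}$ of $$\left(\tau^{(\varepsilon_k)}_\delta(n),\ e^{(\varepsilon_k)}_\delta(n),\ \varepsilon_k^{1/\alpha}\tau_{x^{(\varepsilon_k)}_\delta(n)},\ \varepsilon_k T^{(\varepsilon_k)}_\delta(n)\right)_{n\in\mathbb{N}}$$ converges (for the product topology) to the law of some $\left(\tau_\delta(n),e_\delta(n),\tau^\circ_\delta(n),T_\delta(n)\right)_{n\in\mathbb{N}}$. Then the law of $\tau_\delta(1)$ is absolutely continuous with respect to the law of $(\tau_z)_{z\ne0}$ under $\mathbb{P}$, with density $$\frac{1}{c\,\overline G(\tau)}.$$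
   Context: Fix $a\in(0,1]$ and $\alpha\in(0,1)$; $\mathbb{N}=\{1,2,\dots\}$. Write $x\sim y$ for $x,y\in\mathbb{Z}^d$ when they are nearest neighbours, and $\|\cdot\|$ for the graph ($\ell^1$) norm. An environment is a family $\tau=(\tau_x)_{x\in\mathbb{Z}^d}$ of positive numbers. Under $\mathbb{P}$ the $(\tau_x)$ are i.i.d., $\tau_0\ge1$, and $\mathbb{P}[\tau_0\ge y]\sim y^{-\alpha}$ as $y\to\infty$. Given $\tau$, $(\hat X_t)_{t\ge0}$ is the continuous-time Markov chain on $\mathbb{Z}^d$ with jump rate $(\tau_x\tau_y)^a$ from $x$ to a neighbour $y$, with law $\mathbf{P}^\tau_x$ and expectation $\mathbf{E}^\tau_x$ when started from $x$. The annealed measure is $\overline{\mathbb{P}}=\mathbb{P}\mathbf{P}^\tau_0$. Translations: $(\theta_x\tau)_y=\tau_{x+y}$. Exploration: let $Y$ be the discrete-time walk of successive positions of $\hat X$. List successively the $1$-neighbourhoods $(Y_0+z)_{\|z\|\le1},(Y_1+z)_{\|z\|\le1},\dots$, each enumerated in a fixed predetermined order of $z$, and remove repetitions; the resulting sequence is $(x_i)_{i\in\mathbb{N}}$. Let $r(t)=|\{x\in\mathbb{Z}^d:\exists s\le t,\ \|\hat X_s-x\|\le1\}|$ be the number of sites discovered before time $t$, and let $c>0$ be the constant such that $r(t)/t\to c$ $\overline{\mathbb{P}}$-a.s. as $t\to\infty$. Deep traps: for $\varepsilon>0$, let $(r^{(\varepsilon)}_\delta(n))_{n\in\mathbb{N}}$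 be the increasing enumeration of $\{i\in\mathbb{N}:\varepsilon^{1/\alpha}\tau_{x_i}\ge\delta\}$, let $x^{(\varepsilon)}_\delta(n)=x_{r^{(\varepsilon)}_\delta(n)}$ and $T^{(\varepsilon)}_\delta(n)=\inf\{t:r(t)\ge r^{(\varepsilon)}_\delta(n)\}$. Let $\tau^{(\varepsilon)}_\delta(n)=(\tau_{x^{(\varepsilon)}_\delta(n)+z})_{z\neq0}$ (a random element of $\mathbb{R}^{\mathbb{Z}^d\setminus\{0\}}$ with the product topology). Green functions: $G(\tau)=\mathbf{E}^\tau_0\big[\int_0^\infty\mathbf{1}_{\{\hat X_s=0\}}\,\mathrm{d}s\big]$, and $\overline G(\tau)=\overline G((\tau_z)_{z\ne0})=\lim_{\tau_0\to+\infty}G(\tau)$ (the other coordinates being fixed), which does not depend on $\tau_0$. Finally $e^{(\varepsilon)}_\delta(n)$ is defined by $\int_0^\infty\mathbf{1}_{\{\hat X_s=x^{(\varepsilon)}_\delta(n)\}}\,\mathrm{d}s=e^{(\varepsilon)}_\delta(n)\,G(\theta_{x^{(\varepsilon)}_\delta(n)}\tau)$. *)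

(* Defs.v *)
From HB Require Import structures.
From mathcomp Require Import all_boot all_order all_algebra.
From mathcomp Require Import all_classical all_reals all_analysis.
From mathcomp Require Import measurable_realfun.

Set Implicit Arguments.
Unset Strict Implicit.
Unset Printing Implicit Defensive.

Import Order.TTheory GRing.Theory Num.Theory.
Import numFieldNormedType.Exports.

Local Open Scope classical_set_scope.
Local Open Scope ring_scope.

(* The alias keeps the discrete sigma-algebra below off the matrix type. *)
Definition site (d : nat) : Type := 'rV[int]_d.

HB.instance Definition _ d := GRing.Zmodule.on (site d).
HB.instance Definition _ d := Countable.on (site d).
HB.instance Definition _ d := isPointed.Build (site d) 0.
HB.instance Definition _ d := @isMeasurable.Build default_measure_display
  (site d) discrete_measurable discrete_measurable0
  discrete_measurableC discrete_measurableU.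

Definition l1norm d (x : site d) : nat :=
  \sum_(i < d) `|(x : 'rV[int]_d) ord0 i|%N.

Definition neighbours d (x y : site d) : bool := l1norm (x - y) == 1%N.

(* Generators of the product sigma-algebra on functions I -> T. *)
Definition coordinate_sets (I : Type) dT (T : measurableType dT)
    : set (set (I -> T)) :=
  [set A | exists i B, measurable B /\ A = [set f : I -> T | B (f i)]].

Definition real_family (I : Type) (R : realType) :=
  g_sigma_algebraType (@coordinate_sets I _ R).

Definition environment (R : realType) (d : nat) := real_family (site d) R.

Definition punctured_environment (R : realType) (d : nat) :=
  real_family {z : site d | z != 0} R.

(* A trajectory is its sequence of successive positions and holding times. *)
Definition trajectory (R : realType) (d : nat) :=
  g_sigma_algebraType (@coordinate_sets nat _ (site d * R)%type).

Section Family.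
Variables (I : Type) (R : realType).

Lemma measurable_coordinate (i : I) :
  measurable_fun [set: real_family I R] (fun f : real_family I R => f i).
Proof.
move=> _ B mB; rewrite setTI; apply: sub_sigma_algebra.
by exists i, B.
Qed.

Lemma measurable_into_real_family dT (T : measurableType dT) (g : T -> real_family I R) :
  (forall i, measurable_fun [set: T] (fun x => g x i)) ->
  measurable_fun [set: T] g.
Proof.
move=> mg; pose G := @coordinate_sets I _ R.
apply: (@measurability _ _ T (real_family I R) setT g G) => //.
move=> _ [_ [i [B [mB ->]]] <-].
exact: mg.
Qed.

End Family.

Section Environment.
Variables (R : realType) (d : nat).

Definition shift (x : site d) (t : environment R d) : environment R d :=
  fun y => t (x + y).

Definition off_origin (t : environment R d) : punctured_environment R d :=
  fun z => t (val z).

Definition with_origin (v : R) (u : punctured_environment R d)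
    : environment R d :=
  fun z => oapp u v (insub z).

Lemma measurable_off_origin :
  measurable_fun [set: environment R d] off_origin.
Proof.
by apply: measurable_into_real_family => z; exact: measurable_coordinate.
Qed.

HB.instance Definition _ :=
  isMeasurableFun.Build _ _ _ _ off_origin measurable_off_origin.

(* Independence and identical distribution of the coordinates in one formula. *)
Definition iid_coordinates (P : probability (environment R d) R) : Prop :=
  forall (s : seq (site d)) (B : site d -> set R), uniq s ->
    (forall x, measurable (B x)) ->
    P [set t : environment R d | forall x, x \in s -> B x (t x)] =
    (\prod_(x <- s) P [set t : environment R d | B x (t 0%R)])%E.

Definition jump_rate (a : R) (t : environment R d) (x y : site d) : R :=
  if neighbours x y then (t x * t y) `^ a else 0.

End Environment.

Section Trajectory.
Variables (R : realType) (d : nat).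
Implicit Types (w : trajectory R d) (q : site d -> site d -> R).

Definition position w (n : nat) : site d := (w n).1.
Definition holding_time w (n : nat) : R := (w n).2.
Definition jump_time w (n : nat) : R := \sum_(i < n) holding_time w i.

(* The chain sits at x at time s; after an explosion it sits nowhere. *)
Definition sits_at w (s : R) (x : site d) : Prop :=
  exists n, jump_time w n <= s < jump_time w n.+1 /\ position w n = x.

Definition exit_rate q (x : site d) : R := \sum_(y \in [set: site d]) q x y.

(* Jump chain / holding time description of the continuous-time Markov chain
   with rates q started from x: the positions form a Markov chain with
   transition probabilities q y z / exit_rate q y and, given them, the holding
   times are independent, exponential with parameters exit_rate q (Y_i). *)
Definition ctmc_law q (x : site d)
    (Q : {measure set (trajectory R d) -> \bar R}) : Prop :=
  forall (n : nat) (y : nat -> site d) (s : nat -> R), (forall i, 0 <= s i) ->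
    Q [set w : trajectory R d | forall i, (i <= n)%N ->
         position w i = y i /\ s i < holding_time w i] =
    ((y 0%N == x)%:R
     * \prod_(i < n) (q (y i) (y i.+1) / exit_rate q (y i))
     * \prod_(i < n.+1) expR (- (exit_rate q (y i) * s i)))%:E.

Definition occupation_time w (x : site d) : \bar R :=
  (\int[lebesgue_measure]_(s in `[0%R, +oo[)
     (\1_[set s : R | sits_at w s x] s)%:E)%E.

(* r(t), the number of sites within distance 1 of the walk up to time t. *)
Definition discovered w (t : R) : \bar R :=
  counting [set x : site d | exists s y,
    0 <= s <= t /\ sits_at w s y /\ (l1norm (y - x)%R <= 1)%N].

(* The n-th element (n = 1, 2, ...) of A in increasing order; 0 if there is
   none. *)
Definition nth_element (A : set nat) (n : nat) : nat :=
  xget 0%N [set k | A k /\ (\sum_(j < k.+1) `[< A j >])%N = n].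

(* nb is the fixed enumeration order of the unit ball. *)
Definition ball_order (nb : seq (site d)) : Prop :=
  uniq nb /\ forall z, (z \in nb) = (l1norm z <= 1)%N.

(* The neighbourhoods of Y_0, Y_1, ... put end to end, with repetitions. *)
Definition listing (nb : seq (site d)) w (k : nat) : site d :=
  position w (k %/ size nb) + nth 0 nb (k %% size nb).

(* x_i for i = 1, 2, ...: the sites of the listing in order of first
   appearance. *)
Definition explored (nb : seq (site d)) w (i : nat) : site d :=
  listing nb w (nth_element
    [set k | forall j, (j < k)%N -> listing nb w j <> listing nb w k] i).

End Trajectory.

Section Annealed.
Context {d1 d2 : measure_display} {T1 : measurableType d1}
  {T2 : measurableType d2} {R : realType}.
Variables (P : probability T1 R) (K : R.-pker T1 ~> T2).

Definition annealed (A : set (T1 * T2)) : \bar R :=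
  (\int[P]_t K t (xsection A t))%E.

Let annealed0 : annealed set0 = 0%E.
Proof.
by apply: integral0_eq => t _; rewrite xsection0 measure0.
Qed.

Let annealed_ge0 A : (0 <= annealed A)%E.
Proof. by apply: integral_ge0 => t _; exact: measure_ge0. Qed.

Let annealed_sigma_additive : semi_sigma_additive annealed.
Proof.
move=> A mA tA mUA.
have mK n : measurable_fun [set: T1] (fun t => K t (xsection (A n) t)).
  by apply: measurable_fun_xsection_finite_kernel; rewrite inE; exact: mA.
rewrite [X in _ --> X](_ : _ =
    (\int[P]_t \sum_(0 <= i <oo) K t (xsection (A i) t))%E); last first.
  apply: eq_integral => t _; rewrite xsection_bigcup.
  apply: measure_semi_bigcup => //.
  - by move=> n; exact: measurable_xsection.
  - exact: trivIset_xsection.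
  - by apply: bigcup_measurable => n _; exact: measurable_xsection.
rewrite integral_nneseries//.
by apply: is_cvg_nneseries => n _ _; exact: integral_ge0.
Qed.

HB.instance Definition _ := isMeasure.Build _ _ _ annealed
  annealed0 annealed_ge0 annealed_sigma_additive.

Let annealedT : annealed [set: T1 * T2] = 1%E.
Proof.
rewrite /annealed (eq_integral (fun=> 1%E)).
  by rewrite integral_cst// mul1e; exact: probability_setT.
move=> t _; rewrite (_ : xsection _ t = setT) ?prob_kernel//.
by apply/seteqP; split=> y _ //; rewrite /xsection/= inE.
Qed.

HB.instance Definition _ :=
  Measure_isProbability.Build _ _ _ annealed annealedT.

End Annealed.

Section Traps.
Variables (R : realType) (d : nat).
(* K t is the law of the chain started from 0 in the environment t. *)
Variable K : environment R d -> {measure set (trajectory R d) -> \bar R}.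

Definition green (t : environment R d) : \bar R :=
  (\int[K t]_w occupation_time w 0%R)%E.

Definition green_bar (u : punctured_environment R d) : \bar R :=
  lim (green (with_origin v u) @[v --> +oo]).

Variables (nb : seq (site d)) (alpha delta eps : R).
Implicit Types (p : environment R d * trajectory R d) (n : nat).

Definition trap_index p n : nat :=
  nth_element [set i | (0 < i)%N /\
    delta <= eps `^ alpha^-1 * p.1 (explored nb p.2 i)] n.

Definition trap_site p n : site d := explored nb p.2 (trap_index p n).

Definition trap_environment p n : punctured_environment R d :=
  off_origin (shift (trap_site p n) p.1).

Definition trap_score p n : R :=
  fine (occupation_time p.2 (trap_site p n))
  / fine (green (shift (trap_site p n) p.1)).

Definition trap_depth p n : R := eps `^ alpha^-1 * p.1 (trap_site p n).

Definition trap_time p n : R :=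
  inf [set t | 0 <= t /\ ((trap_index p n)%:R%:E <= discovered p.2 t)%E].

End Traps.

(* Values of the processes indexed by n, with the product topology. *)
Definition trap_space (R : realType) (d : nat) : topologicalType :=
  {ptws nat -> ({ptws {z : site d | z != 0} -> R} * R * R * R)%type}.

(* n = 1, 2, ... is shifted to k = 0, 1, ... *)
Definition trap_process (R : realType) (d : nat)
    (K : environment R d -> {measure set (trajectory R d) -> \bar R})
    (nb : seq (site d)) (alpha delta eps : R)
    (p : environment R d * trajectory R d) : trap_space R d :=
  fun k => (trap_environment nb alpha delta eps p k.+1,
            trap_score K nb alpha delta eps p k.+1,
            trap_depth nb alpha delta eps p k.+1,
            eps * trap_time nb alpha delta eps p k.+1).

Definition cvg_in_law (R : realType) (S : topologicalType)
    d1 (T1 : measurableType d1) (P : probability T1 R) (X : nat -> T1 -> S)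
    d2 (T2 : measurableType d2) (Q : probability T2 R) (Z : T2 -> S) : Prop :=
  forall f : S -> R, continuous f -> (exists M, forall s, `|f s| <= M) ->
    ('E_P[f \o X k] @[k --> \oo] --> 'E_Q[f \o Z])%E.

(* Main.v *)
From HB Require Import structures.
From mathcomp Require Import finmap.
From mathcomp Require Import all_boot all_order all_algebra.
From mathcomp Require Import all_classical all_reals all_analysis.
From mathcomp Require Import measurable_realfun.
From mathcomp Require Import ring lra.
Require Import Defs.

Set Implicit Arguments.
Unset Strict Implicit.
Unset Printing Implicit Defensive.

Import Order.TTheory GRing.Theory Num.Theory.
Import numFieldNormedType.Exports.

Local Open Scope classical_set_scope.
Local Open Scope ring_scope.

(** Call trap a site of depth at least [theta = delta / eps `^ alpha^-1], let
    [p] be the probability that a given site is a trap, and let [T] be the time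
    when the walk first comes within distance [1] of a trap. As [eps] tends to
    [0], [p] tends to [0]. The law of the environment around the first trap is
    found by computing the limit of the mean of [g(tau_1) * expR (- s * p * T)],
    where [tau_1] is that environment and [g] a test function, for each [s > 0],
    and by letting [s] tend to [0] at the end.

    The first trap is found independently of the environment seen from the
    origin. The walk discovers about [c * t] sites up to time [t], and each of
    them is a trap with probability [p] independently of the past. Hence [X =
    expR (- s * p * T)] behaves like [kappa = c / (c + s)] in mean, and is
    asymptotically independent of each bounded function [F] of the environment:
    the mean of [F * X] tends to [kappa] times the mean of [F]
    ([laplace_decouples]). For [F] that depends on finitely many sites this is
    an exact geometric computation ([at_first_trap_bounds]) with the number of
    discovered sites as a clock, and this clock is compared with [T] by the law
    of large numbers for the number of discovered sites ([laplace_gap]).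

    The environment around the first trap is weighted by an inverse Green
    function. Decompose according to the site [x] of the first trap. Whether [x]
    is a trap, what surrounds it, and how the walk reaches its neighbourhood
    without meeting another trap are independent ([integral_trap]), since before
    it comes next to [x] the walk does not feel the depth of [x]. Translating
    [x] to the origin, the mean of [g(tau_1) * X] becomes [p] times the mean of
    [g * U], where [U] is the sum over [x] of the functionals that describe how
    the neighbourhood of the origin is reached from [-x]
    ([trap_expectation_reach]); at this stage the depth of the origin is again
    an independent variable, and can be assumed to lie in an interval [[V, V']].
    When [V] is large, a walk next to the origin jumps to it with probability
    close to [1], so that [U * G], with [G] the Green function at the origin, is
    almost equal to the sum over [x] of the Green functions from [-x] to the
    origin ([stopped_le], [le_stopped]). By reversibility this sum is [1 / (s *
    p)] times the probability that a walk started at the origin is stopped by an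
    exponential clock of rate [s * p] before it meets another trap, in other
    words the mean of [1 - X] ([integral_stopped]). So the mean of [g(tau_1) *
    X] is close to [s^-1] times the mean of [g / G * (1 - X)].

    By the first part, the latter tends to [(1 - kappa) / s = (c + s)^-1] times
    the mean of [g / G]. Letting [s] tend to [0] and then [V] to infinity, the
    mean of [g(tau_1)] tends to that of [g / (c * green_bar)]
    ([first_trap_mean]); that the limiting Green function exists, and is
    approached with the same errors as above, follows from a comparison of the
    Green functions of two environments that differ at the origin only
    ([green_compare]). Continuous functions [g] that approximate indicators of
    orthants then identify the density ([first_trap_density]).

    The chain is handled through path sums. The probability that a killed walk
    does something is a sum over finite paths of products of jump probabilities
    ([hop]), a finite sum of functions of the environment for each length, so
    that symmetry, locality and measurability are all checked on these sums. *)

(** * Sums over the lattice *)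

Section SumZ.
Context {R : realType} {T : countType}.
Implicit Types F G : T -> \bar R.
Local Open Scope ereal_scope.

(** Summation along the enumeration of a countable type turns these sums into
    ordinary series. *)
Definition sumZ F : \bar R := \sum_(0 <= k <oo) oapp F 0 (pickle_inv k).

Lemma oapp_ge0 F k : (forall x, 0 <= F x) -> 0 <= oapp F 0 (@pickle_inv T k).
Proof. by move=> F0; case: pickle_inv => //=. Qed.

Lemma eq_sumZ F G : F =1 G -> sumZ F = sumZ G.
Proof. by move=> FG; apply: eq_eseriesr => k _; case: pickle_inv => //=. Qed.

Lemma le_sumZ F G : (forall x, 0 <= F x) -> (forall x, F x <= G x) ->
  sumZ F <= sumZ G.
Proof.
move=> F0 FG; apply: lee_nneseries => k *; first exact: oapp_ge0.
by case: pickle_inv => //=.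
Qed.

Lemma sumZ_ge0 F : (forall x, 0 <= F x) -> 0 <= sumZ F.
Proof. by move=> F0; apply: nneseries_ge0 => k _ _; exact: oapp_ge0. Qed.

Lemma sumZZl (c : R) F : (forall x, 0 <= F x) ->
  sumZ (fun x => c%:E * F x) = c%:E * sumZ F.
Proof.
move=> F0; rewrite /sumZ -nneseriesZl; last by move=> k _; exact: oapp_ge0.
by apply: eq_eseriesr => k _; case: pickle_inv => //=; rewrite mule0.
Qed.

Lemma sumZ_delta (a : T) (c : \bar R) : 0 <= c ->
  sumZ (fun x => if x == a then c else 0) = c.
Proof.
move=> c0; rewrite /sumZ (nneseriesD1 (n := pickle a)) //; last first.
  by move=> k _; case: pickle_inv => //= x; case: ifP.
rewrite pickleK_inv /= eqxx eseries0 ?adde0 // => k _ /= ka.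
case: (@pickle_inv T k) (@pickle_invK T k) => //= x xk.
by case: eqP => // xa; move: ka; rewrite -xk xa eqxx.
Qed.

Lemma sumZ_sum (I : Type) (r : seq I) (F : I -> T -> \bar R) :
  (forall i x, 0 <= F i x) ->
  sumZ (fun x => \sum_(i <- r) F i x) = \sum_(i <- r) sumZ (F i).
Proof.
move=> F0; rewrite /sumZ -nneseries_sum; last first.
  by move=> i k _; exact: oapp_ge0.
apply: eq_eseriesr => k _; case: pickle_inv => //=.
by rewrite big1.
Qed.

Lemma sumZ_nneseries (F : nat -> T -> \bar R) : (forall n x, 0 <= F n x) ->
  sumZ (fun x => \sum_(0 <= n <oo) F n x) = \sum_(0 <= n <oo) sumZ (F n).
Proof.
move=> F0; rewrite /sumZ nneseries_interchange; last first.
  by move=> k n; exact: oapp_ge0.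
apply: eq_eseriesr => k _; case: pickle_inv => //=.
by rewrite eseries0.
Qed.

End SumZ.

Lemma integral_sumZ {R : realType} {T : countType} d (X : measurableType d)
  (mu : {measure set X -> \bar R}) (F : T -> X -> \bar R) :
  (forall i x, (0 <= F i x)%E) -> (forall i, measurable_fun setT (F i)) ->
  (\int[mu]_x sumZ (F^~ x) = sumZ (fun i => \int[mu]_x F i x))%E.
Proof.
move=> F0 mF; rewrite /sumZ integral_nneseries //; last first.
- by move=> k x _; exact: oapp_ge0.
- by move=> k; case: pickle_inv => //=.
apply: eq_eseriesr => k _; case: pickle_inv => //=.
by rewrite integral0.
Qed.

Lemma measurable_sumZ {R : realType} {T : countType} d (X : measurableType d)
  (F : T -> X -> \bar R) :
  (forall i x, (0 <= F i x)%E) -> (forall i, measurable_fun setT (F i)) ->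
  measurable_fun setT (fun x => sumZ (F^~ x)).
Proof.
move=> F0 mF; apply: ge0_emeasurable_sum.
- by move=> k x _ _; exact: oapp_ge0.
- by move=> k _; case: pickle_inv => //=.
Qed.

(** * The geometry of the lattice *)

Section Lattice.
Context {d : nat}.
Implicit Types x y z : site d.
Local Open Scope ring_scope.

Lemma l1norm0 : l1norm (0 : site d) = 0%N.
Proof. by rewrite /l1norm big1 // => i _; rewrite mxE. Qed.

Lemma l1normN x : l1norm (- x) = l1norm x.
Proof. by apply: eq_bigr => i _; rewrite mxE abszN. Qed.

Lemma l1normB x y : l1norm (x - y) = l1norm (y - x).
Proof. by rewrite -l1normN opprB. Qed.

Lemma ler_l1normD x y : (l1norm (x + y)%R <= l1norm x + l1norm y)%N.
Proof.
rewrite /l1norm -big_split /=; apply: leq_sum => i _; rewrite mxE.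
by rewrite -lez_nat PoszD !abszE ler_normD.
Qed.

Lemma l1norm_eq0 x : (l1norm x == 0%N) = (x == 0).
Proof.
apply/idP/eqP => [|->]; last by rewrite l1norm0.
rewrite /l1norm sum_nat_eq0 => /forallP h; apply/rowP => i.
by move: (h i); rewrite absz_eq0 mxE => /eqP.
Qed.

Lemma ler_l1norm_dist x y z :
  (l1norm (x - z)%R <= l1norm (x - y)%R + l1norm (y - z)%R)%N.
Proof. by have := ler_l1normD (x - y) (y - z); rewrite addrA subrK. Qed.

End Lattice.

(** * Path sums of a killed walk *)

Section PathSums.
Context {R : realType} {d : nat}.
Variable E : seq (site d).
Hypothesis uniq_E : uniq E.
Hypothesis mem_E : forall z, (z \in E) = (l1norm z == 1%N).
Implicit Types (q : site d -> site d -> R) (lam : R) (A H : pred (site d)).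
Implicit Types (phi psi : site d -> R) (x y z : site d) (n N : nat).

Definition total_rate q x : R := \sum_(e <- E) q x (x + e).

Definition step q lam x y : R := q x y / (lam + total_rate q x).

(** The expectation of [phi] at the [n]-th position of the walk with rates [q]
    started at [x], on the event that this walk, killed at rate [lam], makes
    [n] jumps, each of them from a site of [A]. *)
Fixpoint hop q lam A phi n x : R :=
  if n is n'.+1 then
    (A x)%:R * \sum_(e <- E) step q lam x (x + e) * hop q lam A phi n' (x + e)
  else phi x.

Lemma hopS q lam A phi n x : hop q lam A phi n.+1 x =
  (A x)%:R * \sum_(e <- E) step q lam x (x + e) * hop q lam A phi n (x + e).
Proof. by []. Qed.

Lemma eq_hop q q' lam A A' phi phi' n x :
  A =1 A' -> phi =1 phi' -> (forall x y, A x -> l1norm (y - x) = 1%N ->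
     step q lam x y = step q' lam x y) ->
  hop q lam A phi n x = hop q' lam A' phi' n x.
Proof.
move=> AA' pp qq; elim: n x => [|n IH] x; first exact: pp.
rewrite !hopS -AA'; case: (boolP (A x)) => Ax; last by rewrite !mul0r.
congr (_ * _); rewrite !big_seq; apply: eq_bigr => e; rewrite mem_E => /eqP e1.
by rewrite IH qq // addrAC subrr add0r.
Qed.

Section Rates.
Variables (q : site d -> site d -> R) (lam : R).
Hypothesis q_ge0 : forall x y, 0 <= q x y.
Hypothesis q_sym : forall x y, q x y = q y x.
Hypothesis lam_ge0 : 0 <= lam.

Local Notation Q := (total_rate q).
Local Notation st := (step q lam).

Lemma total_rate_ge0 x : 0 <= Q x.
Proof. exact: sumr_ge0. Qed.

Lemma step_ge0 x y : 0 <= st x y.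
Proof. by rewrite divr_ge0 // addr_ge0 // total_rate_ge0. Qed.

Lemma hop_ge0 A phi n x : (forall z, 0 <= phi z) -> 0 <= hop q lam A phi n x.
Proof.
move=> p0; elim: n x => //= n IH x; rewrite mulr_ge0 //.
by apply: sumr_ge0 => e _; rewrite mulr_ge0 // step_ge0.
Qed.

Lemma ler_hop A phi psi n x : (forall z, phi z <= psi z) ->
  hop q lam A phi n x <= hop q lam A psi n x.
Proof.
move=> pp; elim: n x => //= n IH x; rewrite ler_wpM2l //.
by apply: ler_sum => e _; rewrite ler_wpM2l // step_ge0.
Qed.

Lemma hopD A phi psi n x : hop q lam A (fun z => phi z + psi z) n x =
  hop q lam A phi n x + hop q lam A psi n x.
Proof.
elim: n x => //= n IH x; rewrite -mulrDr -big_split /=; congr (_ * _).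
by apply: eq_bigr => e _; rewrite IH mulrDr.
Qed.

Lemma hopZ A c phi n x : hop q lam A (fun z => c * phi z) n x =
  c * hop q lam A phi n x.
Proof.
elim: n x => //= n IH x; rewrite mulrCA; congr (_ * _); rewrite mulr_sumr.
by apply: eq_bigr => e _; rewrite IH mulrCA.
Qed.

(** The recursion defining [hop] singles out the first step of the path; this
    one singles out the last step. *)
Lemma hop_comm A phi n x :
  hop q lam A (fun z => (A z)%:R *
    \sum_(e <- E) st z (z + e) * phi (z + e)) n x = hop q lam A phi n.+1 x.
Proof.
by elim: n x => [//|n IH] x; rewrite hopS [RHS]hopS; congr (_ * _);
  apply: eq_bigr => e _; rewrite IH.
Qed.

(** The term of order [n] of the Green function of the walk killed at rate
    [lam] and when it leaves [A]. *)
Definition green_term A n x y : R :=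
  hop q lam A (fun z => if A z && (z == y) then (lam + Q z)^-1 else 0) n x.

Lemma green_kernel_ge0 A y z :
  0 <= (if A z && (z == y) then (lam + Q z)^-1 else 0).
Proof. by case: ifP => // _; rewrite invr_ge0 addr_ge0 // total_rate_ge0. Qed.

Lemma green_term_ge0 A n x y : 0 <= green_term A n x y.
Proof. by apply: hop_ge0 => z; exact: green_kernel_ge0. Qed.

Lemma green_termS A n x y : green_term A n.+1 x y =
  (A x)%:R * \sum_(e <- E) st x (x + e) * green_term A n (x + e) y.
Proof. by []. Qed.

Lemma memN_E z : (- z \in E) = (z \in E).
Proof. by rewrite !mem_E l1normN. Qed.

Lemma sum_E_delta x y (F : site d -> R) :
  \sum_(e <- E) (if x + e == y then F (x + e) else 0) =
  if y - x \in E then F y else 0.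
Proof.
have eqc e : (x + e == y) = (e == y - x).
  by rewrite [RHS]eq_sym subr_eq addrC eq_sym.
under eq_bigr do rewrite eqc.
case: ifP => yE.
  rewrite (bigD1_seq (y - x)) //= eqxx [x + _]addrC subrK big1 ?addr0 //.
  by move=> e /negPf ->.
rewrite big_seq big1 // => e eE; case: eqP => // eyx.
by rewrite -eyx eE in yE.
Qed.

(** Decomposition at the last step. As the rates are symmetric, it exchanges
    the roles of the end points. *)
Lemma green_termSr A n x y : green_term A n.+1 x y =
  (A y)%:R / (lam + Q y) * \sum_(e <- E) green_term A n x (y + e) * q (y + e) y.
Proof.
elim: n x => [|n IH] x.
  rewrite green_termS /green_term /=.
  pose F1 z := st x z * (A z)%:R / (lam + Q z).
  pose F2 z := (A z)%:R / (lam + Q z) * q z y.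
  have -> : \sum_(e <- E) st x (x + e) *
      (if A (x + e) && (x + e == y) then (lam + Q (x + e))^-1 else 0) =
    \sum_(e <- E) (if x + e == y then F1 (x + e) else 0).
    apply: eq_bigr => e _; rewrite /F1; case: eqP => _; rewrite ?andbT ?andbF ?mulr0 //.
    by case: (A _); rewrite ?mulr1 ?mulr0 ?mul0r.
  have -> : \sum_(e <- E) (if A x && (x == y + e) then (lam + Q x)^-1 else 0)
      * q (y + e) y =
    \sum_(e <- E) (if y + e == x then F2 (y + e) else 0).
    apply: eq_bigr => e _; rewrite /F2 [x == _]eq_sym; case: eqP => [<-|_].
      by case: (A _); rewrite ?mul0r ?mul1r.
    by rewrite andbF mul0r.
  rewrite !sum_E_delta -(memN_E (x - y)) opprB.
  by case: ifP => _; rewrite ?mulr0 // /F1 /F2 /step; ring.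
transitivity (\sum_(e <- E) \sum_(e' <- E) (A x)%:R * (st x (x + e) *
  ((A y)%:R / (lam + Q y) * (green_term A n (x + e) (y + e') * q (y + e') y)))).
  by rewrite green_termS mulr_sumr; apply: eq_bigr => e _; rewrite IH !mulr_sumr.
rewrite exchange_big mulr_sumr; apply: eq_bigr => e' _.
rewrite green_termS mulr_sumr mulr_suml mulr_sumr; apply: eq_bigr => e _.
ring.
Qed.

(** The counting measure is reversible, because the rates are symmetric. *)
Lemma green_term_sym A n x y : green_term A n x y = green_term A n y x.
Proof.
elim: n x y => [|n IH] x y.
  by rewrite /green_term /= [y == x]eq_sym; case: eqP => [->|]; rewrite ?andbF.
rewrite green_termSr green_termS mulr_sumr mulr_sumr; apply: eq_bigr => e _.
rewrite IH /step q_sym; ring.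
Qed.


Lemma sum_step_le1 x : \sum_(e <- E) st x (x + e) <= 1.
Proof.
rewrite -mulr_suml; have := total_rate_ge0 x; rewrite le_eqVlt => /orP[/eqP Q0|Q0].
  by rewrite -[X in X / _]/(Q x) -Q0 mul0r.
rewrite -[X in X / _]/(Q x) ler_pdivrMr ?mul1r ?lerDr //.
by rewrite (lt_le_trans Q0) // lerDr.
Qed.

Lemma sum_hopS A phi N x : \sum_(0 <= n < N.+1) hop q lam A phi n x =
  phi x + (A x)%:R * \sum_(e <- E) st x (x + e) *
     \sum_(0 <= n < N) hop q lam A phi n (x + e).
Proof.
rewrite big_nat_recl //=; congr (_ + _); rewrite -mulr_sumr; congr (_ * _).
by rewrite exchange_big /=; apply: eq_bigr => e _; rewrite mulr_sumr.
Qed.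

Lemma sum_green_ge0 A N x y : 0 <= \sum_(0 <= n < N) green_term A n x y.
Proof. by apply: sumr_ge0 => n _; exact: green_term_ge0. Qed.

(** A path from [x] to [y] first goes to [H], and the time spent in [y] from
    there on is at most [M] on average. *)
Lemma ler_green_first_passage A H y M N x : H y ->
  (forall z K, H z -> \sum_(0 <= n < K) green_term A n z y <= M) ->
  \sum_(0 <= n < N) green_term A n x y <=
  M * \sum_(0 <= n < N) hop q lam (predD A H) (fun z => (H z)%:R) n x.
Proof.
move=> Hy HM; have M0 : 0 <= M.
  by rewrite (le_trans _ (HM y 0%N Hy)) // big_nil.
elim: N x => [|N IH] x; first by rewrite !big_geq // mulr0.
case: (boolP (H x)) => Hx.
  apply: (le_trans (HM _ _ Hx)); rewrite ler_peMr // sum_hopS /= Hx lerDl.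
  by rewrite mul0r.
have xy : (x == y) = false by apply/negbTE; apply: contraNneq Hx => ->.
rewrite !sum_hopS /= xy andbF add0r (negbTE Hx) /= add0r mulrCA.
rewrite ler_wpM2l // mulr_sumr; apply: ler_sum => e _.
rewrite mulrCA; apply: ler_wpM2l; [exact: step_ge0 | exact: IH].
Qed.

(** First passage through [y]: time spent in [y] only starts to count once the
    walk is there. *)
Lemma ler_green_diag A y M N x :
  (forall K, \sum_(0 <= n < K) green_term A n y y <= M) ->
  \sum_(0 <= n < N) green_term A n x y <= M.
Proof.
move=> HM; have M0 : 0 <= M by rewrite (le_trans _ (HM 0%N)) // big_nil.
elim: N x => [|N IH] x; first by rewrite big_geq.
have [->//|/negbTE xy] := eqVneq x y.
rewrite sum_hopS xy andbF add0r.
apply: (@le_trans _ _ (1 * (1 * M))); last by rewrite !mul1r.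
apply: ler_pM.
- by [].
- by apply: sumr_ge0 => e _; rewrite mulr_ge0 ?step_ge0 // sum_green_ge0.
- by case: (A x).
- rewrite (le_trans _ (ler_wpM2r M0 (sum_step_le1 x))) // mulr_suml.
  by apply: ler_sum => e _; apply: ler_wpM2l; [exact: step_ge0 | exact: IH].
Qed.

Definition green_sum A x y : \bar R := (\sum_(0 <= n <oo) (green_term A n x y)%:E)%E.

(** The Laplace transform at [lam] of the first time in [H], for the walk
    killed when it jumps from a site outside [A]. *)
Definition hit_sum A H x : \bar R :=
  (\sum_(0 <= n <oo) (hop q lam (predD A H) (fun z => (H z)%:R) n x)%:E)%E.

Lemma green_sum_ge0 A x y : (0 <= green_sum A x y)%E.
Proof. by apply: nneseries_ge0 => n _ _; rewrite lee_fin green_term_ge0. Qed.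

Lemma hit_term_ge0 A H n x : 0 <= hop q lam (predD A H) (fun z => (H z)%:R) n x.
Proof. by apply: hop_ge0 => z; case: (H z). Qed.

Lemma hit_sum_ge0 A H x : (0 <= hit_sum A H x)%E.
Proof. by apply: nneseries_ge0 => n _ _; rewrite lee_fin hit_term_ge0. Qed.

(** The contribution of the paths with at least one step. *)
Lemma green_sum_rec A x y : A x ->
  (\sum_(e <- E) (st x (x + e)%R)%:E * green_sum A (x + e)%R y <= green_sum A x y)%E.
Proof.
move=> Ax; under eq_bigr => e _.
  rewrite /green_sum -nneseriesZl; last by move=> n _; rewrite lee_fin green_term_ge0.
  over.
rewrite -nneseries_sum; last first.
  by move=> e n _; rewrite -EFinM lee_fin mulr_ge0 ?step_ge0 ?green_term_ge0.
rewrite (eq_eseriesr (g := fun n => (green_term A n.+1 x y)%:E)); last first.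
  move=> n _; rewrite green_termS Ax mul1r -sumEFin.
  by apply: eq_bigr => e _; rewrite -EFinM.
rewrite [leRHS]nneseries_recl //; last first.
  by move=> n _; rewrite lee_fin green_term_ge0.
rewrite [X in (_ <= _ + X)%E](_ : _ = (\sum_(0 <= n <oo) (green_term A n.+1 x y)%:E)%E).
  by rewrite leeDr // lee_fin green_term_ge0.
rewrite -nneseries_addn; last by move=> n; rewrite lee_fin green_term_ge0.
by apply: eq_eseriesr => n _; rewrite addn1.
Qed.

(** The walk that reaches [H] spends from there on a time at least [m] in [y]. *)
Lemma lee_first_passage_green A H y (m : R) N x : 0 <= m ->
  (forall z, H z -> (m%:E <= green_sum A z y)%E) ->
  ((m * \sum_(0 <= n < N) hop q lam (predD A H) (fun z => (H z)%:R) n x)%:E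
    <= green_sum A x y)%E.
Proof.
move=> m0 HM; elim: N x => [|N IH] x.
  by rewrite big_geq // mulr0 green_sum_ge0.
case: (boolP (H x)) => Hx.
  by rewrite sum_hopS /= Hx mul0r addr0 mulr1 HM.
rewrite sum_hopS /= (negbTE Hx) /= add0r; case: (boolP (A x)) => Ax; last first.
  by rewrite mul0r mulr0 green_sum_ge0.
rewrite mul1r mulr_sumr -sumEFin (le_trans _ (green_sum_rec _ Ax)) //.
apply: lee_sum => e _; rewrite mulrCA EFinM lee_wpmul2l //.
by rewrite lee_fin step_ge0.
Qed.

Section Mass.
Hypothesis rate_gt0 : forall x, 0 < lam + Q x.
Variable A : pred (site d).

Definition exit_rate_of x : R := \sum_(e <- E) q x (x + e) * (~~ A (x + e))%:R.

Lemma exit_rate_of_ge0 x : 0 <= exit_rate_of x.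
Proof. by apply: sumr_ge0 => e _; rewrite mulr_ge0. Qed.

Definition survive n x := hop q lam A (fun z => (A z)%:R) n x.

Definition killed n x :=
  hop q lam A (fun z => (A z)%:R * ((lam + exit_rate_of z) / (lam + Q z))) n x.

(** Mass is conserved: what survives a step or is killed was alive. *)
Lemma killedD n x : killed n x + survive n.+1 x = survive n x.
Proof.
rewrite /survive -hop_comm -hopD; apply: eq_hop => // z.
case: (boolP (A z)) => Az; last by rewrite !mul0r addr0.
rewrite !mul1r /exit_rate_of.
have -> : \sum_(e <- E) st z (z + e) * (A (z + e))%:R =
   (\sum_(e <- E) q z (z + e) * (A (z + e))%:R) / (lam + Q z).
  by rewrite mulr_suml; apply: eq_bigr => e _; rewrite /step mulrAC.
rewrite -mulrDl -addrA -big_split /=.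
under eq_bigr do rewrite -mulrDr -natrD addn_negb mulr1.
by rewrite -[\sum_(i <- E) _]/(Q z) divff ?gt_eqF.
Qed.

Lemma sum_killed N x :
  \sum_(0 <= n < N) killed n x + survive N x = (A x)%:R.
Proof.
elim: N => [|N IH]; first by rewrite big_geq // add0r.
by rewrite big_nat_recr //= -addrA killedD.
Qed.

Lemma survive_ge0 n x : 0 <= survive n x.
Proof. by apply: hop_ge0 => z; case: (A z). Qed.

Lemma sum_killed_le1 N x : \sum_(0 <= n < N) killed n x <= 1.
Proof.
have := sum_killed N x; have := survive_ge0 N x.
by case: (A x) => /= ? ?; lra.
Qed.

(** The lifetime of the walk has mean at most [lam^-1]. *)
Lemma sum_green_le N x y : 0 < lam ->
  \sum_(0 <= n < N) green_term A n x y <= lam^-1.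
Proof.
move=> l0; rewrite -[leRHS]mulr1 ler_pdivlMl //.
rewrite (le_trans _ (sum_killed_le1 N x)) // mulr_sumr; apply: ler_sum => n _.
rewrite -hopZ; apply: ler_hop => z; case: (A z); last by rewrite mulr0 mul0r.
have qz := rate_gt0 z; rewrite mul1r; case: ifP => _.
  by rewrite ler_pM2r ?invr_gt0 // lerDl exit_rate_of_ge0.
rewrite mulr0.
by apply: divr_ge0; [exact: addr_ge0 (exit_rate_of_ge0 _) | exact: ltW].
Qed.

(** If the jump rates are bounded on [A], then killing at rate [lam] has at
    each step a probability bounded from below. *)
Lemma survive_geo (theta : R) : 0 <= theta ->
  (forall x, A x -> Q x <= theta * (lam + Q x)) ->
  forall n x, survive n x <= theta ^+ n.
Proof.
move=> t0 h; elim=> [|n IH] x; first by rewrite /survive /=; case: (A x).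
rewrite /survive hopS; case: (boolP (A x)) => Ax; last first.
  by rewrite mul0r exprn_ge0.
rewrite mul1r; apply: (@le_trans _ _ (\sum_(e <- E) st x (x + e) * theta ^+ n)).
  by apply: ler_sum => e _; rewrite ler_wpM2l // ?step_ge0 // IH.
rewrite -mulr_suml exprS ler_wpM2r ?exprn_ge0 //.
by rewrite -mulr_suml ler_pdivrMr // h.
Qed.

Lemma sumZ_green_term (c : site d -> R) n x : (forall y, 0 <= c y) ->
  sumZ (fun y => (c y * green_term A n x y)%:E) =
  (hop q lam A (fun z => (A z)%:R * (c z / (lam + Q z))) n x)%:E.
Proof.
move=> c0; elim: n x => [|n IH] x.
  rewrite /green_term /=.
  under eq_sumZ => y.
    rewrite (_ : _%:E = if y == x then
       ((A x)%:R * (c x / (lam + Q x)))%:E else 0%E); first over.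
    by rewrite [x == y]eq_sym; case: eqP => [->|_];
      case: (A x); rewrite /= ?mul0r ?mul1r ?mulr0.
  by rewrite sumZ_delta // lee_fin mulr_ge0 // divr_ge0 // ltW.
rewrite hopS mulr_sumr -sumEFin.
under eq_bigr => e _ do rewrite mulrA EFinM -IH.
rewrite (eq_sumZ (G := fun y => (\sum_(e <- E) ((A x)%:R * st x (x + e))%:E *
    (c y * green_term A n (x + e) y)%:E)%E)); last first.
  move=> y; rewrite green_termS !mulr_sumr -sumEFin; apply: eq_bigr => e _.
  by rewrite -EFinM; congr (_%:E); ring.
have h0 e y : (0 <= (c y * green_term A n (x + e) y)%:E)%E.
  by rewrite lee_fin mulr_ge0 // green_term_ge0.
rewrite sumZ_sum; last first.
  by move=> e y; rewrite mule_ge0 // lee_fin mulr_ge0 ?step_ge0.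
by apply: eq_bigr => e _; rewrite sumZZl.
Qed.

(** By reversibility, a sum over starting points is a sum over end points,
    hence an expectation for a single walk. *)
Lemma sumZ_green_sum (c : site d -> R) x : (forall y, 0 <= c y) ->
  sumZ (fun y => (c y)%:E * green_sum A y x)%E =
  (\sum_(0 <= n <oo) (hop q lam A (fun z => (A z)%:R * (c z / (lam + Q z))) n x)%:E)%E.
Proof.
move=> c0; rewrite (eq_sumZ (G := fun y => (\sum_(0 <= n <oo)
   (c y * green_term A n x y)%:E)%E)); last first.
  move=> y; rewrite /green_sum -nneseriesZl; last first.
    by move=> n _; rewrite lee_fin green_term_ge0.
  by apply: eq_eseriesr => n _; rewrite -EFinM green_term_sym.
rewrite sumZ_nneseries; last first.
  by move=> n y; rewrite lee_fin mulr_ge0 // green_term_ge0.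
by apply: eq_eseriesr => n _; rewrite sumZ_green_term.
Qed.

Hypothesis lam_gt0 : 0 < lam.

Lemma green_sum_fin x y : green_sum A x y \is a fin_num.
Proof.
rewrite ge0_fin_numE ?green_sum_ge0 //; apply: (@le_lt_trans _ _ (lam^-1)%:E).
  apply: lime_le; first by apply: is_cvg_nneseries => n _ _; rewrite lee_fin green_term_ge0.
  by apply: nearW => N; rewrite sumEFin lee_fin sum_green_le.
exact: ltry.
Qed.

Lemma green_sum_partial N x y :
  \sum_(0 <= n < N) green_term A n x y <= fine (green_sum A x y).
Proof.
rewrite -lee_fin fineK ?green_sum_fin // -sumEFin.
by apply: nneseries_lim_ge => n _ _; rewrite lee_fin green_term_ge0.
Qed.

(** The walk enters [H] on its way to [y], and among the points of [H] none
    gives a larger Green function towards [y] than [y] itself. *)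
Lemma lee_green_hit H x y : H y ->
  (green_sum A x y <= green_sum A y y * hit_sum A H x)%E.
Proof.
move=> Hy; rewrite -(fineK (green_sum_fin y y)).
have f0 : 0 <= fine (green_sum A y y) by rewrite fine_ge0 // green_sum_ge0.
apply: lime_le; first by apply: is_cvg_nneseries => n _ _; rewrite lee_fin green_term_ge0.
apply: nearW => N; rewrite sumEFin.
apply: (@le_trans _ _ (fine (green_sum A y y) *
   \sum_(0 <= n < N) hop q lam (predD A H) (fun z => (H z)%:R) n x)%:E).
  rewrite lee_fin ler_green_first_passage // => z K _.
  by apply: ler_green_diag => K'; exact: green_sum_partial.
rewrite EFinM lee_wpmul2l // -sumEFin.
by apply: nneseries_lim_ge => n _ _; rewrite lee_fin hit_term_ge0.
Qed.

(** Once in [H], the walk may jump to [y] at once, so that the factor [rho] is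
    all that is lost. *)
Lemma lee_hit_green H rho x y : 0 <= rho <= 1 ->
  (forall z, H z -> z != y -> [&& A z, y - z \in E & rho <= st z y]) ->
  (rho%:E * green_sum A y y * hit_sum A H x <= green_sum A x y)%E.
Proof.
move=> /andP[r0 r1] HH; have G0 := green_sum_ge0 A y y.
rewrite -(fineK (green_sum_fin y y)) -EFinM.
have f0 : 0 <= fine (green_sum A y y) by rewrite fine_ge0.
rewrite -nneseriesZl; last by move=> n _; rewrite lee_fin hit_term_ge0.
apply: lime_le.
  apply: is_cvg_nneseries => n _ _.
  by rewrite mule_ge0 // lee_fin ?hit_term_ge0 ?mulr_ge0.
apply: nearW => N; under eq_bigr do rewrite -EFinM.
rewrite sumEFin -mulr_sumr; apply: lee_first_passage_green => [|z Hz].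
  exact: mulr_ge0.
have [->|zy] := eqVneq z y.
  by rewrite EFinM fineK ?green_sum_fin // gee_pMl ?green_sum_fin.
have /and3P[Az yz hr] := HH _ Hz zy.
rewrite (le_trans _ (green_sum_rec _ Az)) // (bigD1_seq (y - z)) //=.
rewrite [z + _]addrC subrK EFinM fineK ?green_sum_fin //.
rewrite (le_trans (y := (st z y)%:E * green_sum A y y)%E) ?lee_wpmul2r // leeDl //.
by apply: sume_ge0 => e _; rewrite mule_ge0 ?green_sum_ge0 // lee_fin step_ge0.
Qed.

End Mass.
End Rates.

Lemma hop_shift q lam A phi n x y :
  hop (fun u v => q (x + u) (x + v)) lam (fun u => A (x + u))
      (fun u => phi (x + u)) n y = hop q lam A phi n (x + y).
Proof.
elim: n y => // n IH y; rewrite !hopS; congr (_ * _); apply: eq_bigr => e _.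
rewrite IH /step /total_rate -addrA; congr (_ / (_ + _) * _).
by apply: eq_bigr => e' _; rewrite -addrA.
Qed.

End PathSums.

Lemma cvge_from_below {R : realType} (u : nat -> \bar R) (S : \bar R) :
  (forall k, 0 <= u k <= S)%E ->
  (forall r : R, (r%:E < S)%E -> \forall k \near \oo, (r%:E < u k)%E) ->
  u @ \oo --> S.
Proof.
move=> uS; case: S uS => [s||] uS h.
- have ufin k : u k \is a fin_num.
    have /andP[u0 us] := uS k.
    by rewrite ge0_fin_numE // (le_lt_trans us) // ltry.
  apply/fine_cvgP; split; first exact: nearW.
  apply/cvgrPdist_lt => e e0.
  have /h : ((s - e)%:E < s%:E)%E by rewrite lte_fin gtrBl.
  apply: filterS => k; rewrite -(fineK (ufin k)) lte_fin => ku.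
  have := uS k; rewrite -(fineK (ufin k)) !lee_fin => /andP[_ us] /=.
  by rewrite ger0_norm ?subr_ge0 // ltrBlDr addrC -ltrBlDr.
- by apply/cvgeyPgt => A; apply: h; rewrite ltry.
- by have := uS 0%N => /andP[u0]; rewrite leeNy_eq => /eqP E0; rewrite E0 in u0.
Qed.

Lemma cvg_bigsum {R : realType} (I : Type) (r : seq I) (f : I -> nat -> R) (l : I -> R) :
  (forall i, f i k @[k --> \oo] --> l i) ->
  \sum_(i <- r) f i k @[k --> \oo] --> \sum_(i <- r) l i.
Proof.
move=> fl; elim: r => [|i r IH].
  by rewrite big_nil; under eq_fun do rewrite big_nil; exact: cvg_cst.
by rewrite big_cons; under eq_fun do rewrite big_cons; exact: cvgD.
Qed.

Section GreenLimit.
Context {R : realType} {d : nat}.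
Variable E : seq (site d).
Hypothesis uniq_E : uniq E.
Hypothesis mem_E : forall z, (z \in E) = (l1norm z == 1%N).
Variables (q : site d -> site d -> R).
Hypothesis q_ge0 : forall x y, 0 <= q x y.
Hypothesis Q_gt0 : forall x, 0 < total_rate E q x.

Lemma cvg_hop (lam : nat -> R) (A : nat -> pred (site d)) phi phi0 n x :
  lam k @[k --> \oo] --> 0 -> (forall x, \forall k \near \oo, A k x) ->
  (forall z, phi k z @[k --> \oo] --> phi0 z) ->
  hop E q (lam k) (A k) (phi k) n x @[k --> \oo] --> hop E q 0 predT phi0 n x.
Proof.
move=> l0 AT pp; elim: n x => [|n IH] x; first exact: pp.
rewrite /=; apply: cvgM.
  apply: cvg_near_cst; move: (AT x); apply: filterS => k Ak.
  by rewrite Ak.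
rewrite [X in _ --> X](_ : _ = \sum_(e <- E) step E q 0 x (x + e) * hop E q 0 predT phi0 n (x + e)) //.
apply: cvg_bigsum => e; apply: cvgM; last exact: IH.
apply: cvgM; first exact: cvg_cst.
apply: cvgV; first by rewrite add0r gt_eqF.
by apply: cvgD => //; exact: cvg_cst.
Qed.

Lemma ler_green_term (lam : R) A n x y : 0 <= lam ->
  green_term E q lam A n x y <= green_term E q 0 predT n x y.
Proof.
move=> l0; have h z : (lam + total_rate E q z)^-1 <= (0 + total_rate E q z)^-1.
  by rewrite add0r lef_pV2 ?posrE ?lerDr // ltr_wpDl.
have i0 z : 0 <= (0 + total_rate E q z)^-1 by rewrite add0r invr_ge0 ltW.
elim: n x => [|n IH] x.
  by rewrite /green_term /=; case: (A x) => /=; case: eqP => _ //=.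
rewrite !green_termS; apply: ler_pM => //.
- apply: sumr_ge0 => e _; rewrite mulr_ge0 ?step_ge0 //; exact: green_term_ge0.
- by case: (A x).
apply: ler_sum => e _; apply: ler_pM => //; first exact: step_ge0.
  exact: green_term_ge0.
by rewrite /step ler_wpM2l.
Qed.

(** The killed Green functions stay below the limit and their terms converge
    one by one; this suffices even when the limit is infinite. *)
Lemma cvg_green_sum (lam : nat -> R) (A : nat -> pred (site d)) x y :
  (forall k, 0 <= lam k) ->
  lam k @[k --> \oo] --> 0 -> (forall x, \forall k \near \oo, A k x) ->
  green_sum E q (lam k) (A k) x y @[k --> \oo] --> green_sum E q 0 predT x y.
Proof.
move=> lge l0 AT; apply: cvge_from_below => [k|r].
  rewrite green_sum_ge0 //=; apply: lee_nneseries => n *.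
    by rewrite lee_fin green_term_ge0.
  by rewrite lee_fin ler_green_term.
move=> rS; have [N rN] : exists N, r < \sum_(0 <= n < N) green_term E q 0 predT n x y.
  apply: contrapT => /forallNP h; move: rS; rewrite ltNge => /negP; apply.
  apply: lime_le; first by apply: is_cvg_nneseries => n _ _; rewrite lee_fin green_term_ge0.
  by apply: nearW => N; rewrite sumEFin lee_fin leNgt; apply/negP/h.
have : \sum_(0 <= n < N) green_term E q (lam k) (A k) n x y @[k --> \oo] -->
    \sum_(0 <= n < N) green_term E q 0 predT n x y.
  apply: cvg_bigsum => n; apply: cvg_hop => // z.
  have [->|zy] := eqVneq z y; last first.
    by rewrite andbF; under eq_fun do rewrite andbF; exact: cvg_cst.
  have : (lam k + total_rate E q y)^-1 @[k --> \oo] --> (0 + total_rate E q y)^-1.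
    apply: cvgV; first by rewrite add0r gt_eqF.
    by apply: cvgD => //; exact: cvg_cst.
  apply: cvg_trans; apply: near_eq_cvg; move: (AT y); apply: filterS => k ->.
  by [].
move=> /cvgr_gt /(_ _ rN); apply: filterS => k rk.
rewrite (lt_le_trans (y := (\sum_(0 <= n < N) green_term E q (lam k) (A k) n x y)%:E)) //.
rewrite -sumEFin; apply: nneseries_lim_ge => n _ _.
by rewrite lee_fin green_term_ge0.
Qed.

End GreenLimit.

(** * The random conductances *)

Section Rates.
Context {R : realType} {d : nat}.
Variables (a : R) (nb : seq (site d)).
Hypothesis nb_order : ball_order nb.
Hypothesis d_gt0 : (0 < d)%N.
Implicit Types (t : environment R d) (x y z o : site d) (lam : R).

Definition steps : seq (site d) := [seq z <- nb | z != 0].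

Lemma mem_nb z : (z \in nb) = (l1norm z <= 1)%N.
Proof. by case: nb_order. Qed.

Lemma uniq_steps : uniq steps.
Proof. by case: nb_order => u _; exact: filter_uniq. Qed.

Lemma mem_steps z : (z \in steps) = (l1norm z == 1%N).
Proof.
rewrite mem_filter mem_nb -l1norm_eq0; case: (l1norm z) => [|[|n]] //=.
Qed.

Lemma steps_nonempty : exists e, e \in steps.
Proof.
exists (delta_mx ord0 (Ordinal d_gt0) : 'rV[int]_d); rewrite mem_steps /l1norm.
rewrite (bigD1 (Ordinal d_gt0)) //= big1 ?addn0 => [|i /negbTE id].
  by rewrite mxE !eqxx.
by rewrite mxE id andbF.
Qed.

Lemma neighboursE x y : neighbours x y = (y - x \in steps).
Proof. by rewrite mem_steps /neighbours l1normB. Qed.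

Lemma neighbours_sym x y : neighbours x y = neighbours y x.
Proof. by rewrite /neighbours l1normB. Qed.

Lemma jump_rate_ge0 t x y : 0 <= jump_rate a t x y.
Proof. by rewrite /jump_rate; case: ifP => // _; exact: powR_ge0. Qed.

Lemma jump_rate_sym t x y : jump_rate a t x y = jump_rate a t y x.
Proof. by rewrite /jump_rate neighbours_sym mulrC. Qed.

Lemma jump_rate_gt0 t x y : (forall z, 0 < t z) -> neighbours x y ->
  0 < jump_rate a t x y.
Proof. by move=> t0 xy; rewrite /jump_rate xy powR_gt0 // mulr_gt0. Qed.

Lemma jump_rateM t x y : (forall z, 0 < t z) -> neighbours x y ->
  jump_rate a t x y = t x `^ a * t y `^ a.
Proof. by move=> t0 xy; rewrite /jump_rate xy powRM // ltW. Qed.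

Lemma neighboursD x e : neighbours x (x + e) = (e \in steps).
Proof. by rewrite neighboursE addrAC subrr add0r. Qed.

Lemma total_jump_rate_gt0 t x : (forall z, 0 < t z) ->
  0 < total_rate steps (jump_rate a t) x.
Proof.
move=> t0; have [e eE] := steps_nonempty.
rewrite /total_rate (bigD1_seq e) ?uniq_steps //= ltr_wpDr //.
  by apply: sumr_ge0 => i _; exact: jump_rate_ge0.
by rewrite jump_rate_gt0 // neighboursD.
Qed.

Lemma exit_rateE t x :
  exit_rate (jump_rate a t) x = total_rate steps (jump_rate a t) x.
Proof.
rewrite /exit_rate /total_rate -(big_map (fun e => x + e) predT (jump_rate a t x)).
rewrite -(fsbig_widen [set` [seq x + e | e <- steps]]) //; last first.
  move=> y [_ /= /negP yE]; rewrite /jump_rate neighboursE; case: ifP => //.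
  move=> /(map_f (fun e => x + e)); rewrite addrC subrK => h.
  by rewrite h in yE.
rewrite -fsbig_seq // map_inj_uniq ?uniq_steps //.
Qed.

Lemma jump_rate_shift t x y z :
  jump_rate a (shift x t) y z = jump_rate a t (x + y) (x + z).
Proof.
by rewrite /jump_rate /shift /neighbours opprD addrACA subrr add0r.
Qed.

Definition agree_off o t t' := forall y, y != o -> t y = t' y.

Lemma jump_rate_agree o t t' x y : agree_off o t t' -> x != o -> y != o ->
  jump_rate a t x y = jump_rate a t' x y.
Proof. by move=> tt xo yo; rewrite /jump_rate !tt. Qed.

Lemma far_neighbour x y o : (1 < l1norm (x - o)%R)%N -> l1norm (y - x) = 1%N ->
  y != o.
Proof.
by move=> xo yx; apply: contraTneq xo => <-; rewrite l1normB yx.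
Qed.

Lemma far_neq x o : (1 < l1norm (x - o)%R)%N -> x != o.
Proof. by apply: contraTneq => ->; rewrite subrr l1norm0. Qed.

(** Away from the unit ball around [o], the walk does not see the value of the
    environment at [o]. *)
Lemma total_rate_agree o t t' x : agree_off o t t' ->
  (1 < l1norm (x - o)%R)%N ->
  total_rate steps (jump_rate a t) x = total_rate steps (jump_rate a t') x.
Proof.
move=> tt xo; rewrite /total_rate !big_seq; apply: eq_bigr => e.
rewrite mem_steps => /eqP e1; apply: (jump_rate_agree tt) (far_neq xo) _.
by apply: far_neighbour xo _; rewrite addrAC subrr add0r.
Qed.

Lemma step_agree o t t' lam x y : agree_off o t t' ->
  (1 < l1norm (x - o)%R)%N -> l1norm (y - x) = 1%N ->
  step steps (jump_rate a t) lam x y = step steps (jump_rate a t') lam x y.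
Proof.
move=> tt xo yx; rewrite /step (total_rate_agree tt) //.
by rewrite (jump_rate_agree tt) ?(far_neq xo) ?(far_neighbour xo yx).
Qed.

(** Relatively to [t 0 `^ a], the rate at which the walk leaves a neighbour of
    the origin otherwise than by jumping to the origin. The summand [1] makes
    room for killing at a rate [lam <= 1]. *)
Definition escape_const t : R :=
  \sum_(z <- steps) (1 + \sum_(e <- steps | z + e != 0) jump_rate a t z (z + e))
                    / t z `^ a.

(** From a neighbour of the origin the next jump leads to the origin with at
    least this probability; for [a > 0] it tends to [1] as [t 0] tends to
    infinity. *)
Definition return_ratio t : R := t 0 `^ a / (t 0 `^ a + escape_const t).

Lemma escape_const_ge0 t : 0 <= escape_const t.
Proof.
apply: sumr_ge0 => z _; rewrite divr_ge0 ?powR_ge0 // addr_ge0 //.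
by apply: sumr_ge0 => e _; exact: jump_rate_ge0.
Qed.

Lemma return_ratio_le1 t : 0 <= return_ratio t <= 1.
Proof.
have C0 := escape_const_ge0 t; have p0 := powR_ge0 (t 0) a.
rewrite /return_ratio divr_ge0 ?addr_ge0 //=.
have [->|n0] := eqVneq (t 0 `^ a + escape_const t) 0; first by rewrite invr0 mulr0.
rewrite ler_pdivrMr ?mul1r ?lerDl //.
by rewrite lt_neqAle eq_sym n0 addr_ge0.
Qed.

Lemma return_ratio_le_step t lam z : (forall y, 0 < t y) -> 0 <= lam <= 1 ->
  z \in steps -> return_ratio t <= step steps (jump_rate a t) lam z 0.
Proof.
move=> t0 /andP[l0 l1] zE; have p0 y : 0 < t y `^ a by exact: powR_gt0.
pose r := \sum_(e <- steps | z + e != 0) jump_rate a t z (z + e).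
have r0 : 0 <= r by apply: sumr_ge0 => e _; exact: jump_rate_ge0.
have Nz : - z \in steps by rewrite mem_steps l1normN -mem_steps.
have nz : neighbours z 0 by rewrite neighboursE sub0r.
have rC : (1 + r) / t z `^ a <= escape_const t.
  rewrite /escape_const (bigD1_seq z) ?uniq_steps //= lerDl.
  apply: sumr_ge0 => y _; rewrite divr_ge0 ?powR_ge0 // addr_ge0 //.
  by apply: sumr_ge0 => e _; exact: jump_rate_ge0.
have C0 := escape_const_ge0 t.
have -> : step steps (jump_rate a t) lam z 0 =
    t z `^ a * t 0 `^ a / (lam + (t z `^ a * t 0 `^ a + r)).
  rewrite /step jump_rateM //; congr (_ / (_ + _)).
  rewrite /total_rate (bigD1_seq (- z)) ?uniq_steps //= subrr jump_rateM //.
  by congr (_ + _); apply: eq_bigl => e; rewrite addrC addr_eq0.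
have k0 := p0 0; have kz := p0 z.
have w0 : 0 < t z `^ a * t 0 `^ a by exact: mulr_gt0.
rewrite /return_ratio ler_pdivrMr ?ltr_wpDr // mulrAC ler_pdivlMr; last first.
  by rewrite ltr_wpDl // ltr_wpDr.
move: rC; rewrite ler_pdivrMr // => rC.
rewrite [t z `^ a * t 0 `^ a in leRHS]mulrC -mulrA ler_pM2l //.
nra.
Qed.

End Rates.

(** * Comparison of Green functions *)

Section GreenComparison.
Context {R : realType} {d : nat}.
Variables (a : R) (nb : seq (site d)).
Hypothesis nb_order : ball_order nb.
Hypothesis d_gt0 : (0 < d)%N.
Implicit Types (t : environment R d) (x y z o : site d) (lam : R).

Local Notation E := (steps nb).
Local Notation rate t := (jump_rate a t).
Let mE := mem_steps nb_order.
Let uE := uniq_steps nb_order.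

(** The Green function at the origin of the walk without killing. *)
Definition green0 t : \bar R := green_sum E (rate t) 0 predT 0 0.

Definition in_unit_ball : pred (site d) := fun x => (l1norm x <= 1)%N.

(** Finite sets that exhaust the lattice. They contain the ball of radius [2]
    around the origin, so that the rates at which the walk leaves them do not
    depend on the value at the origin. *)
Definition exhaustion (j : nat) : pred (site d) := fun x =>
  x \in [seq y + z | y <- nb, z <- nb] ++ pmap pickle_inv (iota 0 j).

Lemma near_exhaustion x : \forall j \near \oo, exhaustion j x.
Proof.
exists (pickle x).+1 => // j /= jx; rewrite /exhaustion mem_cat; apply/orP; right.
by rewrite mem_pmap; apply/mapP; exists (pickle x);
  rewrite ?pickleK_inv // mem_iota.
Qed.

Lemma exhaustion_nbD j y z : (l1norm y <= 1)%N -> (l1norm z <= 1)%N ->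
  exhaustion j (y + z).
Proof.
move=> y1 z1; rewrite /exhaustion mem_cat; apply/orP; left.
by apply/allpairsP; exists (y, z); rewrite !mem_nb.
Qed.

Lemma exhaustion_bound j (F : site d -> R) : (forall x, 0 <= F x) ->
  exists M, forall x, exhaustion j x -> F x <= M.
Proof.
move=> F0; rewrite /exhaustion; set s := _ ++ _; exists (\sum_(x <- s) F x) => x.
by move=> xs; rewrite (big_rem x) //= lerDl sumr_ge0.
Qed.

(** The rates are bounded on a finite set, so that the walk is almost surely
    killed or leaves the set. *)
Lemma sum_killed_exhaustion t lam j : (forall x, 0 < t x) -> 0 < lam ->
  (\sum_(0 <= n <oo) (killed E (rate t) lam (exhaustion j) n 0)%:E = 1)%E.
Proof.
move=> t0 l0; have q0 := jump_rate_ge0 a t.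
have Qp := total_jump_rate_gt0 a nb_order d_gt0 _ t0.
have lQ x : 0 < lam + total_rate E (rate t) x by rewrite addr_gt0.
have [M QM] := exhaustion_bound j (fun x => ltW (Qp x)).
have A0 : exhaustion j 0 by rewrite -[0]addr0 exhaustion_nbD // l1norm0.
have M0 : 0 < M by rewrite (lt_le_trans (Qp 0)) // QM.
pose th := M / (lam + M).
have th0 : 0 <= th by rewrite divr_ge0 ?addr_ge0 // ltW.
have th1 : th < 1 by rewrite /th ltr_pdivrMr ?addr_gt0 // mul1r ltrDr.
have h x : exhaustion j x -> total_rate E (rate t) x <= th * (lam + total_rate E (rate t) x).
  move=> /QM QxM; rewrite /th mulrAC ler_pdivlMr ?addr_gt0 //.
  have := Qp x; nra.
have sv := survive_geo q0 (ltW l0) lQ th0 h.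
apply/cvg_lim => //.
have -> : (fun N => \sum_(0 <= n < N) (killed E (rate t) lam (exhaustion j) n 0)%:E)%E =
   (fun N => (1 - survive E (rate t) lam (exhaustion j) N 0)%:E).
  apply/funext => N; rewrite sumEFin; congr (_%:E).
  have := sum_killed mE lQ (exhaustion j) N 0; rewrite A0 => h'.
  by apply/eqP; rewrite eq_sym subr_eq h'.
apply: cvg_EFin; first exact: nearW.
rewrite /= [X in X @ _](_ : _ = (fun N => 1 - survive E (rate t) lam (exhaustion j) N 0)) //.
rewrite -[X in _ --> X]subr0; apply: cvgB; first exact: cvg_cst.
apply: (squeeze_cvgr (f := fun=> 0) (h := fun n => th ^+ n)).
- by apply: nearW => n; rewrite sv andbT survive_ge0 // ltW.
- exact: cvg_cst.
- by apply: cvg_expr; rewrite ger0_norm.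
Qed.

(** Before it enters the unit ball, the walk does not see the value at the
    origin. *)
Lemma predD_hop_agree t t' lam A phi n x : agree_off 0 t t' ->
  hop E (rate t) lam (predD A in_unit_ball) phi n x =
  hop E (rate t') lam (predD A in_unit_ball) phi n x.
Proof.
move=> tt; apply: eq_hop => // y z /andP[]; rewrite /in_unit_ball -ltnNge => y1 _ yz.
by apply: step_agree tt _ yz; rewrite ?subr0.
Qed.

(** Write [U x] for the probability of reaching the unit ball from [x], the
    same in both environments, and [G x] for the Green function towards the
    origin. First passage through the unit ball gives [G x <= G 0 * U x] in
    [t], and [G x >= return_ratio * G 0 * U x] in [t']. Now sum over [x] with
    the weights [c x], the rates of disappearance from [x]: by reversibility
    the sum of [c x * G x] is the probability that the walk started from the
    origin disappears, that is [1], and [c] is the same in both environments.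
    Hence [return_ratio * G' 0 * sum (c * U) <= 1 <= G 0 * sum (c * U)]. *)
Lemma green_compare_killed t t' lam j : (forall x, 0 < t x) -> (forall x, 0 < t' x) ->
  agree_off 0 t t' -> 0 < lam <= 1 ->
  ((return_ratio a nb t')%:E * green_sum E (rate t') lam (exhaustion j) 0%R 0%R <=
   green_sum E (rate t) lam (exhaustion j) 0%R 0%R)%E.
Proof.
move=> t0 t'0 tt /andP[l0 l1].
have l01 : 0 <= lam <= 1 by rewrite ltW.
set A := exhaustion j.
have lQ t1 (t10 : forall x, 0 < t1 x) x : 0 < lam + total_rate E (rate t1) x.
  by rewrite addr_gt0 // total_jump_rate_gt0.
pose c t x := lam + exit_rate_of E (rate t) A x.
have c_ge0 t1 x : 0 <= c t1 x.
  by rewrite addr_ge0 ?(ltW l0) // exit_rate_of_ge0 // => *; exact: jump_rate_ge0.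
have cE x : c t x = c t' x.
  rewrite /c /exit_rate_of; congr (_ + _); rewrite !big_seq; apply: eq_bigr => e.
  rewrite mE => /eqP e1; case: (leqP (l1norm x) 1) => x1.
    by rewrite /A exhaustion_nbD ?e1 // !mulr0.
  congr (_ * _); have xo : (1 < l1norm (x - 0)%R)%N by rewrite subr0.
  apply: (jump_rate_agree a tt (far_neq xo)).
  by apply: far_neighbour xo _; rewrite addrAC subrr add0r.
pose U t x := hit_sum E (rate t) lam A in_unit_ball x.
have UE x : U t x = U t' x.
  by apply: eq_eseriesr => n _; rewrite (predD_hop_agree _ _ _ _ _ tt).
have U0 t1 x : (0 <= U t1 x)%E.
  by apply: hit_sum_ge0 => [*|]; rewrite ?jump_rate_ge0 ?ltW.
have G0 t1 x : (0 <= green_sum E (rate t1) lam A x 0%R)%E.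
  by apply: green_sum_ge0 => [*|]; rewrite ?jump_rate_ge0 ?ltW.
have total t1 (t10 : forall x, 0 < t1 x) :
    sumZ (fun x => (c t1 x)%:E * green_sum E (rate t1) lam A x 0%R)%E = 1%E.
  rewrite (sumZ_green_sum uE mE) // ?sum_killed_exhaustion //.
  - exact: jump_rate_ge0.
  - exact: jump_rate_sym.
  - exact: ltW.
  - exact: lQ.
pose h := sumZ (fun x => (c t x)%:E * U t x)%E.
have h0 : (0 <= h)%E by apply: sumZ_ge0 => x; rewrite mule_ge0 // lee_fin.
have Gfin t1 (t10 : forall x, 0 < t1 x) : green_sum E (rate t1) lam A 0 0 \is a fin_num.
  by apply: (green_sum_fin mE (jump_rate_ge0 a t1) (ltW l0) (lQ _ t10)).
have H1 : (1 <= green_sum E (rate t) lam A 0%R 0%R * h)%E.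
  rewrite -(total t t0) /h -(fineK (Gfin _ t0)) -sumZZl; last first.
    by move=> x; rewrite mule_ge0 // lee_fin.
  apply: le_sumZ => x; first by rewrite mule_ge0 // lee_fin.
  rewrite muleCA lee_wpmul2l ?lee_fin // fineK ?Gfin //.
  apply: (lee_green_hit mE (jump_rate_ge0 a t) (ltW l0) (lQ _ t0) _ l0).
  by rewrite /in_unit_ball l1norm0.
have H2 : ((return_ratio a nb t')%:E * green_sum E (rate t') lam A 0%R 0%R * h <= 1)%E.
  rewrite -(total t' t'0) /h -(fineK (Gfin _ t'0)) -EFinM -sumZZl; last first.
    by move=> x; rewrite mule_ge0 // lee_fin.
  have rG0 : 0 <= return_ratio a nb t' * fine (green_sum E (rate t') lam A 0 0).
    by rewrite mulr_ge0 ?fine_ge0 //; have /andP[] := return_ratio_le1 a nb t'.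
  apply: le_sumZ => x; first by rewrite !mule_ge0 // lee_fin.
  rewrite muleCA cE UE lee_wpmul2l ?lee_fin // EFinM fineK ?Gfin //.
  apply: (lee_hit_green uE mE (jump_rate_ge0 a t') (ltW l0) (lQ _ t'0) l0).
    exact: return_ratio_le1.
  move=> z; rewrite /in_unit_ball => z1 z0; have zE : z \in E.
    by rewrite mE eqn_leq z1 lt0n l1norm_eq0.
  apply/and3P; split.
  - have : exhaustion j (z + 0) by apply: exhaustion_nbD => //; rewrite l1norm0.
    by rewrite addr0.
  - by rewrite sub0r mE l1normN -mE.
  - exact: return_ratio_le_step.
set rG := (_ * _)%E; have rG0 : (0 <= rG)%E.
  by rewrite mule_ge0 // lee_fin; have /andP[] := return_ratio_le1 a nb t'.
have rGfin : rG \is a fin_num by rewrite fin_numM ?Gfin.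
rewrite -[leLHS]mule1; apply: (le_trans (lee_wpmul2l rG0 H1)).
rewrite muleCA -[leRHS]mule1 lee_wpmul2l //.
Qed.

(** Let the killing rate tend to [0] and the finite sets exhaust the lattice. *)
Lemma green_compare t t' : (forall x, 0 < t x) -> (forall x, 0 < t' x) ->
  agree_off 0 t t' ->
  ((return_ratio a nb t')%:E * green0 t' <= green0 t)%E.
Proof.
move=> t0 t'0 tt.
have lam0 (j : nat) : 0 <= (j.+1%:R^-1 : R) by rewrite invr_ge0.
have lamc : (j.+1%:R^-1 : R) @[j --> \oo] --> 0 by exact: cvg_harmonic.
have C t1 (t10 : forall x, 0 < t1 x) : green_sum E (rate t1) (j.+1%:R^-1) (exhaustion j) 0 0
   @[j --> \oo] --> green0 t1.
  apply: cvg_green_sum => //; [exact: jump_rate_ge0| |exact: near_exhaustion].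
  by move=> x; exact: total_jump_rate_gt0.
have C' := cvgeZl (y := (return_ratio a nb t')%:E) isT (C _ t'0).
apply: (lee_cvg_to C' (C _ t0)).
apply: nearW => j; apply: green_compare_killed => //.
by rewrite invr_gt0 ltr0Sn invf_le1 ?ler1n.
Qed.

End GreenComparison.

(** * Laws of trajectories *)

Lemma integral_indicT {R : realType} dT (T : measurableType dT)
    (mu : {measure set T -> \bar R}) (A : set T) : measurable A ->
  (\int[mu]_x (\1_A x)%:E = mu A)%E.
Proof. by move=> mA; rewrite integral_indic // setIT. Qed.

Lemma ae_probability1 {R : realType} dT (T : measurableType dT)
    (P : probability T R) (A : set T) : measurable A -> P A = 1%E ->
  {ae P, forall x, A x}.
Proof.
move=> mA PA; exists (~` A); split => //; first exact: measurableC.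
by rewrite [LHS]probability_setC // PA subee.
Qed.

Section AsProbability.
Context {R : realType} dT (T : measurableType dT).
Variables (Q : {measure set T -> \bar R}) (Q1 : Q setT = 1%E).

Definition as_probability of Q setT = 1%E : set T -> \bar R := Q.

HB.instance Definition _ := isMeasure.Build _ _ _ (as_probability Q1)
  (measure0 Q) (@measure_ge0 _ _ _ Q) (@measure_semi_sigma_additive _ _ _ Q).

HB.instance Definition _ := Measure_isProbability.Build _ _ _ (as_probability Q1) Q1.

Definition to_probability : probability T R := as_probability Q1.

End AsProbability.


Lemma measurable_set_lt {R : realType} d (T : measurableType d) (f g : T -> R) :
  measurable_fun setT f -> measurable_fun setT g -> measurable [set x | f x < g x].
Proof.
move=> mf mg; have := measurable_fun_ltr mf mg measurableT (Y := [set true]) I.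
by rewrite setTI; congr measurable; apply/seteqP; split => x.
Qed.


Section Trajectories.
Context {R : realType} {d : nat}.
Implicit Types (w : trajectory R d) (n i : nat).

Lemma measurable_trajectory_coordinate i :
  measurable_fun setT (fun w : trajectory R d => w i).
Proof.
move=> _ B mB; rewrite setTI; apply: sub_sigma_algebra.
by exists i, B.
Qed.

Lemma measurable_holding_time i :
  measurable_fun setT (fun w : trajectory R d => holding_time w i).
Proof. exact: measurableT_comp measurable_snd (measurable_trajectory_coordinate i). Qed.

Lemma measurable_position i :
  measurable_fun setT (fun w : trajectory R d => position w i).
Proof. exact: measurableT_comp measurable_fst (measurable_trajectory_coordinate i). Qed.

Lemma measurable_jump_time n :
  measurable_fun setT (fun w : trajectory R d => jump_time w n).
Proof. by apply: measurable_sum => i; exact: measurable_holding_time. Qed.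

Lemma measurable_position_eq i (x : site d) :
  measurable [set w : trajectory R d | position w i = x].
Proof. by have := measurable_position i measurableT (Y := [set x]) I; rewrite setTI. Qed.

Definition path_of w n : seq (site d) := mkseq (position w) n.

Lemma measurable_path_eq n (s : seq (site d)) :
  measurable [set w : trajectory R d | path_of w n = s].
Proof.
have [<-|ns] := eqVneq (size s) n; last first.
  rewrite (_ : [set _ | _] = set0) //; apply/seteqP; split => // w /= ws.
  by move: ns; rewrite -ws size_mkseq eqxx.
rewrite (_ : [set _ | _] = \bigcap_i [set w | (i < size s)%N -> position w i = nth 0 s i]).
  apply: bigcapT_measurable => i; case: (ltnP i (size s)) => h.
    rewrite (_ : [set _ | _] = [set w | position w i = nth 0 s i]).
      exact: measurable_position_eq.
    by apply/seteqP; split => w /=; [exact|].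
  by rewrite (_ : [set _ | _] = setT) //; apply/seteqP; split.
apply/seteqP; split => w /=.
  by move=> ws i _ /= h; rewrite -ws nth_mkseq.
move=> h; apply: (@eq_from_nth _ 0); rewrite size_mkseq // => i si.
by rewrite nth_mkseq // h.
Qed.

(** The initial path takes countably many values. *)
Lemma measurable_fun_path d' (T : measurableType d') dS (S : measurableType dS) n
    (h : seq (site d) -> T -> S) : (forall s, measurable_fun setT (h s)) ->
  measurable_fun setT (fun p : T * trajectory R d => h (path_of p.2 n) p.1).
Proof.
move=> mh _ B mB; rewrite setTI.
rewrite (_ : _ @^-1` _ = \bigcup_k oapp (fun s : seq (site d) =>
   ((h s @^-1` B) `*` [set w | path_of w n = s])) set0 (pickle_inv k)).
  apply: bigcup_measurable => k _; case: pickle_inv => //= s.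
  apply: measurableX; last exact: measurable_path_eq.
  by rewrite -[_ @^-1` _]setTI; exact: mh.
apply/seteqP; split => -[t w] /=.
  by move=> Bh; exists (pickle (path_of w n)) => //; rewrite pickleK_inv.
by move=> [k _]; case: pickle_inv => //= s [/= Bh ->].
Qed.

Lemma measurable_fun_path1 dS (S : measurableType dS) n (h : seq (site d) -> S) :
  measurable_fun setT (fun w : trajectory R d => h (path_of w n)).
Proof.
move=> _ B mB; rewrite setTI.
rewrite (_ : _ @^-1` _ = \bigcup_k oapp (fun s : seq (site d) =>
   if `[< B (h s) >] then [set w | path_of w n = s] else set0) set0 (pickle_inv k)).
  apply: bigcup_measurable => k _; case: pickle_inv => //= s; case: ifP => // _.
  exact: measurable_path_eq.
apply/seteqP; split => w /=.
  by move=> Bh; exists (pickle (path_of w n)) => //; rewrite pickleK_inv /= asboolT.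
by move=> [k _]; case: pickle_inv => //= s; case: asboolP => // Bh ->.
Qed.

Definition cylinder (y : nat -> site d) (s : nat -> R) n : set (trajectory R d) :=
  [set w | forall i, (i <= n)%N -> position w i = y i /\ s i < holding_time w i].

Lemma measurable_cylinder y s n : measurable (cylinder y s n).
Proof.
rewrite (_ : cylinder _ _ _ = \bigcap_i [set w | (i <= n)%N -> position w i = y i /\ s i < holding_time w i]).
  apply: bigcapT_measurable => i; case: (leqP i n) => h; last first.
    by rewrite (_ : [set _ | _] = setT) //; apply/seteqP; split.
  rewrite (_ : [set _ | _] = [set w | position w i = y i] `&`
     (fun w : trajectory R d => holding_time w i) @^-1` `]s i, +oo[).
    apply: measurableI; first exact: measurable_position_eq.
    by rewrite -[_ @^-1` _]setTI; apply: measurable_holding_time.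
  apply/seteqP; split => w /=; first by move=> /(_ isT)[-> si]; rewrite in_itv /= si.
  by rewrite in_itv /= andbT => -[].
apply/seteqP; split => w /=; first by move=> h i _; exact: h.
by move=> h i; exact: h.
Qed.

End Trajectories.


Section Laplace.
Context {R : realType}.
Local Notation mu := (@lebesgue_measure R).

Lemma integral_exponential_lt (lam s : R) : 0 < s ->
  (\int[mu]_v (exponential_pdf lam v * \1_[set v | (v < s)%R] v)%:E =
   (1 - expR (- (lam * s)))%:E)%E.
Proof.
move=> s0; rewrite EFinB -mulNr -exponential_prob_itv0c // /exponential_prob.
rewrite -integral_itv_bndo_bndc; last first.
  by apply: measurable_funTS; apply/measurable_EFinP; exact: measurable_exponential_pdf.
rewrite [RHS]integral_mkcond; apply: eq_integral => v _.
rewrite patchE indicE; case: ifPn => [|].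
  by rewrite inE /= in_itv /= => /andP[v0 vs]; rewrite mem_set // mulr1.
rewrite notin_setE /= in_itv /= => /negP; rewrite negb_and -ltNge -leNgt.
case/orP => h; first by rewrite lt0_exponential_pdf // mul0r.
by rewrite memNset ?mulr0 //= ltNge h.
Qed.

Lemma integral_exponential_laplace (lam Q : R) : 0 <= lam -> 0 < Q ->
  (\int[mu]_v (exponential_pdf lam v * expR (- (Q * v)))%:E =
   (lam / (lam + Q))%:E)%E.
Proof.
move=> l0 Q0; have lQ : 0 < lam + Q by rewrite ltr_wpDl.
rewrite -[RHS]mule1 -(integral_exponential_pdf lQ) -ge0_integralZl_EFin //; last 3 first.
- by move=> v _; rewrite lee_fin exponential_pdf_ge0 // ltW.
- by apply/measurable_EFinP; exact: measurable_exponential_pdf.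
- by rewrite divr_ge0 // ltW.
apply: eq_integral => v _; rewrite -EFinM; congr (_%:E).
case: (leP 0 v) => v0; last by rewrite !lt0_exponential_pdf // mul0r mulr0.
rewrite !exponential_pdfE // mulrA divfK ?gt_eqF // -mulrA -expRD.
by congr (_ * expR _); ring.
Qed.

Lemma integral_tail (Q : R) : 0 < Q ->
  (\int[mu]_(v in `[0%R, +oo[) (expR (- (Q * v)))%:E = (Q^-1)%:E)%E.
Proof.
move=> Q0; rewrite -[RHS]mule1 -(integral_exponential_pdf Q0) -ge0_integralZl_EFin //; last 3 first.
- by move=> v _; rewrite lee_fin exponential_pdf_ge0 // ltW.
- by apply/measurable_EFinP; exact: measurable_exponential_pdf.
- by rewrite invr_ge0 ltW.
rewrite [LHS]integral_mkcond; apply: eq_integral => v _; rewrite patchE.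
case: ifPn => [|].
  rewrite inE /= in_itv /= andbT => v0.
  by rewrite exponential_pdfE // -EFinM mulrA mulVf ?gt_eqF // mul1r mulNr.
rewrite notin_setE /= in_itv /= andbT => /negP; rewrite -ltNge => v0.
by rewrite lt0_exponential_pdf // mule0.
Qed.

Context {d : nat}.
Variables (q : site d -> site d -> R) (x0 : site d) (Q : probability (trajectory R d) R).
Hypothesis q_ge0 : forall x y, 0 <= q x y.
Hypothesis q_gt0 : forall x, 0 < exit_rate q x.
Hypothesis Q_law : ctmc_law q x0 Q.

Local Notation rt := (exit_rate q).

Let cst (y : nat -> site d) n : R := (y 0%N == x0)%:R * \prod_(i < n) (q (y i) (y i.+1) / rt (y i)).

(** The law of the chain is known through the joint tails of the holding
    times. A tail is turned into a Laplace transform by integrating it against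
    the exponential density of parameter [lam], because that density has mass
    [1 - expR (- lam * h)] on the interval from [0] to [h]. The induction is
    on the number [j] of holding times so treated. *)
Lemma cylinder_laplace_rec (lam : R) (y : nat -> site d) n j : 0 <= lam ->
  (j <= n.+1)%N -> forall s : nat -> R, (forall i, 0 <= s i) -> (forall i, (i < j)%N -> s i = 0) ->
  (\int[Q]_w (\1_(cylinder y s n) w * expR (- (lam * jump_time w j)))%:E =
  (cst y n * \prod_(0 <= i < j) (rt (y i) / (lam + rt (y i))) *
    \prod_(j <= i < n.+1) expR (- (rt (y i) * s i)))%:E)%E.
Proof.
move=> l0; elim: j => [|j IH] jn s s0 sj.
  rewrite big_geq // mulr1.
  under eq_integral do rewrite /jump_time big_ord0 mulr0 oppr0 expR0 mulr1.
  rewrite integral_indic //; last exact: measurable_cylinder.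
  by rewrite setIT /cylinder Q_law // /cst big_mkord.
set W := fun w : trajectory R d => expR (- (lam * jump_time w j)).
have mW : measurable_fun setT W.
  by apply: measurableT_comp => //; apply: measurableT_comp => //; apply: measurable_funM => //; exact: measurable_jump_time.
set B := cylinder y s n.
have mB : measurable B by exact: measurable_cylinder.
have mh := @measurable_holding_time R d j.
pose F (p : trajectory R d * R) : \bar R :=
  ((\1_B p.1 * W p.1) * (exponential_pdf lam p.2 * \1_[set v | (v < holding_time p.1 j)%R] p.2))%:E.
have F0 p : (0 <= F p)%E.
  by rewrite lee_fin !mulr_ge0 ?expR_ge0 ?exponential_pdf_ge0.
have mF : measurable_fun setT F.
  apply/measurable_EFinP; apply: measurable_funM.
    by apply: measurable_funM; apply: measurableT_comp => //; exact: measurable_indic.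
  apply: measurable_funM.
    by apply: measurableT_comp => //; exact: measurable_exponential_pdf.
  have -> : (fun p : trajectory R d * R => \1_[set v | (v < holding_time p.1 j)%R] p.2) =
     \1_[set p : trajectory R d * R | (p.2 < holding_time p.1 j)%R] by [].
  by apply: measurable_indic; apply: measurable_set_lt => //; exact: measurableT_comp mh measurable_fst.
have s0j : s j = 0 by rewrite sj.
have jn' : (j <= n)%N by [].
(* Integrating out [v] first produces the Laplace transform of the holding
   time [j]. *)
have E1 : (\int[Q]_w \int[mu]_v F (w, v) =
    \int[Q]_w (\1_B w * W w - \1_B w * W w * expR (- (lam * holding_time w j)))%:E)%E.
  apply: eq_integral => w _; rewrite /F /=.
  under eq_integral do rewrite EFinM.
  have [Bw|Bw] := pselect (B w); last first.
    rewrite indicE memNset // !mul0r subrr.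
    by under eq_integral do rewrite mul0e; rewrite integral0.
  have h0 : 0 < holding_time w j by have [_] := Bw j jn'; rewrite s0j.
  rewrite ge0_integralZl_EFin //; last 3 first.
  - by move=> v _; rewrite lee_fin mulr_ge0 ?exponential_pdf_ge0.
  - apply/measurable_EFinP; apply: measurable_funM.
      exact: measurable_exponential_pdf.
    by apply: measurable_indic; exact: measurable_set_lt.
  - by rewrite mulr_ge0 ?expR_ge0.
  by rewrite integral_exponential_lt // -EFinM mulrBr mulr1.
pose K := cst y n * \prod_(0 <= i < j) (rt (y i) / (lam + rt (y i))) *
    \prod_(j.+1 <= i < n.+1) expR (- (rt (y i) * s i)).
(* Integrating out [w] first produces a tail with [v] in place of [s j], to
   which the induction hypothesis applies. *)
have E2 : (\int[mu]_v \int[Q]_w F (w, v) = (K * (lam / (lam + rt (y j))))%:E)%E.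
  transitivity (\int[mu]_v (K%:E * (exponential_pdf lam v * expR (- (rt (y j) * v)))%:E))%E.
    apply: eq_integral => v _; rewrite /F /=.
    case: (ltP v 0) => v0.
      rewrite lt0_exponential_pdf // mul0r mule0.
      by under eq_integral do rewrite mul0r mulr0; rewrite integral0.
    pose s' := fun i => if i == j then v else s i.
    transitivity (\int[Q]_w ((exponential_pdf lam v)%:E *
        (\1_(cylinder y s' n) w * W w)%:E))%E.
      apply: eq_integral => w _; rewrite -EFinM; congr (_%:E).
      rewrite mulrCA [X in _ = _ * X]mulrC; congr (_ * _).
      rewrite -mulrA mulrCA mulrA [RHS]mulrC [W w * _]mulrC -mulrA [W w * _]mulrC mulrA.
      congr (_ * _); rewrite !indicE -natrM mulnb; congr (_%:R); congr nat_of_bool.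
      apply/idP/idP; rewrite !inE.
        move=> /andP[]; rewrite !inE /= => Bw vh i ij; have [pi si] := Bw i ij.
        by split=> //; rewrite /s'; case: eqP => [->|].
      move=> Cw; apply/andP; split; rewrite inE /=.
        move=> i ij; have [pi] := Cw i ij; rewrite /s'; split=> //.
        by have [_] := Cw i ij; rewrite /s'; case: eqP => // ->; rewrite s0j; exact: le_lt_trans.
      by have [_] := Cw j jn'; rewrite /s' eqxx.
    rewrite ge0_integralZl_EFin //; last 3 first.
    - by move=> w _; rewrite lee_fin mulr_ge0 ?expR_ge0.
    - apply/measurable_EFinP; apply: measurable_funM => //.
      by apply: measurable_indic; exact: measurable_cylinder.
    - exact: exponential_pdf_ge0.
    rewrite IH; last 3 first.
    - exact: ltnW.
    - by move=> i; rewrite /s'; case: eqP.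
    - by move=> i ij; rewrite /s' ltn_eqF // sj // ltnW.
    rewrite -!EFinM; congr (_%:E); rewrite [\prod_(j <= i < n.+1) _]big_ltn //.
    rewrite {1}/s' eqxx.
    have -> : \prod_(j.+1 <= i < n.+1) expR (- (rt (y i) * s' i)) =
       \prod_(j.+1 <= i < n.+1) expR (- (rt (y i) * s i)).
      rewrite big_nat_cond [RHS]big_nat_cond; apply: eq_bigr => i /andP[/andP[ij _] _].
      by rewrite /s' gtn_eqF.
    by rewrite /K; ring.
  rewrite ge0_integralZl //; last 3 first.
  - apply/measurable_EFinP; apply: measurable_funM.
      exact: measurable_exponential_pdf.
    by apply: measurableT_comp => //; apply: measurableT_comp => //; apply: measurable_funM.
  - by move=> v _; rewrite lee_fin mulr_ge0 ?expR_ge0 ?exponential_pdf_ge0.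
  - rewrite lee_fin /K !mulr_ge0 //.
    + by apply: prodr_ge0 => i _; rewrite divr_ge0 // ltW.
    + by apply: prodr_ge0 => i _; rewrite divr_ge0 // ?addr_ge0 // ltW.
    + by apply: prodr_ge0 => i _; exact: expR_ge0.
  by rewrite integral_exponential_laplace.
have Ae w : \1_B w * W w * expR (- (lam * holding_time w j)) <= \1_B w * W w.
  have [Bw|Bw] := pselect (B w); last by rewrite indicE memNset // !mul0r.
  have h0 : 0 < holding_time w j by have [_] := Bw j jn'; rewrite s0j.
  rewrite ler_piMr ?mulr_ge0 ?expR_ge0 // -expR0 ler_expR oppr_le0.
  by rewrite mulr_ge0 // ltW.
have mA : measurable_fun setT (fun w => \1_B w * W w).
  by apply: measurable_funM => //; exact: measurable_indic.
have mAe : measurable_fun setT (fun w => \1_B w * W w * expR (- (lam * holding_time w j))).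
  apply: measurable_funM => //; apply: measurableT_comp => //.
  by apply: measurableT_comp => //; apply: measurable_funM.
have EA : (\int[Q]_w (\1_B w * W w)%:E = K%:E)%E.
  rewrite IH //; last 2 first.
  - exact: ltnW.
  - by move=> i ij; rewrite sj // ltnW.
  rewrite [\prod_(j <= i < n.+1) _]big_ltn // s0j mulr0 oppr0 expR0 mul1r.
  by [].
have EAe : (\int[Q]_w (\1_B w * W w * expR (- (lam * holding_time w j)))%:E +
   (K * (lam / (lam + rt (y j))))%:E = K%:E)%E.
  rewrite -E2 -fubini_tonelli // E1 -EA -ge0_integralD //.
  - by apply: eq_integral => w _; rewrite -EFinD; congr (_%:E); ring.
  - by move=> w _; rewrite lee_fin !mulr_ge0 ?expR_ge0.
  - exact/measurable_EFinP.
  - by move=> w _; rewrite lee_fin subr_ge0.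
  - by apply/measurable_EFinP; exact: measurable_funB.
transitivity (\int[Q]_w (\1_B w * W w * expR (- (lam * holding_time w j)))%:E)%E.
  apply: eq_integral => w _; rewrite -mulrA -expRD; congr (_ * expR _)%:E.
  by rewrite /jump_time big_ord_recr /= mulrDr opprD.
have /eqP := EAe; rewrite eq_sym -sube_eq //; last first.
  by rewrite fin_num_adde_defl.
move=> /eqP <-; rewrite -EFinB; congr (_%:E).
have lQ : lam + rt (y j) != 0 by rewrite gt_eqF // ltr_wpDl.
rewrite big_nat_recr //= /K; field.
exact: lQ.
Qed.



Lemma cylinder_laplace (lam : R) (y : nat -> site d) n : 0 <= lam ->
  (\int[Q]_w (\1_(cylinder y (fun=> 0) n) w * expR (- (lam * jump_time w n)))%:E =
  ((y 0%N == x0)%:R * \prod_(i < n) (q (y i) (y i.+1) / (lam + rt (y i))))%:E)%E.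
Proof.
move=> l0; rewrite (cylinder_laplace_rec y l0 (leqnSn n)) //; congr (_%:E).
rewrite [X in _ * X]big1 ?mulr1; last first.
  by move=> i _; rewrite mulr0 oppr0 expR0.
rewrite /cst big_mkord -mulrA -big_split /=; congr (_ * _); apply: eq_bigr => i _.
by rewrite mulrA divfK ?gt_eqF.
Qed.

Lemma cylinder_tail (y : nat -> site d) n (v : R) : 0 <= v ->
  Q (cylinder y (fun i => if i == n then v else 0) n) =
  ((y 0%N == x0)%:R * \prod_(i < n) (q (y i) (y i.+1) / rt (y i)) *
   expR (- (rt (y n) * v)))%:E.
Proof.
move=> v0; rewrite /cylinder Q_law; last by move=> i; case: eqP.
congr (_%:E); congr (_ * _); rewrite big_ord_recr /= eqxx big1 ?mul1r // => i _.
by rewrite ltn_eqF // mulr0 oppr0 expR0.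
Qed.

(** The mean of the holding time is the integral of its tail. *)
Lemma cylinder_holding (y : nat -> site d) n :
  (\int[Q]_w (\1_(cylinder y (fun=> 0) n) w * holding_time w n)%:E =
  ((y 0%N == x0)%:R * \prod_(i < n) (q (y i) (y i.+1) / rt (y i)) / rt (y n))%:E)%E.
Proof.
pose F (p : trajectory R d * R) : \bar R :=
  (\1_(cylinder y (fun=> 0) n) p.1 * \1_[set p : trajectory R d * R | 0 <= p.2 < holding_time p.1 n] p)%:E.
have mC : measurable (cylinder y (fun=> 0) n : set (trajectory R d)).
  exact: measurable_cylinder.
have mF : measurable_fun setT F.
  apply/measurable_EFinP; apply: measurable_funM.
    by apply: measurableT_comp => //; exact: measurable_indic.
  apply: measurable_indic.
  rewrite (_ : [set _ | _] = snd @^-1` `[0, +oo[ `&` [set p | p.2 < holding_time p.1 n]).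
    apply: measurableI.
      by rewrite -[_ @^-1` _]setTI; exact: measurable_snd.
    by apply: measurable_set_lt => //; exact: measurableT_comp (measurable_holding_time n) measurable_fst.
  apply/seteqP; split => -[w v] /=; rewrite in_itv /= andbT; first by case/andP.
  by case=> -> ->.
have F0 p : (0 <= F p)%E by rewrite lee_fin mulr_ge0.
transitivity (\int[Q]_w \int[mu]_v F (w, v))%E.
  apply: eq_integral => w _; rewrite /F /=.
  have [Cw|Cw] := pselect (cylinder y (fun=> 0) n w); last first.
    rewrite indicE memNset // mul0r.
    by under eq_integral do rewrite mul0r; rewrite integral0.
  rewrite indicE mem_set // mul1r; under eq_integral do rewrite mul1r.
  have h0 : 0 < holding_time w n by have [] := Cw n (leqnn _).
  rewrite (_ : (fun v => _) = (fun v => (\1_(`[0, holding_time w n[ : set R) v)%:E)).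
    rewrite integral_indic // setIT.
    by rewrite [RHS](lebesgue_measure_itv `[0, holding_time w n[) /= lte_fin h0 -EFinB subr0.
  apply/funext => v; rewrite !indicE; congr (_%:R%:E); congr nat_of_bool.
rewrite fubini_tonelli //.
transitivity (\int[mu]_v (((y 0%N == x0)%:R * \prod_(i < n) (q (y i) (y i.+1) / rt (y i)))%:E
   * ((\1_(`[0%R, +oo[ : set R) v) * expR (- (rt (y n) * v)))%:E))%E.
  apply: eq_integral => v _; rewrite /F /=; case: (leP 0 v) => v0; last first.
    rewrite [X in (_ * (X * _)%:E)%E]indicE memNset; last first.
      by rewrite /= in_itv /= andbT; apply/negP; rewrite -ltNge.
    rewrite mul0r mule0; apply: integral0_eq => w _.
    have -> : \1_[set p : trajectory R d * R | 0 <= p.2 < holding_time p.1 n] (w, v) = 0 :> R.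
      by rewrite indicE memNset //= leNgt v0.
    by rewrite mulr0.
  rewrite [X in (_ * (X * _)%:E)%E]indicE mem_set /= ?in_itv ?andbT //= mul1r -EFinM.
  rewrite -cylinder_tail // -integral_indicT; last exact: measurable_cylinder.
  apply: eq_integral => w _; rewrite !indicE -natrM mulnb; congr (_%:R%:E).
  congr nat_of_bool; apply/idP/idP; rewrite !inE.
    move=> /andP[]; rewrite !inE /= => Cw /andP[_ vh] i i_n; have [pi si] := Cw i i_n.
    by split => //; case: eqP => // ->.
  move=> Cw; apply/andP; rewrite !inE; split => /=.
    move=> i i_n; have [pi] := Cw i i_n; case: eqP pi => [->|_] pi si //.
    by split=> //; exact: le_lt_trans v0 si.
  by rewrite v0; have [_] := Cw n (leqnn n); rewrite eqxx.
rewrite ge0_integralZl //; last 2 first.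
- apply/measurable_EFinP; apply: measurable_funM; first exact: measurable_indic.
  by apply: measurableT_comp => //; apply: measurableT_comp => //; apply: measurable_funM.
- rewrite lee_fin mulr_ge0 //; apply: prodr_ge0 => i _.
  by rewrite divr_ge0 // ltW.
rewrite [X in (_ * X)%E](_ : _ = (rt (y n))^-1%:E) // -integral_tail //.
rewrite [RHS]integral_mkcond; apply: eq_integral => v _.
by rewrite patchE indicE; case: ifP => _; rewrite ?mul1r ?mul0r.
Qed.

End Laplace.

(** * Sums over finite paths *)

Section Paths.
Context {R : realType} {d : nat}.
Variable E : seq (site d).
Hypothesis uniq_E : uniq E.
Variable q : site d -> site d -> R.
Implicit Types (x : site d) (s : seq (site d)) (lam : R).

(** The possible continuations of length [n] of a path that sits at [x]. *)
Fixpoint tails x n : seq (seq (site d)) :=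
  if n is n'.+1 then
    flatten [seq [seq (x + e) :: s | s <- tails (x + e) n'] | e <- E]
  else [:: [::]].

Fixpoint path_weight lam x s : R :=
  if s is y :: s' then step E q lam x y * path_weight lam y s' else 1.

Lemma sum_tailsS x n (F : seq (site d) -> R) :
  \sum_(s <- tails x n.+1) F s = \sum_(e <- E) \sum_(s <- tails (x + e) n) F ((x + e) :: s).
Proof. by rewrite /= big_flatten big_map; apply: eq_bigr => e _; rewrite big_map. Qed.

Lemma size_tails x n s : s \in tails x n -> size s = n.
Proof.
elim: n x s => [|n IH] x s /=; first by rewrite inE => /eqP ->.
move=> /flattenP[l /mapP[e eE ->]] /mapP[s' /IH <- ->] //.
Qed.

Lemma uniq_tails x n : uniq (tails x n).
Proof.
elim: n x => [//|n IH] x /=.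
elim: E uniq_E => //= e l IHl /andP[el ul].
rewrite cat_uniq map_inj_uniq ?IH /=; last by move=> s s' [].
rewrite IHl // andbT; apply/hasPn => s /flattenP[l' /mapP[e' e'l ->]].
move=> /mapP[s' _ ->]; apply/negP => /mapP[s'' _] [] /addrI ee _.
by rewrite -ee e'l in el.
Qed.

Lemma path_weightE lam x s : path_weight lam x s =
  \prod_(i < size s) step E q lam (nth 0 (x :: s) i) (nth 0 (x :: s) i.+1).
Proof.
elim: s x => [|y s IH] x; first by rewrite big_ord0.
by rewrite /= big_ord_recl /= IH.
Qed.

Lemma path_weight_ge0 lam x s : (forall y z, 0 <= q y z) -> 0 <= lam ->
  0 <= path_weight lam x s.
Proof.
move=> q0 l0; elim: s x => //= y s IH x; rewrite mulr_ge0 //.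
exact: step_ge0.
Qed.

Lemma hop_paths lam A phi n x : hop E q lam A phi n x =
  \sum_(s <- tails x n) path_weight lam x s * ((all A (belast x s))%:R * phi (last x s)).
Proof.
elim: n x => [|n IH] x; first by rewrite /= big_seq1 !mul1r.
rewrite sum_tailsS hopS mulr_sumr; apply: eq_bigr => e _.
rewrite IH !mulr_sumr; apply: eq_bigr => s _ /=.
by rewrite -mulnb natrM; ring.
Qed.

Lemma sum_path_weight0 x n : (forall y, total_rate E q y != 0) ->
  \sum_(s <- tails x n) path_weight 0 x s = 1.
Proof.
move=> Q0; elim: n x => [|n IH] x; first by rewrite big_seq1.
rewrite sum_tailsS /=.
under eq_bigr do rewrite -mulr_sumr IH mulr1 /step add0r.
by rewrite -mulr_suml -[X in X / _]/(total_rate E q x) divff.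
Qed.

Variables (x0 : site d) (Q : probability (trajectory R d) R).
Hypothesis q_ge0 : forall x y, 0 <= q x y.
Hypothesis exit_total : forall x, exit_rate q x = total_rate E q x.
Hypothesis Q_gt0 : forall x, 0 < total_rate E q x.
Hypothesis Q_law : ctmc_law q x0 Q.

Let exit_gt0 x : 0 < exit_rate q x. Proof. by rewrite exit_total. Qed.

(** The holding times are required to be positive for this to be one of the
    events described by [ctmc_law]. *)
Definition path_event s : set (trajectory R d) :=
  [set w | path_of w (size s) = s /\ forall i, (i < size s)%N -> 0 < holding_time w i].

Lemma path_event_cylinder x s :
  path_event (x :: s) = cylinder (nth 0 (x :: s)) (fun=> 0) (size s).
Proof.
apply/seteqP; split => w.
  move=> [ws wh] i i_s; split; last exact: wh.
  by rewrite -[in RHS]ws nth_mkseq.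
move=> wc; split; last by move=> i /wc[].
apply: (@eq_from_nth _ 0); rewrite size_mkseq // => i i_s.
by rewrite nth_mkseq //; have [] := wc i i_s.
Qed.

Lemma measurable_path_event s : measurable (path_event s).
Proof.
case: s => [|x s]; last by rewrite path_event_cylinder; exact: measurable_cylinder.
by rewrite (_ : path_event _ = setT) //; apply/seteqP; split.
Qed.

Lemma path_event_laplace lam s : 0 <= lam ->
  (\int[Q]_w (\1_(path_event (x0 :: s)) w * expR (- (lam * jump_time w (size s))))%:E =
   (path_weight lam x0 s)%:E)%E.
Proof.
move=> l0; rewrite path_event_cylinder (cylinder_laplace q_ge0 exit_gt0 Q_law) // eqxx mul1r path_weightE.
by congr (_%:E); apply: eq_bigr => i _; rewrite exit_total.
Qed.

Lemma path_event_holding s :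
  (\int[Q]_w (\1_(path_event (x0 :: s)) w * holding_time w (size s))%:E =
   (path_weight 0 x0 s / total_rate E q (last x0 s))%:E)%E.
Proof.
rewrite path_event_cylinder (cylinder_holding q_ge0 exit_gt0 Q_law) eqxx mul1r path_weightE.
rewrite exit_total (nth_last 0 (x0 :: s)) /=; congr (_ / _)%:E; apply: eq_bigr => i _.
by rewrite exit_total /step add0r.
Qed.

(** The law [ctmc_law] only determines the trajectory up to a null set; these
    are the properties that hold outside a null set. *)
Definition regular (w : trajectory R d) := forall n,
  (exists2 s, s \in tails x0 n & path_of w n.+1 = x0 :: s) /\ 0 < holding_time w n.

Definition regular_upto n : set (trajectory R d) :=
  \bigcup_(s in [set` tails x0 n]) path_event (x0 :: s).

Lemma measurable_regular_upto n : measurable (regular_upto n).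
Proof.
apply: fin_bigcup_measurable; first exact: finite_seq.
by move=> s _; exact: measurable_path_event.
Qed.

Lemma path_event_inj n s s' w : s \in tails x0 n -> s' \in tails x0 n ->
  path_event (x0 :: s) w -> path_event (x0 :: s') w -> s = s'.
Proof.
move=> /size_tails sn /size_tails s'n [+ _] [+ _]; rewrite /= sn s'n => -> [].
by [].
Qed.

Lemma sum_path_event n (F : seq (site d) -> R) w s : s \in tails x0 n ->
  path_event (x0 :: s) w ->
  \sum_(s' <- tails x0 n) \1_(path_event (x0 :: s')) w * F s' = F s.
Proof.
move=> sT ws; rewrite (bigD1_seq s) ?uniq_tails //= indicE mem_set // mul1r.
rewrite big_seq_cond big1 ?addr0 // => s' /andP[s'T ss'].
rewrite indicE memNset ?mul0r // => ws'.
by rewrite (path_event_inj sT s'T ws ws') eqxx in ss'.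
Qed.

Lemma sum_path_event0 n (F : seq (site d) -> R) w : ~ regular_upto n w ->
  \sum_(s' <- tails x0 n) \1_(path_event (x0 :: s')) w * F s' = 0.
Proof.
move=> nU; rewrite big_seq_cond big1 // => s' /andP[s'T _].
by rewrite indicE memNset ?mul0r // => ws'; apply: nU; exists s'.
Qed.

(** The weights of the paths of length [n] without killing add up to [1]. *)
Lemma ae_regular_upto n : Q (regular_upto n) = 1%E.
Proof.
rewrite -integral_indicT; last exact: measurable_regular_upto.
transitivity (\int[Q]_w \sum_(s <- tails x0 n)
   (\1_(path_event (x0 :: s)) w * expR (- (0 * jump_time w (size s))))%:E)%E.
  apply: eq_integral => w _.
  rewrite sumEFin; have [[s sT ws]|nU] := pselect (regular_upto n w).
    rewrite (sum_path_event _ sT ws) mul0r oppr0 expR0 indicE mem_set //.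
    by exists s.
  by rewrite sum_path_event0 // indicE memNset.
have m1 s : measurable_fun setT (fun w => (\1_(path_event (x0 :: s)) w *
    expR (- (0 * jump_time w (size s))))%:E).
  apply/measurable_EFinP; apply: measurable_funM.
    by apply: measurable_indic; exact: measurable_path_event.
  apply: measurableT_comp => //; apply: measurableT_comp => //.
  by apply: measurable_funM => //; exact: measurable_jump_time.
rewrite ge0_integral_sum //.
under eq_bigr do rewrite path_event_laplace //.
by rewrite sumEFin sum_path_weight0 // => y; rewrite gt_eqF.
Qed.

Lemma ae_regular : {ae Q, forall w, regular w}.
Proof.
have : {ae Q, forall w, forall n, regular_upto n w}.
  apply/ae_foralln => n.
  apply: ae_probability1; first exact: measurable_regular_upto.
  exact: ae_regular_upto.
apply: filterS => w h n; have [s sT [/= ws wh]] := h n.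
rewrite (size_tails sT) in ws wh; split; first by exists s.
exact: wh.
Qed.

Lemma integral_path n (g : trajectory R d -> R) (h : seq (site d) -> R) :
  measurable_fun setT g -> (forall s, 0 <= h s) ->
  (forall w, regular_upto n w -> 0 <= g w) ->
  (\int[Q]_w (h (path_of w n.+1) * g w)%:E =
   \sum_(s <- tails x0 n) (h (x0 :: s))%:E *
      \int[Q]_w (\1_(path_event (x0 :: s)) w * g w)%:E)%E.
Proof.
move=> mg h0 g0.
pose F s w : R := if s \in tails x0 n then \1_(path_event (x0 :: s)) w * g w else 0.
have F0 s w : 0 <= F s w.
  rewrite /F; case: ifP => // sT.
  rewrite indicE; case: (boolP (w \in _)); rewrite ?mul0r // mul1r inE => ws.
  by apply: g0; exists s.
have mF s : measurable_fun setT (F s).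
  rewrite /F; case sT : (s \in tails x0 n) => //.
  apply: measurable_funM => //; apply: measurable_indic.
  exact: measurable_path_event.
transitivity (\int[Q]_w \sum_(s <- tails x0 n) ((h (x0 :: s))%:E * (F s w)%:E))%E.
  apply: ae_eq_integral => //.
  - apply/measurable_EFinP; apply: measurable_funM => //.
    exact: measurable_fun_path1.
  - apply: emeasurable_sum => s; apply/measurable_EFinP.
    exact: measurable_funM.
  apply: filterS (ae_probability1 (measurable_regular_upto n) (ae_regular_upto n)).
  move=> w [s sT ws] _; have [ps _] := ws.
  rewrite /= (size_tails sT) in ps; rewrite ps.
  rewrite (eq_big_seq (fun s' => (\1_(path_event (x0 :: s')) w * (h (x0 :: s') * g w))%:E)).
    by rewrite sumEFin (sum_path_event (fun s => h (x0 :: s) * g w) sT ws).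
  by move=> s' s'T; rewrite -EFinM /F s'T mulrCA.
rewrite ge0_integral_sum //; last 2 first.
- by move=> s; apply/measurable_EFinP; exact: measurable_funM.
- by move=> s w _; rewrite -EFinM lee_fin mulr_ge0.
apply: eq_big_seq => s sT; rewrite ge0_integralZl_EFin //; last 2 first.
- by move=> w _; rewrite lee_fin.
- exact/measurable_EFinP.
by rewrite /F sT.
Qed.

(** Each step contributes [q / total_rate] for the jump and [total_rate / (lam
    + total_rate)] for the holding time, hence altogether the factor [q / (lam
    + total_rate)] of a walk killed at rate [lam]. *)
Lemma integral_path_laplace lam n (h : seq (site d) -> R) : 0 <= lam -> (forall s, 0 <= h s) ->
  (\int[Q]_w (h (path_of w n.+1) * expR (- (lam * jump_time w n)))%:E =
   (\sum_(s <- tails x0 n) path_weight lam x0 s * h (x0 :: s))%:E)%E.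
Proof.
move=> l0 h0; rewrite integral_path //; last first.
  apply: measurableT_comp => //; apply: measurableT_comp => //.
  by apply: measurable_funM => //; exact: measurable_jump_time.
rewrite -sumEFin; apply: eq_big_seq => s /size_tails sn.
by rewrite -sn path_event_laplace // -EFinM mulrC.
Qed.

Lemma integral_path_holding n (h : seq (site d) -> R) : (forall s, 0 <= h s) ->
  (\int[Q]_w (h (path_of w n.+1) * holding_time w n)%:E =
   (\sum_(s <- tails x0 n) path_weight 0 x0 s * (h (x0 :: s) / total_rate E q (last x0 s)))%:E)%E.
Proof.
move=> h0; rewrite integral_path //; last 2 first.
- exact: measurable_holding_time.
- by move=> w [s /size_tails sn [_ /= wh]]; apply/ltW/wh; rewrite sn.
rewrite -sumEFin; apply: eq_big_seq => s /size_tails sn.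
by rewrite -sn path_event_holding -EFinM; congr (_%:E); ring.
Qed.

End Paths.

(** * The law of the environment *)

Section EnvironmentLaw.
Context {R : realType} {d : nat}.
Variable P : probability (environment R d) R.
Hypothesis P_iid : iid_coordinates P.
Implicit Types (t : environment R d) (x y : site d) (B : site d -> set R) (s : seq (site d)).

Definition box s B : set (environment R d) := [set t | forall x, x \in s -> B x (t x)].

Definition boxes : set (set (environment R d)) :=
  [set A | exists s B, (forall x, measurable (B x)) /\ A = box s B].

Lemma measurable_box s B : (forall x, measurable (B x)) -> measurable (box s B).
Proof.
move=> mB; rewrite (_ : box s B = \bigcap_(x in [set` s]) [set t | B x (t x)]).
  apply: fin_bigcap_measurable; first exact: finite_seq.
  move=> x _; rewrite -[[set _ | _]]setTI.
  exact: measurable_coordinate.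
by apply/seteqP; split => t h x /=; exact: h.
Qed.

Lemma boxes_setI : setI_closed boxes.
Proof.
move=> _ _ [s [B [mB ->]]] [s' [B' [mB' ->]]].
exists (s ++ s'), (fun x => (if x \in s then B x else setT) `&` (if x \in s' then B' x else setT)).
split=> [x|].
  by apply: measurableI; case: ifP.
apply/seteqP; split => t /=.
  by move=> [h h'] x _; split; case: ifP => // xs; [exact: h|exact: h'].
move=> h; split=> x xs.
  by have := h x; rewrite mem_cat xs => /(_ isT) [].
by have := h x; rewrite mem_cat xs orbT => /(_ isT) [].
Qed.

Lemma boxes_generate : @measurable _ (environment R d) = <<s boxes >>.
Proof.
apply/seteqP; split => A.
  apply: smallest_sub; first exact: smallest_sigma_algebra.
  move=> _ [x [B [mB ->]]]; apply: sub_sigma_algebra.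
  exists [:: x], (fun=> B); split => //; apply/seteqP; split => t /=.
    by move=> Bt y; rewrite inE => /eqP ->.
  by apply; rewrite inE.
apply: smallest_sub; first exact: sigma_algebra_measurable.
by move=> _ [s [B [mB ->]]]; exact: measurable_box.
Qed.

Lemma boxesT : boxes setT.
Proof. by exists [::], (fun=> setT); split => //; apply/seteqP; split. Qed.

Lemma eq_environment_law (m : {measure set (environment R d) -> \bar R}) :
  (forall s B, (forall x, measurable (B x)) -> m (box s B) = P (box s B)) ->
  forall A, measurable A -> m A = P A.
Proof.
move=> mP; apply: (measure_unique boxes (fun=> setT)) => //.
- exact: boxes_generate.
- exact: boxes_setI.
- by move=> _; exact: boxesT.
- by apply/seteqP; split => t // _; exists 0%N.
- by move=> _ [s [B [mB ->]]]; exact: mP.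
- by move=> _; have [s [B [mB ->]]] := boxesT; rewrite mP // ltey_eq fin_num_measure //;
    exact: measurable_box.
Qed.

Lemma box_undup s B : box (undup s) B = box s B.
Proof. by apply/seteqP; split => t h x xs; apply: h; rewrite mem_undup in xs *. Qed.

Lemma box_prob s B : (forall x, measurable (B x)) ->
  P (box s B) = (\prod_(x <- undup s) P [set t | B x (t 0%R)])%E.
Proof. by move=> mB; rewrite -box_undup; apply: P_iid => //; exact: undup_uniq. Qed.

Lemma measurable_shift x : measurable_fun setT (@shift R d x).
Proof. by apply: measurable_into_real_family => y; exact: measurable_coordinate. Qed.

Lemma shift_law x A : measurable A -> P (shift x @^-1` A) = P A.
Proof.
have := @eq_environment_law (pushforward P (@shift R d x)).
rewrite /pushforward; apply; [exact: measurable_shift | move=> mS s B mB].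
rewrite -[LHS]/(P (shift x @^-1` box s B)).
have -> : shift x @^-1` box s B = box [seq x + y | y <- s] (fun y => B (y - x)).
  apply/seteqP; split => t /= h y.
    by move=> /mapP[z zs ->]; have := h z zs; rewrite /shift [x + z - x]addrAC subrr add0r.
  by move=> ys; have := h (x + y) (map_f _ ys); rewrite /shift [x + y - x]addrAC subrr add0r.
rewrite !box_prob // undup_map_inj; last exact: addrI.
rewrite big_map; apply: eq_bigr => y _.
by rewrite [x + y - x]addrAC subrr add0r.
Qed.

Lemma integral_shift x (F : environment R d -> \bar R) : measurable_fun setT F ->
  (forall t, 0 <= F t)%E ->
  (\int[P]_t F (shift x t) = \int[P]_t F t)%E.
Proof.
move=> mF F0.
rewrite -(@ge0_integral_pushforward _ _ _ _ _ _ (measurable_shift x) P setT F) //.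
by apply: eq_measure_integral => [|mS A mA _]; [exact: measurable_shift | exact: shift_law].
Qed.

Lemma coordinate_law x (B : set R) : measurable B ->
  P [set t | B (t x)] = P [set t | B (t 0%R)].
Proof.
move=> mB; rewrite -(shift_law (- x)) //.
  by congr (P _); apply/seteqP; split => t /=; rewrite /shift addNr.
by rewrite -[[set _ | _]]setTI; exact: measurable_coordinate.
Qed.

Definition set_coordinate x (v : R) t : environment R d :=
  fun y => if y == x then v else t y.

Lemma measurable_set_coordinate x :
  measurable_fun setT (fun p : R * environment R d => set_coordinate x p.1 p.2).
Proof.
apply: measurable_into_real_family => y; rewrite /set_coordinate.
case: (y == x); first exact: measurable_fst.
exact: measurableT_comp (measurable_coordinate y) measurable_snd.
Qed.

Definition coordinate0 t : R := t 0.

Lemma measurable_coordinate0 : measurable_fun setT coordinate0.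
Proof. exact: measurable_coordinate. Qed.

HB.instance Definition _ := isMeasurableFun.Build _ _ _ _ coordinate0 measurable_coordinate0.

Local Notation nu := (distribution P coordinate0).

(** On boxes the coordinate [x] contributes the same factor whether or not it
    is resampled. *)
Lemma resample_law x A : measurable A ->
  (nu \x P)%E [set p | A (set_coordinate x p.1 p.2)] = P A.
Proof.
have := @eq_environment_law
  (pushforward (nu \x P)%E (fun p : R * environment R d => set_coordinate x p.1 p.2)).
rewrite /pushforward; apply; [exact: measurable_set_coordinate | move=> mS s B mB].
pose C := if x \in s then B x else setT.
pose B' y := if y == x then setT else B y.
have mC : measurable C by rewrite /C; case: ifP.
have mB' y : measurable (B' y) by rewrite /B'; case: ifP.
rewrite -[LHS]/((nu \x P)%E ((fun p => set_coordinate x p.1 p.2) @^-1` box s B)).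
have -> : (fun p => set_coordinate x p.1 p.2) @^-1` box s B = C `*` box s B'.
  apply/seteqP; split => -[v t] /=; rewrite /set_coordinate.
    move=> h; split; rewrite /= /C /B'.
      by case: ifP => // /h; rewrite eqxx.
    by move=> y /h; case: ifP.
  move=> [/= Cv h] y ys; case: eqP => [yx|yx].
    by move: Cv; rewrite /C -yx ys.
  by have := h y ys; rewrite /B'; case: eqP.
rewrite product_measure1E //; last exact: measurable_box.
rewrite -[LHS]/(P [set t | C (t 0%R)] * P (box s B'))%E.
rewrite !box_prob //.
case xs : (x \in s); last first.
  rewrite /C xs [X in (X * _)%E](_ : _ = 1%E) ?mul1e; last exact: probability_setT.
  apply: eq_big_seq => y.
  by rewrite mem_undup /B'; case: eqP => // ->; rewrite xs.
rewrite [RHS](bigD1_seq x) ?undup_uniq ?mem_undup //=.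
rewrite [X in (_ * X)%E](bigD1_seq x) ?undup_uniq ?mem_undup //=.
rewrite /C xs /B' eqxx [X in (_ * (X * _))%E](_ : _ = 1%E) ?mul1e; last exact: probability_setT.
congr (_ * _)%E.
by apply: eq_bigr => y /negbTE ->.
Qed.

(** Resample the coordinate [x] and integrate it out first: [g] does not see
    its new value. *)
Lemma integral_coordinate x (B : set R) (g : environment R d -> \bar R) :
  measurable B -> measurable_fun setT g -> (forall t, 0 <= g t)%E ->
  (forall t v, g (set_coordinate x v t) = g t) ->
  (\int[P]_t ((\1_B (t x))%:E * g t) =
   P [set t | B (t 0%R)] * \int[P]_t g t)%E.
Proof.
move=> mB mg g0 gx.
pose F t : \bar R := ((\1_B (t x))%:E * g t)%E.
have mF : measurable_fun setT F.
  apply: emeasurable_funM => //; apply/measurable_EFinP.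
  apply: measurableT_comp; first exact: measurable_indic.
  exact: measurable_coordinate.
have F0 t : (0 <= F t)%E by rewrite mule_ge0 // lee_fin.
pose S := fun p : R * environment R d => set_coordinate x p.1 p.2.
transitivity (\int[(nu \x P)%E]_p F (S p))%E.
  rewrite -(@ge0_integral_pushforward _ _ _ _ _ _ (measurable_set_coordinate x) (nu \x P)%E setT F) //.
  by apply: eq_measure_integral => [|mS A mA _];
    [exact: measurable_set_coordinate | rewrite /= /pushforward -(resample_law x mA)].
have mFS : measurable_fun setT (F \o S) by exact: measurableT_comp mF (measurable_set_coordinate x).
rewrite (fubini_tonelli1 (F \o S)) //; last by move=> p; exact: F0.
rewrite /fubini_F /F /S /=.
under eq_integral => v _.
  under eq_integral do rewrite /set_coordinate eqxx -/(set_coordinate x v _) gx.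
  rewrite ge0_integralZl_EFin //.
  over.
rewrite ge0_integralZr //.
- by rewrite integral_indicT.
- by apply/measurable_EFinP; exact: measurable_indic.
- exact: integral_ge0.
Qed.

Lemma integral_coordinates (D : seq (site d)) (B : set R) (g : environment R d -> \bar R) :
  uniq D -> measurable B -> measurable_fun setT g -> (forall t, 0 <= g t)%E ->
  (forall x t v, x \in D -> g (set_coordinate x v t) = g t) ->
  (\int[P]_t ((\prod_(x <- D) \1_B (t x))%:E * g t) =
   (P [set t | B (t 0%R)]) ^+ size D * \int[P]_t g t)%E.
Proof.
elim: D => [_ mB mg g0 gD|x D IH /= /andP[xD uD] mB mg g0 gD].
  by under eq_integral do rewrite big_nil mul1e; rewrite mul1e.
under eq_integral do rewrite big_cons EFinM -muleA.
have g0' t : (0 <= (\prod_(y <- D) \1_B (t y))%:E * g t)%E.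
  by rewrite mule_ge0 // lee_fin prodr_ge0.
rewrite integral_coordinate //.
- rewrite IH // => [|y t v yD]; last by apply: gD; rewrite inE yD orbT.
  rewrite muleA; congr (_ * _)%E.
  by case: (size D) => [|n] //; rewrite mule1.
- apply: emeasurable_funM => //; apply/measurable_EFinP.
  apply: measurable_prod => y _; apply: measurableT_comp; first exact: measurable_indic.
  exact: measurable_coordinate.
- move=> t v; rewrite gD ?inE ?eqxx //; congr (_%:E * _)%E.
  apply: eq_big_seq => y yD; rewrite /set_coordinate.
  by case: eqP => // yx; rewrite -yx yD in xD.
Qed.

Lemma ae_coordinates_ge1 : {ae P, forall t, 1 <= t 0} ->
  {ae P, forall t, forall x, 1 <= t x}.
Proof.
move=> h1; have mI : measurable [set t : environment R d | 1 <= t 0].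
  rewrite (_ : [set _ | _] = (fun t : environment R d => t 0) @^-1` `[1, +oo[).
    by rewrite -[_ @^-1` _]setTI; exact: measurable_coordinate.
  by apply/seteqP; split => t /=; rewrite in_itv /= andbT.
have P1 : P [set t : environment R d | 1 <= t 0] = 1%E.
  have [N [mN N0 hN]] := h1; apply/eqP; rewrite eq_le probability_le1 //=.
  have : (P (~` [set t : environment R d | (1 <= t 0)%R]) <= 0)%E.
    by rewrite -N0; apply: le_measure; rewrite ?inE //; exact: measurableC.
  by rewrite probability_setC // sube_le0.
have : {ae P, forall t, forall k : nat, oapp (fun x => 1 <= t x) true (pickle_inv k)}.
  apply/ae_foralln => k; case: pickle_inv => /= [x|]; last exact: aeW.
  apply: (@ae_probability1 _ _ _ P [set t | 1 <= t x]).
    rewrite (_ : [set _ | _] = (fun t : environment R d => t x) @^-1` `[1, +oo[).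
      by rewrite -[_ @^-1` _]setTI; exact: measurable_coordinate.
    by apply/seteqP; split => t /=; rewrite in_itv /= andbT.
  have := @coordinate_law x `[1, +oo[ (measurable_itv _).
  have E y : [set t : environment R d | (`[1, +oo[%classic : set R) (t y)] = [set t | 1 <= t y].
    by apply/seteqP; split => t /=; rewrite in_itv /= andbT.
  by rewrite !E P1.
by apply: filterS => t h x; have := h (pickle x); rewrite pickleK_inv.
Qed.

End EnvironmentLaw.

(** * Annealed integrals *)

Section AnnealedIntegral.
Context d1 d2 (T1 : measurableType d1) (T2 : measurableType d2) (R : realType).
Variables (P : probability T1 R) (K : R.-pker T1 ~> T2).
Local Open Scope ereal_scope.

Lemma measurable_kernel_integral (g : T1 * T2 -> \bar R) : (forall p, 0 <= g p) ->
  measurable_fun setT g -> measurable_fun setT (fun t => \int[K t]_w g (t, w)).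
Proof. by move=> g0 mg; exact: measurable_fun_integral_finite_kernel. Qed.

Import HBNNSimple.

Let integral_annealed_indic A : measurable A ->
  \int[annealed P K]_p (\1_A p)%:E = \int[P]_t \int[K t]_w (\1_A (t, w))%:E.
Proof.
move=> mA; rewrite integral_indicT // /annealed; apply: eq_integral => t _.
rewrite -integral_indicT; last exact: measurable_xsection.
by apply: eq_integral => w _; rewrite !indicE mem_xsection.
Qed.

Let integral_annealed_nnsfun (f : {nnsfun T1 * T2 >-> R}) :
  \int[annealed P K]_p (f p)%:E = \int[P]_t \int[K t]_w (f (t, w))%:E.
Proof.
have fE p : (f p)%:E = \sum_(k \in range f) k%:E * (\1_(f @^-1` [set k]) p)%:E.
  by rewrite fsumEFin //= fimfunE.
have m1 k : measurable_fun setT (fun p : T1 * T2 => (\1_(f @^-1` [set k]) p)%:E : \bar R).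
  exact/measurable_EFinP.
have m2 t k : measurable_fun setT (fun w : T2 => (\1_(f @^-1` [set k]) (t, w))%:E : \bar R).
  apply/measurable_EFinP; apply: measurableT_comp => //.
have k0 (k : R) (p : T1 * T2) : 0 <= k%:E * (\1_(f @^-1` [set k]) p)%:E.
  exact: nnfun_muleindic_ge0.
under [LHS]eq_integral do rewrite fE.
rewrite ge0_integral_fsum //; last by move=> k; exact: measurable_funeM.
transitivity (\sum_(k \in range f) \int[P]_t \int[K t]_w (k%:E * (\1_(f @^-1` [set k]) (t, w))%:E)).
  apply: eq_fsbigr => k; rewrite inE => -[z _ <-{k}].
  rewrite ge0_integralZl_EFin // integral_annealed_indic // -ge0_integralZl_EFin //.
  - by apply: eq_integral => t _; rewrite ge0_integralZl_EFin.
  - by move=> t _; apply: integral_ge0 => w _; rewrite lee_fin.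
  - exact: (measurable_kernel_integral (g := fun p => (\1_(f @^-1` [set f z]) p)%:E)).
rewrite -ge0_integral_fsum //; last 2 first.
- move=> k; apply: (measurable_kernel_integral (g := fun p => k%:E * (\1_(f @^-1` [set k]) p)%:E)) => //.
  exact: measurable_funeM.
- by move=> k t _; apply: integral_ge0 => w _.
apply: eq_integral => t _; rewrite -ge0_integral_fsum //.
- by apply: eq_integral => w _; rewrite fE.
- by move=> k; exact: measurable_funeM.
Qed.

Lemma integral_annealed (g : T1 * T2 -> \bar R) : (forall p, 0 <= g p) ->
  measurable_fun setT g ->
  \int[annealed P K]_p g p = \int[P]_t \int[K t]_w g (t, w).
Proof.
move=> g0 mg; pose g_ := nnsfun_approx measurableT mg.
have mK n : measurable_fun setT (fun t => \int[K t]_w (g_ n (t, w))%:E).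
  apply: (measurable_kernel_integral (g := fun p => (g_ n p)%:E)) => [p|].
    by rewrite lee_fin.
  exact/measurable_EFinP.
have mx t n : measurable_fun setT (fun w => (g_ n (t, w))%:E : \bar R).
  by apply/measurable_EFinP; apply: measurableT_comp.
transitivity (\int[annealed P K]_p (lim ((g_ n p)%:E @[n --> \oo]))).
  by apply/eq_integral => z _; apply/esym/cvg_lim => //=; exact: cvg_nnsfun_approx.
rewrite monotone_convergence//; last 3 first.
  by move=> n; exact/measurable_EFinP.
  by move=> n z _; rewrite lee_fin.
  by move=> z _ a b ab; rewrite lee_fin; exact/lefP/nd_nnsfun_approx.
rewrite (_ : (fun _ => _) = (fun n => \int[P]_t \int[K t]_w (g_ n (t, w))%:E)); last first.
  by apply/funext => n; rewrite integral_annealed_nnsfun.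
rewrite -monotone_convergence//; last 2 first.
- by move=> n y _; apply: integral_ge0 => // z _; rewrite lee_fin.
- move=> y _ a b ab; apply: ge0_le_integral => //.
  + by move=> z _; rewrite lee_fin.
  + by move=> z _; rewrite lee_fin; exact/lefP/nd_nnsfun_approx.
apply: eq_integral => y _; rewrite -monotone_convergence//; last 2 first.
- by move=> n z _; rewrite lee_fin.
- by move=> z _ a b ab; rewrite lee_fin; exact/lefP/nd_nnsfun_approx.
by apply: eq_integral => z _; apply/cvg_lim => //; exact: cvg_nnsfun_approx.
Qed.

Lemma ae_annealed (B : set (T1 * T2)) : measurable B ->
  {ae P, forall t, {ae K t, forall w, B (t, w)}} ->
  {ae annealed P K, forall p, B p}.
Proof.
move=> mB h; exists (~` B); split => //; first exact: measurableC.
rewrite [LHS]/annealed -[RHS](@integral0 _ _ _ P setT).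
apply: ge0_ae_eq_integral => //.
- apply: measurable_fun_xsection_finite_kernel; rewrite inE; exact: measurableC.
apply: filterS h => t [N [mN N0 hN]] _ /=.
apply/eqP; rewrite -measure_le0 -N0; apply: le_measure; rewrite ?inE //.
- by apply: measurable_xsection; exact: measurableC.
- by move=> w; rewrite /xsection /= inE => Bw; apply: hN.
Qed.

End AnnealedIntegral.

(** * The Green function of the process *)

Section GreenFunction.
Context {R : realType} {d : nat}.
Local Notation mu := (@lebesgue_measure R).
Implicit Types (w : trajectory R d) (x : site d).

Lemma jump_timeS w n : jump_time w n.+1 = jump_time w n + holding_time w n.
Proof. by rewrite /jump_time big_ord_recr. Qed.

Lemma jump_time0 w : jump_time w 0 = 0.
Proof. by rewrite /jump_time big_ord0. Qed.

Definition increasing_times w := forall n, 0 < holding_time w n.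

Lemma le_jump_time w m n : increasing_times w -> (m <= n)%N ->
  jump_time w m <= jump_time w n.
Proof.
move=> wi; elim: n => [|n IH]; first by rewrite leqn0 => /eqP ->.
rewrite leq_eqVlt => /orP[/eqP -> //|]; rewrite ltnS => /IH /le_trans; apply.
by rewrite jump_timeS lerDl ltW.
Qed.

Lemma jump_time_ge0 w n : increasing_times w -> 0 <= jump_time w n.
Proof. by move=> wi; rewrite -(jump_time0 w); exact: le_jump_time. Qed.

Definition sitting_set w x n : set R :=
  if position w n == x then [set` `[jump_time w n, jump_time w n.+1[ ] else set0.

(** The time spent in [x] is the total length of disjoint intervals, one for
    each visit. *)
Lemma occupation_timeE w x : increasing_times w ->
  (occupation_time w x =
   \sum_(0 <= n <oo) ((position w n == x)%:R * holding_time w n)%:E)%E.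
Proof.
move=> wi; rewrite /occupation_time integral_mkcond.
have mS n : measurable (sitting_set w x n) by rewrite /sitting_set; case: ifP.
have SE s : (\bigcup_n sitting_set w x n) s <-> sits_at w s x.
  split=> [[n _]|[n [sn nx]]].
    by rewrite /sitting_set; case: eqP => // nx; rewrite /= in_itv /= => sn; exists n.
  by exists n => //; rewrite /sitting_set nx eqxx /= in_itv.
have S0 s : sits_at w s x -> 0 <= s.
  by move=> [n [/andP[sn _] _]]; exact: le_trans (jump_time_ge0 n wi) sn.
transitivity (\int[mu]_s (\1_(\bigcup_n sitting_set w x n) s)%:E)%E.
  apply: eq_integral => s _; rewrite patchE !indicE.
  case: ifPn => [_|].
    by congr (_%:R%:E); congr nat_of_bool; apply/idP/idP; rewrite !inE /= => /SE.
  rewrite notin_setE /= in_itv /= andbT => s0.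
  by rewrite memNset // => /SE /S0.
have mU : measurable (\bigcup_n sitting_set w x n) by apply: bigcup_measurable => n _; exact: mS.
rewrite integral_indicT // measure_semi_bigcup //; last first.
  have lt_disj m n s : (m < n)%N -> sitting_set w x m s -> ~ sitting_set w x n s.
    move=> mn; rewrite /sitting_set; case: eqP => // _; case: eqP => [_|_ _ []] //.
    rewrite /= !in_itv /= => /andP[_ sm] /andP[ns _].
    have := le_trans (le_jump_time wi mn) ns.
    by rewrite leNgt sm.
  move=> m n _ _ [s [sm sn]]; apply/eqP; rewrite eqn_leq leqNgt [(n <= m)%N]leqNgt.
  by apply/andP; split; apply/negP => h;
    [exact: (lt_disj _ _ _ h sn sm) | exact: (lt_disj _ _ _ h sm sn)].
apply: eq_eseriesr => n _; rewrite /sitting_set; case: eqP => _.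
  rewrite mul1r [LHS](lebesgue_measure_itv `[jump_time w n, jump_time w n.+1[) /=.
  by rewrite lte_fin jump_timeS ltrDl wi -EFinB addrAC subrr add0r.
by rewrite mul0r measure0.
Qed.

Definition sitting_event x : set (trajectory R d * R) :=
  [set p | 0 <= p.2 /\ sits_at p.1 p.2 x].

Lemma measurable_sitting_event x : measurable (sitting_event x).
Proof.
have mJ n : measurable_fun setT (fun p : trajectory R d * R => jump_time p.1 n).
  exact: measurableT_comp (measurable_jump_time n) measurable_fst.
rewrite (_ : sitting_event x = snd @^-1` `[0, +oo[ `&`
  \bigcup_n (~` [set p | p.2 < jump_time p.1 n] `&` [set p | p.2 < jump_time p.1 n.+1] `&`
              fst @^-1` [set w | position w n = x])).
  apply: measurableI.
    by rewrite -[_ @^-1` _]setTI; exact: measurable_snd.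
  apply: bigcup_measurable => n _; apply: measurableI; first apply: measurableI.
  - by apply: measurableC; exact: measurable_set_lt.
  - exact: measurable_set_lt.
  - by rewrite -[_ @^-1` _]setTI; apply: measurable_fst => //; exact: measurable_position_eq.
apply/seteqP; split => -[w s] /=; rewrite /sitting_event /= in_itv /= andbT.
  move=> [s0 [n [/andP[ns sn] nx]]]; split=> //; exists n => //; split=> //=; split=> //=.
  by apply/negP; rewrite -leNgt.
move=> [s0 [n _ [[/= /negP]]]]; rewrite -leNgt => ns sn nx; split=> //.
by exists n; rewrite ns sn.
Qed.

Lemma measurable_occupation_time x :
  measurable_fun setT (fun w : trajectory R d => occupation_time w x).
Proof.
have mF : measurable_fun setT (fun p => (\1_(sitting_event x) p)%:E : \bar R).
  by apply/measurable_EFinP; apply: measurable_indic; exact: measurable_sitting_event.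
have := measurable_fun_fubini_tonelli_F (m2 := mu) _ mF.
rewrite (_ : fubini_F _ _ = (fun w => occupation_time w x)).
  by apply => p; rewrite lee_fin.
apply/funext => w; rewrite /fubini_F /occupation_time [RHS]integral_mkcond.
apply: eq_integral => s _; rewrite patchE !indicE /sitting_event.
case: ifPn => [|]; rewrite ?inE ?notin_setE /= in_itv /= andbT => s0.
  congr (_%:R%:E); congr nat_of_bool; apply/idP/idP; rewrite !inE /=; first by case.
  by [].
by rewrite memNset //= => -[].
Qed.


Variables (a : R) (nb : seq (site d)) (t : environment R d).
Hypothesis nb_order : ball_order nb.
Hypothesis d_gt0 : (0 < d)%N.
Hypothesis t_gt0 : forall x, 0 < t x.
Variable Q : probability (trajectory R d) R.
Hypothesis Q_law : ctmc_law (jump_rate a t) 0 Q.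

Local Notation E := (steps nb).
Local Notation rate := (jump_rate a t).
Let uE := uniq_steps nb_order.
Let q0 := jump_rate_ge0 a t.
Let qE := exit_rateE a nb_order t.
Let qp x := total_jump_rate_gt0 a nb_order d_gt0 x t_gt0.

Lemma nth_path_of w n : nth 0 (path_of w n.+1) n = position w n.
Proof. by rewrite nth_mkseq. Qed.

Lemma last_path_of w n : last 0 (path_of w n.+1) = position w n.
Proof. by rewrite -(nth_last 0) size_mkseq nth_path_of. Qed.

(** The holding time at the [n]-th position, when this position is the origin,
    has as its mean the [n]-th term of the Green function. *)
Lemma integral_occupation_time :
  (\int[Q]_w occupation_time w 0%R = green0 a nb t)%E.
Proof.
(* The maximum with [0] makes the terms nonnegative even on the null set where
   some holding time is negative. *)
pose F n w : \bar R := (Num.max 0 ((position w n == 0)%:R * holding_time w n))%:E.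
have mh n : measurable_fun setT (fun w : trajectory R d => (position w n == 0)%:R * holding_time w n).
  apply: measurable_funM; last exact: measurable_holding_time.
  apply: (measurableT_comp (f := fun x : site d => ((x == 0)%:R : R))) => //.
  exact: measurable_position.
have mF n : measurable_fun setT (F n).
  by apply/measurable_EFinP; apply: measurable_maxr => //; exact: measurable_cst.
have F0 n w : (0 <= F n w)%E by rewrite lee_fin le_max lexx.
have aer := ae_regular uE q0 qE qp Q_law.
transitivity (\int[Q]_w \sum_(0 <= n <oo) F n w)%E.
  apply: ae_eq_integral => //.
  - exact: measurable_occupation_time.
  - exact: ge0_emeasurable_sum.
  apply: filterS aer => w wr _.
  have wi : increasing_times w by move=> n; have [] := wr n.
  rewrite occupation_timeE //; apply: eq_eseriesr => n _.
  by rewrite /F max_r // mulr_ge0 // ltW.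
rewrite integral_nneseries //; apply: eq_eseriesr => n _.
transitivity (\int[Q]_w (((last 0 (path_of w n.+1) == 0)%:R) * holding_time w n)%:E)%E.
  apply: ae_eq_integral => //.
    apply/measurable_EFinP; apply: measurable_funM; last exact: measurable_holding_time.
    exact: (measurable_fun_path1 _ (fun s => ((last 0 s == 0)%:R : R))).
  apply: filterS aer => w wr _.
  rewrite /F last_path_of max_r // mulr_ge0 // ltW //.
  by have [] := wr n.
rewrite (integral_path_holding uE q0 qE qp Q_law n (h := fun s => ((last 0 s == 0)%:R))) //.
congr (_%:E); rewrite /green_term hop_paths; apply: eq_bigr => s _.
congr (_ * _); rewrite /= (_ : all predT _) ?mul1r; last exact: all_predT.
by rewrite add0r; case: eqP; rewrite ?mul1r ?mul0r.
Qed.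

End GreenFunction.

(** * Discovery of traps *)

Section Discovery.
Context {R : realType} {d : nat}.
Variables (nb : seq (site d)).
Implicit Types (theta : R) (t : environment R d) (x y z : site d).
Implicit Types (D s : seq (site d)).

Definition around y : seq (site d) := [seq y + z | z <- nb].

(** The walk goes on as long as it sees no trap, a site of depth at least
    [theta]. Traps in [D] are ignored: [D] consists either of the sites on
    which an event depends, or of the site of the trap under study. *)
Definition alive theta D t y : bool :=
  all (fun x => (x \in D) || (t x < theta)) (around y).

Definition cover D s : seq (site d) :=
  [seq x <- undup (flatten [seq around y | y <- s]) | x \notin D].

(** The path is listed from its starting point on. *)
Definition first_trap theta D t s : bool :=
  if s is x :: s' then all (alive theta D t) (belast x s') && ~~ alive theta D t (last x s')
  else false.

Definition past s : seq (site d) := if s is x :: s' then belast x s' else [::].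

Lemma measurable_alive theta D y :
  measurable_fun setT (fun t : environment R d => alive theta D t y).
Proof.
rewrite /alive; elim: (around y) => [|x s IH] /=; first exact: measurable_cst.
apply: measurable_and => //; case: (x \in D); first exact: measurable_cst.
by apply: measurable_fun_ltr => //; exact: measurable_coordinate.
Qed.

Lemma measurable_all_alive theta D s :
  measurable_fun setT (fun t : environment R d => all (alive theta D t) s).
Proof.
elim: s => [|y s IH] /=; first exact: measurable_cst.
by apply: measurable_and => //; exact: measurable_alive.
Qed.

Lemma measurable_first_trap theta D s :
  measurable_fun setT (fun t : environment R d => first_trap theta D t s).
Proof.
case: s => [|x s] /=; first exact: measurable_cst.
apply: measurable_and; first exact: measurable_all_alive.
by apply: measurable_neg; exact: measurable_alive.
Qed.

Lemma measurable_bool_natr dT (T : measurableType dT) (f : T -> bool) :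
  measurable_fun setT f -> measurable_fun setT (fun u => (f u)%:R : R).
Proof.
by move=> mf; apply: (measurableT_comp (f := fun b : bool => (b%:R : R))).
Qed.

Lemma measurable_invr dT (T : measurableType dT) (f : T -> R) :
  measurable_fun setT f -> (forall u, 0 <= f u) -> measurable_fun setT (fun u => (f u)^-1).
Proof.
move=> mf f0; rewrite (_ : (fun u => _) = (fun u => f u `^ (-1))).
  by apply: (measurableT_comp (f := fun v : R => v `^ (-1))) => //; exact: measurable_powR.
by apply/funext => u; rewrite powR_inv1.
Qed.

Variable a : R.
Local Notation E := (steps nb).

Lemma measurable_jump_rate x y :
  measurable_fun setT (fun t : environment R d => jump_rate a t x y).
Proof.
rewrite /jump_rate; case: neighbours; last exact: measurable_cst.
apply: (measurableT_comp (f := fun v : R => v `^ a)); first exact: measurable_powR.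
by apply: measurable_funM; exact: measurable_coordinate.
Qed.

Lemma measurable_total_rate x :
  measurable_fun setT (fun t : environment R d => total_rate E (jump_rate a t) x).
Proof. by apply: measurable_sum => e; exact: measurable_jump_rate. Qed.

Lemma measurable_inv_rate lam x : 0 <= lam ->
  measurable_fun setT (fun t : environment R d => (lam + total_rate E (jump_rate a t) x)^-1).
Proof.
move=> l0; apply: measurable_invr.
  by apply: measurable_funD => //; exact: measurable_total_rate.
by move=> t; rewrite addr_ge0 // total_rate_ge0 // => *; exact: jump_rate_ge0.
Qed.

Lemma measurable_step lam x y : 0 <= lam ->
  measurable_fun setT (fun t : environment R d => step E (jump_rate a t) lam x y).
Proof.
move=> l0; apply: measurable_funM; first exact: measurable_jump_rate.
exact: measurable_inv_rate.
Qed.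

Lemma measurable_path_weight lam x s : 0 <= lam ->
  measurable_fun setT (fun t : environment R d => path_weight E (jump_rate a t) lam x s).
Proof.
move=> l0; elim: s x => [|y s IH] x /=; first exact: measurable_cst.
by apply: measurable_funM => //; exact: measurable_step.
Qed.

Lemma measurable_hop lam (A : environment R d -> pred (site d))
    (phi : environment R d -> site d -> R) n x : 0 <= lam ->
  (forall y, measurable_fun setT (fun t => A t y : bool)) ->
  (forall y, measurable_fun setT (phi^~ y)) ->
  measurable_fun setT (fun t : environment R d => hop E (jump_rate a t) lam (A t) (phi t) n x).
Proof.
move=> l0 mA mphi; elim: n x => [|n IH] x /=; first exact: mphi.
apply: measurable_funM; first exact: measurable_bool_natr.
apply: measurable_sum => e; apply: measurable_funM; last exact: IH.
exact: measurable_step.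
Qed.

Lemma measurable_green_sum lam (A : environment R d -> pred (site d)) x y : 0 <= lam ->
  (forall z, measurable_fun setT (fun t => A t z : bool)) ->
  measurable_fun setT (fun t : environment R d => green_sum E (jump_rate a t) lam (A t) x y).
Proof.
move=> l0 mA; apply: ge0_emeasurable_sum.
  move=> n t _ _; rewrite lee_fin green_term_ge0 // => *; exact: jump_rate_ge0.
move=> n _; apply/measurable_EFinP.
apply: (measurable_hop (phi := fun t z => if A t z && (z == y) then _ else 0)) => // z.
apply: measurable_fun_ifT => //; last exact: measurable_inv_rate.
by apply: measurable_and.
Qed.

Lemma measurable_hit_sum lam (A : environment R d -> pred (site d)) (H : pred (site d)) x : 0 <= lam ->
  (forall z, measurable_fun setT (fun t => A t z : bool)) ->
  measurable_fun setT (fun t : environment R d => hit_sum E (jump_rate a t) lam (A t) H x).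
Proof.
move=> l0 mA; apply: ge0_emeasurable_sum.
  move=> n t _ _; rewrite lee_fin hit_term_ge0 // => *; exact: jump_rate_ge0.
move=> n _; apply/measurable_EFinP.
apply: (measurable_hop (A := fun t => predD (A t) H) (phi := fun t z => (H z)%:R)) => // z.
by apply: measurable_and.
Qed.

(** The following quantities only depend on the environment around the path. *)
Hypothesis nb_order : ball_order nb.

Lemma mem_around x y : (x \in around y) = (l1norm (x - y)%R <= 1)%N.
Proof.
rewrite -(mem_nb nb_order); apply/mapP/idP => [[z zn ->]|xy].
  by rewrite addrAC subrr add0r.
by exists (x - y) => //; rewrite addrC subrK.
Qed.

Lemma uniq_around y : uniq (around y).
Proof. by rewrite map_inj_uniq; [case: nb_order | exact: addrI]. Qed.

Lemma set_coordinate_agree x v t : agree_off x (set_coordinate x v t) t.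
Proof. by move=> y /negbTE yx; rewrite /set_coordinate yx. Qed.

Lemma path_weight_local lam x v t y n s : s \in tails E y n ->
  x \notin flatten [seq around z | z <- belast y s] ->
  path_weight E (jump_rate a (set_coordinate x v t)) lam y s =
  path_weight E (jump_rate a t) lam y s.
Proof.
elim: n y s => [|n IH] y s; first by rewrite inE => /eqP ->.
move=> /flattenP[l /mapP[e eE ->]] /mapP[s' s'T ->] /=.
rewrite mem_cat negb_or mem_around -ltnNge => /andP[xy xs].
rewrite IH //; congr (_ * _).
have ee : l1norm (y + e - y) = 1%N.
  by rewrite addrAC subrr add0r; apply/eqP; rewrite -(mem_steps nb_order).
have yx : (1 < l1norm (y - x)%R)%N by rewrite l1normB.
exact: (step_agree a nb_order lam (set_coordinate_agree (x := x) v t) yx ee).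
Qed.

Lemma all_alive_local theta D x v t s : x \notin flatten [seq around z | z <- s] ->
  all (alive theta D (set_coordinate x v t)) s = all (alive theta D t) s.
Proof.
elim: s => //= y s IH; rewrite mem_cat negb_or => /andP[xy xs].
rewrite IH //; congr (_ && _); apply: eq_in_all => z zy.
rewrite /set_coordinate; case: eqP => // zx.
by rewrite -zx zy in xy.
Qed.

(** The sites outside [D] that are discovered from [y] and not along [s]. *)
Definition fresh D s y : seq (site d) :=
  [seq x <- undup (around y) | (x \notin D) && (x \notin flatten [seq around z | z <- s])].

Lemma size_cover_rcons D s y :
  size (cover D (rcons s y)) = (size (cover D s) + size (fresh D s y))%N.
Proof.
rewrite /cover map_rcons -cats1 flatten_cat /= cats0.
set l1 := flatten _; set l2 := around y.
have /perm_filter/perm_size -> : perm_eq (undup (l1 ++ l2)) (undup (l2 ++ l1)).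
  by apply: perm_undup => x; rewrite !mem_cat orbC.
rewrite undup_cat filter_cat size_cat addnC; congr (_ + _)%N.
by rewrite -filter_predI.
Qed.

Lemma all_alive_rcons theta D t s y :
  all (alive theta D t) (rcons s y) =
  all (alive theta D t) s && all (fun x => t x < theta) (fresh D s y).
Proof.
rewrite all_rcons andbC; case: (boolP (all _ s)) => //= /allP als.
apply/allP/allP => h x.
  rewrite mem_filter mem_undup => /andP[/andP[xD _] xy].
  by have := h x xy; rewrite (negbTE xD).
move=> xy; case: (boolP (x \in D)) => //= xD.
case: (boolP (x \in flatten [seq around z | z <- s])) => [|xs].
  move=> /flattenP[l /mapP[z zs ->]] xz.
  by have /allP/(_ x xz) := als z zs; rewrite (negbTE xD).
by apply: h; rewrite mem_filter mem_undup xD xs.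
Qed.

Lemma uniq_fresh D s y : uniq (fresh D s y).
Proof. by rewrite filter_uniq // undup_uniq. Qed.

Lemma size_fresh D s y : (size (fresh D s y) <= size nb)%N.
Proof.
rewrite size_filter (leq_trans (count_size _ _)) // (leq_trans (size_undup _)) //.
by rewrite size_map.
Qed.

End Discovery.

Section Walk.
Context {R : realType} {d : nat}.
Variables (a : R) (nb : seq (site d)).
Hypothesis nb_order : ball_order nb.
Hypothesis d_gt0 : (0 < d)%N.
Variable P : probability (environment R d) R.
Hypothesis P_iid : iid_coordinates P.
Hypothesis P_ge1 : {ae P, forall t, 1 <= t 0}.
Variable K : R.-pker (environment R d) ~> (trajectory R d).
Hypothesis K_law : forall t : environment R d, (forall y, 0 < t y) ->
  ctmc_law (jump_rate a t) 0 (K t).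
Implicit Types (theta lam : R) (t : environment R d) (D s : seq (site d)).

Local Notation E := (steps nb).
Local Notation pw lam t s := (path_weight E (jump_rate a t) lam 0 s).
Let uE := uniq_steps nb_order.

Lemma ae_positive : {ae P, forall t, forall y, 0 < t y}.
Proof.
apply: filterS (ae_coordinates_ge1 P_iid P_ge1) => t h y.
exact: lt_le_trans ltr01 (h y).
Qed.

Lemma quenched_regular t : (forall y, 0 < t y) -> {ae K t, forall w, regular E 0 w}.
Proof.
move=> t0; pose Q := to_probability (prob_kernel (s := K) t).
exact: (ae_regular (Q := Q) uE (jump_rate_ge0 a t) (exit_rateE a nb_order t)
  (fun x => total_jump_rate_gt0 a nb_order d_gt0 x t0) (K_law t0)).
Qed.

Lemma quenched_path lam t j (h : seq (site d) -> R) : (forall y, 0 < t y) ->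
  0 <= lam -> (forall s, 0 <= h s) ->
  (\int[K t]_w (h (path_of w j.+1) * expR (- (lam * jump_time w j)))%:E =
   (\sum_(s <- tails E 0 j) pw lam t s * h (0 :: s))%:E)%E.
Proof.
move=> t0 l0 h0; pose Q := to_probability (prob_kernel (s := K) t).
exact: (integral_path_laplace (Q := Q) uE (jump_rate_ge0 a t) (exit_rateE a nb_order t)
  (fun x => total_jump_rate_gt0 a nb_order d_gt0 x t0) (K_law t0)).
Qed.

Lemma quenched_green t : (forall y, 0 < t y) -> green K t = green0 a nb t.
Proof.
move=> t0; pose Q := to_probability (prob_kernel (s := K) t).
exact: (integral_occupation_time (Q := Q) nb_order d_gt0 t0 (K_law t0)).
Qed.

Lemma pw_ge0 lam t s : 0 <= lam -> 0 <= pw lam t s.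
Proof. by move=> l0; apply: path_weight_ge0 => // *; exact: jump_rate_ge0. Qed.

Lemma annealed_path lam j (h : seq (site d) -> environment R d -> R) : 0 <= lam ->
  (forall s t, 0 <= h s t) -> (forall s, measurable_fun setT (h s)) ->
  (\int[annealed P K]_p (h (path_of p.2 j.+1) p.1 * expR (- (lam * jump_time p.2 j)))%:E =
   \sum_(s <- tails E 0%R j) \int[P]_t (pw lam t s * h (0%R :: s) t)%:E)%E.
Proof.
move=> l0 h0 mh.
have mg : measurable_fun setT (fun p : environment R d * trajectory R d =>
    (h (path_of p.2 j.+1) p.1 * expR (- (lam * jump_time p.2 j)))%:E : \bar R).
  apply/measurable_EFinP; apply: measurable_funM; first exact: measurable_fun_path.
  apply: measurableT_comp => //; apply: measurableT_comp => //.
  apply: measurable_funM => //.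
  exact: measurableT_comp (measurable_jump_time j) measurable_snd.
have g0 (p : environment R d * trajectory R d) :
    (0 <= (h (path_of p.2 j.+1) p.1 * expR (- (lam * jump_time p.2 j)))%:E)%E.
  by rewrite lee_fin mulr_ge0 ?expR_ge0.
have mpw s : measurable_fun setT (fun t => (pw lam t s * h (0 :: s) t)%:E : \bar R).
  apply/measurable_EFinP; apply: measurable_funM => //.
  exact: measurable_path_weight.
have pw0 s t : (0 <= (pw lam t s * h (0%R :: s) t)%:E)%E.
  by rewrite lee_fin mulr_ge0 // pw_ge0.
rewrite integral_annealed // -ge0_integral_sum //.
apply: ae_eq_integral => //.
- exact: (measurable_kernel_integral K (g := fun p => (h (path_of p.2 j.+1) p.1 * expR (- (lam * jump_time p.2 j)))%:E)).
- exact: emeasurable_sum.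
apply: filterS ae_positive => t t0 _.
by rewrite (quenched_path _ t0 l0 (h := h^~ t)) // sumEFin.
Qed.

End Walk.

(** * The number of sites discovered before the first trap *)

Section AtFirstTrap.
Context {R : realType} {d : nat}.
Variables (nb : seq (site d)).
Implicit Types (theta : R) (t : environment R d) (w : trajectory R d).
Implicit Types (D s : seq (site d)) (F : trajectory R d -> nat -> R).
Implicit Types (p : environment R d * trajectory R d).

(** At most one step discovers the first trap, so that the series has at most
    one nonzero term, and none if there is no trap to be discovered. *)
Definition at_first_trap theta D F p : \bar R :=
  (\sum_(0 <= j <oo) ((first_trap nb theta D p.1 (path_of p.2 j.+1))%:R * F p.2 j)%:E)%E.

Lemma path_ofS w j : path_of w j.+1 = rcons (path_of w j) (position w j).
Proof. by rewrite /path_of /mkseq -addn1 iotaD map_cat add0n cats1. Qed.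

Lemma first_trap_rcons theta D t s y : first_trap nb theta D t (rcons s y) =
  all (alive nb theta D t) s && ~~ alive nb theta D t y.
Proof.
case: s => [|x s] //=.
by rewrite belast_rcons last_rcons.
Qed.

Lemma past_rcons (s : seq (site d)) y : past (rcons s y) = s.
Proof. by case: s => [|x s] //=; rewrite belast_rcons. Qed.

Lemma past_path_of w j : past (path_of w j.+1) = path_of w j.
Proof. by rewrite path_ofS past_rcons. Qed.

Lemma first_trapE theta D t w j : first_trap nb theta D t (path_of w j.+1) =
  all (alive nb theta D t) (path_of w j) && ~~ alive nb theta D t (position w j).
Proof. by rewrite path_ofS first_trap_rcons. Qed.

Lemma all_path_of (A : pred (site d)) w j i : all A (path_of w j) -> (i < j)%N ->
  A (position w i).
Proof.
move=> /allP h ij; apply: h; apply/mapP; exists i => //.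
by rewrite mem_iota.
Qed.

Lemma first_trap_uniq theta D t w i j :
  first_trap nb theta D t (path_of w i.+1) -> first_trap nb theta D t (path_of w j.+1) ->
  i = j.
Proof.
have h m n : (m < n)%N -> first_trap nb theta D t (path_of w m.+1) ->
    ~~ first_trap nb theta D t (path_of w n.+1).
  rewrite !first_trapE => mn /andP[_ nm]; apply: contra nm => /andP[+ _].
  by move=> /all_path_of; exact.
move=> ti tj; case: (ltngtP i j) => // ij.
  by have := h _ _ ij ti; rewrite tj.
by have := h _ _ ij tj; rewrite ti.
Qed.

Lemma at_first_trapE theta D F p j :
  first_trap nb theta D p.1 (path_of p.2 j.+1) -> 0 <= F p.2 j ->
  at_first_trap theta D F p = (F p.2 j)%:E.
Proof.
move=> tj F0; have z k : k != j -> first_trap nb theta D p.1 (path_of p.2 k.+1) = false.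
  by move=> kj; apply/negP => tk; rewrite (first_trap_uniq tk tj) eqxx in kj.
rewrite /at_first_trap (nneseriesD1 (n := j)) //; last first.
  move=> k _; have [->|/z ->] := eqVneq k j; last by rewrite mul0r.
  by rewrite lee_fin mulr_ge0.
rewrite tj mul1r eseries0 ?adde0 // => k _ kj.
by rewrite (z k kj) mul0r.
Qed.

Lemma at_first_trap0 theta D F p :
  (forall j, ~~ first_trap nb theta D p.1 (path_of p.2 j.+1)) ->
  at_first_trap theta D F p = 0%E.
Proof.
by move=> h; rewrite /at_first_trap eseries0 // => j _ _; rewrite (negbTE (h j)) mul0r.
Qed.

Lemma at_first_trapP theta D F p : (forall j, 0 <= F p.2 j) ->
  (exists2 j, first_trap nb theta D p.1 (path_of p.2 j.+1) &
     at_first_trap theta D F p = (F p.2 j)%:E) \/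
  ((forall j, ~~ first_trap nb theta D p.1 (path_of p.2 j.+1)) /\
     at_first_trap theta D F p = 0%E).
Proof.
move=> F0; have [[j tj]|nt] := pselect (exists j, first_trap nb theta D p.1 (path_of p.2 j.+1)).
  by left; exists j => //; exact: at_first_trapE.
have nt' j : ~~ first_trap nb theta D p.1 (path_of p.2 j.+1).
  by apply/negP => tj; apply: nt; exists j.
by right; split => //; exact: at_first_trap0.
Qed.

Lemma at_first_trap_ge0 theta D F p : (forall j, 0 <= F p.2 j) ->
  (0 <= at_first_trap theta D F p)%E.
Proof.
by move=> F0; case: (at_first_trapP theta D F0) => [[j _ ->]|[_ ->]] //; rewrite lee_fin.
Qed.

Lemma at_first_trap_le1 theta D F p : (forall j, 0 <= F p.2 j <= 1) ->
  (at_first_trap theta D F p <= 1)%E.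
Proof.
move=> F01; have F0 j : 0 <= F p.2 j by have /andP[] := F01 j.
case: (at_first_trapP theta D F0) => [[j _ ->]|[_ ->]] //.
by rewrite lee_fin; have /andP[] := F01 j.
Qed.

Lemma measurable_at_first_trap theta D F : (forall w j, 0 <= F w j) ->
  (forall j, measurable_fun setT (F^~ j)) -> measurable_fun setT (at_first_trap theta D F).
Proof.
move=> F0 mF; apply: ge0_emeasurable_sum.
  by move=> j p _ _; rewrite lee_fin mulr_ge0.
move=> j _; apply/measurable_EFinP; apply: measurable_funM; last exact: (measurableT_comp (mF j) measurable_snd).
apply: (measurable_fun_path j.+1 (h := fun s t => ((first_trap nb theta D t s)%:R : R))).
by move=> s; apply: measurable_bool_natr; exact: measurable_first_trap.
Qed.

(** A discrete clock, in which each discovered site outside [D] costs a factor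
    [gamma]. As sites are discovered at a linear speed, it approximates [expR
    (- lam * time)] for a suitable [gamma]. *)
Definition discount (gamma : R) D : trajectory R d -> nat -> R :=
  fun w j => gamma ^+ size (cover nb D (path_of w j)).

Lemma discount01 gamma D w j : 0 <= gamma <= 1 -> 0 <= discount gamma D w j <= 1.
Proof.
by move=> /andP[g0 g1]; rewrite /discount exprn_ge0 //= exprn_ile1.
Qed.

Lemma measurable_discount gamma D j : measurable_fun setT ((discount gamma D)^~ j).
Proof. exact: (measurable_fun_path1 j (fun s => gamma ^+ size (cover nb D s))). Qed.

Lemma size_cover_exclude D s : (size (cover nb [::] s) <= size D + size (cover nb D s))%N.
Proof.
rewrite -size_cat; apply: uniq_leq_size; first by rewrite filter_uniq // undup_uniq.
move=> x; rewrite mem_cat !mem_filter => /andP[_ xs]; rewrite xs andbT.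
by case: (x \in D).
Qed.

Lemma discount_exclude gamma D w j : 0 < gamma <= 1 ->
  gamma ^+ size D * discount gamma D w j <= discount gamma [::] w j <= discount gamma D w j.
Proof.
move=> /andP[g0 g1]; rewrite /discount -exprD.
have sub : {subset cover nb D (path_of w j) <= cover nb [::] (path_of w j)}.
  by move=> x; rewrite !mem_filter => /andP[_ ->].
have le1 : (size (cover nb D (path_of w j)) <= size (cover nb [::] (path_of w j)))%N.
  by apply: uniq_leq_size => //; rewrite filter_uniq // undup_uniq.
have le2 := size_cover_exclude D (path_of w j).
by apply/andP; split; apply: ler_wiXn2l => //; exact: ltW.
Qed.

Lemma alive_exclude theta D t y : all (fun x => t x < theta) D ->
  alive nb theta D t y = alive nb theta [::] t y.
Proof.
move=> /allP h; apply: eq_all => x /=; case: (boolP (x \in D)) => // /h ->.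
by [].
Qed.

Lemma first_trap_exclude theta D t s : all (fun x => t x < theta) D ->
  first_trap nb theta D t s = first_trap nb theta [::] t s.
Proof.
move=> h; case: s => //= x s; rewrite alive_exclude //; congr (_ && _).
by apply: eq_all => y; exact: alive_exclude.
Qed.

(** When [D] carries no trap, ignoring it only changes the clock, by at most
    [size D] sites. *)
Lemma at_first_trap_exclude theta gamma D p : 0 < gamma <= 1 ->
  all (fun x => p.1 x < theta) D ->
  ((gamma ^+ size D)%:E * at_first_trap theta D (discount gamma D) p <=
   at_first_trap theta [::] (discount gamma [::]) p <=
   at_first_trap theta D (discount gamma D) p)%E.
Proof.
move=> /[dup] g01 /andP[g0 g1] h; have g01' : 0 <= gamma <= 1 by rewrite ltW.
have d0 D' j : 0 <= discount gamma D' p.2 j by have /andP[] := discount01 D' p.2 j g01'.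
have [[j tj ->]|[nt ->]] := at_first_trapP theta D (d0 D); last first.
  rewrite mule0 at_first_trap0 ?lexx // => j.
  by rewrite -(first_trap_exclude _ h).
rewrite (at_first_trapE (j := j)) //; last by rewrite -(first_trap_exclude _ h).
by rewrite -EFinM !lee_fin discount_exclude.
Qed.

End AtFirstTrap.

(** Elementary bounds comparing a geometric tail with its linear part. *)
Lemma bernoulli_upper {R : realType} (x : R) n : 0 <= x <= 1 -> 1 - (1 - x) ^+ n <= n%:R * x.
Proof.
move=> /andP[x0 x1]; elim: n => [|n IH]; first by rewrite subrr mul0r.
rewrite exprS -natr1 mulrDl mul1r.
have : 0 <= (1 - x) ^+ n <= 1 by rewrite exprn_ge0 ?subr_ge0 // exprn_ile1 ?subr_ge0 ?gerBl.
move=> /andP[e0 e1]; nra.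
Qed.

Lemma bernoulli_lower {R : realType} (x : R) n m : 0 <= x <= 1 -> (n <= m)%N ->
  n%:R * x * (1 - m%:R * x) <= 1 - (1 - x) ^+ n.
Proof.
move=> x01 nm; have /andP[x0 x1] := x01; elim: n nm => [|n IH] nm; first by rewrite !mul0r subrr.
rewrite exprS -natr1.
have := IH (ltnW nm); have := bernoulli_upper n x01.
have : n%:R + 1 <= m%:R :> R by rewrite natr1 ler_nat.
have : 0 <= n%:R :> R by [].
set e := (1 - x) ^+ n; set N : R := n%:R; set M : R := m%:R => N0 NM h1 h2.
nra.
Qed.

(** * The discovery of the first trap is geometric *)

Lemma prod_indic {R : realType} (T : Type) (s : seq T) (f : T -> R) (theta : R) :
  \prod_(x <- s) \1_(`]-oo, theta[%classic) (f x) = (all (fun x => f x < theta) s)%:R :> R.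
Proof.
elim: s => [|x s IH]; first by rewrite big_nil.
rewrite big_cons IH indicE mem_setE in_itv /=.
by case: (f x < theta) => /=; rewrite ?mul1r ?mul0r.
Qed.

Lemma path_weight_le1 {R : realType} {d : nat} (E : seq (site d)) (q : site d -> site d -> R)
  lam x n s : (forall y z, 0 <= q y z) -> 0 <= lam -> s \in tails E x n ->
  path_weight E q lam x s <= 1.
Proof.
move=> q0 l0; elim: n x s => [|n IH] x s; first by rewrite inE => /eqP ->.
move=> /flattenP[l /mapP[e eE ->]] /mapP[s' s'T ->] /=.
have st0 y z : 0 <= step E q lam y z by apply: step_ge0.
rewrite -[leRHS]mulr1 ler_pM // ?path_weight_ge0 ?IH //.
apply: le_trans (sum_step_le1 E q0 l0 x).
rewrite (big_rem e) //= lerDl; apply: sumr_ge0 => *; exact: st0.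
Qed.

Lemma integral_annealed_fst d1 d2 (T1 : measurableType d1) (T2 : measurableType d2)
    (R : realType) (P : probability T1 R) (K : R.-pker T1 ~> T2) (g : T1 -> \bar R) :
  (forall t, 0 <= g t)%E -> measurable_fun setT g ->
  (\int[annealed P K]_p g p.1 = \int[P]_t g t)%E.
Proof.
move=> g0 mg; rewrite (@integral_annealed _ _ _ _ _ P K (fun p => g p.1)) //.
  apply: eq_integral => t _; transitivity (\int[K t]_w cst (g t) w)%E => //.
  by rewrite integral_cst // prob_kernel mule1.
exact: (measurableT_comp mg measurable_fst).
Qed.

Lemma bounded_cvg {R : realType} dT (T : measurableType dT) (Q : probability T R)
    (f_ : nat -> T -> R) (f : T -> R) (B : R) :
  (forall n, measurable_fun setT (f_ n)) -> measurable_fun setT f ->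
  (forall n x, `|f_ n x| <= B) ->
  {ae Q, forall x, f_ n x @[n --> \oo] --> f x} ->
  (\int[Q]_x (f_ n x)%:E)%E @[n --> \oo] --> (\int[Q]_x (f x)%:E)%E.
Proof.
move=> mf_ mf fB cf.
have [] := @dominated_convergence _ _ _ Q setT measurableT (fun n x => (f_ n x)%:E)
  (fun x => (f x)%:E) (fun=> B%:E) => //.
- by move=> n; exact/measurable_EFinP.
- exact/measurable_EFinP.
- by apply: filterS cf => x cx _; apply: cvg_EFin => //; exact: nearW.
- exact: finite_measure_integrable_cst.
- by apply: aeW => x n _; rewrite lee_fin.
Qed.

(** If each site is a trap with probability [p], and each discovered site is
    penalised by a factor [gamma], then the first trap is found before the
    process dies with probability [p / (1 - (1 - p) * gamma)], up to corrections
    due to the sites being discovered in batches of at most [m]. *)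
Definition geometric_ratio {R : realType} (p gamma : R) := p / (1 - (1 - p) * gamma).

Definition lower_ratio {R : realType} m (p gamma : R) :=
  geometric_ratio p gamma * (1 - m%:R * p).

Definition upper_ratio {R : realType} m (p gamma : R) :=
  geometric_ratio p gamma / (1 - m%:R * (1 - (1 - p) * gamma)).

Section Batches.
Context {R : realType}.
Variables (p gamma : R) (m n : nat).
Hypothesis p01 : 0 <= p <= 1.
Hypothesis g01 : 0 <= gamma < 1.
Hypothesis nm : (n <= m)%N.
Local Notation pi := (1 - (1 - p) * gamma).

Lemma batch_death : [/\ 0 < pi, 0 <= pi <= 1, geometric_ratio p gamma * pi = p,
  0 <= geometric_ratio p gamma & gamma ^+ n * (1 - p) ^+ n = (1 - pi) ^+ n].
Proof.
have /andP[p0 p1] := p01; have /andP[g0 g1] := g01.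
have pi0 : 0 < pi by nra.
split => //; first by rewrite ltW //=; nra.
- by rewrite /geometric_ratio divfK // gt_eqF.
- by rewrite divr_ge0 // ltW.
- by rewrite -exprMn; congr (_ ^+ _); ring.
Qed.

(** A batch of [n] sites contains a trap with probability [1 - (1 - p) ^+ n],
    while trap or discount stop the process there with probability [1 - (1 -
    pi) ^+ n]. For small [p] and [pi] both are close to their linear parts,
    [n%:R * p] and [n%:R * pi]. *)
Lemma batch_lower : m%:R * p <= 1 ->
  lower_ratio m p gamma * (1 - gamma ^+ n * (1 - p) ^+ n) <= 1 - (1 - p) ^+ n.
Proof.
move=> mp; have [pi0 pi01 kE k0 ->] := batch_death.
apply: le_trans (bernoulli_lower p01 nm); rewrite /lower_ratio.
rewrite (_ : n%:R * p * _ = geometric_ratio p gamma * (1 - m%:R * p) * (n%:R * pi)).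
  by apply: ler_wpM2l (bernoulli_upper n pi01); rewrite mulr_ge0 // subr_ge0.
by rewrite -{1}kE; ring.
Qed.

Lemma batch_upper : m%:R * pi < 1 ->
  1 - (1 - p) ^+ n <= upper_ratio m p gamma * (1 - gamma ^+ n * (1 - p) ^+ n).
Proof.
move=> mpi; have [pi0 pi01 kE k0 ->] := batch_death.
have ku : upper_ratio m p gamma * (1 - m%:R * pi) = geometric_ratio p gamma.
  by rewrite /upper_ratio divfK // subr_eq0 eq_sym lt_eqF.
have ku0 : 0 <= upper_ratio m p gamma by rewrite divr_ge0 // subr_ge0 ltW.
apply: le_trans (bernoulli_upper n p01) _.
rewrite (_ : n%:R * p = upper_ratio m p gamma * (n%:R * pi * (1 - m%:R * pi))).
  by apply: ler_wpM2l => //; exact: bernoulli_lower.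
by rewrite -{1}kE -ku; ring.
Qed.

End Batches.

Section Geometric.
Context {R : realType} {d : nat}.
Variables (a : R) (nb : seq (site d)).
Hypothesis nb_order : ball_order nb.
Hypothesis d_gt0 : (0 < d)%N.
Variable P : probability (environment R d) R.
Hypothesis P_iid : iid_coordinates P.
Hypothesis P_ge1 : {ae P, forall t, 1 <= t 0}.
Variable K : R.-pker (environment R d) ~> (trajectory R d).
Hypothesis K_law : forall t : environment R d, (forall y, 0 < t y) ->
  ctmc_law (jump_rate a t) 0 (K t).
Implicit Types (theta gamma : R) (t : environment R d) (D s : seq (site d)).
Implicit Types (A : set (environment R d)).

Local Notation E := (steps nb).
Local Notation pw t s := (path_weight E (jump_rate a t) 0 0 s).

Definition trap_probability theta : R := fine (P [set t | theta <= t 0]).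

Lemma trap_probability01 theta : 0 <= trap_probability theta <= 1.
Proof.
have m : measurable [set t : environment R d | theta <= t 0].
  rewrite (_ : [set _ | _] = (fun t : environment R d => t 0) @^-1` `[theta, +oo[).
    by rewrite -[X in measurable X]setTI; exact: measurable_coordinate.
  by apply/seteqP; split => t /=; rewrite in_itv /= andbT.
rewrite /trap_probability fine_ge0 //= -lee_fin fineK ?fin_num_measure //.
exact: probability_le1.
Qed.

Lemma prob_no_trap theta :
  P [set t | `]-oo, theta[%classic (t 0%R)] = (1 - trap_probability theta)%:E.
Proof.
have m : measurable [set t : environment R d | theta <= t 0].
  rewrite (_ : [set _ | _] = (fun t : environment R d => t 0) @^-1` `[theta, +oo[).
    by rewrite -[X in measurable X]setTI; exact: measurable_coordinate.
  by apply/seteqP; split => t /=; rewrite in_itv /= andbT.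
rewrite (_ : [set t | _] = ~` [set t | theta <= t 0]).
  by rewrite probability_setC // EFinB fineK // fin_num_measure.
apply/seteqP; split => t /=; rewrite in_itv /=; first by rewrite ltNge => /negP.
by move=> /negP; rewrite -ltNge.
Qed.

Definition local_on D A := forall x t v, x \notin D -> A (set_coordinate x v t) <-> A t.

Variables (theta : R) (D : seq (site d)) (A : set (environment R d)).
Hypothesis mA : measurable A.
Hypothesis A_local : local_on D A.

Local Notation p := (trap_probability theta).

(** Given the path, the sites discovered by its last step are traps
    independently of the past. *)
Lemma integral_fresh j s : s \in tails E 0 j ->
  (\int[P]_t (pw t s * (\1_A t * (all (alive nb theta D t) (0 :: s))%:R))%:E =
   ((1 - p) ^+ size (fresh nb D (past (0 :: s)) (last 0 s)))%:E *
   \int[P]_t (pw t s * (\1_A t * (all (alive nb theta D t) (past (0 :: s)))%:R))%:E)%E.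
Proof.
move=> sT; rewrite EFin_expe -prob_no_trap.
rewrite -(integral_coordinates P_iid (uniq_fresh nb D (past (0 :: s)) (last 0 s))) //.
- apply: eq_integral => t _; rewrite -EFinM prod_indic lastI past_rcons all_alive_rcons /=.
  by congr EFin; rewrite -mulnb natrM; ring.
- apply/measurable_EFinP; apply: measurable_funM; first exact: measurable_path_weight.
  apply: measurable_funM; first exact: measurable_indic.
  by apply: measurable_bool_natr; exact: measurable_all_alive.
- by move=> t; rewrite lee_fin !mulr_ge0 // (pw_ge0 _ _ _ _ (lexx _)).
- move=> x t v; rewrite mem_filter => /andP[/andP[xD xs] _].
  rewrite (path_weight_local _ nb_order _ _ _ sT) // all_alive_local //.
  have -> // : \1_A (set_coordinate x v t) = \1_A t :> R.
  rewrite !indicE; congr (_ : bool)%:R; apply/idP/idP; rewrite !inE; exact: (A_local t v xD).1 || exact: (A_local t v xD).2.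
Qed.

Definition surviving (gamma : R) j : \bar R :=
  (\int[annealed P K]_q (\1_A q.1 * (all (alive nb theta D q.1) (path_of q.2 j))%:R *
     discount nb gamma D q.2 j)%:E)%E.

Definition trapped (gamma : R) j : \bar R :=
  (\int[annealed P K]_q (\1_A q.1 * ((first_trap nb theta D q.1 (path_of q.2 j.+1))%:R *
     discount nb gamma D q.2 j))%:E)%E.

(** Both quantities in terms of the probabilities [m s] of following the path
    [s] without meeting a trap before its last step. *)
Lemma surviving_paths gamma j : 0 <= gamma <= 1 -> exists m : seq (site d) -> R,
  let b s := size (cover nb D (past (0 :: s))) in
  let n s := size (fresh nb D (past (0 :: s)) (last 0 s)) in
  [/\ forall s, 0 <= m s,
   surviving gamma j = (\sum_(s <- tails E 0 j) gamma ^+ b s * m s)%:E,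
   surviving gamma j.+1 =
     (\sum_(s <- tails E 0 j) gamma ^+ (b s + n s) * ((1 - p) ^+ n s * m s))%:E &
   trapped gamma j =
     (\sum_(s <- tails E 0 j) gamma ^+ b s * ((1 - (1 - p) ^+ n s) * m s))%:E].
Proof.
move=> /andP[g0 g1].
pose f s t := pw t s * (\1_A t * (all (alive nb theta D t) (past (0 :: s)))%:R).
have mf s : measurable_fun setT (f s).
  apply: measurable_funM; first exact: measurable_path_weight.
  apply: measurable_funM; first exact: measurable_indic.
  by apply: measurable_bool_natr; exact: measurable_all_alive.
have f0 s t : 0 <= f s t by rewrite !mulr_ge0 // (pw_ge0 _ _ _ _ (lexx _)).
pose m s := fine (\int[P]_t (f s t)%:E).
have fin s : s \in tails E 0 j -> (\int[P]_t (f s t)%:E = (m s)%:E)%E.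
  move=> sT; rewrite fineK // ge0_fin_numE ?integral_ge0 // => [|t _]; last by rewrite lee_fin.
  apply: (@le_lt_trans _ _ (\int[P]_t (cst 1%:E t))%E); last first.
    by rewrite integral_cst // mul1e ltey_eq fin_num_measure.
  apply: ge0_le_integral => //.
  - by move=> t _; rewrite lee_fin.
  - exact/measurable_EFinP.
  move=> t _; rewrite lee_fin /f.
  have := path_weight_le1 (jump_rate_ge0 a t) (lexx 0) sT.
  have := pw_ge0 a nb t s (lexx 0).
  by rewrite indicE; case: (t \in A); case: (all _ _); rewrite ?mul0r ?mulr0 ?mulr1 ?mul1r ?ler01.
have g01 D' w i : 0 <= discount nb gamma D' w i by have /andP[] := discount01 nb D' w i (introT andP (conj g0 g1)).
have key (h : seq (site d) -> environment R d -> R) (e : seq (site d) -> R) :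
    (forall s t, 0 <= h s t) -> (forall s, measurable_fun setT (h s)) ->
    (forall s, s \in tails E 0 j -> (\int[P]_t (pw t s * h (0 :: s) t)%:E = (e s)%:E)%E) ->
    (\int[annealed P K]_q (h (path_of q.2 j.+1) q.1)%:E = (\sum_(s <- tails E 0 j) e s)%:E)%E.
  move=> h0 mh he; rewrite -[RHS]sumEFin.
  have -> : (\sum_(s <- tails E 0%R j) (e s)%:E =
      \sum_(s <- tails E 0%R j) \int[P]_t (pw t s * h (0%R :: s) t)%:E)%E.
    by rewrite !big_seq; apply: eq_bigr => s /he.
  rewrite -(annealed_path nb_order d_gt0 P_iid P_ge1 K_law j (lexx 0) h0 mh).
  by apply: eq_integral => q _; rewrite mul0r oppr0 expR0 mulr1.
have mall s : measurable_fun setT (fun t => (all (alive nb theta D t) s)%:R : R).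
  by apply: measurable_bool_natr; exact: measurable_all_alive.
have mIA : measurable_fun setT (\1_A : environment R d -> R) by exact: measurable_indic.
have sh (g x y z : R) : x * (y * z * g) = g * (x * (y * z)) by ring.
have sh' (g x y z : R) : x * (y * (z * g)) = g * (x * (y * z)) by ring.
exists m => b n; split.
- by move=> s; rewrite fine_ge0 // integral_ge0 // => t _; rewrite lee_fin.
- rewrite -(key (fun s t => \1_A t * (all (alive nb theta D t) (past s))%:R * gamma ^+ size (cover nb D (past s)))).
  + by apply: eq_integral => q _; rewrite past_path_of.
  + by move=> s t; rewrite !mulr_ge0 ?exprn_ge0.
  + by move=> s; apply: measurable_funM => //; exact: measurable_funM.
  move=> s sT; rewrite EFinM -fin // -ge0_integralZl_EFin ?exprn_ge0 //.
  + by apply: eq_integral => t _; rewrite -EFinM; congr EFin; exact: sh.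
  + by move=> t _; rewrite lee_fin.
  + exact/measurable_EFinP.
- rewrite -(key (fun s t => \1_A t * (all (alive nb theta D t) s)%:R * gamma ^+ size (cover nb D s))) //.
  + by move=> s t; rewrite !mulr_ge0 ?exprn_ge0.
  + by move=> s; apply: measurable_funM => //; exact: measurable_funM.
  move=> s sT; rewrite -size_cover_rcons [0 :: s]lastI past_rcons -lastI.
  transitivity ((gamma ^+ size (cover nb D (0 :: s)))%:E *
    \int[P]_t (pw t s * (\1_A t * (all (alive nb theta D t) (0%R :: s))%:R))%:E)%E.
    rewrite -ge0_integralZl_EFin ?exprn_ge0 //.
    + by apply: eq_integral => t _; rewrite -EFinM; congr EFin; exact: sh.
    + by move=> t _; rewrite lee_fin !mulr_ge0 // pw_ge0.
    + apply/measurable_EFinP; apply: measurable_funM; first exact: measurable_path_weight.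
      exact: measurable_funM.
  by rewrite (integral_fresh sT) (fin _ sT) -!EFinM.
- rewrite -(key (fun s t => \1_A t * ((first_trap nb theta D t s)%:R * gamma ^+ size (cover nb D (past s))))).
  + by apply: eq_integral => q _; rewrite past_path_of.
  + by move=> s t; rewrite !mulr_ge0 ?exprn_ge0.
  + move=> s; apply: measurable_funM => //; apply: measurable_funM => //.
    by apply: measurable_bool_natr; exact: measurable_first_trap.
  move=> s sT.
  pose r (B : environment R d -> bool) t := pw t s * (\1_A t * (B t)%:R).
  have mr B : measurable_fun setT B -> measurable_fun setT (fun t => (r B t)%:E).
    move=> mB; apply/measurable_EFinP; apply: measurable_funM; first exact: measurable_path_weight.
    by apply: measurable_funM => //; exact: measurable_bool_natr.
  have r0 B t : (0 <= (r B t)%:E)%E by rewrite lee_fin !mulr_ge0 // pw_ge0.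
  pose T t := first_trap nb theta D t (0 :: s).
  pose S t := all (alive nb theta D t) (0 :: s).
  have mT : measurable_fun setT T by exact: measurable_first_trap.
  have mS : measurable_fun setT S by exact: measurable_all_alive.
  (* If the past is free of traps, the last neighbourhood either contains one
     or does not. *)
  have TS : (\int[P]_t (r T t)%:E + \int[P]_t (r S t)%:E = (m s)%:E)%E.
    rewrite -ge0_integralD //; try by [exact: mr]; rewrite -fin //.
    apply: eq_integral => t _; rewrite -EFinD; congr EFin.
    rewrite /r /f /T /S lastI all_rcons past_rcons -lastI /first_trap.
    by case: (all _ _); case: (alive _ _ _ _); rewrite ?mulr0 ?mulr1 ?addr0 ?add0r.
  rewrite [X in (_ + X)%E](integral_fresh sT) (fin _ sT) -EFinM in TS.
  have TE : (\int[P]_t (r T t)%:E = ((1 - (1 - p) ^+ n s) * m s)%:E)%E.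
    by rewrite mulrBl mul1r EFinB -TS addeK.
  rewrite EFinM -TE -ge0_integralZl_EFin ?exprn_ge0 //; last exact: mr.
  by apply: eq_integral => t _; rewrite -EFinM; congr EFin; exact: sh'.
Qed.

(** [batch_lower] and [batch_upper] applied to each path separately. *)
Lemma trapped_bounds gamma j : 0 <= gamma < 1 -> (size nb)%:R * p <= 1 ->
  (size nb)%:R * (1 - (1 - p) * gamma) < 1 ->
  [/\ lower_ratio (size nb) p gamma * (fine (surviving gamma j) - fine (surviving gamma j.+1)) <=
       fine (trapped gamma j),
      fine (trapped gamma j) <=
       upper_ratio (size nb) p gamma * (fine (surviving gamma j) - fine (surviving gamma j.+1)) &
      0 <= fine (surviving gamma j)].
Proof.
move=> g01 mp mpi; have /andP[g0 g1] := g01.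
have [|m [m0 -> -> ->]] := @surviving_paths gamma j; first by rewrite g0 ltW.
have sh (g e q k x : R) : k * (g * x - g * e * (q * x)) = g * x * (k * (1 - e * q)) by ring.
have sh' (g q x : R) : g * ((1 - q) * x) = g * x * (1 - q) by ring.
have b0 s : 0 <= gamma ^+ size (cover nb D (past (0 :: s))) * m s.
  by rewrite mulr_ge0 ?exprn_ge0.
have sn s : (size (fresh nb D (past (0%R :: s)) (last 0%R s)) <= size nb)%N by exact: size_fresh.
rewrite /= -sumrB !mulr_sumr; split.
- apply: ler_sum => s _; rewrite exprD sh sh'; apply: ler_wpM2l; first exact: b0.
  exact: batch_lower (trap_probability01 theta) g01 (sn s) mp.
- apply: ler_sum => s _; rewrite exprD sh sh'; apply: ler_wpM2l; first exact: b0.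
  exact: batch_upper (trap_probability01 theta) g01 (sn s) mpi.
- by apply: sumr_ge0 => s _; exact: b0.
Qed.

Hypothesis cover_infty : {ae annealed P K, forall q, forall n, \forall j \near \oo,
  (n <= size (cover nb [::] (path_of q.2 j)))%N}.

Let m1A : measurable_fun setT (fun q : environment R d * trajectory R d => \1_A q.1 : R).
Proof. by apply: (measurableT_comp (f := (\1_A : environment R d -> R))); [exact: measurable_indic | exact: measurable_fst]. Qed.

(** The walk discovers infinitely many sites, so that the discount tends to
    [0]. *)
Lemma surviving_cvg0 gamma : 0 <= gamma < 1 -> fine (surviving gamma j) @[j --> \oo] --> (0 : R).
Proof.
move=> /andP[g0 g1]; have g01 : 0 <= gamma <= 1 by rewrite g0 ltW.
have d01 w j : 0 <= discount nb gamma D w j <= 1 by exact: discount01.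
have -> : (0 : R) = fine (\int[annealed P K]_q (0%R : R)%:E) by rewrite integral0.
apply: fine_cvg; rewrite fineK ?integral0 //.
rewrite [X in _ --> X](_ : _ = \int[annealed P K]_q (0%R : R)%:E)%E; last by rewrite integral0.
apply: (bounded_cvg (B := 1)) => //.
- move=> j; apply: measurable_funM; last exact: (measurableT_comp (measurable_discount nb gamma D j) measurable_snd).
  apply: measurable_funM => //.
  apply: (measurable_fun_path j (h := fun s t => ((all (alive nb theta D t) s)%:R : R))).
  by move=> s; apply: measurable_bool_natr; exact: measurable_all_alive.
- move=> j q; have /andP[e0 e1] := d01 q.2 j.
  rewrite indicE; case: (q.1 \in A); case: (all _ _); rewrite ?mul1r ?mul0r ?normr0 ?ler01 //.
  by rewrite ger0_norm.
apply: filterS cover_infty => q cq.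
have g2 : gamma ^+ n @[n --> \oo] --> (0 : R) by apply: cvg_expr; rewrite ger0_norm.
apply/cvgr0Pnorm_lt => e e0.
have /cvgr0Pnorm_lt/(_ e e0)[N _ hN] := g2.
apply: filterS (cq (N + size D)%N) => j jN.
have /andP[e0' e1] := d01 q.2 j.
apply: le_lt_trans (hN (size (cover nb D (path_of q.2 j))) _); last first.
  by rewrite /= -(leq_add2r (size D)) (leq_trans jN) // addnC size_cover_exclude.
rewrite [leRHS]ger0_norm ?exprn_ge0 //.
rewrite indicE; case: (q.1 \in A); case: (all _ _); rewrite ?mul1r ?mul0r ?normr0 ?exprn_ge0 //.
by rewrite ger0_norm.
Qed.

(** Summing [trapped_bounds] over [j] telescopes to the initial value of
    [surviving], which is [P A]. So the event [A] enters only through its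
    probability. *)
Lemma at_first_trap_bounds gamma : 0 <= gamma < 1 -> (size nb)%:R * p <= 1 ->
  (size nb)%:R * (1 - (1 - p) * gamma) < 1 ->
  ((lower_ratio (size nb) p gamma)%:E * P A <=
   \int[annealed P K]_q ((\1_A q.1)%:E * at_first_trap nb theta D (discount nb gamma D) q)
   <= (upper_ratio (size nb) p gamma)%:E * P A)%E.
Proof.
move=> g01 mp mpi; have /andP[g0 g1] := g01.
have g01' : 0 <= gamma <= 1 by rewrite g0 ltW.
have d01 w j : 0 <= discount nb gamma D w j <= 1 by exact: discount01.
have -> : (\int[annealed P K]_q ((\1_A q.1)%:E * at_first_trap nb theta D (discount nb gamma D) q) =
    \sum_(0 <= j <oo) trapped gamma j)%E.
  rewrite -integral_nneseries //.
  + apply: eq_integral => q _; rewrite /at_first_trap -nneseriesZl //.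
    by move=> j _; rewrite lee_fin mulr_ge0 //; have /andP[] := d01 q.2 j.
  + move=> j; apply/measurable_EFinP; apply: measurable_funM => //.
    apply: measurable_funM; last exact: (measurableT_comp (measurable_discount nb gamma D j) measurable_snd).
    apply: (measurable_fun_path j.+1 (h := fun s t => ((first_trap nb theta D t s)%:R : R))).
    by move=> s; apply: measurable_bool_natr; exact: measurable_first_trap.
  + by move=> j q _; rewrite lee_fin !mulr_ge0 //; have /andP[] := d01 q.2 j.
have fin j : trapped gamma j = (fine (trapped gamma j))%:E.
  by have [m [_ _ _ ->]] := surviving_paths j g01'.
pose M j := fine (surviving gamma j).
have S0 : (M 0)%:E = P A.
  rewrite /M -[RHS]fineK ?fin_num_measure //; congr (fine _)%:E.
  rewrite -[A in P A]setIT -(integral_indic P measurableT mA).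
  rewrite -(integral_annealed_fst P K (g := fun t => (\1_A t)%:E)) //; last first.
    by apply/measurable_EFinP; exact: measurable_indic.
  apply: eq_integral => q _.
  by rewrite /discount /path_of /mkseq /= !mulr1.
have part N : \sum_(0 <= j < N) (M j - M j.+1) = M 0 - M N.
  rewrite (telescope_sumr_eq (fun j => - M j)) // => [|i _]; first by rewrite opprK addrC.
  by rewrite opprK addrC.
have tb j := trapped_bounds j g01 mp mpi.
have sumE N : (\sum_(0 <= j < N) trapped gamma j =
    (\sum_(0 <= j < N) fine (trapped gamma j))%:E)%E.
  by rewrite -sumEFin; apply: eq_bigr => j _; exact: fin.
have cv : (\sum_(0 <= j < N) trapped gamma j)%E @[N --> \oo] -->
    (\sum_(0 <= j <oo) trapped gamma j)%E.
  by apply: is_cvg_nneseries => j _ _; rewrite fin lee_fin fine_ge0 // integral_ge0 // => q _;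
     rewrite lee_fin !mulr_ge0 //; have /andP[] := d01 q.2 j.
have cM c : (c * (M 0 - M N))%:E @[N --> \oo] --> (c%:E * P A)%E.
  rewrite -S0 -EFinM; apply: cvg_EFin; first exact: nearW.
  rewrite -[X in _ --> c * X]subr0; apply: cvgMr; apply: cvgB; first exact: cvg_cst.
  exact: surviving_cvg0.
apply/andP; split.
  apply: (lee_cvg_to (cM (lower_ratio (size nb) p gamma)) cv).
  apply: nearW => N; rewrite sumE lee_fin -part mulr_sumr.
  by apply: ler_sum => j _; have [] := tb j.
apply: (lee_cvg_to cv (cM (upper_ratio (size nb) p gamma))).
apply: nearW => N; rewrite sumE lee_fin -part mulr_sumr.
by apply: ler_sum => j _; have [] := tb j.
Qed.

End Geometric.

(** * Discovery at linear speed *)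

Lemma counting_uniq {R : realType} (T : choiceType) (s : seq T) : uniq s ->
  (counting [set` s] = (size s)%:R%:E :> \bar R)%E.
Proof.
move=> us; rewrite /counting; case: asboolP => [fs|]; last by move/(_ (finite_seq s)).
congr (_%:R%:E); apply: perm_size; apply: uniq_perm => // x.
by rewrite in_fset_set // mem_setE.
Qed.

Lemma le_counting {R : realType} (T : choiceType) (A B : set T) : A `<=` B ->
  (counting A <= counting B :> \bar R)%E.
Proof.
move=> AB; rewrite /counting; case: asboolP => fA; case: asboolP => fB.
- rewrite lee_fin ler_nat; apply: uniq_leq_size; first exact: fset_uniq.
  move=> x; by rewrite !in_fset_set // => /set_mem/AB/mem_set.
- by rewrite leey.
- by exfalso; apply: fA; exact: sub_finite_set fB.
- by [].
Qed.

(** A relative error [e] in the exponent is harmless however large [x] is,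
    since [x * expR (- x) <= 1]. *)
Lemma expR_ratio {R : realType} (x y e : R) : 0 <= x -> 0 <= e ->
  `|x - y| <= e * x -> e <= 2^-1 ->
  `|expR (- x) - expR (- y)| <= 2 * e.
Proof.
move=> x0 ep; rewrite ler_norml => /andP[h1 h2] e2.
have ub (u : R) : u * expR (- u) <= 1.
  rewrite expRN ler_pdivrMr ?expR_gt0 // mul1r.
  by apply: le_trans (expR_ge1Dx u); rewrite lerDr.
have main (u v : R) : u <= v -> 0 <= expR (- u) - expR (- v) <= (v - u) * expR (- u).
  move=> uv; rewrite subr_ge0 ler_expR lerN2 uv /=.
  have := expR_ge1Dx (u - v); have -> : expR (- v) = expR (- u) * expR (u - v).
    by rewrite -expRD addrA addNr add0r.
  have := expR_gt0 (- u); set E := expR (- u) => E0 h.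
  have : E * (1 + (u - v)) <= E * expR (u - v) by rewrite ler_wpM2l // ltW.
  by rewrite mulrDr mulr1 => ?; nra.
have e0 : 0 <= e * x by have := normr_ge0 (x - y); move: h1 h2; lra.
case: (leP x y) => xy.
  have /andP[m1 m2] := main _ _ xy; rewrite ger0_norm //.
  have ux := ub x; have E0 := expR_gt0 (- x); set E := expR (- x) in m2 ux E0 *.
  have : (y - x) * E <= e * x * E by apply: ler_wpM2r; [exact: ltW | lra].
  by move=> m3; have m4 := ler_wpM2l ep ux; lra.
have /andP[m1 m2] := main _ _ (ltW xy); rewrite distrC ger0_norm //.
have uy := ub y; have E0 := expR_gt0 (- y); set E := expR (- y) in m2 uy E0 *.
have xy2 : x <= 2 * y by nra.
have : (x - y) * E <= e * (2 * y) * E by apply: ler_wpM2r; [exact: ltW | nra].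
by move=> m3; have m4 := ler_wpM2l ep uy; lra.
Qed.

Section Speed.
Context {R : realType} {d : nat}.
Variables (nb : seq (site d)) (c : R) (w : trajectory R d).
Hypothesis nb_order : ball_order nb.
Hypothesis c_gt0 : 0 < c.
Hypothesis w_increasing : increasing_times w.
Hypothesis speed : (discovered w t * (t^-1)%:E)%E @[t --> +oo] --> c%:E.

Local Notation J := (jump_time w).
Local Notation C j := (size (cover nb [::] (path_of w j))).

Lemma mem_cover_path x j : (x \in cover nb [::] (path_of w j)) <->
  exists2 i, (i < j)%N & (l1norm (position w i - x)%R <= 1)%N.
Proof.
rewrite mem_filter mem_undup /=; split.
  move=> /flattenP[l /mapP[y /mapP[i]]]; rewrite mem_iota add0n => /= ij -> ->.
  by rewrite (mem_around nb_order) l1normB => h; exists i.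
move=> [i ij h]; apply/flattenP; exists (around nb (position w i)).
  by apply/mapP; exists (position w i) => //; apply/mapP; exists i; rewrite ?mem_iota.
by rewrite (mem_around nb_order) l1normB.
Qed.

Lemma jump_time_lt m n : J m < J n -> (m < n)%N.
Proof. by move=> mn; rewrite ltnNge; apply/negP => /(le_jump_time w_increasing); rewrite leNgt mn. Qed.

(** Together with the next lemma: the count [C j] of the sites around the
    first [j] positions lies between the values of [discovered] before and at
    the time [J j]. *)
Lemma discovered_le t j : t < J j -> (discovered w t <= (C j)%:R%:E)%E.
Proof.
move=> tj; rewrite -counting_uniq ?filter_uniq ?undup_uniq //.
apply: le_counting => x [s [y [/andP[s0 st] [[n [/andP[ns _] <-]] yx]]]].
apply/mem_cover_path; exists n => //.
by apply: jump_time_lt; exact: le_lt_trans (le_trans ns st) tj.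
Qed.

Lemma le_discovered j : ((C j)%:R%:E <= discovered w (J j))%E.
Proof.
rewrite -counting_uniq ?filter_uniq ?undup_uniq //.
apply: le_counting => x /mem_cover_path[i ij yx].
exists (J i), (position w i); split.
  by rewrite jump_time_ge0 //= le_jump_time // ltnW.
by split => //; exists i; rewrite lexx jump_timeS ltrDl w_increasing.
Qed.

Lemma discovered_linear e : 0 < e -> exists2 T, 0 < T & forall t, T <= t ->
  exists2 v, discovered w t = v%:E & `|v - c * t| <= e * t.
Proof.
move=> e0; have /fine_cvgP[hf /cvgrPdist_le/(_ e e0) hc] := speed.
have [T0 [_ hT]] : exists T0, T0 \is Num.real /\ forall t, T0 < t ->
    (discovered w t * (t^-1)%:E)%E \is a fin_num /\
    `|c - fine (discovered w t * (t^-1)%:E)%E| <= e.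
  by case: hf => A [A0 hA]; case: hc => B [B0 hB]; exists (Num.max A B); rewrite num_real;
     split => // t; rewrite gt_max => /andP[At Bt]; split; [exact: hA | exact: hB].
exists (Num.max 1 (T0 + 1)); first by rewrite lt_max ltr01.
move=> t; rewrite ge_max => /andP[t1 tT]; have t0 : 0 < t by exact: lt_le_trans t1.
have [] : (discovered w t * (t^-1)%:E)%E \is a fin_num /\
    `|c - fine (discovered w t * (t^-1)%:E)%E| <= e by apply: hT; rewrite (lt_le_trans _ tT) // ltrDl.
have ti : 0 < t^-1 by rewrite invr_gt0.
case: (discovered w t) => [v|/=|/=].
- rewrite -EFinM /= => _ h; exists v => //.
  rewrite (_ : v - c * t = - ((c - v / t) * t)); last by rewrite mulrBl divfK ?gt_eqF // opprB.
  by rewrite normrN normrM (gtr0_norm t0) ler_wpM2r // ltW.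
- by rewrite gt0_mulye ?lte_fin.
- by rewrite gt0_mulNye ?lte_fin.
Qed.

(** The walk cannot explode, since it keeps discovering sites at a finite
    positive rate. *)
Lemma jump_time_infty M : \forall j \near \oo, M <= J j.
Proof.
have [j hj] : exists j, M <= J j.
  apply: contrapT => nj; have lt j : J j < M by rewrite ltNge; apply/negP => h; apply: nj; exists j.
  have [T T0 hT] := discovered_linear (divr_gt0 c_gt0 (ltr0Sn R 1)).
  pose t := Num.max T M.
  (* If all the jumps took place before [M], nothing would be discovered
     later. *)
  have same s : M <= s -> discovered w s = discovered w M.
    move=> Ms; congr counting; apply/seteqP; split => x [u [y [/andP[u0 us] [hs yx]]]].
      exists u, y; split => //; rewrite u0 /=; case: hs => n [/andP[_ un] _].
      exact: ltW (lt_trans un (lt n.+1)).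
    by exists u, y; split => //; rewrite u0 (le_trans us).
  have tT : T <= t by rewrite le_max lexx.
  have tM : M <= t by rewrite le_max lexx orbT.
  have t0 : 0 < t by exact: lt_le_trans tT.
  have [v ve] := hT t tT; rewrite ler_norml => /andP[_ v2].
  have [|u ue] := hT (4 * t); first by rewrite (le_trans tT) //; lra.
  rewrite ler_norml => /andP[u1 _].
  have uv : v = u by apply/EFin_inj; rewrite -ve -ue same // same // (le_trans tM) //; lra.
  have ct : 0 < c * t by rewrite mulr_gt0.
  by rewrite uv in v2; lra.
exists j => // i /= ji; exact: le_trans hj (le_jump_time w_increasing ji).
Qed.

(** Squeeze [C j] between the values of [discovered] at the times [(1 - h) * J
    j] and [J j]. *)
Lemma cover_linear e : 0 < e -> \forall j \near \oo, `|(C j)%:R - c * J j| <= e * J j.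
Proof.
move=> e0; have e2 : 0 < e / 2 by rewrite divr_gt0.
have [T T0 hT] := discovered_linear e2.
pose h := Num.min 2^-1 (e / (2 * c)).
have h0 : 0 < h by rewrite lt_min invr_gt0 ltr0Sn /= divr_gt0 ?mulr_gt0.
have h2 : h <= 2^-1 by rewrite ge_min lexx.
have hc : h * c <= e / 2.
  rewrite -ler_pdivlMr // (_ : e / 2 / c = e / (2 * c)); last by rewrite invfM mulrA.
  by rewrite ge_min lexx orbT.
apply: filterS (jump_time_infty (2 * T)) => j jT.
have J0 : 0 < J j by rewrite (lt_le_trans _ jT) // mulr_gt0.
have [v ve] : exists2 v, discovered w (J j) = v%:E & `|v - c * J j| <= e / 2 * J j by apply: hT; lra.
rewrite ler_norml => /andP[v1 v2].
have [u ue] : exists2 u, discovered w ((1 - h) * J j) = u%:E & `|u - c * ((1 - h) * J j)| <= e / 2 * ((1 - h) * J j).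
  by apply: hT; nra.
rewrite ler_norml => /andP[u1 u2].
have := le_discovered j; rewrite ve lee_fin => Cv.
have : (discovered w ((1 - h) * J j) <= (C j)%:R%:E)%E by apply: discovered_le; nra.
rewrite ue lee_fin => uC.
rewrite ler_norml; apply/andP; split; last by nra.
have : u >= c * ((1 - h) * J j) - e / 2 * ((1 - h) * J j) by lra.
move=> uu; have : h * c * J j <= e / 2 * J j by rewrite ler_wpM2r // ltW.
have : 0 <= e / 2 * (h * J j) by rewrite !mulr_ge0 // ltW.
by nra.
Qed.

Lemma cover_infty n : \forall j \near \oo, (n <= C j)%N.
Proof.
have c2 : 0 < c / 2 by rewrite divr_gt0.
near=> j; rewrite -(ler_nat R).
have J1 : n%:R / (c / 2) <= J j by near: j; exact: jump_time_infty.
have : `|(C j)%:R - c * J j| <= c / 2 * J j by near: j; exact: cover_linear.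
rewrite ler_norml => /andP[h _].
by rewrite ler_pdivrMr // in J1; lra.
Unshelve. all: by end_near.
Qed.

End Speed.

(** * The Laplace transform of the discovery time of the first trap *)

Section LaplaceTransform.
Context {R : realType} {d : nat}.
Variables (a : R) (nb : seq (site d)) (c : R).
Hypothesis nb_order : ball_order nb.
Hypothesis d_gt0 : (0 < d)%N.
Hypothesis c_gt0 : 0 < c.
Variable P : probability (environment R d) R.
Hypothesis P_iid : iid_coordinates P.
Hypothesis P_ge1 : {ae P, forall t, 1 <= t 0}.
Variable K : R.-pker (environment R d) ~> (trajectory R d).
Hypothesis K_law : forall t : environment R d, (forall y, 0 < t y) ->
  ctmc_law (jump_rate a t) 0 (K t).
Hypothesis c_speed : {ae annealed P K, forall p,
  (discovered p.2 t * (t^-1)%:E)%E @[t --> +oo] --> c%:E}.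
Variable theta : nat -> R.
Hypothesis theta_infty : theta k @[k --> \oo] --> +oo.
Local Notation p k := (trap_probability P (theta k)).
Hypothesis p_gt0 : forall k, 0 < p k.
Hypothesis p_cvg0 : p k @[k --> \oo] --> 0.
Variable s : R.
Hypothesis s_gt0 : 0 < s.
Implicit Types (q : environment R d * trajectory R d) (D : seq (site d)).

Definition laplace_rate k := s * p k.

(** The random variable whose mean is the Laplace transform of the time when the
    first trap is discovered. The absolute value keeps it in [[0, 1]] on the null
    set of trajectories with negative jump times. *)
Definition trap_laplace k q : R :=
  fine (at_first_trap nb (theta k) [::] (fun w j => expR (- (laplace_rate k * `|jump_time w j|))) q).

Let gam k := expR (- (laplace_rate k / c)).

(** The approximation of [trap_laplace] by the number of discovered sites. *)
Definition trap_discount D k q : R :=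
  fine (at_first_trap nb (theta k) D (discount nb (gam k) D) q).

Lemma ae_increasing : {ae annealed P K, forall q, increasing_times q.2}.
Proof.
pose B := [set q : environment R d * trajectory R d | increasing_times q.2].
have mB : measurable B.
  rewrite (_ : B = \bigcap_n [set q | 0 < holding_time q.2 n]).
    apply: bigcapT_measurable => n.
    rewrite (_ : [set _ | _] = (fun q : environment R d * trajectory R d => holding_time q.2 n) @^-1` `]0, +oo[).
      rewrite -[X in measurable X]setTI.
      exact: (measurableT_comp (measurable_holding_time n) measurable_snd).
    by apply/seteqP; split => q /=; rewrite in_itv /= andbT.
  by apply/seteqP; split => q h n; [move=> _; exact: (h n) | exact: (h n I)].
apply: (ae_annealed mB); apply: filterS (ae_positive P_iid P_ge1) => t t0.
have := quenched_regular nb_order d_gt0 K_law t0.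
by apply: filterS => w h n; have [] := h n.
Qed.

Lemma near_all_alive t (l : seq (site d)) :
  \forall k \near \oo, all (alive nb (theta k) [::] t) l.
Proof.
have below (l' : seq (site d)) : \forall k \near \oo, all (fun x => t x < theta k) l'.
  elim: l' => [|x l' IH] /=; first exact: nearW.
  have /cvgryPgt/(_ (t x)) := theta_infty.
  by apply: filterS2 IH => k -> ->.
elim: l => [|y l IH] /=; first exact: nearW.
apply: filterS2 IH (below (around nb y)) => k -> h; rewrite andbT.
by apply: sub_all h => x ->; rewrite orbT.
Qed.

Lemma laplace_rate_ge0 k : 0 <= laplace_rate k.
Proof. by rewrite mulr_ge0 // ltW. Qed.

Lemma gam01 k : 0 < gam k <= 1.
Proof.
by rewrite expR_gt0 /= -expR0 ler_expR oppr_le0 divr_ge0 ?laplace_rate_ge0 // ltW.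
Qed.

Lemma trap_laplaceE k q j : first_trap nb (theta k) [::] q.1 (path_of q.2 j.+1) ->
  trap_laplace k q = expR (- (laplace_rate k * `|jump_time q.2 j|)).
Proof. by move=> tj; rewrite /trap_laplace (at_first_trapE tj) // expR_ge0. Qed.

Lemma trap_discountE D k q j : first_trap nb (theta k) D q.1 (path_of q.2 j.+1) ->
  trap_discount D k q = discount nb (gam k) D q.2 j.
Proof.
by move=> tj; rewrite /trap_discount (at_first_trapE tj) // exprn_ge0 // expR_ge0.
Qed.

Lemma trap_laplace0 k q : (forall j, ~~ first_trap nb (theta k) [::] q.1 (path_of q.2 j.+1)) ->
  trap_laplace k q = 0.
Proof. by move=> nt; rewrite /trap_laplace at_first_trap0. Qed.

Lemma trap_discount0 D k q : (forall j, ~~ first_trap nb (theta k) D q.1 (path_of q.2 j.+1)) ->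
  trap_discount D k q = 0.
Proof. by move=> nt; rewrite /trap_discount at_first_trap0. Qed.

(** The first of many traps is met late, when the number of discovered sites is
    close to the elapsed time multiplied by [c]. *)
Lemma laplace_gap q : increasing_times q.2 ->
  (discovered q.2 t * (t^-1)%:E)%E @[t --> +oo] --> c%:E ->
  trap_laplace k q - trap_discount [::] k q @[k --> \oo] --> 0.
Proof.
move=> wi sp; apply/cvgr0Pnorm_le => e e0.
pose h := Num.min 2^-1 (e / 2).
have h0 : 0 < h by rewrite lt_min invr_gt0 ltr0Sn /= divr_gt0.
have h2 : h <= 2^-1 by rewrite ge_min lexx.
have he : h <= e / 2 by rewrite ge_min lexx orbT.
have [j0 _ hj0] := cover_linear nb_order c_gt0 wi sp (mulr_gt0 c_gt0 h0).
apply: filterS (near_all_alive q.1 (path_of q.2 j0)) => k al.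
have [[j tj]|nt] := pselect (exists j, first_trap nb (theta k) [::] q.1 (path_of q.2 j.+1)); last first.
  have nt' j : ~~ first_trap nb (theta k) [::] q.1 (path_of q.2 j.+1).
    by apply/negP => tj; apply: nt; exists j.
  by rewrite trap_laplace0 // trap_discount0 // subrr normr0 ltW.
have jj : (j0 <= j)%N.
  rewrite leqNgt; apply/negP => jj; move: tj; rewrite first_trapE => /andP[_ /negP]; apply.
  exact: all_path_of al jj.
rewrite (trap_laplaceE tj) (trap_discountE tj) (ger0_norm (jump_time_ge0 _ wi)) /discount /gam -expRM_natl.
have -> : (size (cover nb [::] (path_of q.2 j)))%:R * - (laplace_rate k / c) =
  - (laplace_rate k / c * (size (cover nb [::] (path_of q.2 j)))%:R) by rewrite mulrN mulrC.
apply: le_trans (_ : 2 * h <= e); last by lra.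
apply: expR_ratio => //; [by rewrite mulr_ge0 ?laplace_rate_ge0 // jump_time_ge0 | exact: ltW |].
have := hj0 j jj; set C : R := (size _)%:R => hC.
have -> : laplace_rate k * jump_time q.2 j - laplace_rate k / c * C =
    - (laplace_rate k / c * (C - c * jump_time q.2 j)).
  by rewrite mulrBr mulrA divfK ?gt_eqF // opprB.
have lc : 0 <= laplace_rate k / c by rewrite divr_ge0 ?laplace_rate_ge0 // ltW.
rewrite normrN normrM (ger0_norm lc); apply: le_trans (ler_wpM2l lc hC) _.
have sh (l u : R) : l / c * (c * h * u) = h * (l * u) by field; rewrite gt_eqF.
by rewrite sh.
Qed.

End LaplaceTransform.

(** * Asymptotic independence from a generating family of events *)

Section Rintegrals.
Context dT (T : measurableType dT) (R : realType) (Q : probability T R).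
Implicit Types (f g : T -> R) (B : R).

Lemma bounded_integrable f B : measurable_fun setT f -> (forall x, `|f x| <= B) ->
  Q.-integrable setT (EFin \o f).
Proof.
move=> mf fB; apply: (le_integrable measurableT (g := cst B%:E)); last exact: finite_measure_integrable_cst.
  exact/measurable_EFinP.
by move=> x _; rewrite lee_fin (le_trans (fB x)) // ler_norm.
Qed.

Lemma bounded_Rcvg (f_ : nat -> T -> R) f B :
  (forall n, measurable_fun setT (f_ n)) -> measurable_fun setT f ->
  (forall n x, `|f_ n x| <= B) -> (forall x, `|f x| <= B) ->
  {ae Q, forall x, f_ n x @[n --> \oo] --> f x} ->
  \int[Q]_x f_ n x @[n --> \oo] --> \int[Q]_x f x.
Proof.
move=> mf_ mf fB fB' cf; apply: fine_cvg.
rewrite fineK; first exact: (bounded_cvg (B := B)).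
exact: integrable_fin_num (bounded_integrable mf fB').
Qed.

End Rintegrals.

Lemma near_bounded_Rcvg dT (T : measurableType dT) (R : realType) (Q : probability T R)
    (f_ : nat -> T -> R) (f : T -> R) (B : R) :
  (forall n, measurable_fun setT (f_ n)) -> measurable_fun setT f ->
  (\forall n \near \oo, forall x, `|f_ n x| <= B) -> (forall x, `|f x| <= B) ->
  {ae Q, forall x, f_ n x @[n --> \oo] --> f x} ->
  \int[Q]_x f_ n x @[n --> \oo] --> \int[Q]_x f x.
Proof.
move=> mf_ mf [N _ hN] fB cf.
rewrite -(cvg_shiftn N); apply: (bounded_Rcvg (B := B)) => //.
- by move=> n x; apply: hN; rewrite /= leq_addl.
by apply: filterS cf => x; rewrite -(cvg_shiftn N).
Qed.

Section Mixing.
Context dT (T : measurableType dT) (R : realType) (Q : probability T R).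
Variables (X : nat -> T -> R) (kappa : R).
Hypothesis mX : forall k, measurable_fun setT (X k).
Hypothesis X01 : forall k x, 0 <= X k x <= 1.
Hypothesis kappa01 : 0 <= kappa <= 1.
Implicit Types (F G : T -> R) (B : R).

(** [X k] behaves in the limit as a variable of mean [kappa] independent of [F]. *)
Definition decouples F :=
  \int[Q]_x (F x * X k x) @[k --> \oo] --> kappa * \int[Q]_x F x.

Let int F B (mF : measurable_fun setT F) (FB : forall x, `|F x| <= B) k :
  Q.-integrable setT (EFin \o (fun x => F x * X k x)).
Proof.
apply: (bounded_integrable Q (B := B)); first exact: measurable_funM.
move=> x; have /andP[x0 x1] := X01 k x; rewrite normrM (ger0_norm x0).
by rewrite (le_trans _ (FB x)) // ler_piMr.
Qed.

Lemma decouplesD F G B : measurable_fun setT F -> measurable_fun setT G ->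
  (forall x, `|F x| <= B) -> (forall x, `|G x| <= B) ->
  decouples F -> decouples G -> decouples (fun x => F x + G x).
Proof.
move=> mF mG FB GB hF hG; rewrite /decouples RintegralD //; try exact: bounded_integrable.
rewrite mulrDr; apply: cvg_trans (cvgD hF hG); apply: near_eq_cvg.
apply: nearW => k; rewrite -[LHS]RintegralD //; try exact: (int _ FB); try exact: (int _ GB).
by apply: eq_Rintegral => x _; rewrite mulrDl.
Qed.

Lemma decouplesZ F B r : measurable_fun setT F -> (forall x, `|F x| <= B) ->
  decouples F -> decouples (fun x => r * F x).
Proof.
move=> mF FB hF; rewrite /decouples RintegralZl //; last exact: (bounded_integrable Q mF FB).
rewrite mulrCA.
have h : r * \int[Q]_x (F x * X k x) @[k --> \oo] --> r * (kappa * \int[Q]_x F x) by exact: cvgMr hF.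
apply: cvg_trans h; apply: near_eq_cvg.
apply: nearW => k; rewrite -[LHS]RintegralZl //; last exact: (int mF FB).
by apply: eq_Rintegral => x _; rewrite mulrA.
Qed.

(** Since [X k] lies in [[0, 1]], replacing [F] by [F_ n] costs the same in
    mean for all [k]. *)
Lemma decouples_lim (F_ : nat -> T -> R) F B : (forall n, measurable_fun setT (F_ n)) ->
  measurable_fun setT F -> (forall n x, `|F_ n x| <= B) -> (forall x, `|F x| <= B) ->
  (forall x, F_ n x @[n --> \oo] --> F x) -> (forall n, decouples (F_ n)) -> decouples F.
Proof.
move=> mF_ mF FB_ FB cF hF; apply/cvgrPdist_le => e e0.
have mD n : measurable_fun setT (fun x => F x - F_ n x) by exact: measurable_funB.
have DB n x : `|F x - F_ n x| <= B + B by rewrite (le_trans (ler_normB _ _)) // lerD.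
have iD n := bounded_integrable Q (mD n) (DB n).
have mN n : measurable_fun setT (fun x => `|F x - F_ n x|) by exact: measurableT_comp.
have c0 : \int[Q]_x `|F x - F_ n x| @[n --> \oo] --> (0 : R).
  rewrite -[X in _ --> X](_ : \int[Q]_x (cst 0 x) = 0); last by rewrite Rintegral_cst // mul0r.
  apply: (bounded_Rcvg (B := B + B)) => //.
  - by move=> n x; rewrite normr_id.
  - by move=> x; rewrite normr0 addr_ge0 // (le_trans _ (FB x)).
  apply: aeW => x; rewrite -(normr0 R); apply: cvg_norm.
  rewrite -[X in _ --> X](subrr (F x)); apply: cvgB => //; exact: cvg_cst.
have e3 : 0 < e / 3 by rewrite divr_gt0.
have /cvgr0Pnorm_le/(_ _ e3)[n _ /(_ n (leqnn n)) hn] := c0.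
have n0 : 0 <= \int[Q]_x `|F x - F_ n x| by apply: Rintegral_ge0.
rewrite ger0_norm // in hn.
have /cvgrPdist_le/(_ _ e3) := hF n; apply: filterS => k hk.
have E1 : \int[Q]_x F x = \int[Q]_x F_ n x + \int[Q]_x (F x - F_ n x).
  rewrite -RintegralD //; last exact: (bounded_integrable Q (mF_ n) (FB_ n)).
  by apply: eq_Rintegral => x _; rewrite addrC subrK.
have E2 : \int[Q]_x (F x * X k x) = \int[Q]_x (F_ n x * X k x) + \int[Q]_x ((F x - F_ n x) * X k x).
  rewrite -RintegralD //; [|exact: (int (mF_ n) (FB_ n))|exact: (int (mD n) (DB n))].
  by apply: eq_Rintegral => x _; rewrite mulrBl addrC subrK.
have h1 : `|\int[Q]_x (F x - F_ n x)| <= e / 3 by rewrite (le_trans (le_normr_Rintegral _ _)).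
have h2 : `|\int[Q]_x ((F x - F_ n x) * X k x)| <= e / 3.
  apply: le_trans (le_normr_Rintegral _ (int (mD n) (DB n) k)) _ => //.
  apply: le_trans hn; apply: le_Rintegral => //.
  - apply: (bounded_integrable Q (B := B + B)).
      by apply: measurableT_comp => //; exact: measurable_funM.
    move=> x; have /andP[x0 x1] := X01 k x; rewrite normr_id normrM (ger0_norm x0).
    by rewrite (le_trans _ (DB n x)) // ler_piMr.
  - by apply: (bounded_integrable Q (B := B + B)) => // x; rewrite normr_id.
  by move=> x _; have /andP[x0 x1] := X01 k x; rewrite normrM (ger0_norm x0) ler_piMr.
have h3 : `|kappa * \int[Q]_x (F x - F_ n x)| <= e / 3.
  have /andP[k0 k1] := kappa01.
  by rewrite normrM (ger0_norm k0) (le_trans _ h1) // ler_piMl.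
rewrite E1 E2 mulrDr.
move: hk h2 h3; set a1 := kappa * _; set a2 := Rintegral _ _ _; set a3 := kappa * _; set a4 := Rintegral _ _ _.
by rewrite !ler_norml => /andP[? ?] /andP[? ?] /andP[? ?]; apply/andP; split; lra.
Qed.

Context dS (S : measurableType dS) (phi : T -> S).
Hypothesis mphi : measurable_fun setT phi.

Let mI A : measurable A -> measurable_fun setT (fun x => \1_A (phi x) : R).
Proof. by move=> mA; apply: (measurableT_comp (f := (\1_A : S -> R))) => //; exact: measurable_indic. Qed.

Let I1 A x : `|\1_A (phi x) : R| <= 1.
Proof. by rewrite indicE; case: (_ \in _); rewrite ?normr1 ?normr0 ?ler01. Qed.

Variable G : set (set S).
Hypothesis G_generates : @measurable _ S = <<s G >>.
Hypothesis G_setI : setI_closed G.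
Hypothesis G_T : decouples (fun=> 1).
Hypothesis G_decouples : forall A, G A -> decouples (fun x => \1_A (phi x)).

(** The events that decouple form a Dynkin system. *)
Lemma decouples_indic A : measurable A -> decouples (fun x => \1_A (phi x)).
Proof.
move=> mA; have := mA; rewrite G_generates.
apply: (dynkin_induction (P := fun A => decouples (fun x => \1_A (phi x))) G_generates) => //.
- by rewrite (_ : (fun x => _) = fun=> 1) //; apply/funext => x; rewrite indicT.
- move=> B mB hB.
  have -> : (fun x => \1_(~` B) (phi x) : R) = (fun x => 1 + (-1) * \1_B (phi x)).
    by apply/funext => x; rewrite !indicE in_setC; case: (_ \in B); rewrite /= ?mulr1 ?mulr0 ?subrr ?addr0.
  apply: (decouplesD (B := 1)) => //.
  + by apply: measurable_funM => //; exact: mI.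
  + by move=> x; rewrite normr1.
  + by move=> x; rewrite mulN1r normrN.
  by apply: (decouplesZ (B := 1)) => //; exact: mI.
move=> F mF tF hF; apply: (decouples_lim (B := 1) (F_ := fun n x => \1_(\big[setU/set0]_(i < n) F i) (phi x))).
- by move=> n; apply: mI; exact: bigsetU_measurable.
- by apply: mI; exact: bigcupT_measurable.
- by [].
- by [].
- move=> x.
  have [[i _ Fi]|nF] := pselect ((\bigcup_k F k) (phi x)).
    apply: cvg_near_cst; exists i.+1 => // n /= ni; rewrite !indicE !mem_set //.
      by exists i.
    by rewrite -bigcup_mkord; exists i.
  apply: cvg_near_cst; apply: nearW => n; rewrite !indicE !memNset // -bigcup_mkord => -[i _ Fi].
  by apply: nF; exists i.
elim=> [|n IH].
  have -> : (fun x => \1_(\big[setU/set0]_(i < 0) F i) (phi x) : R) = (fun x => 0 * 1).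
    by apply/funext => x; rewrite big_ord0 indic0 mul0r.
  by apply: (decouplesZ (B := 1)) => // x; rewrite normr1.
have -> : (fun x => \1_(\big[setU/set0]_(i < n.+1) F i) (phi x) : R) =
    (fun x => \1_(\big[setU/set0]_(i < n) F i) (phi x) + \1_(F n) (phi x)).
  apply/funext => x; rewrite big_ord_recr /= !indicE in_setU.
  case: (boolP (phi x \in F n)) => [Fn|]; last by rewrite orbF addr0.
  rewrite orbT memNset ?add0r // -bigcup_mkord => -[i /= ni Fi].
  have h := tF i n I I.
  have : i = n by apply: h; exists (phi x); split => //; exact: set_mem.
  by move=> ein; rewrite ein ltnn in ni.
apply: (decouplesD (B := 1)) => //; apply: mI => //.
exact: bigsetU_measurable.
Qed.

Import HBNNSimple.

(** A bounded function is a limit of simple functions. *)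
Lemma decouples_measurable (F : S -> R) B : measurable_fun setT F ->
  (forall y, 0 <= F y <= B) -> decouples (F \o phi).
Proof.
move=> mF F0.
have mE : measurable_fun setT (EFin \o F) by exact/measurable_EFinP.
pose f n := nnsfun_approx measurableT mE n.
have cf y : (f n y)%:E @[n --> \oo] --> (F y)%:E.
  by apply: cvg_nnsfun_approx => // x _; rewrite lee_fin; have /andP[] := F0 x.
have fF n y : f n y <= F y.
  rewrite -lee_fin; apply: (lee_cvg_to (cvg_cst (f n y)%:E) (cf y)).
  by exists n => // m /= nm; rewrite lee_fin; exact/lefP/nd_nnsfun_approx.
have B0 y : `|F y| <= B by have /andP[? ?] := F0 y; rewrite ger0_norm.
apply: (decouples_lim (B := B) (F_ := fun n x => f n (phi x))).
- by move=> n; apply: measurableT_comp.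
- exact: measurableT_comp.
- by move=> n x; rewrite ger0_norm // (le_trans (fF n _)) //; have /andP[] := F0 (phi x).
- by move=> x; exact: B0.
- by move=> x; move/fine_cvgP: (cf (phi x)) => [_ h]; exact: h.
move=> n; pose g (l : seq R) x : R := \sum_(r <- l) r * \1_((f n : S -> R) @^-1` [set r]) (phi x).
have -> : (fun x => f n (phi x)) = g (fset_set (range (f n))).
  by apply/funext => x; rewrite {1}(fimfunE (f n)) fsbig_finite.
suff : exists C, [/\ measurable_fun setT (g (fset_set (range (f n)))),
    forall x, `|g (fset_set (range (f n))) x| <= C & decouples (g (fset_set (range (f n))))].
  by move=> [C []].
elim: (enum_fset _) => [|r l [C [mg gC hg]]].
  exists 0; have -> : g [::] = fun=> 0 by apply/funext => x; rewrite /g big_nil.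
  split => // [x|]; first by rewrite normr0.
  rewrite (_ : (fun=> 0) = fun x : T => 0 * 1); last by apply/funext => x; rewrite mul0r.
  by apply: (decouplesZ (B := 1)) => // x; rewrite normr1.
have mr : measurable (f n @^-1` [set r]) by [].
have -> : g (r :: l) = fun x => r * \1_(f n @^-1` [set r]) (phi x) + g l x.
  by apply/funext => x; rewrite /g big_cons.
have m1 : measurable_fun setT (fun x => r * \1_(f n @^-1` [set r]) (phi x)).
  by apply: measurable_funM => //; exact: mI.
have b1 x : `|r * \1_(f n @^-1` [set r]) (phi x)| <= `|r| by rewrite normrM ler_piMr.
exists (`|r| + C); split.
- exact: measurable_funD.
- by move=> x; rewrite (le_trans (ler_normD _ _)) // lerD.
apply: (decouplesD (B := Num.max `|r| C)) => //.
- by move=> x; rewrite le_max b1.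
- by move=> x; rewrite le_max gC orbT.
by apply: (decouplesZ (B := 1)) => //; [exact: mI | exact: decouples_indic].
Qed.

End Mixing.

(** * The first trap is found independently of the environment *)

Lemma cvg_exp1 {R : realType} (g : nat -> R) n : g k @[k --> \oo] --> (1 : R) ->
  g k ^+ n @[k --> \oo] --> (1 : R).
Proof.
move=> g1; elim: n => [|n IH]; first exact: cvg_cst.
rewrite (_ : (fun k => _) = fun k => g k * g k ^+ n); last by apply/funext => k; rewrite exprS.
by rewrite -[X in _ --> X]mulr1; apply: cvgM.
Qed.

Section GeometricLimit.
Context {R : realType}.
Variables (p : nat -> R) (r : R) (m : nat).
Hypothesis p_gt0 : forall k, 0 < p k.
Hypothesis p_cvg0 : p k @[k --> \oo] --> 0.
Hypothesis r_gt0 : 0 < r.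
Local Notation gam k := (expR (- (r * p k))).
Local Notation pi k := (1 - (1 - p k) * gam k).

Lemma discount_cvg1 : gam k @[k --> \oo] --> (1 : R).
Proof.
rewrite -[X in _ --> X]expR0; apply: continuous_cvg; first exact: continuous_expR.
by rewrite -oppr0 -(mulr0 r); apply: cvgN; apply: cvgMr.
Qed.

Lemma death_cvg : pi k / p k @[k --> \oo] --> 1 + r.
Proof.
have E k : pi k / p k = gam k + (1 - gam k) / p k.
  rewrite (_ : pi k = p k * gam k + (1 - gam k)); last by ring.
  by rewrite mulrDl [p k * _]mulrC mulfK // gt_eqF.
under eq_cvg do rewrite E; apply: cvgD; first exact: discount_cvg1.
have lo : r / (1 + r * p k) @[k --> \oo] --> r.
  rewrite -[X in _ --> X]divr1; apply: cvgMr; apply: cvgV => //.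
  rewrite -[X in _ --> X]addr0; apply: cvgD; first exact: cvg_cst.
  by rewrite -(mulr0 r); apply: cvgMr.
apply: (squeeze_cvgr _ lo (cvg_cst r)); apply: nearW => k.
have rp : 0 < r * p k by rewrite mulr_gt0.
apply/andP; split; last first.
  by rewrite ler_pdivrMr //; have := expR_ge1Dx (- (r * p k)); lra.
rewrite ler_pdivrMr ?addr_gt0 // mulrAC ler_pdivlMr //.
have : gam k * (1 + r * p k) <= gam k * expR (r * p k).
  by rewrite ler_wpM2l ?expR_ge1Dx // ltW // expR_gt0.
by rewrite -expRD addNr expR0 => h; lra.
Qed.

Lemma geometric_ratio_cvg : geometric_ratio (p k) (gam k) @[k --> \oo] --> (1 + r)^-1.
Proof.
rewrite (_ : (fun k => _) = fun k => (pi k / p k)^-1).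
  by apply: cvgV; [rewrite lt0r_neq0 // addr_gt0 | exact: death_cvg].
by apply/funext => k; rewrite /geometric_ratio invf_div.
Qed.

Lemma batch_cvg0 : m%:R * pi k @[k --> \oo] --> 0.
Proof.
rewrite -(mulr0 m%:R); apply: cvgMr; rewrite (_ : (fun k => _) = fun k => pi k / p k * p k).
  by rewrite -(mulr0 (1 + r)); apply: cvgM; [exact: death_cvg | exact: p_cvg0].
by apply/funext => k; rewrite divfK // gt_eqF.
Qed.

Lemma lower_ratio_cvg : lower_ratio m (p k) (gam k) @[k --> \oo] --> (1 + r)^-1.
Proof.
rewrite -[X in _ --> X]mulr1; apply: cvgM; first exact: geometric_ratio_cvg.
rewrite -[X in _ --> X]subr0 -(mulr0 m%:R); apply: cvgB; first exact: cvg_cst.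
exact: cvgMr.
Qed.

Lemma upper_ratio_cvg : upper_ratio m (p k) (gam k) @[k --> \oo] --> (1 + r)^-1.
Proof.
rewrite -[X in _ --> X]divr1; apply: cvgM; first exact: geometric_ratio_cvg.
apply: cvgV => //; rewrite -[X in _ --> X]subr0; apply: cvgB; first exact: cvg_cst.
exact: batch_cvg0.
Qed.

Lemma near_small_batches : \forall k \near \oo, m%:R * p k <= 1 /\ m%:R * pi k < 1.
Proof.
have h1 : m%:R * p k @[k --> \oo] --> 0 by rewrite -(mulr0 m%:R); apply: cvgMr.
have h2 : \forall k \near \oo, m%:R * p k < 1 by apply: (cvgr_lt _ h1).
have h3 : \forall k \near \oo, m%:R * pi k < 1 by apply: (cvgr_lt _ batch_cvg0).
by apply: filterS2 h2 h3 => k /ltW.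
Qed.

End GeometricLimit.

Section LaplaceLimit.
Context {R : realType} {d : nat}.
Variables (a : R) (nb : seq (site d)) (c : R).
Hypothesis nb_order : ball_order nb.
Hypothesis d_gt0 : (0 < d)%N.
Hypothesis c_gt0 : 0 < c.
Variable P : probability (environment R d) R.
Hypothesis P_iid : iid_coordinates P.
Hypothesis P_ge1 : {ae P, forall t, 1 <= t 0}.
Variable K : R.-pker (environment R d) ~> (trajectory R d).
Hypothesis K_law : forall t : environment R d, (forall y, 0 < t y) ->
  ctmc_law (jump_rate a t) 0 (K t).
Hypothesis c_speed : {ae annealed P K, forall p,
  (discovered p.2 t * (t^-1)%:E)%E @[t --> +oo] --> c%:E}.
Variable theta : nat -> R.
Hypothesis theta_infty : theta k @[k --> \oo] --> +oo.
Local Notation p k := (trap_probability P (theta k)).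
Hypothesis p_gt0 : forall k, 0 < p k.
Hypothesis p_cvg0 : p k @[k --> \oo] --> 0.
Variable s : R.
Hypothesis s_gt0 : 0 < s.
Implicit Types (q : environment R d * trajectory R d) (D : seq (site d)).

Local Notation X := (trap_laplace nb P theta s).
Local Notation Gam := (trap_discount nb c P theta s).
Local Notation lam k := (laplace_rate P theta s k).
Local Notation gam k := (expR (- (lam k / c))).

Lemma trap_laplace_fin k q : at_first_trap nb (theta k) [::]
  (fun w j => expR (- (lam k * `|jump_time w j|))) q = (X k q)%:E.
Proof.
rewrite /trap_laplace.
by case: (@at_first_trapP _ _ nb (theta k) [::] (fun w j => expR (- (lam k * `|jump_time w j|))) q) => [j|[j _ ->]|[_ ->]]; rewrite ?expR_ge0.
Qed.

Lemma trap_discount_fin D k q : at_first_trap nb (theta k) D (discount nb (gam k) D) q =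
  (Gam D k q)%:E.
Proof.
rewrite /trap_discount.
by case: (@at_first_trapP _ _ nb (theta k) D (discount nb (gam k) D) q) => [j|[j _ ->]|[_ ->]]; rewrite /discount ?exprn_ge0 ?expR_ge0.
Qed.

Lemma measurable_trap_laplace k : measurable_fun setT (X k).
Proof.
apply/measurable_EFinP; rewrite (_ : EFin \o _ = at_first_trap nb (theta k) [::]
  (fun w j => expR (- (lam k * `|jump_time w j|)))); last first.
  by apply/funext => q; rewrite trap_laplace_fin.
apply: measurable_at_first_trap => [w j|j]; first exact: expR_ge0.
apply: measurableT_comp => //; apply: measurableT_comp => //.
apply: measurable_funM => //; apply: measurableT_comp => //.
exact: measurable_jump_time.
Qed.

Lemma measurable_trap_discount D k : measurable_fun setT (Gam D k).
Proof.
apply/measurable_EFinP; rewrite (_ : EFin \o _ = at_first_trap nb (theta k) D (discount nb (gam k) D)); last first.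
  by apply/funext => q; rewrite trap_discount_fin.
apply: measurable_at_first_trap => [w j|j]; last exact: measurable_discount.
by rewrite exprn_ge0 // expR_ge0.
Qed.

Lemma trap_discount01 D k q : 0 <= Gam D k q <= 1.
Proof.
have g01 : 0 <= gam k <= 1 by have /andP[/ltW -> ->] := gam01 c_gt0 p_gt0 s_gt0 k.
rewrite -!lee_fin -trap_discount_fin; apply/andP; split.
  by apply: at_first_trap_ge0 => j; have /andP[] := discount01 nb D q.2 j g01.
by apply: at_first_trap_le1 => j; exact: discount01.
Qed.

Lemma trap_laplace01 k q : 0 <= X k q <= 1.
Proof.
rewrite -!lee_fin -trap_laplace_fin; apply/andP; split.
  by apply: at_first_trap_ge0 => j; exact: expR_ge0.
apply: at_first_trap_le1 => j; rewrite expR_ge0 -expR0 ler_expR oppr_le0.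
by rewrite mulr_ge0 // laplace_rate_ge0.
Qed.

Local Notation Q := (annealed P K).

Definition count_traps D k q : R := \sum_(x <- D) ((theta k <= q.1 x)%R)%:R.

(** If [D] contains no trap, exploring it costs at most a factor
    [gam k ^+ size D]; the possible traps in [D] are rare. *)
Lemma trap_discount_exclude D k q :
  gam k ^+ size D * Gam D k q - count_traps D k q <= Gam [::] k q <=
  Gam D k q + count_traps D k q.
Proof.
have g01 := gam01 c_gt0 p_gt0 s_gt0 k.
have [h|] := boolP (all (fun x => q.1 x < theta k) D).
  have := at_first_trap_exclude nb g01 h; rewrite !trap_discount_fin -EFinM !lee_fin => /andP[h1 h2].
  rewrite /count_traps big_seq big1 ?subr0 ?addr0 ?h1 // => x xD.
  by have /allP/(_ x xD) := h; rewrite ltNge => /negbTE ->.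
move=> /allPn[x xD]; rewrite -leNgt => tx.
have S1 : 1 <= count_traps D k q.
  by rewrite /count_traps (big_rem x) //= tx lerDl sumr_ge0.
have /andP[a0 a1] := trap_discount01 [::] k q; have /andP[b0 b1] := trap_discount01 D k q.
have gb : gam k ^+ size D * Gam D k q <= 1.
  have /andP[g0 g1] := g01; rewrite -[leRHS]mulr1 ler_pM ?exprn_ge0 ?exprn_ile1 // ltW.
by apply/andP; split; lra.
Qed.

Lemma measurable_count_traps D k : measurable_fun setT (count_traps D k).
Proof.
apply: measurable_sum => x; apply: measurable_bool_natr; apply: measurable_fun_ler => //.
exact: (measurableT_comp (measurable_coordinate x) measurable_fst).
Qed.

Lemma count_traps_bound D k q : 0 <= count_traps D k q <= (size D)%:R.
Proof.
rewrite /count_traps sumr_ge0 //=; elim: D => [|x D IH]; first by rewrite big_nil.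
by rewrite big_cons /= -natr1 addrC lerD //; case: (theta k <= q.1 x).
Qed.

Lemma expected_traps D k : \int[Q]_q count_traps D k q = (size D)%:R * p k.
Proof.
have mx x : measurable [set t : environment R d | theta k <= t x].
  rewrite (_ : [set _ | _] = (fun t : environment R d => t x) @^-1` `[theta k, +oo[).
    by rewrite -[X in measurable X]setTI; exact: measurable_coordinate.
  by apply/seteqP; split => t /=; rewrite in_itv /= andbT.
have Px x : P [set t : environment R d | theta k <= t x] = (p k)%:E.
  rewrite /trap_probability fineK ?fin_num_measure //.
  have := coordinate_law P_iid x (measurable_itv `[theta k, +oo[).
  by rewrite /=; under eq_set do rewrite in_itv /= andbT; move=> ->; under eq_set do rewrite in_itv /= andbT.
rewrite /Rintegral (_ : (\int[Q]_q (count_traps D k q)%:E = \sum_(x <- D) (p k)%:E)%E).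
  by rewrite sumEFin /= big_const_seq count_predT iter_addr_0 mulr_natl.
rewrite (integral_annealed_fst P K (g := fun t => (\sum_(x <- D) ((theta k <= t x)%R)%:R)%:E)) //.
- under eq_integral do rewrite -sumEFin; rewrite ge0_integral_sum //.
  + apply: eq_bigr => x _; rewrite -(Px x) -[X in P X]setIT -integral_indic //.
    apply: eq_integral => t _; rewrite indicE; congr (_%:R%:E); congr nat_of_bool.
    by apply/idP/idP => [/mem_set|/set_mem].
  + move=> x; apply/measurable_EFinP; apply: measurable_bool_natr; apply: measurable_fun_ler => //.
    exact: measurable_coordinate.
- by move=> t; rewrite lee_fin sumr_ge0.
- apply/measurable_EFinP; apply: measurable_sum => x; apply: measurable_bool_natr.
  by apply: measurable_fun_ler => //; exact: measurable_coordinate.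
Qed.

Local Notation kappa := ((1 + s / c)^-1).

(** Ignore the traps in [D] as long as the clock runs, apply
    [at_first_trap_bounds], and put them back at a small cost by
    [trap_discount_exclude]. *)
Lemma discount_limit D (A : set (environment R d)) : measurable A -> local_on D A ->
  \int[Q]_q (\1_A q.1 * Gam [::] k q) @[k --> \oo] --> kappa * \int[Q]_q \1_A q.1.
Proof.
move=> mA lA.
have m1A : measurable_fun setT (fun q : environment R d * trajectory R d => \1_A q.1 : R).
  by apply: (measurableT_comp (f := (\1_A : environment R d -> R))); [exact: measurable_indic | exact: measurable_fst].
have A01 (t : environment R d) : 0 <= (\1_A t : R) <= 1 by rewrite indicE; case: (_ \in _); rewrite ?lexx ler01.
have IA : \int[Q]_q \1_A q.1 = fine (P A).
  congr fine; rewrite (integral_annealed_fst P K (g := fun t => (\1_A t)%:E)).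
  - by rewrite integral_indic // setIT.
  - by move=> t; rewrite lee_fin.
  - by apply/measurable_EFinP; exact: measurable_indic.
have iG D' k : Q.-integrable setT (EFin \o (fun q => \1_A q.1 * Gam D' k q)).
  apply: (bounded_integrable Q (B := 1)).
    by apply: measurable_funM => //; exact: measurable_trap_discount.
  move=> q; have /andP[x0 x1] := A01 q.1; have /andP[y0 y1] := trap_discount01 D' k q.
  by rewrite ger0_norm ?mulr_ge0 // -[leRHS]mulr1 ler_pM.
have iC k : Q.-integrable setT (EFin \o count_traps D k).
  apply: (bounded_integrable Q (B := (size D)%:R)); first exact: measurable_count_traps.
  by move=> q; have /andP[x0 x1] := count_traps_bound D k q; rewrite ger0_norm.
have r0 : 0 < s / c by rewrite divr_gt0.
have gE k : gam k = expR (- (s / c * p k)) by rewrite /laplace_rate mulrAC.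
have g1 : gam k ^+ size D @[k --> \oo] --> (1 : R).
  apply: cvg_exp1; under eq_cvg do rewrite gE.
  exact: discount_cvg1.
have C0 : (size D)%:R * p k @[k --> \oo] --> (0 : R) by rewrite -(mulr0 (size D)%:R); apply: cvgMr.
pose lo k := gam k ^+ size D * (lower_ratio (size nb) (p k) (gam k) * fine (P A)) - (size D)%:R * p k.
pose up k := upper_ratio (size nb) (p k) (gam k) * fine (P A) + (size D)%:R * p k.
have clo : lo k @[k --> \oo] --> kappa * fine (P A).
  rewrite -[X in _ --> X]subr0; apply: cvgB => //; rewrite -[X in _ --> X]mul1r; apply: cvgM => //.
  apply: cvgMl; under eq_cvg do rewrite gE; exact: lower_ratio_cvg.
have cup : up k @[k --> \oo] --> kappa * fine (P A).
  rewrite -[X in _ --> X]addr0; apply: cvgD => //.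
  apply: cvgMl; under eq_cvg do rewrite gE; exact: upper_ratio_cvg.
rewrite IA; apply: (squeeze_cvgr _ clo cup).
apply: filterS (near_small_batches (size nb) p_gt0 p_cvg0 r0) => k; rewrite -gE => -[mp mpi].
have g01 : 0 <= gam k < 1.
  by rewrite expR_ge0 -expR0 ltr_expR oppr_lt0 divr_gt0 // mulr_gt0.
have ae_cover : {ae Q, forall q, forall n, \forall j \near \oo,
    (n <= size (cover nb [::] (path_of q.2 j)))%N}.
  apply: filterS2 (ae_increasing nb_order d_gt0 P_iid P_ge1 K_law) c_speed => q wi sp n.
  exact: cover_infty nb_order c_gt0 wi sp n.
have := at_first_trap_bounds nb_order d_gt0 P_iid P_ge1 K_law mA lA ae_cover g01 mp mpi.
under eq_integral do rewrite trap_discount_fin -EFinM.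
rewrite -[(\int[_]_x _)%E]fineK; last exact: integrable_fin_num (iG D k).
rewrite -[P A]fineK ?fin_num_measure // -!EFinM !lee_fin => /andP[h1 h2].
have g0 : 0 <= gam k ^+ size D <= 1 by have /andP[? ?] := g01; rewrite exprn_ge0 //= exprn_ile1 // ltW.
have /andP[g0' g1'] := g0.
have bG q : 0 <= \1_A q.1 * Gam D k q <= 1.
  have /andP[x0 x1] := A01 q.1; have /andP[y0 y1] := trap_discount01 D k q.
  by rewrite mulr_ge0 //= -[leRHS]mulr1 ler_pM.
have mG : measurable_fun setT (fun q => \1_A q.1 * Gam D k q).
  by apply: measurable_funM => //; exact: measurable_trap_discount.
have mC := measurable_count_traps D k.
have i1 : Q.-integrable setT (EFin \o (fun q => gam k ^+ size D * (\1_A q.1 * Gam D k q))).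
  apply: (bounded_integrable Q (B := 1)); first exact: measurable_funM.
  by move=> q; have /andP[x0 x1] := bG q; rewrite ger0_norm; [apply: mulr_ile1 | apply: mulr_ge0].
have i2 : Q.-integrable setT (EFin \o (fun q => gam k ^+ size D * (\1_A q.1 * Gam D k q) - count_traps D k q)).
  apply: (bounded_integrable Q (B := 1 + (size D)%:R)).
    by apply: measurable_funB => //; exact: measurable_funM.
  move=> q; have /andP[x0 x1] := bG q; have /andP[c0 c1] := count_traps_bound D k q.
  rewrite (le_trans (ler_normB _ _)) // lerD //; last by rewrite ger0_norm.
  by rewrite ger0_norm; [apply: mulr_ile1 | apply: mulr_ge0].
have i3 : Q.-integrable setT (EFin \o (fun q => \1_A q.1 * Gam D k q + count_traps D k q)).
  apply: (bounded_integrable Q (B := 1 + (size D)%:R)); first exact: measurable_funD.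
  move=> q; have /andP[x0 x1] := bG q; have /andP[c0' c1] := count_traps_bound D k q.
  by rewrite ger0_norm ?addr_ge0 // lerD.
apply/andP; split.
- rewrite /lo -expected_traps.
  apply: (@le_trans _ _ (\int[Q]_q (gam k ^+ size D * (\1_A q.1 * Gam D k q) - count_traps D k q))).
    by rewrite RintegralB // RintegralZl // lerD2r ler_wpM2l.
  apply: le_Rintegral => // q _; have /andP[+ _] := trap_discount_exclude D k q.
  have /andP[c0' _] := count_traps_bound D k q.
  by rewrite indicE; case: (_ \in _); rewrite /= ?mul0r ?mulr0 ?mul1r // sub0r oppr_le0.
rewrite /up -expected_traps.
apply: (@le_trans _ _ (\int[Q]_q (\1_A q.1 * Gam D k q + count_traps D k q))); last first.
  by rewrite RintegralD // lerD2r.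
apply: le_Rintegral => // q _; have /andP[_ +] := trap_discount_exclude D k q.
have /andP[c0' _] := count_traps_bound D k q.
by rewrite indicE; case: (_ \in _); rewrite /= ?mul0r ?mul1r // add0r.
Qed.

(** [laplace_gap] passes from the discrete clock to the elapsed time. *)
Lemma laplace_limit D (A : set (environment R d)) : measurable A -> local_on D A ->
  decouples Q X kappa (fun q => \1_A q.1).
Proof.
move=> mA lA.
have m1A : measurable_fun setT (fun q : environment R d * trajectory R d => \1_A q.1 : R).
  by apply: (measurableT_comp (f := (\1_A : environment R d -> R))); [exact: measurable_indic | exact: measurable_fst].
have A01 (t : environment R d) : 0 <= (\1_A t : R) <= 1 by rewrite indicE; case: (_ \in _); rewrite ?lexx ler01.
have mX k : measurable_fun setT (fun q => \1_A q.1 * X k q) by apply: measurable_funM => //; exact: measurable_trap_laplace.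
have mG k : measurable_fun setT (fun q => \1_A q.1 * Gam [::] k q) by apply: measurable_funM => //; exact: measurable_trap_discount.
have bX k q : `|\1_A q.1 * X k q| <= 1.
  have /andP[x0 x1] := A01 q.1; have /andP[y0 y1] := trap_laplace01 k q.
  by rewrite ger0_norm ?mulr_ge0 // -[leRHS]mulr1 ler_pM.
have bG k q : `|\1_A q.1 * Gam [::] k q| <= 1.
  have /andP[x0 x1] := A01 q.1; have /andP[y0 y1] := trap_discount01 [::] k q.
  by rewrite ger0_norm ?mulr_ge0 // -[leRHS]mulr1 ler_pM.
have gap : \int[Q]_q (\1_A q.1 * X k q - \1_A q.1 * Gam [::] k q) @[k --> \oo] --> (0 : R).
  rewrite -[X in _ --> X](_ : \int[Q]_q (cst 0 q) = 0); last by rewrite Rintegral_cst // mul0r.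
  apply: (bounded_Rcvg (B := 1 + 1)) => //.
  - by move=> k; exact: measurable_funB.
  - by move=> k q; rewrite (le_trans (ler_normB _ _)) // lerD.
  - by move=> q; rewrite normr0.
  apply: filterS2 (ae_increasing nb_order d_gt0 P_iid P_ge1 K_law) c_speed => q wi sp.
  have h := laplace_gap nb_order c_gt0 theta_infty p_gt0 s_gt0 wi sp.
  have h' : \1_A q.1 * (X k q - Gam [::] k q) @[k --> \oo] --> \1_A q.1 * (0 : R) by exact: cvgMr h.
  rewrite mulr0 in h'; apply: cvg_trans h'; apply: near_eq_cvg; apply: nearW => k.
  by rewrite mulrBr.
rewrite /decouples -[X in _ --> X]addr0.
apply: cvg_trans (cvgD (discount_limit mA lA) gap); apply: near_eq_cvg; apply: nearW => k.
rewrite -[LHS]RintegralD //; last 2 first.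
- exact: (bounded_integrable Q (mG k) (bG k)).
- apply: (bounded_integrable Q (B := 1 + 1)); first exact: measurable_funB.
  by move=> q; rewrite (le_trans (ler_normB _ _)) // lerD.
by apply: eq_Rintegral => q _; rewrite addrC subrK.
Qed.

Lemma kappa01 : 0 <= kappa <= 1.
Proof.
have r0 : 0 < s / c by rewrite divr_gt0.
have r1 : 0 < 1 + s / c by rewrite addr_gt0.
by apply/andP; split; [rewrite invr_ge0 ltW | rewrite invf_le1 // lerDl ltW].
Qed.

Lemma local_box l (B : site d -> set R) : local_on l (box l B).
Proof.
move=> x t v xl; split => h y yl; have := h y yl; rewrite /set_coordinate.
  by case: eqP => // yx; rewrite -yx yl in xl.
by case: eqP => // yx; rewrite -yx yl in xl.
Qed.

(** The boxes, each of which only depends on finitely many sites, generate the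
    events of the environment. *)
Lemma laplace_decouples (F : environment R d -> R) B : measurable_fun setT F ->
  (forall t, 0 <= F t <= B) -> decouples Q X kappa (F \o fst).
Proof.
have mX := measurable_trap_laplace.
apply: (decouples_measurable mX trap_laplace01 kappa01 measurable_fst (boxes_generate (R := R) (d := d))).
- exact: boxes_setI.
- have -> : (fun=> 1) = (fun q : environment R d * trajectory R d => \1_(box [::] (fun=> setT)) q.1 : R).
    by apply/funext => q; rewrite indicE mem_set.
  by apply: (@laplace_limit [::]); [exact: measurable_box | exact: local_box].
move=> _ [l [B' [mB ->]]].
by apply: (@laplace_limit l); [exact: measurable_box | exact: local_box].
Qed.

End LaplaceLimit.

(** * The environment around the first trap *)

Section SumZFacts.
Context {R : realType}.
Local Open Scope ereal_scope.

Lemma sumZ_exchange {T1 T2 : countType} (F : T1 -> T2 -> \bar R) :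
  (forall x y, 0 <= F x y) ->
  sumZ (fun x => sumZ (F x)) = sumZ (fun y => sumZ (F^~ y)).
Proof.
move=> F0; rewrite [in RHS]/sumZ.
rewrite (sumZ_nneseries (F := fun k x => oapp (F x) 0 (@pickle_inv T2 k))); last first.
  by move=> k x; exact: oapp_ge0.
apply: eq_eseriesr => k _; case: pickle_inv => //=.
by rewrite /sumZ eseries0 // => i _ _; case: pickle_inv.
Qed.

Lemma sumZ_opp {d : nat} (F : site d -> \bar R) : (forall x, 0 <= F x) ->
  sumZ (fun x => F (- x)%R) = sumZ F.
Proof.
move=> F0; transitivity (sumZ (fun x : site d => sumZ (fun y => if y == (- x)%R then F y else 0))).
  apply: eq_sumZ => x; apply: etrans (esym (sumZ_delta (- x)%R (F0 _))) _.
  by apply: eq_sumZ => y; case: eqP => // ->.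
rewrite sumZ_exchange => [|x y]; last by case: ifP.
apply: eq_sumZ => y; apply: etrans _ (sumZ_delta (- y)%R (F0 y)).
by apply: eq_sumZ => x; rewrite eq_sym eqr_oppLR.
Qed.

Lemma sumZ_seq {T : countType} (s : seq T) (F : T -> \bar R) : uniq s ->
  (forall x, 0 <= F x) -> \sum_(x <- s) F x = sumZ (fun x => (x \in s)%:R%:E * F x).
Proof.
move=> us F0; transitivity (\sum_(i <- s) sumZ (fun x : T => if x == i then F i else 0)).
  by apply: eq_bigr => i _; rewrite sumZ_delta.
rewrite -sumZ_sum => [|i x]; last by case: ifP.
apply: eq_sumZ => x; case: (boolP (x \in s)) => xs; last first.
  rewrite mul0e big_seq big1 // => i si; case: eqP => // xi.
  by rewrite xi si in xs.
rewrite mul1e (bigD1_seq x) //= eqxx big1 ?adde0 // => i ix.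
by rewrite eq_sym (negbTE ix).
Qed.

End SumZFacts.

Section View.
Context {R : realType} {d : nat}.
Variables (a : R) (nb : seq (site d)).
Hypothesis nb_order : ball_order nb.
Hypothesis d_gt0 : (0 < d)%N.
Variable P : probability (environment R d) R.
Hypothesis P_iid : iid_coordinates P.
Hypothesis P_ge1 : {ae P, forall t, 1 <= t 0}.
Variable K : R.-pker (environment R d) ~> (trajectory R d).
Hypothesis K_law : forall t : environment R d, (forall y, 0 < t y) ->
  ctmc_law (jump_rate a t) 0 (K t).
Implicit Types (t : environment R d) (x y z : site d) (s : seq (site d)).
Local Notation E := (steps nb).
Let uE := uniq_steps nb_order.
Let mE := mem_steps nb_order.

Variables (theta lam : R) (g : punctured_environment R d -> R).
Hypothesis lam_gt0 : 0 < lam.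
Hypothesis g_ge0 : forall u, 0 <= g u.
Hypothesis mg : measurable_fun setT g.
Let lam_ge0 := ltW lam_gt0.

Definition view x t : R := g (off_origin (shift x t)).

(** The value of [g] at the environment around the traps discovered from [y];
    when [g] vanishes in presence of a second trap, the sum has at most one
    nonzero term. *)
Definition trap_view t y : R := \sum_(x <- around nb y) ((theta <= t x)%R)%:R * view x t.

Definition ball_at x : pred (site d) := fun z => (l1norm (z - x)%R <= 1)%N.

(** The Laplace transform of the first time in the ball around [x], for the
    walk killed by the traps other than [x]. *)
Definition reach x t : \bar R := hit_sum E (jump_rate a t) lam (alive nb theta [:: x] t) (ball_at x) 0.

Lemma view_ge0 x t : 0 <= view x t. Proof. exact: g_ge0. Qed.

Lemma measurable_view x : measurable_fun setT (view x).
Proof.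
apply: (measurableT_comp mg); apply: (measurableT_comp (@measurable_off_origin R d)).
exact: measurable_shift.
Qed.

Lemma trap_view_ge0 t y : 0 <= trap_view t y.
Proof. by apply: sumr_ge0 => x _; rewrite mulr_ge0 // view_ge0. Qed.

Lemma measurable_trap x : measurable_fun setT (fun t : environment R d => ((theta <= t x)%R)%:R : R).
Proof.
apply: measurable_bool_natr; apply: measurable_fun_ler => //.
exact: measurable_coordinate.
Qed.

Lemma measurable_trap_view y : measurable_fun setT (trap_view^~ y).
Proof.
apply: measurable_sum => x; apply: measurable_funM; first exact: measurable_trap.
exact: measurable_view.
Qed.

Lemma reach_ge0 x t : (0 <= reach x t)%E.
Proof. by apply: hit_sum_ge0 => // *; exact: jump_rate_ge0. Qed.

Lemma measurable_reach x : measurable_fun setT (reach x).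
Proof.
by apply: measurable_hit_sum => // z; exact: measurable_alive.
Qed.

Lemma alive_ball t x z : theta <= t x ->
  alive nb theta [::] t z = alive nb theta [:: x] t z && ~~ ball_at x z.
Proof.
move=> tx; rewrite /ball_at l1normB -(mem_around nb_order).
case: (boolP (x \in around nb z)) => xz /=; rewrite ?andbF ?andbT.
  by apply/negP => /allP/(_ x xz) /=; rewrite ltNge tx.
apply: eq_in_all => y yz; rewrite !inE; case: (eqVneq y x) => // yx.
by rewrite yx in yz; rewrite yz in xz.
Qed.

(** A trap [x] next to the end of the path is discovered there for the first
    time when the path avoids the ball around [x] and all other traps. *)
Lemma first_trap_view t s : (first_trap nb theta [::] t (0 :: s))%:R * trap_view t (last 0 s) =
  \sum_(x <- around nb (last 0 s)) ((theta <= t x)%R)%:R * view x t *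
     (all (predD (alive nb theta [:: x] t) (ball_at x)) (belast 0 s))%:R.
Proof.
rewrite mulr_sumr !big_seq; apply: eq_bigr => x xy.
case: (boolP (theta <= t x)) => tx; last by rewrite !mul0r mulr0.
rewrite mulrC; congr (_ * _%:R); congr nat_of_bool.
rewrite /first_trap; have -> : ~~ alive nb theta [::] t (last 0 s).
  by apply/negP => /allP/(_ x xy) /=; rewrite ltNge tx.
by rewrite andbT; apply: eq_all => z; rewrite (alive_ball _ tx) andbC.
Qed.

Lemma reach_paths x t : (reach x t =
  \sum_(0 <= j <oo) (\sum_(s <- tails E 0 j) path_weight E (jump_rate a t) lam 0 s *
     ((all (predD (alive nb theta [:: x] t) (ball_at x)) (belast 0%R s))%:R *
       (ball_at x (last 0%R s))%:R))%:E)%E.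
Proof. by apply: eq_eseriesr => j _; rewrite hop_paths. Qed.

(** The walk is stopped before the value at [x] has any influence on its
    jumps. *)
Lemma reach_local x t v : reach x (set_coordinate x v t) = reach x t.
Proof.
apply: eq_eseriesr => j _; congr EFin; apply: eq_hop => //.
  move=> z /=; congr (_ && _); apply: eq_all => y; rewrite inE /set_coordinate.
  by case: eqP.
move=> y z /= /andP[xy _] yz.
apply: (step_agree a nb_order) yz; first exact: set_coordinate_agree.
by rewrite ltnNge.
Qed.

Lemma view_local x t v : view x (set_coordinate x v t) = view x t.
Proof.
rewrite /view; congr g; apply/funext => z; rewrite /off_origin /shift /set_coordinate.
by case: eqP => // /eqP; rewrite -subr_eq0 addrAC subrr add0r (negbTE (valP z)).
Qed.

Lemma reach_shift x t : reach x t = hit_sum E (jump_rate a (shift x t)) lam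
  (alive nb theta [:: 0] (shift x t)) in_unit_ball (- x).
Proof.
apply: eq_eseriesr => j _; congr EFin.
rewrite -[in LHS](subrr x) -(hop_shift E (jump_rate a t)).
have -> : (fun u v : site d => jump_rate a t (x + u) (x + v)) = jump_rate a (shift x t).
  by apply/funext => u; apply/funext => v; rewrite jump_rate_shift.
apply: (eq_hop mE) => // z /=; last by rewrite /ball_at addrAC subrr add0r.
rewrite /ball_at addrAC subrr add0r; congr (_ && _).
rewrite /alive /around !all_map; apply: eq_all => y /=.
by rewrite !inE /shift addrA -[X in (_ == X) || _]addr0 -addrA (inj_eq (addrI x)).
Qed.

Definition reach0 t x : \bar R :=
  hit_sum E (jump_rate a t) lam (alive nb theta [:: 0] t) in_unit_ball x.

Lemma reach0_ge0 t x : (0 <= reach0 t x)%E.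
Proof. by apply: hit_sum_ge0 => // *; exact: jump_rate_ge0. Qed.

Lemma measurable_reach0 x : measurable_fun setT (reach0^~ x).
Proof. by apply: measurable_hit_sum => // z; exact: measurable_alive. Qed.

Lemma reach0_local t v x : reach0 (set_coordinate 0 v t) x = reach0 t x.
Proof.
apply: eq_eseriesr => j _; congr EFin; apply: eq_hop => //.
  move=> z /=; congr (_ && _); apply: eq_all => y; rewrite inE /set_coordinate.
  by case: eqP.
move=> y z /= /andP[xy _] yz.
apply: (step_agree a nb_order (o := 0)) yz; first exact: set_coordinate_agree.
by rewrite subr0 ltnNge.
Qed.

(** The expectation, at the discovery of the first trap, of [g] at the
    environment around it times [expR (- lam * time)]. *)
Definition trap_expectation : \bar R := (\sum_(0 <= j <oo)
  \int[annealed P K]_q ((first_trap nb theta [::] q.1 (path_of q.2 j.+1))%:R *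
    trap_view q.1 (position q.2 j) * expR (- (lam * jump_time q.2 j)))%:E)%E.

(** Decomposition according to the site of the first trap. *)
Lemma trap_expectationE : trap_expectation =
  sumZ (fun x => \int[P]_t (((theta <= t x)%R%:R * view x t)%:E * reach x t))%E.
Proof.
pose r j x t := \sum_(s <- tails E 0 j) path_weight E (jump_rate a t) lam 0 s *
     ((all (predD (alive nb theta [:: x] t) (ball_at x)) (belast 0 s))%:R *
       (ball_at x (last 0 s))%:R).
pose f x t := ((theta <= t x)%R)%:R * view x t.
have f0 x t : 0 <= f x t by rewrite mulr_ge0 // view_ge0.
have mf x : measurable_fun setT (f x).
  by apply: measurable_funM; [exact: measurable_trap | exact: measurable_view].
have r0 j x t : 0 <= r j x t.
  by apply: sumr_ge0 => s _; rewrite !mulr_ge0 // pw_ge0.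
have mr j x : measurable_fun setT (r j x).
  apply: measurable_sum => s; apply: measurable_funM; first exact: measurable_path_weight.
  apply: measurable_funM => //; apply: measurable_bool_natr.
  elim: (belast 0 s) => [|z l IH] /=; first exact: measurable_cst.
  apply: measurable_and => //; apply: measurable_and; first exact: measurable_cst.
  exact: measurable_alive.
have mfr j x : measurable_fun setT (fun t => (f x t * r j x t)%:E : \bar R).
  by apply/measurable_EFinP; apply: measurable_funM.
have fr0 j x t : (0 <= (f x t * r j x t)%:E)%E by rewrite lee_fin mulr_ge0.
transitivity (\sum_(0 <= j <oo) \int[P]_t sumZ (fun x => (f x t * r j x t)%:E))%E; last first.
  under eq_eseriesr => j _ do rewrite integral_sumZ //.
  rewrite -sumZ_nneseries; last by move=> j x; exact: integral_ge0.
  apply: eq_sumZ => x; rewrite -integral_nneseries //.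
  apply: eq_integral => t _; rewrite reach_paths -nneseriesZl //.
  by move=> j _; rewrite lee_fin; exact: r0.
apply: eq_eseriesr => j _.
pose h s t := (first_trap nb theta [::] t s)%:R * trap_view t (last 0 s).
have h0 s t : 0 <= h s t by rewrite mulr_ge0 // trap_view_ge0.
have mh s : measurable_fun setT (h s).
  apply: measurable_funM; last exact: measurable_trap_view.
  by apply: measurable_bool_natr; exact: measurable_first_trap.
transitivity (\int[annealed P K]_q (h (path_of q.2 j.+1) q.1 * expR (- (lam * jump_time q.2 j)))%:E)%E.
  by apply: eq_integral => q _; rewrite /h last_path_of.
rewrite (annealed_path nb_order d_gt0 P_iid P_ge1 K_law j lam_ge0 h0 mh) -ge0_integral_sum //; last 2 first.
- by move=> s; apply/measurable_EFinP; apply: measurable_funM => //; exact: measurable_path_weight.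
- by move=> s t _; rewrite lee_fin mulr_ge0 // pw_ge0.
apply: eq_integral => t _; rewrite /h.
pose w s x := path_weight E (jump_rate a t) lam 0 s * (f x t *
   (all (predD (alive nb theta [:: x] t) (ball_at x)) (belast 0 s))%:R).
have w0 s x : (0 <= (w s x)%:E)%E by rewrite lee_fin mulr_ge0 ?pw_ge0 // mulr_ge0.
transitivity (\sum_(s <- tails E 0%R j) sumZ (fun x => (x \in around nb (last 0%R s))%:R%:E * (w s x)%:E))%E.
  apply: eq_bigr => s _; rewrite -(sumZ_seq (F := fun x => (w s x)%:E)) ?uniq_around //.
  by rewrite sumEFin first_trap_view mulr_sumr.
rewrite -sumZ_sum; last first.
  by move=> s x; rewrite mule_ge0 // lee_fin.
apply: eq_sumZ => x; rewrite /r mulr_sumr -sumEFin; apply: eq_bigr => s _.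
rewrite -EFinM (mem_around nb_order) l1normB -/(ball_at x (last 0 s)) /w.
have sh (b1 b2 b3 u : R) : b1 * (b2 * (u * b3)) = u * (b2 * (b3 * b1)) by ring.
by congr EFin; exact: sh.
Qed.

(** Whether [x] is a trap, what surrounds [x] and how the walk reaches the
    neighbourhood of [x] are independent; by translation the site [x] may be
    placed at the origin. *)
Lemma integral_trap x :
  (\int[P]_t (((theta <= t x)%R%:R * view x t)%:E * reach x t) =
   (trap_probability P theta)%:E *
   \int[P]_t ((g (off_origin t))%:E * reach0 t (- x)%R))%E.
Proof.
have mF : measurable_fun setT (fun t => (view x t)%:E * reach x t)%E.
  by apply: emeasurable_funM; [apply/measurable_EFinP; exact: measurable_view | exact: measurable_reach].
have F0 t : (0 <= (view x t)%:E * reach x t)%E by rewrite mule_ge0 ?reach_ge0 // lee_fin view_ge0.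
have Ploc : P [set t | `[theta, +oo[%classic (t 0%R)] = (trap_probability P theta)%:E.
  rewrite /trap_probability fineK ?fin_num_measure //; last first.
    rewrite (_ : [set _ | _] = (fun t : environment R d => t 0) @^-1` `[theta, +oo[).
      by rewrite -[X in measurable X]setTI; exact: measurable_coordinate.
    by apply/seteqP; split => t /=; rewrite in_itv /= andbT.
  by congr (P _); apply/seteqP; split => t /=; rewrite in_itv /= andbT.
transitivity (\int[P]_t ((\1_(`[theta, +oo[%classic) (t x))%:E * ((view x t)%:E * reach x t)))%E.
  apply: eq_integral => t _; rewrite EFinM -muleA indicE mem_setE in_itv /= andbT //.
rewrite (integral_coordinate P_iid (B := `[theta, +oo[%classic)) //; last first.
  by move=> t v; rewrite view_local reach_local.
rewrite Ploc; congr (_ * _)%E.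
rewrite -(integral_shift P_iid x (F := fun t => (g (off_origin t))%:E * reach0 t (- x)%R)%E).
- by apply: eq_integral => t _; rewrite reach_shift.
- apply: emeasurable_funM; last exact: measurable_reach0.
  by apply/measurable_EFinP; apply: (measurableT_comp mg); exact: measurable_off_origin.
- by move=> t; rewrite mule_ge0 ?reach0_ge0 // lee_fin.
Qed.

Definition total_reach t : \bar R := sumZ (fun x => reach0 t (- x)).

Lemma total_reach_ge0 t : (0 <= total_reach t)%E.
Proof. by apply: sumZ_ge0 => x; exact: reach0_ge0. Qed.

Lemma measurable_total_reach : measurable_fun setT total_reach.
Proof.
apply: (measurable_sumZ (F := fun x t => reach0 t (- x))) => x; last exact: measurable_reach0.
by move=> t; exact: reach0_ge0.
Qed.

(** Neither [g] nor [reach0] sees the value at the origin, which is therefore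
    independent of them and may be required to lie in [I]. *)
Lemma trap_expectation_reach (I : set R) : measurable I ->
  (P [set t | I (t 0%R)] * trap_expectation = (trap_probability P theta)%:E *
   \int[P]_t ((\1_I (t 0%R) * g (off_origin t))%:E * total_reach t))%E.
Proof.
move=> mI; rewrite trap_expectationE.
have mF x : measurable_fun setT (fun t => (g (off_origin t))%:E * reach0 t (- x)%R)%E.
  apply: emeasurable_funM; last exact: measurable_reach0.
  by apply/measurable_EFinP; apply: (measurableT_comp mg); exact: measurable_off_origin.
have F0 x t : (0 <= (g (off_origin t))%:E * reach0 t (- x)%R)%E.
  by rewrite mule_ge0 ?reach0_ge0 // lee_fin.
have mI0 : measurable_fun setT (fun t : environment R d => (\1_I (t 0))%:E : \bar R).
  apply/measurable_EFinP; apply: (measurableT_comp (f := (\1_I : R -> R))).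
    exact: measurable_indic.
  exact: measurable_coordinate.
have I0 (t : environment R d) : (0 <= (\1_I (t 0%R) : R)%:E)%E by rewrite lee_fin.
have mI1 : measurable [set t : environment R d | I (t 0)].
  by rewrite -[X in measurable X]setTI; exact: (measurable_coordinate (0 : site d)).
rewrite (eq_sumZ (G := fun x => (trap_probability P theta)%:E *
   \int[P]_t ((g (off_origin t))%:E * reach0 t (- x)%R))%E); last exact: integral_trap.
rewrite sumZZl; last by move=> x; exact: integral_ge0.
rewrite muleCA; congr (_ * _)%E.
rewrite -[P _]fineK ?fin_num_measure // -sumZZl; last by move=> x; exact: integral_ge0.
rewrite fineK ?fin_num_measure //.
transitivity (sumZ (fun x => \int[P]_t ((\1_I (t 0%R))%:E * ((g (off_origin t))%:E * reach0 t (- x)%R))))%E.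
  apply: eq_sumZ => x; rewrite integral_coordinate //.
  by move=> t v; rewrite reach0_local -[off_origin (set_coordinate _ _ _)]/(off_origin _);
     congr ((g _)%:E * _)%E; apply/funext => z; rewrite /off_origin /set_coordinate (negbTE (valP z)).
rewrite -integral_sumZ; last 2 first.
- by move=> x t; rewrite mule_ge0.
- by move=> x; apply: emeasurable_funM.
apply: eq_integral => t _; rewrite /total_reach -sumZZl; last by move=> x; exact: reach0_ge0.
by apply: eq_sumZ => x; rewrite EFinM muleA.
Qed.

(** ** Comparison with the Green function *)

Definition killed_green t : \bar R := green_sum E (jump_rate a t) lam (alive nb theta [:: 0] t) 0 0.

(** The probability that the walk, killed when it discovers a trap other than the
    origin, is stopped by an independent exponential time of parameter [lam]. *)
Definition stopped t : \bar R := (\sum_(0 <= n <oo) (hop E (jump_rate a t) lam (alive nb theta [:: 0] t)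
  (fun z => (alive nb theta [:: 0%R] t z)%:R * (lam / (lam + total_rate E (jump_rate a t) z))) n 0%R)%:E)%E.

Let rate_pos t x : 0 < lam + total_rate E (jump_rate a t) x.
Proof. by rewrite ltr_wpDr // total_rate_ge0 // => *; exact: jump_rate_ge0. Qed.

Lemma killed_green_fin t : killed_green t \is a fin_num.
Proof.
by apply: green_sum_fin => // *; exact: jump_rate_ge0.
Qed.

(** By reversibility, the law of the site where the walk from the origin is
    stopped is given by the Green functions towards the origin. *)
Lemma stopped_green t : stopped t = sumZ (fun x => lam%:E *
  green_sum E (jump_rate a t) lam (alive nb theta [:: 0%R] t) (- x)%R 0%R)%E.
Proof.
rewrite (sumZ_opp (F := fun x => lam%:E * green_sum E (jump_rate a t) lam (alive nb theta [:: 0%R] t) x 0%R)%E); last first.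
  by move=> x; rewrite mule_ge0 ?lee_fin // green_sum_ge0 // => *; exact: jump_rate_ge0.
by rewrite (sumZ_green_sum uE mE (jump_rate_ge0 a t) (jump_rate_sym a t) lam_ge0 (rate_pos t)).
Qed.

(** First passage through the unit ball, summed over the starting points. *)
Lemma stopped_le t : (stopped t <= lam%:E * killed_green t * total_reach t)%E.
Proof.
rewrite stopped_green -(fineK (killed_green_fin t)) -EFinM -sumZZl; last first.
  by move=> x; exact: reach0_ge0.
apply: le_sumZ => x.
  by rewrite mule_ge0 ?lee_fin // green_sum_ge0 // => *; exact: jump_rate_ge0.
rewrite EFinM (fineK (killed_green_fin t)) -muleA lee_pmul2l // ?lte_fin //.
apply: (lee_green_hit mE (jump_rate_ge0 a t) lam_ge0 (rate_pos t)) => //.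
by rewrite /in_unit_ball l1norm0.
Qed.

Definition no_trap_around t := forall z, z != 0 -> (l1norm z <= 2)%N -> t z < theta.

(** From the unit ball, the walk jumps to the origin with probability at least
    [return_ratio], and no trap prevents it from doing so. *)
Lemma le_stopped t : (forall y, 0 < t y) -> lam <= 1 -> no_trap_around t ->
  ((return_ratio a nb t)%:E * (lam%:E * killed_green t * total_reach t) <= stopped t)%E.
Proof.
move=> t0 l1 nt; rewrite stopped_green -(fineK (killed_green_fin t)) -!EFinM muleA -EFinM -sumZZl; last first.
  by move=> x; exact: reach0_ge0.
have [r0 r1] := andP (return_ratio_le1 a nb t).
have K0 : 0 <= fine (killed_green t).
  by rewrite fine_ge0 // green_sum_ge0 // => *; exact: jump_rate_ge0.
apply: le_sumZ => x.
  apply: mule_ge0; last exact: reach0_ge0.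
  by rewrite lee_fin; apply: mulr_ge0 => //; exact: mulr_ge0.
rewrite mulrCA EFinM EFinM (fineK (killed_green_fin t)) -muleA lee_pmul2l // ?lte_fin //.
apply: (lee_hit_green uE mE (jump_rate_ge0 a t) lam_ge0 (rate_pos t)) => //; first by rewrite r0.
move=> z; rewrite /in_unit_ball => z1 z0.
have zE : z \in E by rewrite mE; move: z1; rewrite leq_eqVlt ltnS leqn0 l1norm_eq0 (negbTE z0) orbF.
apply/and3P; split; last by apply: return_ratio_le_step => //; rewrite lam_ge0.
- apply/allP => y; rewrite (mem_around nb_order) inE => yz.
  case: (eqVneq y 0) => //= y0; apply: nt => //.
  by rewrite -[y]subr0 (leq_trans (ler_l1norm_dist y z 0)) // subr0 (leq_add yz z1).
- by rewrite sub0r memN_E.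
Qed.

End View.

(** * Stopping before the first trap *)

Section Stopped.
Context {R : realType} {d : nat}.
Variables (a : R) (nb : seq (site d)).
Hypothesis nb_order : ball_order nb.
Hypothesis d_gt0 : (0 < d)%N.
Variable P : probability (environment R d) R.
Hypothesis P_iid : iid_coordinates P.
Hypothesis P_ge1 : {ae P, forall t, 1 <= t 0}.
Variable K : R.-pker (environment R d) ~> (trajectory R d).
Hypothesis K_law : forall t : environment R d, (forall y, 0 < t y) ->
  ctmc_law (jump_rate a t) 0 (K t).
Hypothesis K_infty : {ae annealed P K, forall q, jump_time q.2 j @[j --> \oo] --> +oo}.
Implicit Types (t : environment R d) (x y z : site d) (s : seq (site d)).
Local Notation E := (steps nb).
Local Notation Q := (annealed P K).

Lemma annealed_path_abs lam j (h : seq (site d) -> environment R d -> R) : 0 <= lam ->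
  (forall s t, 0 <= h s t) -> (forall s, measurable_fun setT (h s)) ->
  (\int[Q]_p (h (path_of p.2 j.+1) p.1 * expR (- (lam * `|jump_time p.2 j|)))%:E =
   \sum_(s <- tails E 0%R j) \int[P]_t (path_weight E (jump_rate a t) lam 0 s * h (0%R :: s) t)%:E)%E.
Proof.
move=> l0 h0 mh; rewrite -(annealed_path nb_order d_gt0 P_iid P_ge1 K_law j l0 h0 mh).
have mJ : measurable_fun setT (fun p : environment R d * trajectory R d => jump_time p.2 j).
  exact: measurableT_comp (measurable_jump_time j) measurable_snd.
have mp (f : R -> R) : measurable_fun setT f -> measurable_fun setT
    (fun p : environment R d * trajectory R d => (h (path_of p.2 j.+1) p.1 * expR (- (lam * f (jump_time p.2 j))))%:E : \bar R).
  move=> mf; apply/measurable_EFinP; apply: measurable_funM; first exact: measurable_fun_path.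
  apply: measurableT_comp => //; apply: measurableT_comp => //.
  by apply: measurable_funM => //; exact: (measurableT_comp mf mJ).
apply: ae_eq_integral => //.
- have mn : measurable_fun setT (fun x : R => `|x|) by exact: measurableT_comp.
  have m1 := mp _ mn; exact: m1.
- have m1 := mp id (@measurable_id _ _ setT).
  exact: m1.
apply: filterS (ae_increasing nb_order d_gt0 P_iid P_ge1 K_law) => p pi _.
by rewrite ger0_norm // jump_time_ge0.
Qed.

Variables (theta lam : R).
Hypothesis lam_gt0 : 0 < lam.
Let lam_ge0 := ltW lam_gt0.
Variables (F : environment R d -> R) (B : R).
Hypothesis mF : measurable_fun setT F.
Hypothesis F0B : forall t, 0 <= F t <= B.
Hypothesis F_supp : forall t, F t != 0 -> t 0 < theta.

Local Notation alive0 t := (alive nb theta [:: 0] t).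
Local Notation stop n t := (hop E (jump_rate a t) lam (alive0 t)
  (fun z => (alive0 t z)%:R * (lam / (lam + total_rate E (jump_rate a t) z))) n 0).
Local Notation hit n t := (hop E (jump_rate a t) lam (alive0 t) (fun z => (~~ alive0 t z)%:R) n 0).
Local Notation run n t := (hop E (jump_rate a t) lam (alive0 t) (fun=> 1) n 0).

Let q0 t := jump_rate_ge0 a t.

Let rate_pos t x : 0 < lam + total_rate E (jump_rate a t) x.
Proof. by rewrite ltr_wpDr // total_rate_ge0. Qed.

(** At its [n]-th position the walk is stopped, discovers a trap, or makes
    another jump. *)
Lemma run_split n t : stop n t + hit n t + run n.+1 t = run n t.
Proof.
rewrite -hop_comm -!hopD; apply: (eq_hop (mem_steps nb_order)) => // z.
under eq_bigr do rewrite mulr1.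
rewrite -mulr_suml -/(total_rate E (jump_rate a t) z); have := rate_pos t z.
case: (alive0 t z) => /= r; rewrite ?mul1r ?mul0r ?addr0 ?add0r //.
by rewrite -mulrDl divff // gt_eqF.
Qed.

Lemma sum_stop N t : \sum_(0 <= n < N) stop n t + \sum_(0 <= n < N) hit n t = 1 - run N t.
Proof.
elim: N => [|N IH]; first by rewrite !big_geq //= addr0 subrr.
rewrite !big_nat_recr //= addrACA IH -(run_split N t).
by rewrite /= opprD; set u := run N.+1 t; ring.
Qed.

Let stop_ge0 n t : 0 <= stop n t.
Proof. by apply: hop_ge0 => // z; rewrite mulr_ge0 // divr_ge0 // ltW. Qed.
Let hit_ge0 n t : 0 <= hit n t.
Proof. by apply: hop_ge0 => // z. Qed.
Let run_ge0 n t : 0 <= run n t.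
Proof. by apply: hop_ge0 => // z. Qed.

Let mhit n : measurable_fun setT (fun t => hit n t).
Proof.
apply: measurable_hop => // y; first exact: measurable_alive.
by apply: measurable_bool_natr; apply: measurable_neg; exact: measurable_alive.
Qed.

Let mrun n : measurable_fun setT (fun t => run n t).
Proof. by apply: measurable_hop => // y; exact: measurable_alive. Qed.

Let mstop n : measurable_fun setT (fun t => stop n t).
Proof.
apply: measurable_hop => // y; first exact: measurable_alive.
apply: measurable_funM; first by apply: measurable_bool_natr; exact: measurable_alive.
by apply: measurable_funM => //; exact: measurable_inv_rate.
Qed.

Let F_ge0 t : 0 <= F t. Proof. by have /andP[] := F0B t. Qed.

Lemma annealed_hop (phi : environment R d -> site d -> R) (h : seq (site d) -> environment R d -> R) n :
  (forall t z, 0 <= phi t z) -> (forall s, measurable_fun setT (h s)) ->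
  (forall t y, measurable_fun setT (phi^~ y)) ->
  (forall s t, h (0 :: s) t = (all (alive0 t) (belast 0 s))%:R * phi t (last 0 s)) ->
  (forall s t, 0 <= h s t) ->
  (\int[Q]_p (F p.1 * h (path_of p.2 n.+1) p.1 * expR (- (lam * `|jump_time p.2 n|)))%:E =
   \int[P]_t (F t * hop E (jump_rate a t) lam (alive0 t) (phi t) n 0)%:E)%E.
Proof.
move=> phi0 mh mphi hE h0.
rewrite (annealed_path_abs n (h := fun s t => F t * h s t)) //; last 2 first.
- by move=> s t; rewrite mulr_ge0.
- by move=> s; exact: measurable_funM.
rewrite -ge0_integral_sum //; last 2 first.
- move=> s; apply/measurable_EFinP; apply: measurable_funM; first exact: measurable_path_weight.
  exact: measurable_funM.
- by move=> s t _; rewrite lee_fin !mulr_ge0 // pw_ge0.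
apply: eq_integral => t _; rewrite sumEFin hop_paths mulr_sumr; congr EFin.
by apply: eq_bigr => s _; rewrite hE mulrCA.
Qed.

(** The jump times tend to infinity, so that the walk does not make infinitely
    many jumps before it is killed. *)
Lemma integral_run_cvg0 : (\int[P]_t (F t * run n t)%:E)%E @[n --> \oo] --> 0%E.
Proof.
have E0 : (fun n => \int[P]_t (F t * run n t)%:E)%E = (fun n =>
   \int[Q]_p (F p.1 * (all (alive0 p.1) (path_of p.2 n))%:R * expR (- (lam * `|jump_time p.2 n|)))%:E)%E.
  apply/funext => n.
  rewrite -(annealed_hop (h := fun s t => (all (alive0 t) (past s))%:R)) //.
  - by apply: eq_integral => p _; rewrite past_path_of.
  - by move=> s; apply: measurable_bool_natr; exact: measurable_all_alive.
  - by move=> s t; rewrite mulr1.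
rewrite E0 [X in _ --> X](_ : _ = \int[Q]_p (cst 0 p)%:E)%E; last by rewrite integral0.
have mall n : measurable_fun setT (fun p : environment R d * trajectory R d => (all (alive0 p.1) (path_of p.2 n))%:R : R).
  apply: (measurable_fun_path n (h := fun s t => ((all (alive0 t) s)%:R : R))).
  by move=> s; apply: measurable_bool_natr; exact: measurable_all_alive.
apply: (bounded_cvg (B := B)) => //.
- move=> n; apply: measurable_funM.
    by apply: measurable_funM => //; exact: (measurableT_comp mF measurable_fst).
  apply: measurableT_comp => //; apply: measurableT_comp => //.
  apply: measurable_funM => //; apply: measurableT_comp => //.
  exact: measurableT_comp (measurable_jump_time n) measurable_snd.
- move=> n p; have /andP[F0 FB] := F0B p.1.
  have e0 := expR_gt0 (- (lam * `|jump_time p.2 n|)).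
  have e1 : expR (- (lam * `|jump_time p.2 n|)) <= 1 by rewrite -expR0 ler_expR oppr_le0 mulr_ge0.
  rewrite ger0_norm ?mulr_ge0 ?expR_ge0 // (le_trans _ FB) //.
  rewrite -mulrA ler_piMr //; case: (all _ _); rewrite ?mul1r ?mul0r //.
apply: filterS K_infty => p pJ.
apply/cvgr0Pnorm_le => e e0.
have /cvgryPge/(_ ((B + 1) / (lam * e))) := pJ; apply: filterS => n hn.
have /andP[F0 FB] := F0B p.1; have B0 : 0 <= B by exact: le_trans FB.
have le0 : 0 < lam * e by rewrite mulr_gt0.
have J0 : 0 <= jump_time p.2 n by rewrite (le_trans _ hn) // divr_ge0 ?addr_ge0 // ltW.
rewrite (ger0_norm J0) ger0_norm ?mulr_ge0 ?expR_ge0 //.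
apply: (@le_trans _ _ (B * expR (- (lam * jump_time p.2 n)))).
  rewrite ler_wpM2r ?expR_ge0 //; case: (all _ _); rewrite ?mulr1 ?mulr0 //.
have h1 := expR_ge1Dx (lam * jump_time p.2 n).
rewrite expRN ler_pdivrMr ?expR_gt0 // -ler_pdivrMl //.
rewrite ler_pdivrMr // in hn.
have h2 : B / e <= lam * jump_time p.2 n.
  rewrite ler_pdivrMr //; nra.
rewrite mulrC; lra.
Qed.

Lemma stopped_ge0 t : (0 <= stopped a nb theta lam t)%E.
Proof. by apply: nneseries_ge0 => n _ _; rewrite lee_fin. Qed.

Lemma measurable_stopped : measurable_fun setT (stopped a nb theta lam).
Proof.
apply: ge0_emeasurable_sum => [n t _ _|n _]; first by rewrite lee_fin.
by apply/measurable_EFinP; exact: mstop.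
Qed.

(** Mass is conserved: the walk is stopped by the exponential clock unless it
    discovers a trap first. On the support of [F] the origin is no trap
    itself, so that excluding it makes no difference. *)
Lemma integral_stopped : (\int[P]_t ((F t)%:E * stopped a nb theta lam t) +
  \int[Q]_p ((F p.1)%:E * at_first_trap nb theta [::] (fun w j => expR (- (lam * `|jump_time w j|))) p) =
  \int[P]_t (F t)%:E)%E.
Proof.
pose X := at_first_trap nb theta [:: 0] (fun w j => expR (- (lam * `|jump_time w j|))).
have e0 (w : trajectory R d) j : 0 <= expR (- (lam * `|jump_time w j|)) by exact: expR_ge0.
have -> : (\int[Q]_p ((F p.1)%:E * at_first_trap nb theta [::] (fun w j => expR (- (lam * `|jump_time w j|))) p) =
    \int[Q]_p ((F p.1)%:E * X p))%E.
  apply: eq_integral => p _; have [->|/F_supp t0] := eqVneq (F p.1) 0; first by rewrite !mul0e.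
  congr (_ * _)%E; apply: eq_eseriesr => j _; rewrite (@first_trap_exclude _ _ nb theta [:: 0]) //.
  by rewrite /= t0.
have hitE n : (\int[P]_t (F t * hit n t)%:E = \int[Q]_p ((F p.1)%:E *
    ((first_trap nb theta [:: 0%R] p.1 (path_of p.2 n.+1))%:R * expR (- (lam * `|jump_time p.2 n|)))%:E))%E.
  rewrite -(annealed_hop (h := fun s t => (first_trap nb theta [:: 0] t s)%:R)) //.
  - by apply: eq_integral => p _; rewrite -EFinM mulrA.
  - by move=> s; apply: measurable_bool_natr; exact: measurable_first_trap.
  - by move=> t y; apply: measurable_bool_natr; apply: measurable_neg; exact: measurable_alive.
  - by move=> s t; rewrite -natrM mulnb.
have mft n : measurable_fun setT (fun p : environment R d * trajectory R d =>
    ((first_trap nb theta [:: 0] p.1 (path_of p.2 n.+1))%:R * expR (- (lam * `|jump_time p.2 n|)))%:E : \bar R).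
  apply/measurable_EFinP; apply: measurable_funM.
    apply: (measurable_fun_path n.+1 (h := fun s t => ((first_trap nb theta [:: 0] t s)%:R : R))).
    by move=> s; apply: measurable_bool_natr; exact: measurable_first_trap.
  apply: measurableT_comp => //; apply: measurableT_comp => //.
  apply: measurable_funM => //; apply: measurableT_comp => //.
  exact: measurableT_comp (measurable_jump_time n) measurable_snd.
have mF1 : measurable_fun setT (fun p : environment R d * trajectory R d => (F p.1)%:E : \bar R).
  by apply/measurable_EFinP; exact: (measurableT_comp mF measurable_fst).
have XE : (\int[Q]_p ((F p.1)%:E * X p) = \sum_(0 <= n <oo) \int[P]_t (F t * hit n t)%:E)%E.
  under eq_eseriesr => n _ do rewrite hitE.
  rewrite -integral_nneseries //; last 2 first.
  - by move=> n; apply: emeasurable_funM.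
  - by move=> n p _; rewrite mule_ge0 // lee_fin // mulr_ge0.
  by apply: eq_integral => p _; rewrite -nneseriesZl // => n _; rewrite lee_fin mulr_ge0.
have SE : (\int[P]_t ((F t)%:E * stopped a nb theta lam t) =
    \sum_(0 <= n <oo) \int[P]_t (F t * stop n t)%:E)%E.
  rewrite -integral_nneseries //; last 2 first.
  - by move=> n; apply/measurable_EFinP; apply: measurable_funM => //; exact: mstop.
  - by move=> n t _; rewrite lee_fin mulr_ge0.
  by apply: eq_integral => t _; rewrite -nneseriesZl // => n _; rewrite lee_fin.
have st0 n : (0 <= \int[P]_t (F t * stop n t)%:E)%E.
  by apply: integral_ge0 => t _; rewrite lee_fin mulr_ge0.
have ht0 n : (0 <= \int[P]_t (F t * hit n t)%:E)%E.
  by apply: integral_ge0 => t _; rewrite lee_fin mulr_ge0.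
have FB t : `|F t| <= B by have /andP[? ?] := F0B t; rewrite ger0_norm.
have intF : P.-integrable setT (EFin \o F) by exact: (bounded_integrable P mF FB).
have finF := integrable_fin_num measurableT intF.
rewrite XE SE -nneseriesD //.
have mE (f : environment R d -> R) : measurable_fun setT f ->
    measurable_fun setT (fun t => (F t * f t)%:E : \bar R).
  by move=> mf; apply/measurable_EFinP; exact: measurable_funM.
have addE (f g : environment R d -> R) : measurable_fun setT f -> measurable_fun setT g ->
    (forall t, 0 <= f t) -> (forall t, 0 <= g t) ->
    (\int[P]_t (F t * f t)%:E + \int[P]_t (F t * g t)%:E = \int[P]_t (F t * (f t + g t))%:E)%E.
  move=> mf mg f0 g0; rewrite -ge0_integralD //; try exact: mE.
  - by apply: eq_integral => t _; rewrite -EFinD mulrDr.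
  - by move=> t _; rewrite lee_fin mulr_ge0.
  - by move=> t _; rewrite lee_fin mulr_ge0.
have part N : (\sum_(0 <= n < N) (\int[P]_t (F t * stop n t)%:E + \int[P]_t (F t * hit n t)%:E) +
    \int[P]_t (F t * run N t)%:E = \int[P]_t (F t)%:E)%E.
  elim: N => [|N IH].
    by rewrite big_geq // add0e; apply: eq_integral => t _; rewrite mulr1.
  rewrite big_nat_recr // -[RHS]IH -addeA; congr (_ + _)%E.
  have msh : measurable_fun setT (fun t => stop N t + hit N t) by apply: measurable_funD; [exact: mstop | exact: mhit].
  rewrite (addE _ _ (mstop N) (mhit N)) // (addE _ _ msh (mrun N.+1)) //; last first.
    by move=> t; exact: addr_ge0.
  by apply: eq_integral => t _; rewrite (run_split N t).
apply/cvg_lim => //.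
have -> : (fun N => \sum_(0 <= n < N) (\int[P]_t (F t * stop n t)%:E + \int[P]_t (F t * hit n t)%:E))%E =
   (fun N => \int[P]_t (F t)%:E - \int[P]_t (F t * run N t)%:E)%E.
  apply/funext => N; rewrite -(part N) addeK //.
  apply: integrable_fin_num => //; apply: (bounded_integrable P (B := B)); first exact: measurable_funM.
  move=> t; have /andP[x0 x1] := F0B t; rewrite ger0_norm ?mulr_ge0 // (le_trans _ x1) // ler_piMr //.
  have := sum_stop N t; have : 0 <= \sum_(0 <= n < N) stop n t by apply: sumr_ge0.
  by have : 0 <= \sum_(0 <= n < N) hit n t by [apply: sumr_ge0]; move=> ? ? ?; lra.
rewrite -[X in _ --> X]sube0; apply: cvgeB => //; first by rewrite fin_num_adde_defl.
  exact: cvg_cst.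
exact: integral_run_cvg0.
Qed.

End Stopped.

(** * Letting the depth of the traps tend to infinity *)

Section TrapLimit.
Context {R : realType} {d : nat}.
Variables (a : R) (nb : seq (site d)) (c : R).
Hypothesis a_ge0 : 0 <= a.
Hypothesis nb_order : ball_order nb.
Hypothesis d_gt0 : (0 < d)%N.
Hypothesis c_gt0 : 0 < c.
Variable P : probability (environment R d) R.
Hypothesis P_iid : iid_coordinates P.
Hypothesis P_ge1 : {ae P, forall t, 1 <= t 0}.
Variable K : R.-pker (environment R d) ~> (trajectory R d).
Hypothesis K_law : forall t : environment R d, (forall y, 0 < t y) ->
  ctmc_law (jump_rate a t) 0 (K t).
Hypothesis c_speed : {ae annealed P K, forall p,
  (discovered p.2 t * (t^-1)%:E)%E @[t --> +oo] --> c%:E}.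
Variable theta : nat -> R.
Hypothesis theta_infty : theta k @[k --> \oo] --> +oo.
Local Notation p k := (trap_probability P (theta k)).
Hypothesis p_gt0 : forall k, 0 < p k.
Hypothesis p_cvg0 : p k @[k --> \oo] --> 0.
Implicit Types (t : environment R d) (x y z : site d).
Local Notation E := (steps nb).
Local Notation Q := (annealed P K).

Variables (M V V' : R) (g : punctured_environment R d -> R).
Hypothesis M_ge0 : 0 <= M.
Hypothesis V_gt0 : 0 < V.
Hypothesis VV' : V <= V'.
Hypothesis g01 : forall u, 0 <= g u <= 1.
Hypothesis mg : measurable_fun setT g.
(** Where [g] does not vanish, the environment is bounded near the origin. This
    bounds the jump rates there, and excludes a second trap within distance [2]
    of the first one. *)
Hypothesis g_tame : forall u, g u != 0 ->
  forall z : {z : site d | z != 0}, (l1norm (val z) <= 2)%N -> u z <= M.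

Let g_ge0 u : 0 <= g u. Proof. by have /andP[] := g01 u. Qed.

Lemma ae_jump_time_infty : {ae Q, forall q, jump_time q.2 j @[j --> \oo] --> +oo}.
Proof.
apply: filterS2 (ae_increasing nb_order d_gt0 P_iid P_ge1 K_law) c_speed => q wi sp.
by apply/cvgryPge => A; exact: jump_time_infty c_gt0 wi sp A.
Qed.

Lemma tame_bound t z : g (off_origin t) != 0 -> z != 0 -> (l1norm z <= 2)%N -> t z <= M.
Proof. move=> gt z0 z2; have := g_tame gt (z := exist (fun z : site d => z != 0) z z0).
by apply. Qed.

(** ** Uniform bounds *)

(** The power of a negative number is [1], whence the summand [1]. *)
Lemma powR_bound (x y : R) : x <= y -> 0 <= y -> x `^ a <= 1 + y `^ a.
Proof.
move=> xy y0; have [x0|x0] := leP 0 x.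
  by rewrite (le_trans (ge0_ler_powR _ _ _ xy)) // lerDr.
rewrite (le_trans _ (_ : 1 <= _)) // ?lerDl ?powR_ge0 //.
rewrite /powR lt_eqF // ln0 ?mulr0 ?expR0 // ltW //.
Qed.

Definition rate_bound : R := \sum_(e <- E) (1 + (V' * M) `^ a).

Lemma total_rate_bound t : V <= t 0 <= V' -> g (off_origin t) != 0 ->
  total_rate E (jump_rate a t) 0 <= rate_bound.
Proof.
move=> /andP[Vt tV] gt; rewrite /total_rate /rate_bound !big_seq; apply: ler_sum => e eE.
rewrite /jump_rate (neighboursD nb_order) eE add0r; apply: powR_bound; last first.
  by rewrite mulr_ge0 // (le_trans _ VV') // ltW.
have tM : t e <= M.
  have e1 : l1norm e = 1%N by apply/eqP; rewrite -(mem_steps nb_order).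
  by apply: tame_bound; rewrite -?l1norm_eq0 ?e1.
have [te|te] := leP 0 (t e); first by rewrite ler_pM // (le_trans _ Vt) // ltW.
rewrite (@le_trans _ _ 0) ?mulr_ge0 //; last by rewrite (le_trans _ VV') // ltW.
by rewrite pmulr_rle0 ?ltW // (lt_le_trans V_gt0).
Qed.

Definition escape_bound : R :=
  \sum_(z <- E) (1 + \sum_(e <- E | z + e != 0) (M * M) `^ a).

Lemma escape_const_bound t : (forall y, 1 <= t y) -> g (off_origin t) != 0 ->
  escape_const a nb t <= escape_bound.
Proof.
move=> t1 gt; rewrite /escape_const /escape_bound !big_seq; apply: ler_sum => z zE.
have z1 : l1norm z = 1%N by apply/eqP; rewrite -(mem_steps nb_order).
have z0 : z != 0 by rewrite -l1norm_eq0 z1.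
have tM y : y != 0 -> (l1norm y <= 2)%N -> t y <= M by exact: tame_bound.
have ta : 1 <= t z `^ a.
  have : 1 `^ a <= t z `^ a by rewrite ge0_ler_powR ?nnegrE // (le_trans _ (t1 z)).
  by rewrite powR1.
rewrite ler_pdivrMr; last exact: lt_le_trans ta.
apply: (@le_trans _ _ (1 + \sum_(e <- E | z + e != 0) (M * M) `^ a)); last first.
  by rewrite ler_peMr // addr_ge0 // sumr_ge0 // => *; exact: powR_ge0.
rewrite lerD2l big_seq_cond [leRHS]big_seq_cond; apply: ler_sum => e /andP[eE ze].
have e1 : l1norm e = 1%N by apply/eqP; rewrite -(mem_steps nb_order).
rewrite /jump_rate (neighboursD nb_order) eE ge0_ler_powR ?nnegrE ?mulr_ge0 //.
- by rewrite (le_trans _ (t1 z)).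
- by rewrite (le_trans _ (t1 (z + e))).
apply: ler_pM; rewrite ?(le_trans _ (t1 _)) // tM ?z1 //.
by rewrite (leq_trans (ler_l1normD _ _)) // z1 e1.
Qed.

(** A lower bound for [return_ratio] that is uniform in the environment; for
    [a > 0] it tends to [1] as [V] tends to infinity. *)
Definition min_return : R := V `^ a / (V `^ a + escape_bound).

Lemma escape_bound_ge0 : 0 <= escape_bound.
Proof.
by apply: sumr_ge0 => z _; rewrite addr_ge0 // sumr_ge0 // => *; exact: powR_ge0.
Qed.

Lemma min_return01 : 0 < min_return <= 1.
Proof.
have V0 := powR_gt0 a V_gt0; have e0 := escape_bound_ge0.
by rewrite divr_gt0 ?ltr_wpDr //= ler_pdivrMr ?mul1r ?lerDl // ltr_wpDr.
Qed.

Lemma le_return_ratio t : (forall y, 1 <= t y) -> V <= t 0 -> g (off_origin t) != 0 ->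
  min_return <= return_ratio a nb t.
Proof.
move=> t1 Vt gt; have V0 := powR_gt0 a V_gt0; have e0 := escape_const_ge0 a nb t.
have eb := escape_const_bound t1 gt.
have Va : V `^ a <= t 0 `^ a by rewrite ge0_ler_powR ?nnegrE // ?(le_trans _ Vt) // ltW.
rewrite /min_return /return_ratio ler_pdivrMr ?ltr_wpDr ?escape_bound_ge0 //.
rewrite mulrAC ler_pdivlMr ?ltr_wpDr // ?(lt_le_trans V0) //.
set x := V `^ a in V0 Va *; set y := t 0 `^ a in Va *; nra.
Qed.

(** ** Convergence of the Green functions *)

Definition inv_green0 t : R := (fine (green0 a nb t))^-1.

Variable s : R.
Hypothesis s_gt0 : 0 < s.
Local Notation lam k := (laplace_rate P theta s k).
Local Notation X := (trap_laplace nb P theta s).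
Local Notation kappa := ((1 + s / c)^-1).

Let lam_gt0 k : 0 < lam k. Proof. by rewrite mulr_gt0. Qed.

Definition inv_green k t : R := (fine (killed_green a nb (theta k) (lam k) t))^-1.

Lemma measurable_inv_green k : measurable_fun setT (inv_green k).
Proof.
apply: measurable_invr => [|t].
  apply: measurableT_comp => //; apply: measurable_green_sum => // [|z]; first exact: ltW.
  exact: measurable_alive.
by rewrite fine_ge0 // green_sum_ge0 // => *; [exact: jump_rate_ge0 | exact: ltW].
Qed.

Lemma measurable_inv_green0 : measurable_fun setT inv_green0.
Proof.
apply: measurable_invr => [|t].
  apply: measurableT_comp => //; exact: measurable_green_sum.
by rewrite fine_ge0 // green_sum_ge0 // => *; exact: jump_rate_ge0.
Qed.

(** The walk spends at least the first holding time at its starting point. *)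
Lemma le_green_sum t l (A : pred (site d)) : 0 <= l -> A 0 ->
  (((l + total_rate E (jump_rate a t) 0)^-1)%:E <= green_sum E (jump_rate a t) l A 0%R 0%R)%E.
Proof.
move=> l0 A0; have q0 := jump_rate_ge0 a t.
rewrite /green_sum (nneseriesD1 (n := 0%N)) //; last first.
  by move=> n _; rewrite lee_fin green_term_ge0.
rewrite {1}/green_term /= A0 eqxx leeDl // nneseries_ge0 // => n _ _.
by rewrite lee_fin green_term_ge0.
Qed.

Lemma inv_green_sum_bound t l (A : pred (site d)) : 0 <= l -> A 0 ->
  0 <= (fine (green_sum E (jump_rate a t) l A 0 0))^-1 <= l + total_rate E (jump_rate a t) 0.
Proof.
move=> l0 A0; have q0 := jump_rate_ge0 a t.
have Q0 : 0 <= total_rate E (jump_rate a t) 0 by exact: total_rate_ge0.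
have [m0|m0] := eqVneq (l + total_rate E (jump_rate a t) 0) 0.
  rewrite (_ : green_sum _ _ _ _ _ _ = 0%E) ?invr0 ?m0 ?lexx //.
  apply: eseries0 => -[|n] _ _; first by rewrite /green_term /= A0 eqxx m0 invr0.
  by rewrite green_termS big1 ?mulr0 // => e _; rewrite /step m0 invr0 mulr0 mul0r.
have mp : 0 < l + total_rate E (jump_rate a t) 0 by rewrite lt_neqAle eq_sym m0 addr_ge0.
have G0 : (0 <= green_sum E (jump_rate a t) l A 0%R 0%R)%E by exact: green_sum_ge0.
have G1 := le_green_sum t l0 A0.
rewrite invr_ge0 fine_ge0 //=.
case: (green_sum _ _ _ _ _ _) G0 G1 => [r|_ _|//] /=; last by rewrite invr0 ltW.
rewrite !lee_fin => r0 rG; have rp : 0 < r by rewrite (lt_le_trans _ rG) // invr_gt0.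
by rewrite -[leRHS]invrK lef_pV2 // posrE // invr_gt0.
Qed.

Lemma alive_origin k t : M < theta k -> g (off_origin t) != 0 -> alive nb (theta k) [:: 0] t 0.
Proof.
move=> Mk gt; apply/allP => y; rewrite (mem_around nb_order) subr0 inE => y1.
case: (eqVneq y 0) => //= y0; apply: le_lt_trans Mk.
by apply: tame_bound => //; exact: leq_trans y1 _.
Qed.

Lemma cvg_inv_green t : (forall y, 0 < t y) -> inv_green k t @[k --> \oo] --> inv_green0 t.
Proof.
move=> t0; have q0 := jump_rate_ge0 a t.
have Q0 x : 0 < total_rate E (jump_rate a t) x by exact: total_jump_rate_gt0.
have l0 : lam k @[k --> \oo] --> (0 : R) by rewrite -(mulr0 s); apply: cvgMr.
have al x : \forall k \near \oo, alive nb (theta k) [:: 0] t x.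
  have := near_all_alive nb theta_infty t [:: x]; apply: filterS => k /= /andP[+ _].
  by apply: sub_all => y /= ->; rewrite orbT.
have cG := cvg_green_sum q0 Q0 (x := 0) (y := 0) (fun k => ltW (lam_gt0 k)) l0 al.
have G1 : (((0 + total_rate E (jump_rate a t) 0)^-1)%:E <= green0 a nb t)%E.
  exact: (@le_green_sum t 0 predT).
have fin k : killed_green a nb (theta k) (lam k) t = (fine (killed_green a nb (theta k) (lam k) t))%:E.
  by rewrite fineK // killed_green_fin.
rewrite /inv_green0; rewrite -/(green0 a nb t) in cG.
case: (green0 a nb t) G1 cG => [r|_|//] /=.
  rewrite lee_fin add0r => rG /fine_cvgP[_ h]; apply: cvgV.
    by rewrite gt_eqF // (lt_le_trans _ rG) // invr_gt0.
  exact: h.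
move=> h; rewrite invr0; apply/gtr0_cvgV0.
  have /cvgeyPgt/(_ 0) := h; apply: filterS => k; rewrite -/(killed_green a nb (theta k) (lam k) t) fin lte_fin => h'.
  exact: h'.
apply/cvgryPge => A; have /cvgeyPge/(_ A) := h; apply: filterS => k.
by rewrite -/(killed_green a nb (theta k) (lam k) t) fin lee_fin.
Qed.

Local Notation Iv := (`[V, V']%classic : set R).

(** The inverse Green function undoes the factor [killed_green] in
    [stopped_le] and [le_stopped]. *)
Definition weight k t : R := \1_Iv (t 0) * g (off_origin t) * inv_green k t.
Definition weight0 t : R := \1_Iv (t 0) * g (off_origin t) * inv_green0 t.

Let mIg : measurable_fun setT (fun t : environment R d => \1_Iv (t 0) * g (off_origin t)).
Proof.
apply: measurable_funM.
  apply: (measurableT_comp (f := (\1_Iv : R -> R))); first exact: measurable_indic.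
  exact: measurable_coordinate.
by apply: (measurableT_comp mg); exact: measurable_off_origin.
Qed.

Let Ig01 t : 0 <= \1_Iv (t 0) * g (off_origin t) <= 1.
Proof.
have /andP[h0 h1] := g01 (off_origin t).
by rewrite indicE; case: (_ \in _); rewrite ?mul1r ?mul0r ?h0 ?lexx ?ler01.
Qed.

Lemma weight_supp t : \1_Iv (t 0) * g (off_origin t) != 0 -> V <= t 0 <= V' /\ g (off_origin t) != 0.
Proof.
rewrite indicE mem_setE in_itv /= mulf_eq0 negb_or => /andP[h ->]; split => //.
by move: h; case: (V <= t 0 <= V') => //; rewrite eqxx.
Qed.

Lemma weight01 k t : M < theta k -> lam k <= 1 -> 0 <= weight k t <= 1 + rate_bound.
Proof.
move=> Mk l1; have /andP[e0 e1] := Ig01 t.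
have rb0 : 0 <= rate_bound by apply: sumr_ge0 => e _; rewrite addr_ge0 ?powR_ge0.
rewrite /weight; have [->|/weight_supp[Vt gt]] := eqVneq (\1_Iv (t 0) * g (off_origin t)) 0.
  by rewrite mul0r lexx addr_ge0.
have /andP[i0 i1] := inv_green_sum_bound t (ltW (lam_gt0 k)) (alive_origin Mk gt).
have tb := total_rate_bound Vt gt.
rewrite mulr_ge0 //= -[leRHS]mul1r ler_pM //.
by apply: le_trans i1 _; rewrite lerD.
Qed.

Lemma weight0_01 t : 0 <= weight0 t <= 1 + rate_bound.
Proof.
have /andP[e0 e1] := Ig01 t.
have rb0 : 0 <= rate_bound by apply: sumr_ge0 => e _; rewrite addr_ge0 ?powR_ge0.
rewrite /weight0; have [->|/weight_supp[Vt gt]] := eqVneq (\1_Iv (t 0) * g (off_origin t)) 0.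
  by rewrite mul0r lexx addr_ge0.
have /andP[i0 i1] := inv_green_sum_bound t (lexx 0) (A := predT) isT.
have tb := total_rate_bound Vt gt.
rewrite mulr_ge0 //= -[leRHS]mul1r ler_pM //.
by apply: le_trans i1 _; rewrite lerD.
Qed.

Lemma measurable_weight k : measurable_fun setT (weight k).
Proof. by apply: measurable_funM => //; exact: measurable_inv_green. Qed.

Lemma measurable_weight0 : measurable_fun setT weight0.
Proof. by apply: measurable_funM => //; exact: measurable_inv_green0. Qed.

Lemma cvg_weight t : (forall y, 0 < t y) -> weight k t @[k --> \oo] --> weight0 t.
Proof. by move=> t0; apply: cvgMr; exact: cvg_inv_green. Qed.

(** By [integral_stopped] this is the mean of [weight k * stopped]. *)
Definition stopped_mean k : R :=
  \int[P]_t weight k t - \int[Q]_q (weight k q.1 * X k q).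

Lemma ae_fst (B : set (environment R d)) : measurable B -> {ae P, forall t, B t} ->
  {ae Q, forall q, B q.1}.
Proof.
move=> mB hB; apply: (ae_annealed (B := [set q | B q.1])).
  by rewrite -[X in measurable X]setTI; exact: measurable_fst.
by apply: filterS hB => t Bt; exact: aeW.
Qed.

Lemma measurable_positive : measurable [set t : environment R d | forall y, 0 < t y].
Proof.
rewrite (_ : [set _ | _] = \bigcap_(k in [set: nat]) (oapp (fun y : site d => [set t : environment R d | 0 < t y]) setT (pickle_inv k))).
  apply: bigcapT_measurable => k; case: pickle_inv => //= y.
  rewrite (_ : [set _ | _] = (fun t : environment R d => t y) @^-1` `]0, +oo[).
    by rewrite -[X in measurable X]setTI; exact: measurable_coordinate.
  by apply/seteqP; split => t /=; rewrite in_itv /= andbT.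
apply/seteqP; split => t h.
  by move=> k _; case: pickle_inv => //= y; exact: h.
by move=> y; have := h (pickle y) I; rewrite pickleK_inv.
Qed.

Let near_bounds : \forall k \near \oo, M < theta k /\ V' < theta k /\ lam k <= 1.
Proof.
have l0 : lam k @[k --> \oo] --> (0 : R) by rewrite -(mulr0 s); apply: cvgMr.
have h1 : \forall k \near \oo, lam k < 1 by apply: (cvgr_lt _ l0).
have /cvgryPgt h := theta_infty.
by apply: filterS3 h1 (h M) (h V') => k /ltW.
Qed.

(** The weights converge, and [X k] decouples from their limit. *)
Lemma stopped_mean_cvg :
  stopped_mean k @[k --> \oo] --> (1 - kappa) * \int[P]_t weight0 t.
Proof.
have B0 : 0 <= 1 + rate_bound by have /andP[h1 h2] := weight0_01 (fun=> 0); exact: le_trans h2.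
have w0B t : `|weight0 t| <= 1 + rate_bound.
  by have /andP[h1 h2] := weight0_01 t; rewrite ger0_norm.
have wB : \forall k \near \oo, forall t, `|weight k t| <= 1 + rate_bound.
  apply: filterS near_bounds => k [Mk [_ l1]] t.
  by have /andP[h1 h2] := weight01 t Mk l1; rewrite ger0_norm.
have mw := measurable_weight; have mw0 := measurable_weight0.
have mX := measurable_trap_laplace nb P theta s.
have X01 := trap_laplace01 nb p_gt0 s_gt0.
have mwf k : measurable_fun setT (fun q : environment R d * trajectory R d => weight k q.1).
  exact: (measurableT_comp (mw k) measurable_fst).
have mw0f : measurable_fun setT (fun q : environment R d * trajectory R d => weight0 q.1).
  exact: (measurableT_comp mw0 measurable_fst).
have aeP : {ae P, forall t, weight k t @[k --> \oo] --> weight0 t}.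
  by apply: filterS (ae_positive P_iid P_ge1) => t; exact: cvg_weight.
have aeQ : {ae Q, forall q, weight k q.1 @[k --> \oo] --> weight0 q.1}.
  apply: filterS (ae_fst measurable_positive (ae_positive P_iid P_ge1)) => q.
  exact: cvg_weight.
have c1 := near_bounded_Rcvg mw mw0 wB w0B aeP.
have IQ : \int[Q]_q weight0 q.1 = \int[P]_t weight0 t.
  congr fine; rewrite (integral_annealed_fst P K (g := fun t => (weight0 t)%:E)) //.
  - by move=> t; rewrite lee_fin; have /andP[] := weight0_01 t.
  - by apply/measurable_EFinP; exact: mw0.
have dec : \int[Q]_q (weight0 q.1 * X k q) @[k --> \oo] --> kappa * \int[P]_t weight0 t.
  rewrite -IQ.
  exact: (laplace_decouples nb_order d_gt0 c_gt0 P_iid P_ge1 K_law c_speed theta_infty p_gt0 p_cvg0 s_gt0 mw0 weight0_01).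
have gap : \int[Q]_q ((weight k q.1 - weight0 q.1) * X k q) @[k --> \oo] --> (0 : R).
  rewrite -[X in _ --> X](_ : \int[Q]_q (cst 0 q) = 0); last by rewrite Rintegral_cst // mul0r.
  apply: (near_bounded_Rcvg (B := (1 + rate_bound) + (1 + rate_bound))) => //.
  - by move=> k; apply: measurable_funM => //; exact: measurable_funB.
  - apply: filterS wB => k wk q; have /andP[x0 x1] := X01 k q.
    rewrite normrM (ger0_norm x0); apply: le_trans (ler_piMr (normr_ge0 _) x1) _.
    by apply: le_trans (ler_normB _ _) _; exact: lerD (wk q.1) (w0B q.1).
  - by move=> q; rewrite normr0 addr_ge0.
  apply: filterS aeQ => q cq; apply/cvgr0Pnorm_le => e e0.
  have /cvgrPdist_le/(_ _ e0) := cq; apply: filterS => k hk; have /andP[x0 x1] := X01 k q.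
  by rewrite normrM (ger0_norm x0) (le_trans _ hk) // distrC ler_piMr.
have -> : (1 - kappa) * \int[P]_t weight0 t = \int[P]_t weight0 t - (kappa * \int[P]_t weight0 t + 0).
  by rewrite addr0 mulrBl mul1r.
apply: cvg_trans (cvgB c1 (cvgD dec gap)); apply: near_eq_cvg.
apply: filterS wB => k wk; rewrite -[RHS]/(_ - _); congr (_ - _).
rewrite -[LHS]RintegralD //; last 2 first.
- apply: (bounded_integrable Q (B := 1 + rate_bound)); first exact: measurable_funM.
  by move=> q; have /andP[x0 x1] := X01 k q; rewrite normrM (ger0_norm x0) (le_trans _ (w0B q.1)) // ler_piMr.
- apply: (bounded_integrable Q (B := (1 + rate_bound) + (1 + rate_bound))).
    by apply: measurable_funM => //; exact: measurable_funB.
  move=> q; have /andP[x0 x1] := X01 k q.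
  rewrite normrM (ger0_norm x0); apply: le_trans (ler_piMr (normr_ge0 _) x1) _.
  by apply: le_trans (ler_normB _ _) _; exact: lerD (wk q.1) (w0B q.1).
by apply: eq_Rintegral => q _; rewrite -mulrDl addrC subrK.
Qed.

Local Notation TE k := (trap_expectation nb P K (theta k) (lam k) g).

(** Multiplied by the weight, [stopped_le] and [le_stopped] become bounds for
    the integral in [trap_expectation_reach]. The trap probability there is
    [s^-1 * lam k]. *)
Lemma stopped_mean_bounds : \forall k \near \oo,
  ((s^-1 * stopped_mean k)%:E <= P [set t | Iv (t 0%R)] * TE k)%E /\
  (min_return%:E * (P [set t | Iv (t 0%R)] * TE k) <= (s^-1 * stopped_mean k)%:E)%E.
Proof.
apply: filterS near_bounds => k [Mk [V'k l1]].
have tr := trap_expectation_reach nb_order d_gt0 P_iid P_ge1 K_law (theta k) (lam_gt0 k) g_ge0 mg (measurable_itv `[V, V']).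
have w0B t : 0 <= weight k t <= 1 + rate_bound by exact: weight01.
have w0 t : 0 <= weight k t by have /andP[] := w0B t.
have w_supp t : weight k t != 0 -> t 0 < theta k.
  rewrite /weight mulf_eq0 negb_or => /andP[/weight_supp[/andP[_ h] _] _].
  exact: le_lt_trans h V'k.
have := integral_stopped nb_order d_gt0 P_iid P_ge1 K_law ae_jump_time_infty (lam_gt0 k)
  (measurable_weight k) w0B w_supp.
under [X in (_ + X)%E]eq_integral do rewrite trap_laplace_fin -EFinM.
have iw : P.-integrable setT (EFin \o weight k).
  apply: (bounded_integrable P (B := 1 + rate_bound)); first exact: measurable_weight.
  by move=> t; have /andP[h1 h2] := w0B t; rewrite ger0_norm.
have iwX : Q.-integrable setT (EFin \o (fun q => weight k q.1 * X k q)).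
  apply: (bounded_integrable Q (B := 1 + rate_bound)).
    apply: measurable_funM; first exact: (measurableT_comp (measurable_weight k) measurable_fst).
    exact: measurable_trap_laplace.
  move=> q; have /andP[h1 h2] := w0B q.1.
  have /andP[x0 x1] := trap_laplace01 nb p_gt0 s_gt0 k q.
  by rewrite normrM (ger0_norm x0) (ger0_norm h1) (le_trans _ h2) // ler_piMr.
move=> st; have SE : (\int[P]_t ((weight k t)%:E * stopped a nb (theta k) (lam k) t) = (stopped_mean k)%:E)%E.
  rewrite /stopped_mean EFinB /Rintegral !fineK; try exact: integrable_fin_num.
  by rewrite -st addeK //; exact: integrable_fin_num iwX.
have pl : p k = s^-1 * lam k by rewrite mulrA mulVf ?mul1r ?gt_eqF.
pose T := total_reach a nb (theta k) (lam k); pose St := stopped a nb (theta k) (lam k).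
pose e t := \1_Iv (t 0) * g (off_origin t).
have e0 t : 0 <= e t by have /andP[] := Ig01 t.
have T0 t : (0 <= T t)%E by apply: total_reach_ge0.
have S0 t : (0 <= St t)%E by apply: stopped_ge0.
have mT : measurable_fun setT T by exact: (measurable_total_reach a nb (theta k) (lam_gt0 k)).
have mS : measurable_fun setT St by exact: (measurable_stopped a nb (theta k) (lam_gt0 k)).
have meT : measurable_fun setT (fun t => (e t)%:E * T t)%E.
  by apply: emeasurable_funM => //; apply/measurable_EFinP.
have eT0 t : (0 <= (e t)%:E * T t)%E by rewrite mule_ge0 // lee_fin.
have mwS : measurable_fun setT (fun t => (weight k t)%:E * St t)%E.
  by apply: emeasurable_funM => //; apply/measurable_EFinP; exact: measurable_weight.
have wS0 t : (0 <= (weight k t)%:E * St t)%E by rewrite mule_ge0 // lee_fin.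
have l0 := ltW (lam_gt0 k).
pose G t := fine (killed_green a nb (theta k) (lam k) t).
have GE t : killed_green a nb (theta k) (lam k) t = (G t)%:E.
  by rewrite /G fineK // killed_green_fin.
have G0 t : 0 <= G t.
  by rewrite /G fine_ge0 // green_sum_ge0 // => *; exact: jump_rate_ge0.
have rG t : 0 <= inv_green k t * G t <= 1.
  rewrite /inv_green -/(G t); have [->|n0] := eqVneq (G t) 0; first by rewrite mulr0 lexx ler01.
  by rewrite mulVf // ler01 lexx.
have up t : ((weight k t)%:E * St t <= (lam k)%:E * ((e t)%:E * T t))%E.
  have h := stopped_le a nb_order (theta k) (lam_gt0 k) t; rewrite GE -/(T t) -/(St t) in h.
  apply: (@le_trans _ _ ((weight k t)%:E * ((lam k)%:E * (G t)%:E * T t))%E).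
    by apply: lee_wpmul2l => //; rewrite lee_fin.
  rewrite !muleA -!EFinM; apply: lee_wpmul2r => //; rewrite lee_fin.
  rewrite /weight -/(e t); have /andP[r0 r1] := rG t.
  have -> : e t * inv_green k t * lam k * G t = lam k * e t * (inv_green k t * G t) by ring.
  by rewrite ler_piMr // mulr_ge0.
have lo : {ae P, forall t, (min_return%:E * ((lam k)%:E * ((e t)%:E * T t)) <= (weight k t)%:E * St t)%E}.
  have := ae_coordinates_ge1 P_iid P_ge1; apply: filterS => t t1.
  have t0 y : 0 < t y by exact: lt_le_trans (t1 y).
  have [ez|] := eqVneq (e t) 0; first by rewrite ez !(mul0e, mule0).
  move=> /weight_supp[/andP[Vt tV'] gt].
  have nt : no_trap_around (theta k) t.
    by move=> z z0 z2; apply: le_lt_trans Mk; exact: tame_bound.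
  have h := le_stopped a nb_order (lam_gt0 k) t0 l1 nt; rewrite GE -/(T t) -/(St t) in h.
  have rr := le_return_ratio t1 Vt gt.
  have Gp : G t != 0.
    have := le_green_sum t l0 (alive_origin Mk gt).
    rewrite -/(killed_green a nb (theta k) (lam k) t) GE lee_fin => h'.
    rewrite gt_eqF // (lt_le_trans _ h') // invr_gt0 ltr_wpDr // total_rate_ge0 //.
    exact: jump_rate_ge0.
  have w0' := w0 t.
  apply: (@le_trans _ _ ((weight k t)%:E * ((return_ratio a nb t)%:E * ((lam k)%:E * (G t)%:E * T t)))%E); last first.
    by apply: lee_wpmul2l => //; rewrite lee_fin.
  rewrite !muleA -!EFinM; apply: lee_wpmul2r => //; rewrite lee_fin.
  have -> : weight k t * return_ratio a nb t * lam k * G t = return_ratio a nb t * lam k * e t.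
    rewrite /weight -/(e t) /inv_green -/(G t).
    rewrite (_ : _ * _ * _ = return_ratio a nb t * lam k * e t * ((G t)^-1 * G t)); last by ring.
    by rewrite mulVf // mulr1.
  by rewrite ler_wpM2r // ler_wpM2r.
have IE : (\int[P]_t ((lam k)%:E * ((e t)%:E * T t)) = (lam k)%:E * \int[P]_t ((e t)%:E * T t))%E.
  by rewrite ge0_integralZl_EFin.
have J0 : (0 <= \int[P]_t ((e t)%:E * T t))%E by exact: integral_ge0.
have s0 : 0 <= s^-1 by rewrite invr_ge0 ltW.
rewrite tr pl EFinM EFinM -SE; split.
  rewrite -muleA; apply: lee_wpmul2l; first by rewrite lee_fin.
  rewrite -IE; apply: ge0_le_integral => //.
  by apply: emeasurable_funM.
rewrite muleCA -muleA; apply: lee_wpmul2l; first by rewrite lee_fin.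
rewrite muleCA -IE -ge0_integralZl_EFin //; last 3 first.
- by move=> t _; rewrite mule_ge0 // lee_fin.
- by apply: emeasurable_funM.
- by have /andP[/ltW] := min_return01.
apply: ae_ge0_le_integral => //.
- by move=> t _; rewrite mule_ge0 ?lee_fin //; [have /andP[/ltW] := min_return01 | rewrite mule_ge0 // lee_fin].
- by apply: emeasurable_funM => //; apply: emeasurable_funM.
by apply: filterS lo.
Qed.

End TrapLimit.

(** * The first trap in the exploration *)

Section NthElement.
Implicit Types (A : set nat) (n k i : nat).

(** [nth_element A n] is by definition the element of [A] of rank [n]. *)
Definition rank A k : nat := \sum_(j < k.+1) `[< A j >].

Lemma rank0 A : rank A 0 = `[< A 0%N >] :> nat.
Proof. by rewrite /rank big_ord_recr big_ord0. Qed.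

Lemma rankS A k : rank A k.+1 = (rank A k + `[< A k.+1 >])%N.
Proof. by rewrite /rank big_ord_recr. Qed.

Lemma leq_rank A i k : (i <= k)%N -> (rank A i <= rank A k)%N.
Proof.
elim: k => [|k IH]; first by rewrite leqn0 => /eqP ->.
rewrite leq_eqVlt => /orP[/eqP -> //|]; rewrite ltnS => /IH h.
by rewrite rankS (leq_trans h) // leq_addr.
Qed.

Lemma ltn_rank A i k : A k -> (i < k)%N -> (rank A i < rank A k)%N.
Proof.
case: k => // k Ak; rewrite ltnS => ik.
by rewrite rankS (asboolT Ak) addn1 ltnS leq_rank.
Qed.

Lemma nth_elementE A k : A k -> nth_element A (rank A k) = k.
Proof.
move=> Ak; apply: xget_unique => // j [Aj]; rewrite -/(rank A j) => e.
by case: (ltngtP j k) => // jk; [have := ltn_rank Ak jk | have := ltn_rank Aj jk]; rewrite e ltnn.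
Qed.

Lemma nth_element_below A k n : (0 < n <= rank A k)%N ->
  exists i, [/\ (i <= k)%N, A i & rank A i = n].
Proof.
elim: k => [|k IH] /andP[n0 nk].
  exists 0%N; move: nk; rewrite rank0.
  case: asboolP => [A0|_]; last by rewrite leqNgt n0.
  by move=> n1; split => //; apply/eqP; rewrite eqn_leq n0 n1.
have [nk'|nk'] := leqP n (rank A k).
  by have [|i [ik Ai e]] := IH; [rewrite n0 | exists i; split => //; exact: leqW].
exists k.+1; move: nk; rewrite rankS; case: asboolP => [Ak|_]; last by rewrite addn0 leqNgt nk'.
by rewrite addn1 => h; split => //; apply/eqP; rewrite eqn_leq h andbT.
Qed.

End NthElement.

Section Discrete.
Context dX (X : measurableType dX).

(** Evaluation at an index that is random, with countably many values. *)
Lemma measurable_select (T : countType) dY (Y : measurableType dY) (K : X -> T) (G : T -> X -> Y) :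
  (forall x, measurable (K @^-1` [set x])) -> (forall x, measurable_fun setT (G x)) ->
  measurable_fun setT (fun p => G (K p) p).
Proof.
move=> mK mG _ B mB; rewrite setTI.
rewrite (_ : _ @^-1` B = \bigcup_(k in [set: nat]) oapp (fun x => K @^-1` [set x] `&` G x @^-1` B) set0 (choice.pickle_inv k)).
  apply: bigcupT_measurable => k; case: choice.pickle_inv => //= x.
  by apply: measurableI => //; rewrite -[X in measurable X]setTI; exact: mG.
apply/seteqP; split => p /=.
  by move=> h; exists (choice.pickle (K p)) => //; rewrite choice.pickleK_inv.
by move=> [k _]; case: choice.pickle_inv => //= x [<-].
Qed.

Lemma measurable_eq_fun (T : countType) (f g : X -> T) :
  (forall x, measurable (f @^-1` [set x])) -> (forall x, measurable (g @^-1` [set x])) ->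
  measurable [set p | f p = g p].
Proof.
move=> mf mg; rewrite (_ : [set p | _] = \bigcup_(k in [set: nat]) oapp (fun x => f @^-1` [set x] `&` g @^-1` [set x]) set0 (choice.pickle_inv k)).
  by apply: bigcupT_measurable => k; case: choice.pickle_inv => //= x; exact: measurableI.
apply/seteqP; split => p /=.
  by move=> h; exists (choice.pickle (f p)) => //; rewrite choice.pickleK_inv.
by move=> [k _]; case: choice.pickle_inv => //= x [-> ->].
Qed.

Lemma measurable_rank (A : X -> set nat) k n : (forall i, measurable [set p | A p i]) ->
  measurable [set p | rank (A p) k = n].
Proof.
move=> mA; elim: k n => [|k IH] n.
  have [->|[->|n2]] : n = 0%N \/ (n = 1%N \/ (1 < n)%N) by case: n => [|[|n]]; [left|right;left|right;right].
  - rewrite (_ : [set p | _] = ~` [set p | A p 0%N]); first exact: measurableC.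
    by apply/seteqP; split => p; rewrite /= rank0; case: asboolP.
  - rewrite (_ : [set p | _] = [set p | A p 0%N]) //.
    by apply/seteqP; split => p; rewrite /= rank0; case: asboolP.
  - rewrite (_ : [set p | _] = set0) //; apply/seteqP; split => p //=.
    by rewrite rank0 => e; move: n2; rewrite -e; case: asboolP.
rewrite (_ : [set p | _] = ([set p | rank (A p) k = n] `&` ~` [set p | A p k.+1]) `|`
   (if n is n'.+1 then [set p | rank (A p) k = n'] `&` [set p | A p k.+1] else set0)).
  apply: measurableU; first by apply: measurableI => //; exact: measurableC.
  by case: n => // n; exact: measurableI.
apply/seteqP; split => p /=; rewrite rankS; case: asboolP => Ak /=.
- by rewrite addn1 => <-; right.
- by rewrite addn0 => ->; left.
- by case=> [[]//|]; case: n => // n [-> _]; rewrite addn1.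
- by rewrite addn0; case=> [[]//|]; case: n => // n [].
Qed.

Lemma measurable_nth_element (A : X -> set nat) n k : (forall i, measurable [set p | A p i]) ->
  measurable ((fun p => nth_element (A p) n) @^-1` [set k]).
Proof.
move=> mA; pose S j := [set p | A p j /\ rank (A p) j = n].
have mS j : measurable (S j).
  rewrite (_ : S j = [set p | A p j] `&` [set p | rank (A p) j = n]) //.
  by apply: measurableI => //; exact: measurable_rank.
rewrite (_ : _ @^-1` _ = S k `|` (if k == 0%N then ~` \bigcup_j S j else set0)).
  apply: measurableU => //; case: ifP => // _; apply: measurableC.
  exact: bigcupT_measurable.
apply/seteqP; split => p /=.
  rewrite /nth_element; case: xgetP => [j -> [Aj jn] <-|nS <-]; first by left.
  by right => -[j _]; exact: nS.
case=> [[Ak <-]|]; first exact: nth_elementE.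
case: eqP => // -> nS; rewrite /nth_element; case: xgetP => // j -> Sj.
by exfalso; apply: nS; eexists; last exact: Sj.
Qed.

End Discrete.

Section FirstTrap.
Context {R : realType} {d : nat}.
Variables (nb : seq (site d)) (alpha delta eps : R).
Hypothesis nb_order : ball_order nb.
Hypothesis delta_gt0 : 0 < delta.
Hypothesis eps_gt0 : 0 < eps.
Implicit Types (p : environment R d * trajectory R d).

Definition threshold : R := delta / eps `^ alpha^-1.

Lemma le_threshold (x : R) : (delta <= eps `^ alpha^-1 * x) = (threshold <= x).
Proof. by rewrite /threshold ler_pdivrMr ?powR_gt0 // mulrC. Qed.

Let nb_size : (0 < size nb)%N.
Proof.
by rewrite -has_predT; apply/hasP; exists 0; rewrite // (mem_nb nb_order) l1norm0.
Qed.

Lemma listing_around (w : trajectory R d) k : listing nb w k \in around nb (position w (k %/ size nb)).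
Proof. by apply: (map_f (fun z => _ + z)); rewrite mem_nth // ltn_mod. Qed.

Lemma around_listing (w : trajectory R d) j x : x \in around nb (position w j) ->
  exists2 k, (k %/ size nb)%N = j & listing nb w k = x.
Proof.
move=> /mapP[z zn ->]; exists (j * size nb + index z nb)%N.
  by rewrite divnMDl // divn_small ?addn0 // index_mem.
rewrite /listing divnMDl // divn_small ?addn0 ?index_mem //.
by rewrite modnMDl modn_small ?index_mem // nth_index.
Qed.

(** The trap with the smallest index in the exploration is found around the
    position where the walk discovers its first trap. *)
Lemma trap_site_around p j : first_trap nb threshold [::] p.1 (path_of p.2 j.+1) ->
  trap_site nb alpha delta eps p 1 \in around nb (position p.2 j) /\
  threshold <= p.1 (trap_site nb alpha delta eps p 1).
Proof.
rewrite first_trapE => /andP[al /allPn[x xj]] /=; rewrite -leNgt => tx.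
set t := p.1 in al tx *; set w := p.2 in al xj *.
have [k kj kx] := around_listing xj.
have ex : exists k, threshold <= t (listing nb w k) by exists k; rewrite kx.
(* [k0] is the first entry of the listing that is a trap. It has not occurred
   before, so that it is explored, with index [rank FA k0]. *)
case: (ex_minnP ex) => k0 tk0 k0min.
have k0j : (k0 %/ size nb)%N = j.
  apply/eqP; rewrite eqn_leq -{1}kj leq_div2r ?k0min ?kx //= leqNgt; apply/negP => lt.
  have /allP/(_ _ (listing_around w k0)) := all_path_of al lt.
  by rewrite /= ltNge tk0.
pose FA := [set k | forall j, (j < k)%N -> listing nb w j <> listing nb w k].
have FA0 : FA k0.
  by move=> i ik e; have := k0min i; rewrite e => /(_ tk0); rewrite leqNgt ik.
pose A := [set i | (0 < i)%N /\ delta <= eps `^ alpha^-1 * t (explored nb w i)].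
have r0 : (0 < rank FA k0)%N by rewrite /rank big_ord_recr /= asboolT // addn1.
have ek0 : explored nb w (rank FA k0) = listing nb w k0 by rewrite /explored nth_elementE.
have A0 : A (rank FA k0) by split => //; rewrite ek0 le_threshold.
have r1 : rank A (rank FA k0) = 1%N.
  rewrite /rank big_ord_recr /= asboolT // big1 ?add0n // => i _.
  case: asboolP => // -[i0]; rewrite le_threshold => ti.
  have [|k' [k'k FA' rk']] := @nth_element_below FA k0 i.
    by rewrite i0 ltnW // (ltn_ord i).
  have : (k0 <= k')%N by apply: k0min; rewrite -[k'](nth_elementE FA') rk'.
  move=> kk'; have e : k' = k0 by apply/eqP; rewrite eqn_leq k'k kk'.
  by have := ltn_ord i; rewrite -rk' e ltnn.
have -> : trap_site nb alpha delta eps p 1 = listing nb w k0.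
  have e1 := nth_elementE A0; rewrite r1 in e1.
  by rewrite -ek0 -e1.
by rewrite tk0 -k0j listing_around.
Qed.

Local Notation mset A := (measurable (A : set (environment R d * trajectory R d))).

Lemma measurable_listing k x : mset ((fun p => listing nb p.2 k) @^-1` [set x]).
Proof.
rewrite (_ : _ @^-1` _ = (fun p => position p.2 (k %/ size nb)) @^-1` [set x - nth 0 nb (k %% size nb)]).
  rewrite -[X in measurable X]setTI.
  exact: (measurableT_comp (measurable_position _) measurable_snd).
by apply/seteqP; split => p /=; rewrite /listing; [move=> <-; rewrite addrK | move=> ->; rewrite subrK].
Qed.

Lemma measurable_explored i x : mset ((fun p => explored nb p.2 i) @^-1` [set x]).
Proof.
have mFA k : mset [set p | forall j, (j < k)%N -> listing nb p.2 j <> listing nb p.2 k].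
  rewrite (_ : [set p | _] = \bigcap_j (if (j < k)%N then ~` [set p | listing nb p.2 j = listing nb p.2 k] else setT)).
    apply: bigcapT_measurable => j; case: ifP => // _; apply: measurableC.
    by apply: measurable_eq_fun => y; exact: measurable_listing.
  apply/seteqP; split => p /= h j; first by case: ifP => // jk _; exact: h.
  by move=> jk; have := h j I; rewrite jk.
rewrite (_ : _ @^-1` _ = \bigcup_k ((fun p => nth_element [set k | forall j, (j < k)%N -> listing nb p.2 j <> listing nb p.2 k] i) @^-1` [set k] `&` (fun p => listing nb p.2 k) @^-1` [set x])).
  apply: bigcupT_measurable => k; apply: measurableI; last exact: measurable_listing.
  exact: measurable_nth_element.
apply/seteqP; split => p /=; first by move=> <-; eexists.
by move=> [k _ [<-]].
Qed.

Lemma measurable_trap_site n x : mset ((fun p => trap_site nb alpha delta eps p n) @^-1` [set x]).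
Proof.
have mA i : mset [set p | (0 < i)%N /\ delta <= eps `^ alpha^-1 * p.1 (explored nb p.2 i)].
  case: (ltnP 0 i) => i0; last by rewrite (_ : [set p | _] = set0) //; apply/seteqP; split => p // [].
  rewrite (_ : [set p | _] = (fun p => p.1 (explored nb p.2 i)) @^-1` `[threshold, +oo[%classic); last first.
    apply/seteqP; split => p /=; rewrite in_itv /= andbT -le_threshold; first by case.
    by [].
  rewrite -[X in measurable X]setTI.
  have mE : measurable_fun setT (fun p : environment R d * trajectory R d => p.1 (explored nb p.2 i)).
    apply: (measurable_select (G := fun y p => p.1 y)); first exact: measurable_explored.
    by move=> y; exact: (measurableT_comp (measurable_coordinate y) measurable_fst).
  exact: mE.
rewrite (_ : _ @^-1` _ = \bigcup_k ((fun p => nth_element [set i | (0 < i)%N /\ delta <= eps `^ alpha^-1 * p.1 (explored nb p.2 i)] n) @^-1` [set k] `&` (fun p => explored nb p.2 k) @^-1` [set x])).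
  apply: bigcupT_measurable => k; apply: measurableI; last exact: measurable_explored.
  exact: measurable_nth_element.
apply/seteqP; split => p /=; first by move=> <-; eexists.
by move=> [k _ [<-]].
Qed.

Lemma measurable_trap_environment n :
  measurable_fun setT (fun p : environment R d * trajectory R d => trap_environment nb alpha delta eps p n).
Proof.
apply: measurable_into_real_family => z.
apply: (measurable_select (K := fun p => trap_site nb alpha delta eps p n) (G := fun y p => p.1 (y + val z))).
  exact: measurable_trap_site.
by move=> y; exact: (measurableT_comp (measurable_coordinate (y + val z)) measurable_fst).
Qed.

Variables (M : R) (g : punctured_environment R d -> R).
Hypothesis M_threshold : M < threshold.
Hypothesis g_tame : forall u, g u != 0 ->
  forall z : {z : site d | z != 0}, (l1norm (val z) <= 2)%N -> u z <= M.

(** Another trap discovered at the same time would lie within distance [2] of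
    the first one, where [g_tame] excludes it. *)
Lemma trap_view_first p j : first_trap nb threshold [::] p.1 (path_of p.2 j.+1) ->
  trap_view nb threshold g p.1 (position p.2 j) = g (trap_environment nb alpha delta eps p 1).
Proof.
move=> tj; have [xj tx] := trap_site_around tj.
set x := trap_site _ _ _ _ _ _ in xj tx; rewrite /trap_view (bigD1_seq x) ?uniq_around //=.
rewrite tx mul1r big_seq_cond big1 ?addr0 // => y /andP[yj yx].
case: (boolP (threshold <= p.1 y)) => ty; last by rewrite mul0r.
rewrite mul1r; apply/eqP; apply: contraT => gy.
have z0 : x - y != 0 by rewrite subr_eq0 eq_sym.
have h : (l1norm (x - y)%R <= 2)%N -> p.1 x <= M.
  have -> : p.1 x = off_origin (shift y p.1) (exist (fun z : site d => z != 0) (x - y) z0).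
    by rewrite /off_origin /shift /= addrCA subrr addr0.
  exact: (g_tame gy (z := exist (fun z : site d => z != 0) (x - y) z0)).
have : p.1 x <= M.
  apply: h; rewrite (leq_trans (ler_l1norm_dist x (position p.2 j) y)) // (@leq_add _ _ 1 1) //.
    by rewrite -(mem_around nb_order).
  by rewrite l1normB -(mem_around nb_order).
by rewrite leNgt (lt_le_trans M_threshold).
Qed.

End FirstTrap.

(** * The limit law of the environment around the first trap *)

Section TrapProbability.
Context {R : realType} {d : nat}.
Variables (alpha delta : R) (eps : nat -> R).
Hypothesis alpha_gt0 : 0 < alpha.
Hypothesis delta_gt0 : 0 < delta.
Hypothesis eps_gt0 : forall k, 0 < eps k.
Hypothesis eps_cvg0 : eps k @[k --> \oo] --> 0.
Variable P : probability (environment R d) R.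
Hypothesis P_tail : fine (P [set t : environment R d | y <= t 0]) / y `^ (- alpha)
              @[y --> +oo] --> (1 : R).

Local Notation theta k := (threshold alpha delta (eps k)).

Lemma threshold_infty : theta k @[k --> \oo] --> +oo.
Proof.
apply/cvgryPge => A; pose B := Num.max 1 A.
have B0 : 0 < B by rewrite lt_max ltr01.
have b0 : 0 < (delta / B) `^ alpha by rewrite powR_gt0 // divr_gt0.
have h : \forall k \near \oo, eps k < (delta / B) `^ alpha by apply: (cvgr_lt _ eps_cvg0).
apply: filterS h => k hk; apply: (@le_trans _ _ B); first by rewrite le_max lexx orbT.
have e0 : 0 < eps k `^ alpha^-1 by rewrite powR_gt0.
rewrite /threshold ler_pdivlMr // mulrC -ler_pdivlMr //.
have -> : delta / B = ((delta / B) `^ alpha) `^ alpha^-1.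
  by rewrite -powRrM mulfV ?gt_eqF // powRr1 // divr_ge0 // ltW.
by apply: ge0_ler_powR; rewrite ?nnegrE ?invr_ge0 ltW // ltW.
Qed.

Let mtrap y : measurable [set t : environment R d | y <= t 0].
Proof.
rewrite (_ : [set _ | _] = (fun t : environment R d => t 0) @^-1` `[y, +oo[).
  by rewrite -[X in measurable X]setTI; exact: measurable_coordinate.
by apply/seteqP; split => t /=; rewrite in_itv /= andbT.
Qed.

Lemma trap_probability_gt0 y : 0 < trap_probability P y.
Proof.
have [B [_ hB]] : \forall y \near +oo, 0 < fine (P [set t : environment R d | y <= t 0]) / y `^ (- alpha).
  by apply: (cvgr_gt _ P_tail).
pose z := Num.max y (B + 1).
have : 0 < fine (P [set t : environment R d | z <= t 0]) / z `^ (- alpha).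
  by apply: hB; rewrite lt_max ltrDl ltr01 orbT.
have [->|_] := eqVneq (z `^ (- alpha)) 0; first by rewrite invr0 mulr0 ltxx.
move=> h; have hz : 0 < fine (P [set t : environment R d | z <= t 0]).
  rewrite lt_neqAle fine_ge0 // andbT eq_sym; apply: contraTneq h => ->.
  by rewrite mul0r ltxx.
apply: lt_le_trans hz _; rewrite fine_le ?fin_num_measure //.
apply: le_measure; rewrite ?inE // => t /=; apply: le_trans.
by rewrite le_max lexx.
Qed.

Lemma trap_probability_cvg0 : trap_probability P (theta k) @[k --> \oo] --> 0.
Proof.
have E k : trap_probability P (theta k) = \int[P]_t ((theta k <= t 0)%R)%:R.
  rewrite /trap_probability /Rintegral -[X in P X]setIT -integral_indic //.
  congr fine; apply: eq_integral => t _; rewrite indicE; congr (_%:R%:E); congr nat_of_bool.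
  by apply/idP/idP => [/set_mem|/mem_set].
rewrite -[X in _ --> X](_ : \int[P]_t (cst 0 t) = 0); last by rewrite Rintegral_cst // mul0r.
rewrite (_ : (fun k => trap_probability P (theta k)) = fun k => \int[P]_t ((theta k <= t 0)%R)%:R); last exact/funext.
apply: (bounded_Rcvg (B := 1)) => //.
- move=> k; apply: measurable_bool_natr; apply: measurable_fun_ler => //.
  exact: measurable_coordinate.
- by move=> k t; case: (theta k <= t 0); rewrite ?normr1 ?normr0.
- by move=> t; rewrite normr0.
apply: aeW => t; have /cvgryPgt/(_ (t 0)) := threshold_infty => h.
by apply: cvg_near_cst; apply: filterS h => k; rewrite ltNge => /negbTE ->.
Qed.

End TrapProbability.

Lemma le_of_perturbation (R : realFieldType) (x y z : R) :
  (forall s, 0 < s -> x <= y + s * z) -> x <= y.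
Proof.
move=> h; apply/ler_addgt0Pr => e e0.
have z0 : 0 < `|z| + 1 by rewrite ltr_pwDr.
apply: (le_trans (h (e / (`|z| + 1)) _)); first by rewrite divr_gt0.
rewrite lerD2l mulrAC ler_pdivrMr // ler_pM2l //.
by apply: le_trans (ler_norm _) _; rewrite lerDl.
Qed.

Section FirstTrapLaw.
Context {R : realType} {d : nat}.
Variables (a : R) (nb : seq (site d)) (c : R).
Hypothesis a_ge0 : 0 <= a.
Hypothesis nb_order : ball_order nb.
Hypothesis d_gt0 : (0 < d)%N.
Hypothesis c_gt0 : 0 < c.
Variable P : probability (environment R d) R.
Hypothesis P_iid : iid_coordinates P.
Hypothesis P_ge1 : {ae P, forall t, 1 <= t 0}.
Variable K : R.-pker (environment R d) ~> (trajectory R d).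
Hypothesis K_law : forall t : environment R d, (forall y, 0 < t y) ->
  ctmc_law (jump_rate a t) 0 (K t).
Hypothesis c_speed : {ae annealed P K, forall p,
  (discovered p.2 t * (t^-1)%:E)%E @[t --> +oo] --> c%:E}.
Variables (alpha delta : R) (eps : nat -> R).
Hypothesis alpha_gt0 : 0 < alpha.
Hypothesis delta_gt0 : 0 < delta.
Hypothesis eps_gt0 : forall k, 0 < eps k.
Hypothesis eps_cvg0 : eps k @[k --> \oo] --> 0.
Hypothesis P_tail : fine (P [set t : environment R d | y <= t 0]) / y `^ (- alpha)
              @[y --> +oo] --> (1 : R).
Local Notation theta := (fun k => threshold alpha delta (eps k)).
Local Notation Q := (annealed P K).
Implicit Types (q : environment R d * trajectory R d).

Variables (M V V' : R) (g : punctured_environment R d -> R).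
Hypothesis M_ge0 : 0 <= M.
Hypothesis V_gt0 : 0 < V.
Hypothesis VV' : V <= V'.
Hypothesis g01 : forall u, 0 <= g u <= 1.
Hypothesis mg : measurable_fun setT g.
Hypothesis g_tame : forall u, g u != 0 ->
  forall z : {z : site d | z != 0}, (l1norm (val z) <= 2)%N -> u z <= M.

Local Notation tau k q := (trap_environment nb alpha delta (eps k) q 1).
Local Notation p k := (trap_probability P (theta k)).
Let p_gt0 k : 0 < p k := trap_probability_gt0 P_tail (theta k).
Let p_cvg0 : p k @[k --> \oo] --> 0.
Proof. exact: trap_probability_cvg0. Qed.
Let theta_infty : theta k @[k --> \oo] --> +oo :=
  threshold_infty alpha_gt0 delta_gt0 eps_gt0 eps_cvg0.
Let g_ge0 u : 0 <= g u. Proof. by have /andP[] := g01 u. Qed.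

Let mtau k : measurable_fun setT (fun q => g (tau k q)).
Proof. by apply: (measurableT_comp mg); exact: measurable_trap_environment. Qed.

Section FixedRate.
Variable s : R.
Hypothesis s_gt0 : 0 < s.
Local Notation lam k := (laplace_rate P theta s k).
Local Notation X := (trap_laplace nb P theta s).
Local Notation kappa := ((1 + s / c)^-1).
Local Notation TE k := (trap_expectation nb P K (theta k) (lam k) g).

Let lam_ge0 k : 0 <= lam k. Proof. by rewrite mulr_ge0 // ltW. Qed.

(** When the first trap is discovered, [trap_view] is the value of [g] at the
    environment around it. *)
Lemma trap_expectation_tau k : M < theta k ->
  TE k = (\int[Q]_q (g (tau k q) * X k q))%:E.
Proof.
move=> Mk; have X01 := trap_laplace01 nb p_gt0 s_gt0.
have int : Q.-integrable setT (EFin \o (fun q => g (tau k q) * X k q)).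
  apply: (bounded_integrable Q (B := 1)).
    by apply: measurable_funM => //; exact: measurable_trap_laplace.
  move=> q; have /andP[x0 x1] := X01 k q; have /andP[y0 y1] := g01 (tau k q).
  by rewrite normrM (ger0_norm x0) (ger0_norm y0) mulr_ile1.
rewrite /Rintegral fineK; last exact: integrable_fin_num.
pose h s' t := (first_trap nb (theta k) [::] t s')%:R * trap_view nb (theta k) g t (last 0 s').
have h0 s' t : 0 <= h s' t by rewrite mulr_ge0 // trap_view_ge0.
have mh s' : measurable_fun setT (h s').
  apply: measurable_funM; last exact: measurable_trap_view.
  by apply: measurable_bool_natr; exact: measurable_first_trap.
transitivity (\sum_(0 <= j <oo) \int[Q]_q (h (path_of q.2 j.+1) q.1 * expR (- (lam k * `|jump_time q.2 j|)))%:E)%E.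
  apply: eq_eseriesr => j _.
  rewrite (annealed_path_abs nb_order d_gt0 P_iid P_ge1 K_law j (lam_ge0 k) h0 mh).
  rewrite -(annealed_path nb_order d_gt0 P_iid P_ge1 K_law j (lam_ge0 k) h0 mh).
  by apply: eq_integral => q _; rewrite /h last_path_of.
rewrite -integral_nneseries //; last 2 first.
- move=> j; apply/measurable_EFinP; apply: measurable_funM; first exact: measurable_fun_path.
  apply: measurableT_comp => //; apply: measurableT_comp => //.
  apply: measurable_funM => //; apply: measurableT_comp => //.
  exact: measurableT_comp (measurable_jump_time j) measurable_snd.
- by move=> j q _; rewrite lee_fin mulr_ge0 // expR_ge0.
apply: eq_integral => q _.
have [[j tj]|nt] := pselect (exists j, first_trap nb (theta k) [::] q.1 (path_of q.2 j.+1)); last first.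
  have nt' j : ~~ first_trap nb (theta k) [::] q.1 (path_of q.2 j.+1) by apply/negP => tj; apply: nt; exists j.
  rewrite trap_laplace0 // mulr0 eseries0 // => j _ _.
  by rewrite /h (negbTE (nt' j)) !mul0r.
rewrite (trap_laplaceE P s tj) -(trap_view_first nb_order (eps_gt0 k) Mk g_tame tj).
rewrite (nneseriesD1 (n := j)) //; last first.
  by move=> i _; rewrite lee_fin mulr_ge0 // expR_ge0.
rewrite eseries0 ?adde0; first by rewrite /h tj mul1r last_path_of.
move=> i _ ij; rewrite /h; case: (boolP (first_trap nb (theta k) [::] q.1 (path_of q.2 i.+1))) => ti; last by rewrite !mul0r.
by rewrite (first_trap_uniq ti tj) eqxx in ij.
Qed.

Variable mu : R.
Hypothesis tau_cvg : \int[Q]_q g (tau k q) @[k --> \oo] --> mu.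

Local Notation W := (\int[P]_t weight0 a nb V V' g t).
Local Notation PI := (fine (P [set t : environment R d | `[V, V']%classic (t 0)])).
Local Notation rho := (min_return a nb M V).

(** The Laplace weight lies in [[0, 1]] and its mean tends to [kappa], so that
    removing it from the mean of [g (tau k q)] costs at most [1 - kappa] in
    the limit. *)
Lemma mean_bounds : s^-1 * ((1 - kappa) * W) <= PI * mu /\
  rho * (PI * (mu - (1 - kappa))) <= s^-1 * ((1 - kappa) * W).
Proof.
have X01 := trap_laplace01 nb p_gt0 s_gt0.
have mX := measurable_trap_laplace nb P theta s.
have cm := stopped_mean_cvg a_ge0 nb_order d_gt0 c_gt0 P_iid P_ge1 K_law c_speed theta_infty p_gt0 p_cvg0 M_ge0 V_gt0 VV' g01 mg g_tame s_gt0.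
have bd := stopped_mean_bounds a_ge0 nb_order d_gt0 c_gt0 P_iid P_ge1 K_law c_speed theta_infty p_gt0 p_cvg0 M_ge0 V_gt0 VV' g01 mg g_tame s_gt0.
have PIE : P [set t | `[V, V']%classic (t 0)] = PI%:E.
  rewrite fineK // fin_num_measure // -[X in measurable X]setTI.
  exact: (measurable_coordinate (0 : site d)).
have PI0 : 0 <= PI by rewrite fine_ge0.
have /cvgryPgt/(_ M) nearM := theta_infty.
have Q1 : \int[Q]_q 1 = 1 by rewrite Rintegral_cst // mul1r; exact: (congr1 fine (probability_setT Q)).
pose S k := \int[Q]_q (g (tau k q) * X k q).
have bd' : \forall k \near \oo, s^-1 * stopped_mean a nb P K theta V V' g s k <= PI * S k /\
    rho * (PI * S k) <= s^-1 * stopped_mean a nb P K theta V V' g s k.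
  apply: filterS2 bd nearM => k [h1 h2] Mk.
  by move: h1 h2; rewrite PIE (trap_expectation_tau Mk) -!EFinM !lee_fin.
have cX : \int[Q]_q X k q @[k --> \oo] --> kappa.
  have h : decouples Q X kappa ((fun=> 1) \o fst).
    apply: (laplace_decouples nb_order d_gt0 c_gt0 P_iid P_ge1 K_law c_speed theta_infty p_gt0 p_cvg0 s_gt0 (B := 1)).
      exact: measurable_cst.
    by move=> _; rewrite ler01 lexx.
  rewrite -[X in _ --> X]mulr1 -[X in _ * X](_ : \int[Q]_q ((fun=> 1) \o fst) q = 1).
    apply: cvg_trans h; apply: near_eq_cvg; apply: nearW => k.
    by apply: eq_Rintegral => q _ /=; rewrite mul1r.
  exact: Q1.
have iX k : Q.-integrable setT (EFin \o X k).
  by apply: (bounded_integrable Q (B := 1)) => // q; have /andP[x0 x1] := X01 k q; rewrite ger0_norm.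
have ig k : Q.-integrable setT (EFin \o (fun q => g (tau k q))).
  apply: (bounded_integrable Q (B := 1)) => [|q]; first exact: mtau.
  by have /andP[x0 x1] := g01 (tau k q); rewrite ger0_norm.
have igX k : Q.-integrable setT (EFin \o (fun q => g (tau k q) * X k q)).
  apply: (bounded_integrable Q (B := 1)); first by apply: measurable_funM => //; exact: mtau.
  move=> q; have /andP[x0 x1] := X01 k q; have /andP[y0 y1] := g01 (tau k q).
  by rewrite normrM (ger0_norm x0) (ger0_norm y0) mulr_ile1.
have i1X k : Q.-integrable setT (EFin \o (fun q => 1 - X k q)).
  apply: (bounded_integrable Q (B := 1)) => [|q]; first exact: measurable_funB.
  by have /andP[x0 x1] := X01 k q; rewrite ger0_norm ?subr_ge0 // gerBl.
have SE k : S k <= \int[Q]_q g (tau k q) <= S k + (1 - \int[Q]_q X k q).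
  apply/andP; split.
    apply: le_Rintegral => // q _; have /andP[x0 x1] := X01 k q.
    by rewrite ler_piMr.
  have -> : 1 - \int[Q]_q X k q = \int[Q]_q (1 - X k q).
    rewrite RintegralB //; last exact: finite_measure_integrable_cst.
    by rewrite Q1.
  rewrite -RintegralD //; apply: le_Rintegral => //.
    apply: (bounded_integrable Q (B := 1 + 1)).
      by apply: measurable_funD; [apply: measurable_funM => //; exact: mtau | exact: measurable_funB].
    move=> q; have /andP[x0 x1] := X01 k q; have /andP[y0 y1] := g01 (tau k q).
    rewrite ger0_norm; last by rewrite addr_ge0 ?mulr_ge0 ?subr_ge0.
    by rewrite lerD ?mulr_ile1 // gerBl.
  move=> q _; have /andP[x0 x1] := X01 k q; have /andP[y0 y1] := g01 (tau k q).
  set u := g _ in y0 y1 *; set v := X k q in x0 x1 *; nra.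
have l1 : s^-1 * stopped_mean a nb P K theta V V' g s k @[k --> \oo] --> s^-1 * ((1 - kappa) * W) by exact: cvgMr.
have l2 : PI * \int[Q]_q g (tau k q) @[k --> \oo] --> PI * mu by exact: cvgMr.
have l3 : rho * (PI * (\int[Q]_q g (tau k q) - (1 - \int[Q]_q X k q))) @[k --> \oo] -->
    rho * (PI * (mu - (1 - kappa))).
  by apply: cvgMr; apply: cvgMr; apply: cvgB => //; apply: cvgB => //; exact: cvg_cst.
have /andP[/ltW rho0 _] := min_return01 a nb M V_gt0.
split.
  apply: (ler_cvg_to l1 l2); apply: filterS bd' => k [h1 _].
  by apply: le_trans h1 _; rewrite ler_wpM2l //; have /andP[] := SE k.
apply: (ler_cvg_to l3 l1); apply: filterS bd' => k [_ h2].
apply: le_trans _ h2; rewrite ler_wpM2l // ler_wpM2l //; by rewrite lerBlDr; have /andP[] := SE k.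
Qed.

End FixedRate.

Variable mu : R.
Hypothesis tau_cvg : \int[Q]_q g (tau k q) @[k --> \oo] --> mu.

Local Notation W := (\int[P]_t weight0 a nb V V' g t).
Local Notation PI := (fine (P [set t : environment R d | `[V, V']%classic (t 0)])).
Local Notation rho := (min_return a nb M V).

(** Let [s] tend to [0] in [mean_bounds], where [s^-1 * (1 - kappa) = (c +
    s)^-1]. *)
Lemma first_trap_bounds : W <= PI * (c * mu) /\ rho * (PI * (c * mu)) <= W.
Proof.
have eqr (s : R) : 0 < s -> s^-1 * (1 - (1 + s / c)^-1) = (c + s)^-1.
  move=> s0; have cs : c + s != 0 by rewrite gt_eqF // addr_gt0.
  have c0 : c != 0 by rewrite gt_eqF.
  by field; rewrite c0 cs gt_eqF.
split.
- apply: (le_of_perturbation (z := PI * mu)) => s s0.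
  have [h _] := mean_bounds s0 tau_cvg.
  move: h; rewrite mulrA eqr // mulrC ler_pdivrMr ?addr_gt0 // => h.
  by apply: le_trans h _; rewrite le_eqVlt; apply/orP; left; apply/eqP; ring.
- apply: (le_of_perturbation (z := rho * PI * (1 - mu))) => s s0.
  have [_ h] := mean_bounds s0 tau_cvg.
  have sk : 1 - (1 + s / c)^-1 = s * (c + s)^-1 by rewrite -(eqr s) // mulrA divff ?mul1r ?gt_eqF.
  have sw : s^-1 * ((1 - (1 + s / c)^-1) * W) = W / (c + s) by rewrite mulrA eqr // mulrC.
  move: h; rewrite sw sk ler_pdivlMr ?addr_gt0 //.
  set r := rho; set q := PI; set w := W => h.
  have e : (c + s)^-1 * (c + s) = 1 by rewrite mulVf // gt_eqF // addr_gt0.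
  have -> : r * (q * (c * mu)) = r * (q * (mu - s * (c + s)^-1)) * (c + s) + s * (r * q * (1 - mu)).
    by rewrite -[RHS]addr0 -[X in _ = _ + X](subrr (r * q * s * ((c + s)^-1 * (c + s)))) {2}e; ring.
  by rewrite lerD2r.
Qed.

End FirstTrapLaw.


(** * The Green function of an infinitely deep trap *)

Lemma cvg_powR_infty (R : realType) (a : R) : 0 < a -> x `^ a @[x --> +oo] --> +oo.
Proof.
move=> a0; apply/cvgryPge => A; near=> x.
have x0 : 0 < x by near: x; exact: nbhs_pinfty_gt.
have Ax : `|A| `^ a^-1 <= x by near: x; exact: nbhs_pinfty_ge.
apply: le_trans (ler_norm _) _.
have -> : `|A| = (`|A| `^ a^-1) `^ a by rewrite -powRrM mulVf ?powRr1 // gt_eqF.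
by rewrite ge0_ler_powR ?nnegrE ?powR_ge0 // ltW.
Unshelve. all: by end_near. Qed.

Section GreenBar.
Context {R : realType} {d : nat}.
Variables (a : R) (nb : seq (site d)).
Hypothesis a_gt0 : 0 < a.
Hypothesis nb_order : ball_order nb.
Hypothesis d_gt0 : (0 < d)%N.
Variable K : R.-pker (environment R d) ~> (trajectory R d).
Hypothesis K_law : forall t : environment R d, (forall y, 0 < t y) ->
  ctmc_law (jump_rate a t) 0 (K t).
Implicit Types (t : environment R d) (u : punctured_environment R d) (v : R).

Lemma with_origin0 v u : with_origin v u 0 = v.
Proof. by rewrite /with_origin insubF // eqxx. Qed.

Lemma with_origin_off v t : with_origin v (off_origin t) = set_coordinate 0 v t.
Proof.
apply/funext => y; rewrite /with_origin /set_coordinate; case: eqP => [->|/eqP y0].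
  by rewrite insubF // eqxx.
by rewrite insubT.
Qed.

Lemma with_origin_self t : with_origin (t 0) (off_origin t) = t.
Proof. by rewrite with_origin_off; apply/funext => y; rewrite /set_coordinate; case: eqP => // ->. Qed.

Lemma measurable_with_origin v : measurable_fun setT (with_origin v : _ -> environment R d).
Proof.
apply: measurable_into_real_family => y; rewrite /with_origin.
by case: insubP => [z _ _|_] /=; [exact: measurable_coordinate | exact: measurable_cst].
Qed.

(** Stated through a full environment, so that [measurable_positive] applies. *)
Definition positive : set (punctured_environment R d) :=
  [set u | forall y, 0 < with_origin 1 u y].

Lemma measurable_punctured_positive : measurable positive.
Proof.
have := measurable_with_origin 1 measurableT (@measurable_positive R d).
by rewrite setTI.
Qed.

Lemma positiveP u : positive u -> forall v, 0 < v -> forall y, 0 < with_origin v u y.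
Proof.
move=> pu v v0 y; have := pu y; rewrite /with_origin.
by case: insub.
Qed.

Lemma positive_off t : (forall y, 0 < t y) -> positive (off_origin t).
Proof.
by move=> t0 y; rewrite with_origin_off /set_coordinate; case: eqP.
Qed.

Lemma agree_with_origin v v' u : agree_off 0 (with_origin v u) (with_origin v' u).
Proof. by move=> y y0; rewrite /with_origin insubT. Qed.

Lemma escape_const_agree t t' : agree_off 0 t t' -> escape_const a nb t = escape_const a nb t'.
Proof.
move=> tt; rewrite /escape_const !big_seq; apply: eq_bigr => z zE.
have z0 : z != 0 by move: zE; rewrite (mem_steps nb_order) -l1norm_eq0; case: l1norm.
rewrite tt //; congr ((1 + _) / _); apply: eq_bigr => e ze.
exact: jump_rate_agree tt z0 ze.
Qed.

Section FixedEnvironment.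
Variable u : punctured_environment R d.
Hypothesis u_gt0 : positive u.
Local Notation G v := (green0 a nb (with_origin v u)).
Local Notation ratio v := (return_ratio a nb (with_origin v u)).

Lemma return_ratio_gt0 t : (forall y, 0 < t y) -> 0 < return_ratio a nb t.
Proof.
move=> t0; have := escape_const_ge0 a nb t => e0.
by rewrite /return_ratio divr_gt0 ?ltr_wpDr // powR_gt0.
Qed.

Lemma green0_ge0 t : (0 <= green0 a nb t)%E.
Proof. by apply: green_sum_ge0 => // x y; exact: jump_rate_ge0. Qed.

Lemma cvg_inv_return_ratio : (ratio v)^-1 @[v --> +oo] --> (1 : R).
Proof.
pose e := escape_const a nb (with_origin 1 u).
have h : 1 + e * (v `^ a)^-1 @[v --> +oo] --> (1 : R).
  rewrite -[X in _ --> X]addr0 -[X in _ --> _ + X](mulr0 e); apply: cvgD; first exact: cvg_cst.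
  apply: cvgMr; apply/gtr0_cvgV0; last exact: cvg_powR_infty.
  by near=> v; apply: powR_gt0; near: v; exact: nbhs_pinfty_gt.
apply: cvg_trans h; apply: near_eq_cvg; near=> v.
have v0 : 0 < v by near: v; exact: nbhs_pinfty_gt.
rewrite /return_ratio with_origin0 (escape_const_agree (agree_with_origin v 1 u)) -/e.
by rewrite invf_div mulrDl divff // gt_eqF // powR_gt0.
Unshelve. all: by end_near. Qed.

Definition green_inf : \bar R := ereal_inf [set G v | v in [set v | 0 < v]].

Lemma green_inf_le v : 0 < v -> (green_inf <= G v)%E.
Proof. by move=> v0; apply: ereal_inf_lbound; exists v. Qed.

Lemma le_green_inf v : 0 < v -> ((ratio v)%:E * G v <= green_inf)%E.
Proof.
move=> v0; apply: le_ereal_inf_tmp => _ [v' v'0 <-].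
exact: (green_compare a nb_order d_gt0 (positiveP u_gt0 (v'0 : 0 < v')) (positiveP u_gt0 v0) (agree_with_origin v' v u)).
Qed.

(** By [green_compare], the Green function lies between its infimum and the
    product of the infimum with the inverse of a ratio that tends to [1]. *)
Lemma cvg_green0 : G v @[v --> +oo] --> green_inf.
Proof.
have L0 : (0 <= green_inf)%E by apply: le_ereal_inf_tmp => _ [v' _ <-]; exact: green0_ge0.
have up v : 0 < v -> (G v <= ((ratio v)^-1)%:E * green_inf)%E.
  move=> v0; have r0 := return_ratio_gt0 (positiveP u_gt0 v0).
  have := le_green_inf v0; rewrite -(@lee_pmul2l _ ((ratio v)^-1)%:E) ?lte_fin ?invr_gt0 //.
  by rewrite muleA -EFinM mulVf ?mul1e // gt_eqF.
have low := green_inf_le; move: L0 up low.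
case: green_inf => [l|_ _ low|//].
  rewrite lee_fin => l0 up low.
  apply: (squeeze_cvge (f := cst l%:E) (h := fun v => ((ratio v)^-1 * l)%:E)).
  - near=> v; have v0 : 0 < v by near: v; exact: nbhs_pinfty_gt.
    by rewrite low //= EFinM up.
  - exact: cvg_cst.
  - apply/cvg_EFin; first exact: nearW.
    rewrite -[X in _ --> X](mul1r l); apply: cvgMl; exact: cvg_inv_return_ratio.
apply: cvg_near_cst; near=> v; have v0 : 0 < v by near: v; exact: nbhs_pinfty_gt.
by apply/eqP; rewrite -leye_eq low.
Unshelve. all: by end_near. Qed.

Lemma green_barE : green_bar K u = green_inf.
Proof.
apply: cvg_lim => //; apply: cvg_trans cvg_green0; apply: near_eq_cvg; near=> v.
have v0 : 0 < v by near: v; exact: nbhs_pinfty_gt.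
by rewrite (quenched_green nb_order d_gt0 K_law) //; exact: positiveP.
Unshelve. all: by end_near. Qed.

End FixedEnvironment.

Lemma green0_gt0 t : (forall y, 0 < t y) -> (0 < green0 a nb t)%E.
Proof.
move=> t0; apply: lt_le_trans (le_green_sum a nb t (l := 0) (A := predT) _ _) => //.
by rewrite lte_fin invr_gt0 add0r total_jump_rate_gt0.
Qed.

Lemma green_bar_gt0 u : positive u -> (0 < green_bar K u)%E.
Proof.
move=> pu; rewrite green_barE //; apply: lt_le_trans (le_green_inf pu ltr01).
by rewrite mule_gt0 // ?lte_fin ?return_ratio_gt0 ?green0_gt0 //; exact: positiveP.
Qed.

(** The value [0] outside [positive], a null set, makes this a measurable function. *)
Definition inv_green_bar u : R := (((fine \o green_bar K) \_ positive) u)^-1.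

Lemma inv_green_barE u : positive u -> inv_green_bar u = (fine (green_bar K u))^-1.
Proof. by move=> pu; rewrite /inv_green_bar patchT // mem_set. Qed.

Lemma patched_green_bar_ge0 u : 0 <= ((fine \o green_bar K) \_ positive) u.
Proof.
rewrite /patch; case: ifPn => // /set_mem pu.
by rewrite fine_ge0 // ltW // green_bar_gt0.
Qed.

Lemma inv_green_bar_ge0 u : 0 <= inv_green_bar u.
Proof. by rewrite invr_ge0 patched_green_bar_ge0. Qed.

(** The bounds [ratio * G <= green_bar <= G] in terms of the inverses. *)
Lemma inv_green_bar_bounds t : (forall y, 0 < t y) ->
  return_ratio a nb t * inv_green_bar (off_origin t) <= inv_green0 a nb t
    <= inv_green_bar (off_origin t).
Proof.
move=> t0; have pu := positive_off t0.
have G0 := green_bar_gt0 pu; have r0 := return_ratio_gt0 t0; have g0 := green0_gt0 t0.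
have := le_green_inf pu (t0 0); have := green_inf_le (off_origin t) (t0 0).
rewrite with_origin_self -green_barE // inv_green_barE // /inv_green0.
move: G0 g0; case: (green_bar K _) => [x|_|//]; case: (green0 a nb t) => [y|_|//] //=; last 2 first.
- by move=> _ _; rewrite gt0_muley.
- by move=> _ _; rewrite invr0 mulr0 lexx.
rewrite !lte_fin -EFinM !lee_fin => x0 y0 xy ryx.
by rewrite lef_pV2 // xy andbT ler_pdivrMr // mulrC ler_pdivlMr // mulrC.
Qed.

(** The limit may be taken along the integers. *)
Lemma measurable_green_bar : measurable_fun positive (green_bar K).
Proof.
apply: (emeasurable_fun_cvg (fun n u => green0 a nb (with_origin n.+1%:R u))).
  move=> n; apply: measurable_funTS.
  apply: (measurableT_comp (f := green0 a nb)); last exact: measurable_with_origin.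
  exact: measurable_green_sum.
move=> u pu; rewrite green_barE //.
have h := cvg_green0 pu; apply: (cvg_comp _ _ _ h).
rewrite (cvg_shiftS (fun n => n%:R : R)); exact: cvgr_idn.
Qed.

Lemma measurable_inv_green_bar : measurable_fun setT inv_green_bar.
Proof.
apply: measurable_invr; last exact: patched_green_bar_ge0.
apply/(measurable_restrictT _ measurable_punctured_positive).
apply: (measurable_comp (F := setT)) => //; exact: measurable_green_bar.
Qed.

End GreenBar.

(** * The mean of a test function of the limit environment *)

Section FirstTrapMean.
Context {R : realType} {d : nat}.
Variables (a : R) (nb : seq (site d)) (c : R).
Hypothesis a_gt0 : 0 < a.
Hypothesis nb_order : ball_order nb.
Hypothesis d_gt0 : (0 < d)%N.
Hypothesis c_gt0 : 0 < c.
Variable P : probability (environment R d) R.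
Hypothesis P_iid : iid_coordinates P.
Hypothesis P_ge1 : {ae P, forall t, 1 <= t 0}.
Variable K : R.-pker (environment R d) ~> (trajectory R d).
Hypothesis K_law : forall t : environment R d, (forall y, 0 < t y) ->
  ctmc_law (jump_rate a t) 0 (K t).
Hypothesis c_speed : {ae annealed P K, forall p,
  (discovered p.2 t * (t^-1)%:E)%E @[t --> +oo] --> c%:E}.
Variables (alpha delta : R) (eps : nat -> R).
Hypothesis alpha_gt0 : 0 < alpha.
Hypothesis delta_gt0 : 0 < delta.
Hypothesis eps_gt0 : forall k, 0 < eps k.
Hypothesis eps_cvg0 : eps k @[k --> \oo] --> 0.
Hypothesis P_tail : fine (P [set t : environment R d | y <= t 0]) / y `^ (- alpha)
              @[y --> +oo] --> (1 : R).
Local Notation Q := (annealed P K).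
Local Notation J V V' := [set t : environment R d | `[V, V']%classic (t 0)].
Local Notation h u := (inv_green_bar K u).
Implicit Types (V : R) (t : environment R d).

Let mJ V V' : measurable (J V V').
Proof. by rewrite -[X in measurable X]setTI; exact: (measurable_coordinate (0 : site d)). Qed.

Lemma exists_depth_interval V : exists V', V <= V' /\ 0 < fine (P (J V V')).
Proof.
apply: contrapT => nex.
have P0 n : P (J V (V + n%:R)) = 0%E.
  apply/eqP; rewrite -(@fineK _ (P (J V (V + n%:R)))) ?fin_num_measure // eqe eq_le fine_ge0 // andbT.
  by rewrite leNgt; apply/negP => Pn; apply: nex; exists (V + n%:R); rewrite lerDl.
have : P.-negligible (\bigcup_n J V (V + n%:R)).
  by apply: negligible_bigcup => n; exists (J V (V + n%:R)); split; [exact: mJ | exact: P0 | by []].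
move=> /(measure_negligible (bigcupT_measurable _ (fun n => mJ V (V + n%:R)))) P1.
have := trap_probability_gt0 P_tail V; rewrite /trap_probability ltNge => /negP; apply.
rewrite (_ : [set t | V <= t 0] = \bigcup_n J V (V + n%:R)) ?P1 //.
apply/seteqP; split => t /=.
  move=> Vt; exists (Num.truncn (t 0 - V)).+1 => //=.
  by rewrite in_itv /= Vt -lerBlDl ltW // truncnS_gt.
by case=> n _ /=; rewrite in_itv => /andP[].
Qed.

Variables (M : R) (g : punctured_environment R d -> R).
Hypothesis M_ge0 : 0 <= M.
Hypothesis g01 : forall u, 0 <= g u <= 1.
Hypothesis mg : measurable_fun setT g.
Hypothesis g_tame : forall u, g u != 0 ->
  forall z : {z : site d | z != 0}, (l1norm (val z) <= 2)%N -> u z <= M.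

Local Notation f t := (g (off_origin t) * h (off_origin t)).
Local Notation A := (\int[P]_t (f t)%:E)%E.

Let f_ge0 t : 0 <= f t.
Proof.
have /andP[g0 _] := g01 (off_origin t); rewrite mulr_ge0 //.
exact: (inv_green_bar_ge0 a_gt0 nb_order d_gt0 K_law).
Qed.

Let mf : measurable_fun setT (fun t => f t).
Proof.
apply: measurable_funM.
  by apply: measurableT_comp; last exact: measurable_off_origin.
apply: (measurableT_comp (f := inv_green_bar K)); last exact: measurable_off_origin.
exact: (measurable_inv_green_bar a_gt0 nb_order d_gt0 K_law).
Qed.

Let mJ01 V V' : measurable_fun setT (fun t : environment R d => \1_`[V, V']%classic (t 0) : R).
Proof. by apply: measurableT_comp; [exact: measurable_indic | exact: measurable_coordinate]. Qed.

(** The depth of the origin is independent of the environment off the origin. *)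
Lemma integral_depth V V' :
  (\int[P]_t (\1_`[V, V']%classic (t 0) * f t)%:E = P (J V V') * A)%E.
Proof.
under eq_integral do rewrite EFinM.
rewrite (integral_coordinate P_iid (x := 0) (B := `[V, V']%classic)) //.
- exact/measurable_EFinP.
- move=> t v; have -> : off_origin (set_coordinate 0 v t) = off_origin t => //.
  by apply/funext => -[z z0]; rewrite /off_origin /set_coordinate /= (negbTE z0).
Qed.

(** On the support of the weight, [inv_green0] lies between [min_return *
    inv_green_bar] and [inv_green_bar], and the latter does not depend on the
    depth of the origin. *)
Lemma depth_bounds V V' : 0 < V -> V <= V' ->
  let W := \int[P]_t weight0 a nb V V' g t in
  (W%:E <= P (J V V') * A)%E /\ ((min_return a nb M V)%:E * (P (J V V') * A) <= W%:E)%E.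
Proof.
move=> V0 VV' /=; have a0 := ltW a_gt0.
have w01 := weight0_01 a0 nb_order M_ge0 V0 VV' g01 g_tame.
have mw := measurable_weight0 a nb V V' mg.
have /andP[rho0 _] := min_return01 a nb M V0.
have -> : (\int[P]_t weight0 a nb V V' g t)%:E = (\int[P]_t (weight0 a nb V V' g t)%:E)%E.
  rewrite /Rintegral fineK //; apply: integrable_fin_num => //.
  apply: (bounded_integrable P (B := 1 + rate_bound a nb M V')) => // t.
  by have /andP[w0 w1] := w01 t; rewrite ger0_norm.
rewrite -integral_depth.
have pos t : (forall y, 1 <= t y) -> forall y, 0 < t y by move=> t1 y; exact: lt_le_trans (t1 y).
have mprod : measurable_fun setT (fun t => \1_`[V, V']%classic (t 0) * f t) by exact: measurable_funM.
split.
  apply: ae_ge0_le_integral => //.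
  - by move=> t _; have /andP[w0 _] := w01 t; rewrite lee_fin.
  - exact/measurable_EFinP.
  - by move=> t _; rewrite lee_fin mulr_ge0.
  - exact/measurable_EFinP.
  apply: filterS (ae_coordinates_ge1 P_iid P_ge1) => t t1 _.
  have /andP[_ le] := inv_green_bar_bounds a_gt0 nb_order d_gt0 K_law (pos t t1).
  rewrite lee_fin /weight0 mulrA ler_wpM2l // mulr_ge0 //.
  by have /andP[] := g01 (off_origin t).
rewrite -ge0_integralZl_EFin //; last 3 first.
- by move=> t _; rewrite lee_fin mulr_ge0.
- exact/measurable_EFinP.
- exact: ltW.
apply: ae_ge0_le_integral => //.
- by move=> t _; rewrite -EFinM lee_fin mulr_ge0 ?(ltW rho0) // mulr_ge0.
- by apply: emeasurable_funM; [exact: measurable_cst | exact/measurable_EFinP].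
- by move=> t _; have /andP[w0 _] := w01 t; rewrite lee_fin.
- exact/measurable_EFinP.
apply: filterS (ae_coordinates_ge1 P_iid P_ge1) => t t1 _.
rewrite -EFinM lee_fin /weight0 indicE.
case: (boolP (t 0 \in `[V, V']%classic)) => [/set_mem /=|_]; last by rewrite !mul0r mulr0.
rewrite in_itv /= !mul1r => /andP[Vt _].
have [->|g0] := eqVneq (g (off_origin t)) 0; first by rewrite !mul0r mulr0.
rewrite mulrCA ler_wpM2l //; first by have /andP[] := g01 (off_origin t).
have /andP[le _] := inv_green_bar_bounds a_gt0 nb_order d_gt0 K_law (pos t t1).
apply: le_trans le; rewrite ler_wpM2r //.
  exact: (inv_green_bar_ge0 a_gt0 nb_order d_gt0 K_law).
exact: (le_return_ratio a0 nb_order M_ge0 V0 g_tame).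
Qed.

Variable mu : R.
Hypothesis tau_cvg : \int[Q]_q g (trap_environment nb alpha delta (eps k) q 1) @[k --> \oo] --> mu.

(** The probability of the depth interval cancels between [depth_bounds] and
    [first_trap_bounds]. Then let [V] tend to infinity, so that [min_return]
    tends to [1]. *)
Lemma first_trap_mean : A = (c * mu)%:E.
Proof.
have a0 := ltW a_gt0.
have bounds V : 0 < V -> ((min_return a nb M V)%:E * A <= (c * mu)%:E)%E /\
    ((min_return a nb M V * (c * mu))%:E <= A)%E.
  move=> V0; have [V' [VV' PV]] := exists_depth_interval V.
  have [b1 b2] := depth_bounds V0 VV'.
  have [b3 b4] := first_trap_bounds a0 nb_order d_gt0 c_gt0 P_iid P_ge1 K_law c_speed
    alpha_gt0 delta_gt0 eps_gt0 eps_cvg0 P_tail M_ge0 V0 VV' g01 mg g_tame tau_cvg.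
  have PE : P (J V V') = (fine (P (J V V')))%:E by rewrite fineK // fin_num_measure.
  have PV' : (0 < (fine (P (J V V')))%:E)%E by rewrite lte_fin.
  split.
    rewrite -(@lee_pmul2l _ (fine (P (J V V')))%:E) // muleCA -EFinM.
    by apply: le_trans (_ : (_ <= (\int[P]_t weight0 a nb V V' g t)%:E)%E) _; rewrite -?PE // lee_fin.
  rewrite -(@lee_pmul2l _ (fine (P (J V V')))%:E) // -EFinM mulrCA.
  by apply: le_trans (_ : (_ <= (\int[P]_t weight0 a nb V V' g t)%:E)%E) _; rewrite -?PE // lee_fin.
have A0 : (0 <= A)%E by apply: integral_ge0 => t _; rewrite lee_fin.
have := bounds 1 ltr01; move: A0 bounds; case: A => [x|_ _ [+ _]|//]; last first.
  have /andP[r0 _] := min_return01 a nb M (ltr01 : 0 < (1 : R)).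
  by rewrite gt0_muley ?lte_fin // leye_eq.
move=> _ bounds _; congr EFin.
pose B := escape_bound a nb M.
have B0 : 0 <= B by exact: escape_bound_ge0.
(* [V] tends to infinity as [s] tends to [0], which is then a perturbation
   parameter. *)
have pick s : 0 < s -> exists2 V, 0 < V & V `^ a = s^-1.
  move=> s0; exists (s^-1 `^ a^-1); first by rewrite powR_gt0 // invr_gt0.
  by rewrite -powRrM mulVf ?gt_eqF // powRr1 // invr_ge0 ltW.
have ratioE s y z : 0 < s -> s^-1 / (s^-1 + B) * y <= z -> y <= z + s * (z * B).
  move=> s0; have e : s * s^-1 = 1 by rewrite divff // gt_eqF.
  have sB : 0 < s^-1 + B by rewrite ltr_wpDr // invr_gt0.
  move=> hy; have : s^-1 * y <= z * (s^-1 + B) by rewrite -ler_pdivrMr // [leLHS]mulrAC.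
  rewrite -(ler_pM2l s0) => {}hy.
  have -> : y = s * (s^-1 * y) by rewrite mulrA e mul1r.
  apply: (le_trans hy); rewrite le_eqVlt; apply/orP; left; apply/eqP.
  by rewrite mulrDr mulrDr [s * (z / s)]mulrCA e mulr1.
apply/eqP; rewrite eq_le; apply/andP; split.
  apply: (le_of_perturbation (z := c * mu * B)) => s s0.
  have [V V0 VE] := pick s s0; have [hb _] := bounds V V0.
  by move: hb; rewrite -EFinM lee_fin /min_return VE; exact: ratioE.
apply: (le_of_perturbation (z := x * B)) => s s0.
have [V V0 VE] := pick s s0; have [_ hb] := bounds V V0.
by move: hb; rewrite lee_fin /min_return VE; exact: ratioE.
Qed.

End FirstTrapMean.

(** * Continuous approximations of boxes *)

Section Ramp.
Context {R : realType}.
Implicit Types (n : nat) (b x : R).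

(** A continuous function decreasing from [1] at [b] to [0] at [b + 1 / n.+1]. *)
Definition ramp n b x : R := Num.max 0 (Num.min 1 (1 - n.+1%:R * (x - b))).

Lemma ramp01 n b x : 0 <= ramp n b x <= 1.
Proof. by rewrite /ramp le_max lexx /= ge_max ler01 ge_min lexx. Qed.

Lemma ramp_le n b x : x <= b -> ramp n b x = 1.
Proof.
move=> xb; have h : 1 <= 1 - n.+1%:R * (x - b).
  by rewrite lerDl oppr_ge0 mulr_ge0_le0 // subr_le0.
by rewrite /ramp (min_l h) max_r.
Qed.

Lemma ramp_eq0 n b x : 1 <= n.+1%:R * (x - b) -> ramp n b x = 0.
Proof.
move=> h; apply/eqP; rewrite eq_le; have /andP[-> _] := ramp01 n b x; rewrite andbT.
by rewrite /ramp ge_max lexx ge_min subr_le0 h orbT.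
Qed.

Lemma ramp_support n b x : ramp n b x != 0 -> x <= b + 1.
Proof.
apply: contraNle => bx; apply/eqP/ramp_eq0.
have xb : 1 <= x - b by rewrite lerBrDl ltW.
by rewrite -[leLHS]mul1r ler_pM // ler1n.
Qed.

Lemma ramp_anti n b x : ramp n b x <= ramp 0 b x.
Proof.
have [xb|bx] := leP x b; first by rewrite !ramp_le.
have xb : 0 <= x - b by rewrite subr_ge0 ltW.
rewrite /ramp; apply: le_max2; rewrite ?lexx //; apply: le_min2; rewrite ?lexx //.
by rewrite lerD2l lerN2 ler_wpM2r // ler_nat.
Qed.

Lemma cvg_ramp b x : ramp n b x @[n --> \oo] --> ((x <= b)%R%:R : R).
Proof.
have [xb|bx] := leP x b.
  by rewrite (_ : (fun n => _) = cst 1); [exact: cvg_cst | apply/funext => n; rewrite ramp_le].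
apply: cvg_near_cst; have xb : 0 < x - b by rewrite subr_gt0.
near=> n; apply: ramp_eq0; rewrite -ler_pdivrMr // mul1r.
apply: (@le_trans _ _ n%:R); last by rewrite ler_nat.
by near: n; exact: nbhs_infty_ger.
Unshelve. all: by end_near. Qed.

Lemma continuous_ramp n b : continuous (ramp n b).
Proof.
move=> x; apply: (@continuous_max R R (cst 0) (fun x => Num.min 1 (1 - n.+1%:R * (x - b)))).
  exact: cst_continuous.
apply: (@continuous_min R R (cst 1) (fun x => 1 - n.+1%:R * (x - b))).
  exact: cst_continuous.
apply: cvgB; first exact: cvg_cst.
by apply: cvgM; [exact: cvg_cst | apply: cvgB; [exact: cvg_id | exact: cvg_cst]].
Qed.

End Ramp.

Section Bump.
Context {R : realType} {d : nat}.
Local Notation I := {z : site d | z != 0}.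
Local Notation E := (punctured_environment R d).
Implicit Types (n : nat) (s : seq I) (b : I -> R) (u : E).

Definition orthant s b : set E := [set u | forall z, z \in s -> u z <= b z].

Definition bump n s b u : R := \prod_(z <- s) ramp n (b z) (u z).

Lemma bump01 n s b u : 0 <= bump n s b u <= 1.
Proof.
rewrite /bump; elim: s => [|z s /andP[h0 h1]]; first by rewrite big_nil ler01 lexx.
have /andP[r0 r1] := ramp01 n (b z) (u z).
by rewrite big_cons mulr_ge0 //= mulr_ile1.
Qed.

Lemma bump_support n s b u : bump n s b u != 0 -> forall z, z \in s -> u z <= b z + 1.
Proof.
rewrite /bump; elim: s => [|z s IH] //; rewrite big_cons mulf_eq0 negb_or => /andP[zb sb] y.
by rewrite inE => /orP[/eqP ->|/(IH sb)//]; exact: ramp_support zb.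
Qed.

Lemma bump_anti n s b u : bump n s b u <= bump 0 s b u.
Proof.
apply: ler_prod => z _; have /andP[-> _] := ramp01 n (b z) (u z); exact: ramp_anti.
Qed.

Lemma cvg_bump s b u : bump n s b u @[n --> \oo] --> (\1_(orthant s b) u : R).
Proof.
rewrite indicE (_ : (u \in orthant s b) = all (fun z => u z <= b z) s); last first.
  by apply/idP/allP => [/set_mem h z /h|h]; [|apply/mem_set].
rewrite /bump; elim: s => [|z s IH] /=.
  by rewrite (_ : (fun n => _) = cst 1); [exact: cvg_cst | apply/funext => n; rewrite big_nil].
rewrite (_ : (fun n => _) = fun n => ramp n (b z) (u z) * \prod_(z <- s) ramp n (b z) (u z));
  last by apply/funext => n; rewrite big_cons.
by rewrite -mulnb natrM; apply: cvgM => //; exact: cvg_ramp.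
Qed.

Lemma measurable_bump n s b : measurable_fun setT (bump n s b).
Proof.
apply: measurable_prod => z _; apply: (measurableT_comp (f := ramp n (b z))).
  by apply: continuous_measurable_fun; exact: continuous_ramp.
exact: measurable_coordinate.
Qed.

Lemma continuous_bump n s b :
  continuous (fun x : trap_space R d => bump n s b (x 0%N).1.1.1).
Proof.
have cz z : continuous (fun x : trap_space R d => (x 0%N).1.1.1 z).
  move=> x; pose X := ({ptws I -> R} * R * R * R)%type.
  have c1 : (fun x : trap_space R d => x 0%N) @ x --> x 0%N.
    exact: (@proj_continuous nat (fun=> X) 0%N x).
  have c2 : (fun x : trap_space R d => (x 0%N).1) @ x --> (x 0%N).1.
    by apply: (cvg_comp _ _ c1); exact: cvg_fst.
  have c3 : (fun x : trap_space R d => (x 0%N).1.1) @ x --> (x 0%N).1.1.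
    by apply: (cvg_comp _ _ c2); exact: cvg_fst.
  have c4 : (fun x : trap_space R d => (x 0%N).1.1.1) @ x --> (x 0%N).1.1.1.
    by apply: (cvg_comp _ _ c3); exact: cvg_fst.
  exact: (cvg_comp _ _ c4 (@proj_continuous I (fun=> R) z _)).
rewrite /bump; elim: s => [|z s IH] x.
  rewrite (_ : (fun x => _) = cst 1); first exact: cst_continuous.
  by apply/funext => y; rewrite big_nil.
rewrite (_ : (fun x => _) = (fun x : trap_space R d => ramp n (b z) ((x 0%N).1.1.1 z)) \*
    (fun x => \prod_(z <- s) ramp n (b z) ((x 0%N).1.1.1 z))); last first.
  by apply/funext => y; rewrite big_cons.
apply: continuousM; last exact: IH.
apply: (@continuous_comp _ _ _ (fun x : trap_space R d => (x 0%N).1.1.1 z) (ramp n (b z))).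
  exact: cz.
exact: continuous_ramp.
Qed.

(** A cube that contains the punctured ball of radius [2], where a test
    function has to control the environment. *)
Definition around2 : seq I :=
  pmap insub [seq (\row_i ((f i : nat)%:Z - 2) : site d) | f : {ffun 'I_d -> 'I_5}].

Lemma mem_around2 (z : I) : (l1norm (val z) <= 2)%N -> z \in around2.
Proof.
move=> z2; rewrite mem_pmap_sub; apply/mapP.
have zi (i : 'I_d) : (`|(val z : 'rV[int]_d) ord0 i|%N <= 2)%N.
  by apply: leq_trans z2; rewrite /l1norm (bigD1 i) //= leq_addr.
exists [ffun i => inord (absz ((val z : 'rV[int]_d) ord0 i + 2))]; rewrite ?mem_enum //.
apply/rowP => i; rewrite mxE ffunE inordK; have := zi i; by move: ((val z : 'rV[int]_d) ord0 i) => [[|[|[|n]]]|[|[|n]]].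
Qed.

(** Orthants whose bumps vanish where the environment is large near the
    origin. *)
Definition wide_orthants : set (set E) :=
  [set A | exists s b, {subset around2 <= s} /\ A = orthant s b].

Lemma measurable_orthant s b : measurable (orthant s b).
Proof.
rewrite (_ : orthant s b = \bigcap_(z in [set` s]) [set u | u z <= b z]).
  apply: fin_bigcap_measurable; first exact: finite_seq.
  move=> z _; rewrite (_ : [set _ | _] = (fun u : E => u z) @^-1` `]-oo, b z]).
    by rewrite -[X in measurable X]setTI; exact: measurable_coordinate.
  by apply/seteqP; split => u /=; rewrite in_itv.
by apply/seteqP; split => u h z /=; exact: h.
Qed.

Lemma wide_orthants_setI : setI_closed wide_orthants.
Proof.
move=> _ _ [s [b [sub ->]]] [s' [b' [sub' ->]]].
exists (s ++ s'), (fun z => Num.min (if z \in s then b z else b' z) (if z \in s' then b' z else b z)).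
split=> [z /sub zs|]; first by rewrite mem_cat zs.
apply/seteqP; split => u /=.
  move=> [h h'] z; rewrite mem_cat le_min.
  case: (boolP (z \in s)) => [zs _|_ /= zs']; last by rewrite zs' h'.
  by rewrite (h z zs) /=; case: ifP => [/h'//|_]; exact: h.
move=> h; split=> z zs; have := h z; rewrite mem_cat zs ?orbT => /(_ isT); rewrite le_min => /andP[//].
Qed.

(** A half space is the union of the wide orthants with the same bound in one
    direction and large bounds in the others. *)
Lemma wide_orthants_generate : @measurable _ E = <<s wide_orthants >>.
Proof.
apply/seteqP; split => A; last first.
  apply: smallest_sub; first exact: sigma_algebra_measurable.
  by move=> _ [s [b [_ ->]]]; exact: measurable_orthant.
apply: smallest_sub; first exact: smallest_sigma_algebra.
move=> _ [z [B [mB ->]]].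
pose T := g_sigma_algebraType wide_orthants.
have mz : measurable_fun setT (fun u : T => (u : E) z).
  apply: (measurability (@RGenOInfty.G R)); first exact: RGenOInfty.measurableE.
  move=> _ [_ [x ->] <-]; rewrite setTI.
  rewrite (_ : _ @^-1` _ = ~` \bigcup_n orthant (z :: around2) (fun y => if y == z then x else n%:R)).
    apply: measurableC; apply: bigcupT_measurable => n; apply: sub_sigma_algebra.
    by exists (z :: around2), (fun y => if y == z then x else n%:R); split => // y; rewrite inE orbC => ->.
  apply/seteqP; split => u /=; rewrite in_itv /= andbT.
    by rewrite ltNge => /negP uz [n _ /(_ z)]; rewrite mem_head eqxx => /(_ isT).
  move=> nu; rewrite ltNge; apply/negP => uz; apply: nu.
  exists (\max_(y <- around2) (Num.truncn (u y)).+1)%N => // y; rewrite inE.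
  case: eqP => [->//|_ /= ys]; apply/ltW/(lt_le_trans (truncnS_gt (u y))).
  by rewrite ler_nat (leq_bigmax_seq (F := fun y => (Num.truncn (u y)).+1) (P := predT) y ys isT).
by have := mz measurableT B mB; rewrite setTI.
Qed.

Lemma wide_orthants_cover :
  \bigcup_n orthant around2 (fun=> n%:R) = [set: E].
Proof.
apply/seteqP; split => // u _.
exists (\max_(y <- around2) (Num.truncn (u y)).+1)%N => // y ys.
apply/ltW/(lt_le_trans (truncnS_gt (u y))).
by rewrite ler_nat (leq_bigmax_seq (F := fun y => (Num.truncn (u y)).+1) (P := predT) y ys isT).
Qed.

End Bump.

(** * Densities *)

Section Density.
Context dT (T : measurableType dT) (R : realType).
Variables (mu : {measure set T -> \bar R}) (f : T -> \bar R).

(** The proofs that [f] is measurable and nonnegative are arguments, so that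
    the structure of measure can be inferred. *)
Definition density_measure (mf : measurable_fun setT f) (f0 : forall x, (0 <= f x)%E) A : \bar R :=
  (\int[mu]_(x in A) f x)%E.

Variables (mf : measurable_fun setT f) (f0 : forall x, (0 <= f x)%E).

Let density_measure0 : density_measure mf f0 set0 = 0%E.
Proof. exact: integral_set0. Qed.

Let density_measure_ge0 A : (0 <= density_measure mf f0 A)%E.
Proof. exact: integral_ge0. Qed.

Let density_measure_sigma_additive : semi_sigma_additive (density_measure mf f0).
Proof.
move=> A mA tA mUA; rewrite [X in _ --> X](_ : _ =
    (\sum_(0 <= i <oo) \int[mu]_(x in A i) f x)%E).
  by apply: is_cvg_nneseries => n _ _; exact: integral_ge0.
by rewrite /density_measure ge0_integral_bigcup //; exact: measurable_funTS.
Qed.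

HB.instance Definition _ := isMeasure.Build _ _ _ (density_measure mf f0)
  density_measure0 density_measure_ge0 density_measure_sigma_additive.

End Density.

(** * The density of the first trap environment *)

Section FirstTrapDensity.
Context {R : realType} {d : nat}.
Variables (a : R) (nb : seq (site d)) (c : R).
Hypothesis a_gt0 : 0 < a.
Hypothesis nb_order : ball_order nb.
Hypothesis d_gt0 : (0 < d)%N.
Hypothesis c_gt0 : 0 < c.
Variable P : probability (environment R d) R.
Hypothesis P_iid : iid_coordinates P.
Hypothesis P_ge1 : {ae P, forall t, 1 <= t 0}.
Variable K : R.-pker (environment R d) ~> (trajectory R d).
Hypothesis K_law : forall t : environment R d, (forall y, 0 < t y) ->
  ctmc_law (jump_rate a t) 0 (K t).
Hypothesis c_speed : {ae annealed P K, forall p,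
  (discovered p.2 t * (t^-1)%:E)%E @[t --> +oo] --> c%:E}.
Variables (alpha delta : R) (eps : nat -> R).
Hypothesis alpha_gt0 : 0 < alpha.
Hypothesis delta_gt0 : 0 < delta.
Hypothesis eps_gt0 : forall k, 0 < eps k.
Hypothesis eps_cvg0 : eps k @[k --> \oo] --> 0.
Hypothesis P_tail : fine (P [set t : environment R d | y <= t 0]) / y `^ (- alpha)
              @[y --> +oo] --> (1 : R).
Variables (dW : measure_display) (W : measurableType dW) (Q : probability W R).
Variable tau : {RV Q >-> punctured_environment R d}.
Local Notation I := {z : site d | z != 0}.
Local Notation h := (inv_green_bar K).
Local Notation O := (@orthant R d).
Implicit Types (s : seq I) (b : I -> R) (u : punctured_environment R d).

Hypothesis bump_cvg : forall n s b,
  \int[annealed P K]_q bump n s b (trap_environment nb alpha delta (eps k) q 1) @[k --> \oo]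
    --> \int[Q]_w bump n s b (tau w).

Let h_ge0 u : 0 <= h u.
Proof. exact: (inv_green_bar_ge0 a_gt0 nb_order d_gt0 K_law). Qed.

Let mh : measurable_fun setT h.
Proof. exact: (measurable_inv_green_bar a_gt0 nb_order d_gt0 K_law). Qed.

Let moff : measurable_fun setT (@off_origin R d) := @measurable_off_origin R d.

(** [first_trap_mean] for the bumps that decrease to the indicator of the
    orthant. *)
Lemma orthant_law s b : {subset around2 <= s} ->
  (\int[P]_t (\1_(O s b) (off_origin t) * h (off_origin t))%:E
    = c%:E * distribution Q tau (O s b))%E.
Proof.
move=> sub; pose M := \sum_(z <- s) (`|b z| + 1).
have bM z : z \in s -> b z + 1 <= M.
  move=> zs; rewrite /M (big_rem z) //= -[leLHS]addr0 lerD ?lerD2r ?ler_norm //.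
  by apply: sumr_ge0 => y _; rewrite addr_ge0.
have M0 : 0 <= M by apply: sumr_ge0 => y _; rewrite addr_ge0.
have tame n u : bump n s b u != 0 ->
    forall z : I, (l1norm (val z) <= 2)%N -> u z <= M.
  move=> /bump_support hu z /mem_around2/sub zs.
  by apply: le_trans (hu z zs) _; exact: bM.
pose F n t := (bump n s b (off_origin t) * h (off_origin t))%:E.
have FE n : (\int[P]_t F n t = (c * \int[Q]_w bump n s b (tau w))%:E)%E.
  exact: (first_trap_mean a_gt0 nb_order d_gt0 c_gt0 P_iid P_ge1 K_law c_speed alpha_gt0
    delta_gt0 eps_gt0 eps_cvg0 P_tail M0 (bump01 n s b) (measurable_bump n s b) (@tame n)
    (@bump_cvg n s b)).
have F0 n t : (0 <= F n t)%E.
  by have /andP[b0 _] := bump01 n s b (off_origin t); rewrite lee_fin mulr_ge0.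
have mF n : measurable_fun setT (F n).
  apply/measurable_EFinP; apply: measurable_funM.
    exact: measurableT_comp (measurable_bump n s b) moff.
  exact: measurableT_comp mh moff.
have intF : P.-integrable setT (F 0).
  apply/integrableP; split=> //; under eq_integral do rewrite gee0_abs //.
  by rewrite FE ltry.
have c1 : (\int[P]_t F n t @[n --> \oo] -->
    \int[P]_t (\1_(O s b) (off_origin t) * h (off_origin t))%:E)%E.
  apply: (@dominated_cvg _ _ _ P setT measurableT F _ (F 0)) => //.
  - move=> t _; apply/cvg_EFin; first exact: nearW.
    by apply: cvgMl; exact: cvg_bump.
  - by move=> n t _; rewrite gee0_abs // lee_fin ler_wpM2r // bump_anti.
have mtau : measurable_fun setT tau by [].
have c2 : \int[Q]_w bump n s b (tau w) @[n --> \oo] --> \int[Q]_w \1_(O s b) (tau w).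
  apply: (bounded_Rcvg (B := 1)).
  - by move=> n; exact: measurableT_comp (measurable_bump n s b) mtau.
  - by apply: measurableT_comp mtau; apply: measurable_indic; exact: measurable_orthant.
  - by move=> n w; have /andP[b0 b1] := bump01 n s b (tau w); rewrite ger0_norm.
  - by move=> w; rewrite indicE; case: (_ \in _); rewrite ?normr1 ?normr0.
  - by apply: aeW => w; exact: cvg_bump.
have c3 : (\int[P]_t F n t @[n --> \oo] --> (c * \int[Q]_w \1_(O s b) (tau w))%:E)%E.
  under eq_cvg do rewrite FE.
  by apply/cvg_EFin; [exact: nearW | exact: cvgMr].
rewrite (cvg_unique (@ereal_hausdorff R) c1 c3) EFinM; congr (_ * _)%E.
rewrite /Rintegral fineK.
  transitivity (\int[distribution Q tau]_u (\1_(O s b) u)%:E)%E; last first.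
    by rewrite integral_indic ?setIT //; exact: measurable_orthant.
  rewrite ge0_integral_distribution //.
  by apply/measurable_EFinP; apply: measurable_indic; exact: measurable_orthant.
apply: integrable_fin_num => //; apply: (bounded_integrable Q (B := 1)).
  by apply: measurableT_comp mtau; apply: measurable_indic; exact: measurable_orthant.
by move=> w; rewrite indicE; case: (_ \in _); rewrite ?normr1 ?normr0.
Qed.

Local Notation P' := (distribution P (@off_origin R d)).
Let D u : \bar R := (h u / c)%:E.
Let mD : measurable_fun setT D.
Proof. by apply/measurable_EFinP; exact: measurable_funM. Qed.
Let D0 u : (0 <= D u)%E.
Proof. by rewrite lee_fin divr_ge0 // ltW. Qed.

(** Both sides are measures, and they agree on the wide orthants. *)
Lemma first_trap_density A : measurable A ->
  distribution Q tau A = (\int[P']_(u in A) (h u / c)%:E)%E.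
Proof.
move=> mA; rewrite -[RHS]/(density_measure P' mD D0 A).
apply: (measure_unique (@wide_orthants R d) (fun n => O around2 (fun=> n%:R))) mA => //.
- exact: wide_orthants_generate.
- exact: wide_orthants_setI.
- by move=> n; exists around2, (fun=> n%:R); split.
- exact: wide_orthants_cover.
- move=> _ [s [b [sub ->]]]; have mO := measurable_orthant s b.
  rewrite [RHS]/(density_measure _ _ _ _) /density_measure integral_mkcond.
  rewrite ge0_integral_distribution //; last 2 first.
  + by apply/(measurable_restrictT _ mO); exact: measurable_funTS.
  + by move=> u; rewrite erestrict_ge0.
  have c0 : (c%:E * c^-1%:E = 1)%E by rewrite -EFinM divff // gt_eqF.
  rewrite -[LHS]mul1e -[X in (X * _)%E]c0 [(c%:E * _)%E]muleC -muleA -orthant_law //.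
  rewrite -ge0_integralZl_EFin ?invr_ge0 ?(ltW c_gt0) //; last 2 first.
  + by move=> t _; rewrite lee_fin mulr_ge0.
  + apply/measurable_EFinP; apply: measurable_funM.
      by apply: measurableT_comp moff; exact: measurable_indic.
    exact: measurableT_comp mh moff.
  apply: eq_integral => t _; rewrite /= patchE indicE -EFinM.
  by case: (_ \in _); rewrite ?mul1r ?mul0r ?mulr0 // mulrC.
- move=> n; apply: le_lt_trans (probability_le1 _ _) (ltry _).
  exact: measurable_orthant.
Qed.

End FirstTrapDensity.

Local Open Scope charge_scope.

Theorem proposition1p5
  (R : realType) (d : nat) (hd : (5 <= d)%N)
  (a alpha : R) (ha : 0 < a <= 1) (halpha : 0 < alpha < 1)
  (P : probability (environment R d) R)
  (P_iid : iid_coordinates P)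
  (P_ge1 : {ae P, forall t, 1 <= t 0})
  (P_tail : fine (P [set t : environment R d | y <= t 0]) / y `^ (- alpha)
              @[y --> +oo] --> (1 : R))
  (Pq : site d -> R.-pker (environment R d) ~> (trajectory R d))
  (Pq_law : forall (t : environment R d) (x : site d), (forall y, 0 < t y) ->
     ctmc_law (jump_rate a t) x (Pq x t))
  (nb : seq (site d)) (nb_order : ball_order nb)
  (c : R) (c_gt0 : 0 < c)
  (c_speed : {ae annealed P (Pq 0), forall p,
     (discovered p.2 t * (t^-1)%:E)%E @[t --> +oo] --> c%:E})
  (delta : R) (delta_gt0 : 0 < delta)
  (eps : nat -> R) (eps_gt0 : forall k, 0 < eps k)
  (eps_cvg0 : eps k @[k --> \oo] --> 0)
  (dW : measure_display) (W : measurableType dW) (Q : probability W R)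
  (tau_lim : nat -> {RV Q >-> punctured_environment R d})
  (e_lim depth_lim T_lim : nat -> {RV Q >-> R})
  (hlim : cvg_in_law (annealed P (Pq 0))
     (fun k => trap_process (Pq 0) nb alpha delta (eps k))
     Q (fun w => (fun n => (tau_lim n w, e_lim n w, depth_lim n w, T_lim n w))
                 : trap_space R d)) :
  (distribution Q (tau_lim 0%N) `<< distribution P (@off_origin R d)) /\
  ('d (charge_of_finite_measure (distribution Q (tau_lim 0%N)))
     '/d (distribution P (@off_origin R d))
   = (fun u => (c%:E * green_bar (Pq 0%R) u)^-1%E)
   %[ae distribution P (@off_origin R d)]).

Proof.
have /andP[a_gt0 _] := ha; have /andP[alpha_gt0 _] := halpha.
have d_gt0 : (0 < d)%N by exact: leq_trans hd.
have K_law (t : environment R d) : (forall y, 0 < t y) -> ctmc_law (jump_rate a t) 0 (Pq 0 t).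
  exact: Pq_law.
pose h := inv_green_bar (Pq 0); pose P' := distribution P (@off_origin R d).
(* Convergence in law, tested on the first component of the first trap. *)
have bump_cvg n s b :
    \int[annealed P (Pq 0)]_q bump n s b (trap_environment nb alpha delta (eps k) q 1) @[k --> \oo]
    --> \int[Q]_w bump n s b (tau_lim 0%N w).
  have bnd u : `|bump n s b u| <= 1 by have /andP[b0 b1] := bump01 n s b u; rewrite ger0_norm.
  have hb : exists M, forall x : trap_space R d, `|bump n s b (x 0%N).1.1.1| <= M.
    by exists 1 => x; exact: bnd.
  have := hlim _ (@continuous_bump R d n s b) hb.
  have mb := measurable_bump n s b.
  rewrite unlock -[X in _ --> X]fineK; last first.
    apply: integrable_fin_num => //; apply: (bounded_integrable Q (B := 1)) => [|w]; last exact: bnd.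
    exact: measurableT_comp mb (@measurable_funPT _ _ _ _ (tau_lim 0%N)).
  exact: fine_cvg.
have law A : measurable A -> distribution Q (tau_lim 0%N) A = (\int[P']_(u in A) (h u / c)%:E)%E.
  exact: (first_trap_density a_gt0 nb_order d_gt0 c_gt0 P_iid P_ge1 K_law c_speed alpha_gt0
    delta_gt0 eps_gt0 eps_cvg0 P_tail bump_cvg).
have dom : distribution Q (tau_lim 0%N) `<< P'.
  apply/null_content_dominatesP => A mA A0; rewrite law //.
  by apply: null_set_integral => //; apply: measurable_funTS; apply/measurable_EFinP;
    apply: measurable_funM => //; exact: (measurable_inv_green_bar a_gt0 nb_order d_gt0 K_law).
split=> //; apply: (ae_eq_trans (g := fun u => (h u / c)%:E)).
  apply: integral_ae_eq => //; first exact: Radon_Nikodym_integrable.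
    apply/measurable_EFinP; apply: measurable_funM => //.
    exact: (measurable_inv_green_bar a_gt0 nb_order d_gt0 K_law).
  by move=> A _ mA; rewrite -Radon_Nikodym_integral //; exact: law.
have pos : {ae P', forall u, positive u}.
  have mp := measurableC (@measurable_punctured_positive R d).
  exists (~` (@positive R d)); split => //.
  rewrite -[LHS]/(P (@off_origin R d @^-1` (~` @positive R d))); apply: measure_negligible.
    by have := @measurable_off_origin R d measurableT _ mp; rewrite setTI.
  have [N [mN N0 hN]] := ae_coordinates_ge1 P_iid P_ge1.
  exists N; split => // t /= nt; apply: hN => /= t1; apply: nt.
  by apply: positive_off => y; exact: lt_le_trans (t1 y).
apply: filterS pos => u pu _.
have := green_bar_gt0 a_gt0 nb_order d_gt0 K_law pu.
rewrite /h inv_green_barE //; case: (green_bar _ u) => [x|_|//] /=.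
  rewrite lte_fin => x0; have cx : c * x != 0 by rewrite gt_eqF // mulr_gt0.
  by rewrite -EFinM /inve (negbTE cx) invfM mulrC.
by rewrite invr0 mul0r gt0_muley ?lte_fin.
Qed.
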